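(* Consider the delayed van der Pol oscillator $$\ddot x(t)+a(x^2(t)-1)\dot x(t)+x(t)=f(x(t-\tau))+\varepsilon g(\omega' t,x(t),x(t-\tau),\varepsilon),\qquad(\mathrm{V})$$ where $f$ and $g$ are analytic in all variables, $g(\phi,x,y,\varepsilon)$ is $2\pi$-periodic in each component of $\phi\in\mathbb{T}^{n_0}$, $\omega'=(\omega_1',\dots,\omega_{n_0}')$, and $$f(0)=f''(0)=0,\qquad f'(0)=b,\qquad f'''(0)=6b_1.$$ Suppose $b=1$, $b_1\ne0$, and $\tau=\tau_0(a)$, where $\omega_0=\sqrt{2-a^2}$ and $$\tau_0(a)=\begin{cases}\frac{1}{\omega_0}\arcsin(a\omega_0), & 1<a<\sqrt2,\\ \frac{1}{\omega_0}\left(\pi-\arcsin(a\omega_0)\right), & 0<a\le1.\end{cases}$$ Suppose $\omega'$ satisfies $|\langle k,\omega'\rangle|\ge\gamma_0|k|^{-\iota}$ for all $k\in\mathbb{Z}^{n_0}\setminus\{0\}$, with constants $\iota\ge n_0+1$ and $0<\gamma_0\ll1$. Expand $$g(\phi,x,y,\varepsilon)=\sum_{m+n\ge0}g_{mn}(\phi;\varepsilon)x^my^n,$$ and assume that at least one of the two functions $g_{00}(\phi;0)$ and $g_{10}(\phi;0)+g_{01}(\phi;0)$ has nonvanishing average over $\phi\in\mathbb{T}^{n_0}$. Then for most parameter values $a$ in $\Pi_0=[\frac14,\frac54]$ and for sufficiently small $\varepsilon$, the equation (V) possesses a quasi-periodic solution $x(t)$ with frequency $\omega'$ and $x=O(\varepsilon^{1/3})$.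 That is, there is $\varepsilon^*>0$ such that for $0<\varepsilon\le\varepsilon^*$ there is a subset $\Pi_{\gamma_0}\subset\Pi_0$ with Lebesgue measure $\mathrm{Meas}\,\Pi_{\gamma_0}=\mathrm{Meas}\,\Pi_0-O(\gamma_0)$ such that for every $a\in\Pi_{\gamma_0}$ the equation (V) with $\tau=\tau_0(a)$ has a quasi-periodic solution $x(t)$ with frequency $\omega'$ satisfying $\sup_t|x(t)|=O(\varepsilon^{1/3})$.
   Context: $\mathbb{T}^{n_0}=\mathbb{R}^{n_0}/2\pi\mathbb{Z}^{n_0}$; $\langle\cdot,\cdot\rangle$ is the usual scalar product; $|k|=|k_1|+\dots+|k_{n_0}|$ for integer vectors. The average of a function $h(\phi)$ on $\mathbb{T}^{n_0}$ is $(2\pi)^{-n_0}\int_{\mathbb{T}^{n_0}}h(\phi)\,d\phi$. A quasi-periodic solution with frequency $\omega'$ is one of the form $x(t)=X(\omega't)$ with $X$ being $2\pi$-periodic in each variable. The constant in $O(\gamma_0)$ does not depend on $\gamma_0$ or $\varepsilon$, and that in $O(\varepsilon^{1/3})$ does not depend on $\varepsilon$. *)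

(* Defs.v *)
From HB Require Import structures.
From mathcomp Require Import all_boot all_order all_algebra.
From mathcomp Require Import all_classical all_reals all_analysis.

Set Implicit Arguments.
Unset Strict Implicit.
Unset Printing Implicit Defensive.

Import Order.TTheory GRing.Theory Num.Theory.
Import numFieldNormedType.Exports.

Local Open Scope classical_set_scope.
Local Open Scope ring_scope.

Section PowerSeries.
Variable R : realType.

(* [u] is absolutely summable over the index type [I], with sum [s]. *)
Definition has_sum (I : choiceType) (u : I -> R) (s : R) : Prop :=
  summable [set: I] (EFin \o u) /\
  (\esum_(i in [set: I]) ((EFin \o u)^\+ i)
     - \esum_(i in [set: I]) ((EFin \o u)^\- i) = s%:E)%E.

(* Indices are multi-indices alpha in nat^n; the monomial is (z - p)^alpha. *)
Definition analytic_at (n : nat) (h : 'rV[R]_n -> R) (p : 'rV[R]_n) : Prop :=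
  exists (c : {ffun 'I_n -> nat} -> R) (r : R), 0 < r /\
    forall z : 'rV[R]_n, (forall i, `|z 0 i - p 0 i| < r) ->
      has_sum (fun alpha : {ffun 'I_n -> nat} =>
                 c alpha * \prod_(i < n) (z 0 i - p 0 i) ^+ alpha i)
              (h z).

Definition analytic1 (f : R -> R) : Prop :=
  forall p : 'rV[R]_1, analytic_at (fun z : 'rV[R]_1 => f (z 0 0)) p.

(* Joint analyticity of [g phi x y eps] on R^n * R * R * ]-eps0, eps0[; the
   four arguments are packed into one row (phi, x, y, eps) of length n + 3. *)
Definition analytic_perturbation (n : nat) (eps0 : R)
    (g : 'rV[R]_n -> R -> R -> R -> R) : Prop :=
  forall p : 'rV[R]_(n + 3), `|rsubmx p 0 2%:R| < eps0 ->
    analytic_at (fun z : 'rV[R]_(n + 3) =>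
        g (lsubmx z) (rsubmx z 0 0) (rsubmx z 0 1) (rsubmx z 0 2%:R)) p.

End PowerSeries.

Section Torus.
Variable R : realType.

(* Functions on the torus R^n / (2 pi Z)^n are represented by functions on R^n
   that are 2 pi-periodic in each variable. *)
Definition torus_periodic (n : nat) (h : 'rV[R]_n -> R) : Prop :=
  forall (phi : 'rV[R]_n) (i : 'I_n),
    h (phi + (2 * pi) *: delta_mx 0 i) = h phi.

(* Iterated Lebesgue integral over the fundamental cell [0, 2 pi]^n; it is only
   applied to continuous functions, for which the order is immaterial. *)
Fixpoint torus_integral (n : nat) : ('rV[R]_n -> R) -> R :=
  match n with
  | 0 => fun h => h 0
  | m.+1 => fun h : 'rV[R]_(1 + m) -> R =>
      \int[@lebesgue_measure R]_(t in `[0, 2 * pi]%classic)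
        torus_integral (fun phi : 'rV[R]_m => h (row_mx t%:M phi))
  end.

Definition torus_average (n : nat) (h : 'rV[R]_n -> R) : R :=
  (2 * pi) ^- n * torus_integral h.

Definition dotr (n : nat) (k : 'rV[int]_n) (omega : 'rV[R]_n) : R :=
  \sum_(i < n) (k 0 i)%:~R * omega 0 i.

Definition l1norm (n : nat) (k : 'rV[int]_n) : R :=
  (\sum_(i < n) `|k 0 i|)%:~R.

Definition diophantine (n : nat) (omega : 'rV[R]_n) (gamma iota : R) : Prop :=
  forall k : 'rV[int]_n, k != 0 ->
    gamma * l1norm k `^ (- iota) <= `|dotr k omega|.

(* Continuity of the hull [X] is part of the notion: when the coordinates of
   [omega] are rationally independent and n > 1, an arbitrary function [x]
   would have a (discontinuous) periodic hull. *)
Definition quasi_periodic (n : nat) (omega : 'rV[R]_n) (x : R -> R) : Prop :=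
  exists X : 'rV[R]_n -> R,
    [/\ continuous X, torus_periodic X & forall t : R, x t = X (t *: omega)].

End Torus.

Section VanDerPol.
Variable R : realType.

Definition omega0 (a : R) : R := Num.sqrt (2 - a ^+ 2).

Definition tau0 (a : R) : R :=
  (omega0 a)^-1 *
    (if 1 < a then asin (a * omega0 a) else pi - asin (a * omega0 a)).

Definition Pi0 : set R := [set` `[(1 / 4)%R, (5 / 4)%R]].

Definition vdp_solution (n : nat) (f : R -> R)
    (g : 'rV[R]_n -> R -> R -> R -> R) (omega : 'rV[R]_n) (a tau eps : R)
    (x : R -> R) : Prop :=
  forall t : R,
    [/\ derivable x t 1, derivable x^`()%classic t 1 &
        x^`(2)%classic t + a * (x t ^+ 2 - 1) * x^`()%classic t + x t
        = f (x (t - tau)) + eps * g (t *: omega) (x t) (x (t - tau)) eps].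

End VanDerPol.

Arguments Pi0 R : clear implicits.

(* Main.v *)
(* A quasi-periodic solution is a Fourier series with summable coefficients X_k,
   k in Z^n, on which the linear part of (V) acts as multiplication by
   L(<k, omega'>), L(w) = 1 - w^2 - i a w - exp (- i w tau). For tau = tau_0(a)
   this function vanishes exactly at 0 and at +-omega_0. No KAM iteration is
   needed: at the right scale the nonlinearity shifts L to
   L_d(w) = L(w) + d (i p w + q + r exp (- i w tau)) with d > 0 small, and if
   the shift is transversal at 0 and at omega_0, then |L_d(w)| is at least a
   constant times max (d, dist (w, {0, +-omega_0})) (1 + |w|). Hence the multiplier
   d / L_d and its product with w are bounded uniformly in d, and the equation
   becomes a fixed point problem for H, where X involves (d / L_d) H.

   If g_00 has nonzero average, x = s (c + z) with eps = s^3, d = s^2 and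
   b1 c^3 + average g_00 = 0; the forcing part of z tends to 0 with s because each
   nonzero mode is nonresonant, and the map is a contraction. Otherwise x = s (u + z)
   with eps = d = s, where u solves the linear equation forced by g_00 (here the
   Diophantine condition and the decay of Fourier coefficients are used), and the
   averages of g_10 and g_01 provide the shift. The linear map is then bounded but
   not small; its square is small, because two modes j <> k cannot both be nearly
   resonant unless <j - k, omega'> is close to 0, omega_0 or 2 omega_0 in absolute
   value.

   Transversality fails for countably many a only, by Rolle's theorem, and the
   resonances of order k exclude a set of parameters of measure O(gamma_0 w_k)
   with summable weights w_k. Analyticity enters through absolutely convergent
   Fourier-Taylor expansions, obtained by gluing the local power series with
   piecewise polynomial functions whose Fourier series are explicit. *)
Require Import Defs.
From HB Require Import structures.
From mathcomp Require Import all_boot all_order all_algebra.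
From mathcomp Require Import all_classical all_reals all_analysis.
From mathcomp Require Import complex ring lra.
From mathcomp Require Import zify.
Import ComplexField.Normc.

Set Implicit Arguments.
Unset Strict Implicit.
Unset Printing Implicit Defensive.

Import Order.TTheory GRing.Theory Num.Theory.
Import numFieldNormedType.Exports.

Local Open Scope classical_set_scope.
Local Open Scope ring_scope.

(** The multiplier can have size one on infinitely many nearly resonant modes, so the linear part
    supplies no smallness mode by mode. In the forced scaling, what remains at order s^3 besides the
    mean-free forcing is at least quadratic in [z]: it contracts on a ball whose radius is fixed
    before [s], and only higher Taylor terms carry a factor [s]. In the other scaling the remaining
    linear term is multiplication by the mean-free parts of g_10 and g_01, which has order one; this
    forces the passage to the square.

    Since omega' is fixed, [a] acts on the small divisors only through omega_0: the zero of L at 0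
    is controlled by the Diophantine hypothesis, those at +-omega_0 by removing strips in [a]. A
    countable degeneracy set has neighbourhoods of arbitrarily small measure but without a rate. The
    measure of such a neighbourhood is prescribed to be below gamma_0, which keeps the loss
    O(gamma_0); the price is that the transversality constant, and with it the largest epsilon,
    depends on gamma_0 in an uncontrolled way. The parameter set is chosen before epsilon. *)

Section ComplexModulus.
Variable R : realType.
Implicit Types x y z : R[i].

Lemma normc_ge0 x : 0 <= normc x.
Proof. by case: x => a b /=; exact: sqrtr_ge0. Qed.

Lemma ler_Re_normc x : `|complex.Re x| <= normc x.
Proof.
case: x => a b /=; rewrite -sqrtr_sqr; apply: ler_wsqrtr.
by rewrite lerDl sqr_ge0.
Qed.

Lemma ler_Im_normc x : `|complex.Im x| <= normc x.
Proof.
case: x => a b /=; rewrite -sqrtr_sqr; apply: ler_wsqrtr.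
by rewrite lerDr sqr_ge0.
Qed.

Lemma normc_real (a : R) : normc (a%:C)%C = `|a|.
Proof. by rewrite /normc /= expr0n addr0 sqrtr_sqr. Qed.

Lemma ler_normc_sum (I : Type) (s : seq I) (P : pred I) (u : I -> R[i]) :
  normc (\sum_(i <- s | P i) u i) <= \sum_(i <- s | P i) normc (u i).
Proof.
elim/big_rec2: _ => [|i a b _ le]; first by rewrite normc0.
by apply: le_trans (le_normcD _ _) _; rewrite lerD2l.
Qed.

Lemma ler_normcB x y : normc (x - y) <= normc x + normc y.
Proof. by apply: le_trans (le_normcD _ _) _; rewrite normcN. Qed.

Lemma normc_ReIm x : normc x <= `|complex.Re x| + `|complex.Im x|.
Proof.
rewrite {1}(complexE x); apply: le_trans (le_normcD _ _) _.
by rewrite normcM !normc_real /= expr0n add0r expr1n sqrtr1 mul1r.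
Qed.

Lemma normcJ' x : normc (x^*)%C = normc x.
Proof. by case: x => a b /=; rewrite sqrrN. Qed.

Lemma conjcM x y : ((x * y)^*)%C = (x^*)%C * (y^*)%C.
Proof. exact: rmorphM. Qed.

Lemma conjcD x y : ((x + y)^*)%C = (x^*)%C + (y^*)%C.
Proof. exact: rmorphD. Qed.

End ComplexModulus.

(** * Absolutely convergent families *)

Section UnconditionalSums.
Variable R : realType.
Local Notation C := R[i].

(** The bound is carried explicitly because it plays the role of the Wiener norm: every later
    contraction estimate is a comparison of such bounds. *)
Definition absum (I : eqType) (u : I -> C) (M : R) : Prop :=
  forall s : seq I, uniq s -> \sum_(i <- s) normc (u i) <= M.

Definition hsum (I : eqType) (u : I -> C) (z : C) : Prop :=
  forall e : R, 0 < e -> exists2 s0 : seq I, uniq s0 &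
    forall s : seq I, uniq s -> {subset s0 <= s} ->
      normc (\sum_(i <- s) u i - z) <= e.

(** The default value 0 for a family without a sum makes [csumZf] true without any summability
    hypothesis. *)
Definition csum (I : eqType) (u : I -> C) : C := xget 0 [set z | hsum u z].

Lemma normc_eq0P (z : C) : (forall e, 0 < e -> normc z <= e) -> z = 0.
Proof.
move=> h; apply: eq0_normc; apply/eqP; rewrite eq_le normc_ge0 andbT.
by apply/ler_addgt0Pr => e e0; rewrite add0r; exact: h.
Qed.

Lemma ler_normc_trans (x y z : C) :
  normc (x - z) <= normc (x - y) + normc (y - z).
Proof.
have -> : x - z = (x - y) + (y - z) by ring.
exact: le_normcD.
Qed.

Lemma normcBC (x y : C) : normc (x - y) = normc (y - x).
Proof. by rewrite -normcN opprB. Qed.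

Lemma sum_share (I : Type) (s : seq I) (e : R) : 0 <= e ->
  \sum_(i <- s) e / (size s).+1%:R <= e.
Proof.
move=> e0; rewrite big_const_seq count_predT iter_addr_0 -[_ *+ size s]mulr_natl mulrCA.
by rewrite -[leRHS]mulr1 ler_wpM2l // ler_pdivrMr // mul1r ler_nat.
Qed.

Lemma perm_filter_sub (I : eqType) (s r : seq I) : uniq s -> uniq r ->
  {subset s <= r} -> perm_eq [seq x <- r | x \in s] s.
Proof.
move=> us ur sub; apply: uniq_perm; rewrite ?filter_uniq // => i.
by rewrite mem_filter; case si: (i \in s) => //=; exact: sub.
Qed.

Lemma ler_sum_sub (I : eqType) (s r : seq I) (f : I -> R) : uniq s -> uniq r ->
  {subset s <= r} -> (forall i, 0 <= f i) ->
  \sum_(i <- s) f i <= \sum_(i <- r) f i.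
Proof.
move=> us ur sub f0.
rewrite [leRHS](bigID (mem s)) /= -[leLHS]addr0 lerD ?sumr_ge0 //.
by rewrite -[leRHS]big_filter (perm_big _ (perm_filter_sub us ur sub)).
Qed.

Section OneIndex.
Variable I : eqType.
Implicit Types (u v : I -> C) (s : seq I).

Lemma absum_ge0 u M : absum u M -> 0 <= M.
Proof. by move=> /(_ [::] isT); rewrite big_nil. Qed.

Lemma absum_le u M N : M <= N -> absum u M -> absum u N.
Proof. by move=> MN h s us; apply: le_trans (h s us) MN. Qed.

Lemma absum_term u M i : absum u M -> normc (u i) <= M.
Proof. by move=> /(_ [:: i] isT); rewrite big_seq1. Qed.

Lemma absum_mono u v M : (forall i, normc (v i) <= normc (u i)) ->
  absum u M -> absum v M.
Proof. by move=> vu h s us; apply: le_trans (h s us); apply: ler_sum. Qed.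

Lemma absumD u v M N : absum u M -> absum v N ->
  absum (fun i => u i + v i) (M + N).
Proof.
move=> hu hv s us; apply: le_trans (lerD (hu s us) (hv s us)).
by rewrite -big_split; apply: ler_sum => i _; exact: le_normcD.
Qed.

Lemma absumN u M : absum u M -> absum (fun i => - u i) M.
Proof. by apply: absum_mono => i; rewrite normcN. Qed.

Lemma absumB u v M N : absum u M -> absum v N ->
  absum (fun i => u i - v i) (M + N).
Proof. by move=> hu hv; apply: absumD hu (absumN hv). Qed.

Lemma absumM_bounded u (m : I -> C) B M : 0 <= B ->
  (forall i, normc (m i) <= B) -> absum u M -> absum (fun i => m i * u i) (B * M).
Proof.
move=> B0 mB hu s us; apply: (@le_trans _ _ (\sum_(i <- s) B * normc (u i))).
  by apply: ler_sum => j _; rewrite normcM ler_wpM2r ?normc_ge0.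
by rewrite -mulr_sumr ler_wpM2l ?hu.
Qed.

Lemma absumZ u a M : absum u M -> absum (fun i => a * u i) (normc a * M).
Proof.
move=> hu s us; under eq_bigr do rewrite normcM.
by rewrite -mulr_sumr ler_wpM2l ?hu ?normc_ge0.
Qed.

Lemma absum0 : absum (fun _ : I => 0) 0.
Proof. by move=> s _; rewrite big1 // => i _; rewrite normc0. Qed.

(** A finite set whose partial sum is within [e] of the supremum of all finite sums leaves at most
    [e] to every set disjoint from it. *)
Lemma absum_tail u M e : 0 < e -> absum u M ->
  exists2 s0 : seq I, uniq s0 & forall s, uniq s ->
    (forall i, i \in s -> i \notin s0) -> \sum_(i <- s) normc (u i) <= e.
Proof.
move=> e0 hu.
pose A := [set x : R | exists2 s : seq I, uniq s & x = \sum_(i <- s) normc (u i)].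
have supA : has_sup A.
  split; first by exists 0, [::]; rewrite ?big_nil.
  by exists M => _ [s us ->]; exact: hu.
have [_ [s0 us0 ->] h0] := sup_adherent e0 supA.
exists s0 => // s us dis.
have : A (\sum_(i <- s0 ++ s) normc (u i)).
  exists (s0 ++ s) => //; rewrite cat_uniq us0 us andbT /=.
  by apply/hasPn => i /dis.
move=> /(ub_le_sup (proj2 supA)); rewrite big_cat /=; lra.
Qed.

Lemma hsum_unique u x y : hsum u x -> hsum u y -> x = y.
Proof.
move=> hx hy; apply/eqP; rewrite -subr_eq0; apply/eqP; apply: normc_eq0P => e e0.
have e20 : 0 < e / 2 by rewrite divr_gt0.
have [s us hs] := hx _ e20; have [t ut ht] := hy _ e20.
have h1 := hs (undup (s ++ t)) (undup_uniq _).
have h2 := ht (undup (s ++ t)) (undup_uniq _).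
apply: le_trans (ler_normc_trans _ (\sum_(i <- undup (s ++ t)) u i) _) _.
rewrite normcBC [e]splitr lerD ?h1 ?h2 // => i;
  by rewrite mem_undup mem_cat => ->; rewrite ?orbT.
Qed.

Lemma csumE u z : hsum u z -> csum u = z.
Proof. by move=> h; apply: xget_unique => // y hy; apply: hsum_unique hy h. Qed.

Lemma hsumD u v x y : hsum u x -> hsum v y -> hsum (fun i => u i + v i) (x + y).
Proof.
move=> hx hy e e0.
have e20 : 0 < e / 2 by rewrite divr_gt0.
have [s us hs] := hx _ e20; have [t ut ht] := hy _ e20.
exists (undup (s ++ t)); first exact: undup_uniq.
move=> r ur sub; rewrite big_split /=.
have -> : forall a b : C, a + b - (x + y) = (a - x) + (b - y) by move=> *; ring.
apply: le_trans (le_normcD _ _) _.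
rewrite [e]splitr lerD ?hs ?ht // => i ii; apply: sub;
  by rewrite mem_undup mem_cat ii ?orbT.
Qed.

Lemma hsumZ u x a : hsum u x -> hsum (fun i => a * u i) (a * x).
Proof.
move=> hx e e0.
have n0 := normc_ge0 a.
have d0 : 0 < e / (normc a + 1) by rewrite divr_gt0 // ltr_wpDl.
have [s us hs] := hx _ d0; exists s => // r ur sub.
rewrite -mulr_sumr -mulrBr normcM.
apply: (@le_trans _ _ (normc a * (e / (normc a + 1)))).
  by rewrite ler_wpM2l ?hs.
rewrite mulrCA ger_pMr // ler_pdivrMr ?mul1r; lra.
Qed.

Lemma hsumN u x : hsum u x -> hsum (fun i => - u i) (- x).
Proof.
move=> /(hsumZ (-1)); rewrite mulN1r; congr hsum.
by apply: funext => i; rewrite mulN1r.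
Qed.

Lemma hsumB u v x y : hsum u x -> hsum v y -> hsum (fun i => u i - v i) (x - y).
Proof. by move=> hx hy; apply: hsumD hx (hsumN hy). Qed.

Lemma hsum_seq u s : uniq s -> (forall i, i \notin s -> u i = 0) ->
  hsum u (\sum_(i <- s) u i).
Proof.
move=> us u0 e e0; exists s => // r ur sub.
suff -> : \sum_(i <- r) u i = \sum_(i <- s) u i by rewrite subrr normc0 ltW.
rewrite (bigID (mem s)) /= [X in _ + X]big1 ?addr0; last by move=> i /u0.
by rewrite -big_filter (perm_big _ (perm_filter_sub us ur sub)).
Qed.

Lemma hsum_pos_ex (p : I -> R) M : (forall i, 0 <= p i) ->
  (forall s, uniq s -> \sum_(i <- s) p i <= M) ->
  exists S : R, hsum (fun i => (p i)%:C%C) S%:C%C.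
Proof.
move=> p0 hM.
pose A := [set x : R | exists2 s : seq I, uniq s & x = \sum_(i <- s) p i].
have supA : has_sup A.
  split; first by exists 0, [::]; rewrite ?big_nil.
  by exists M => _ [s us ->]; exact: hM.
exists (sup A) => e e0.
have [_ [s0 us0 ->] h0] := sup_adherent e0 supA.
exists s0 => // s us sub.
rewrite -rmorph_sum -rmorphB normc_real distrC ger0_norm; last first.
  by rewrite subr_ge0; apply: (ub_le_sup (proj2 supA)); exists s.
have : \sum_(i <- s0) p i <= \sum_(i <- s) p i by exact: ler_sum_sub.
lra.
Qed.

Lemma hsum_ex u M : absum u M -> exists z, hsum u z.
Proof.
move=> hu.
have pos (f : I -> R) : (forall i, `|f i| <= normc (u i)) ->
    exists S : R, hsum (fun i => (f i)%:C%C) S%:C%C.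
  move=> fu.
  have [|s us|S1 h1] := @hsum_pos_ex (fun i => `|f i|) M.
  - by move=> i.
  - by apply: le_trans (hu s us); apply: ler_sum.
  have [|s us|S2 h2] := @hsum_pos_ex (fun i => `|f i| - f i) (M + M).
  - by move=> i; rewrite subr_ge0 ler_norm.
  - apply: le_trans (lerD (hu s us) (hu s us)).
    rewrite -big_split; apply: ler_sum => i _ /=.
    by apply: (lerD (fu i)); apply: le_trans (ler_norm _) _; rewrite normrN.
  exists (S1 - S2); have := hsumB h1 h2; rewrite -rmorphB; congr hsum.
  by apply: funext => i; rewrite -rmorphB; congr (_%:C)%C; ring.
have [a ha] := pos (fun i => complex.Re (u i)) (fun i => ler_Re_normc _).
have [b hb] := pos (fun i => complex.Im (u i)) (fun i => ler_Im_normc _).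
exists (a%:C + 'i * b%:C)%C.
have := hsumD ha (hsumZ 'i%C hb); congr hsum.
by apply: funext => i; rewrite -complexE.
Qed.

Lemma absum_hsum u M : absum u M -> hsum u (csum u).
Proof. by move=> /hsum_ex[z hz]; rewrite (csumE hz). Qed.

Lemma hsum_le u M z : absum u M -> hsum u z -> normc z <= M.
Proof.
move=> hu hz; apply/ler_addgt0Pr => e e0.
have [s us /(_ s us (fun _ => id)) hs] := hz _ e0.
have -> : z = \sum_(i <- s) u i - (\sum_(i <- s) u i - z) by ring.
apply: le_trans (ler_normcB _ _) _; apply: lerD hs.
by apply: le_trans (ler_normc_sum _ _ _) (hu s us).
Qed.

Lemma csum_le u M : absum u M -> normc (csum u) <= M.
Proof. by move=> hu; apply: (hsum_le hu (absum_hsum hu)). Qed.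

Lemma csumD u v M N : absum u M -> absum v N ->
  csum (fun i => u i + v i) = csum u + csum v.
Proof.
by move=> hu hv; apply: csumE (hsumD (absum_hsum hu) (absum_hsum hv)).
Qed.

Lemma csumB u v M N : absum u M -> absum v N ->
  csum (fun i => u i - v i) = csum u - csum v.
Proof.
by move=> hu hv; apply: csumE (hsumB (absum_hsum hu) (absum_hsum hv)).
Qed.

Lemma csumZ u a M : absum u M -> csum (fun i => a * u i) = a * csum u.
Proof. by move=> hu; apply: csumE (hsumZ _ (absum_hsum hu)). Qed.

(* no summability is needed: when [a != 0] both sums exist or neither does *)
Lemma csumZf u a : csum (fun i => a * u i) = a * csum u.
Proof.
have [->|a0] := eqVneq a 0.
  rewrite mul0r; apply: csumE; have := @hsum_seq (fun=> 0) [::] isT (fun _ _ => erefl).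
  by rewrite big_nil; congr hsum; apply: funext => i; rewrite mul0r.
have [[z hz]|nz] := pselect (exists z, hsum u z).
  by rewrite (csumE (hsumZ a hz)) (csumE hz).
rewrite /csum !xgetPN ?mulr0 // => z hz; first by apply: nz; exists z.
apply: nz; exists (a^-1 * z); have := hsumZ a^-1 hz; congr hsum.
by apply: funext => i; rewrite mulKf.
Qed.

Lemma csum0 : csum (fun _ : I => 0 : C) = 0.
Proof.
by rewrite (csumE (@hsum_seq (fun=> 0) [::] isT (fun _ _ => erefl))) big_nil.
Qed.

Lemma csum_seq u s : uniq s -> (forall i, i \notin s -> u i = 0) ->
  csum u = \sum_(i <- s) u i.
Proof. by move=> us u0; apply: csumE (hsum_seq us u0). Qed.

Lemma csum1 u i : (forall j, j != i -> u j = 0) -> csum u = u i.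
Proof.
move=> h; rewrite (@csum_seq _ [:: i]) // ?big_seq1 // => j.
by rewrite inE => /h.
Qed.

Lemma hsum_conj u z : hsum u z -> hsum (fun i => (u i)^*%C) z^*%C.
Proof.
move=> h e e0; have [s us hs] := h e e0; exists s => // r ur sub.
by rewrite -rmorph_sum -rmorphB normcJ' hs.
Qed.

Lemma csum_conj u M : absum u M -> csum (fun i => (u i)^*%C) = (csum u)^*%C.
Proof. by move=> hu; apply: csumE (hsum_conj (absum_hsum hu)). Qed.

(* Tannery's theorem *)
Lemma csum_dominated u (v : nat -> I -> C) M : absum u M ->
  (forall n i, normc (v n i) <= normc (u i)) ->
  (forall i e, 0 < e -> \forall n \near \oo, normc (v n i - u i) <= e) ->
  forall e, 0 < e -> \forall n \near \oo, normc (csum (v n) - csum u) <= e.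
Proof.
move=> hu vu lim e e0.
have [s us tail] := absum_tail (divr_gt0 e0 (ltr0n _ 4)) hu.
have e4 : 0 < e / 2 / (size s).+1%:R by rewrite !divr_gt0.
have near_s : \forall n \near \oo, forall i, i \in s ->
    normc (v n i - u i) <= e / 2 / (size s).+1%:R.
  elim: s {us tail} (e / 2 / _) e4 => [|j s IH] d d0; first by near=> n.
  near=> n => i; rewrite inE => /predU1P[->|]; first by near: n; exact: lim.
  by move: i; near: n; exact: IH.
near=> n.
have hv : absum (v n) M by apply: absum_mono hu.
have hd : absum (fun i => v n i - u i) (e / 2 + (e / 4 + e / 4)).
  move=> r ur; rewrite (bigID (mem s)) /=; apply: lerD; last first.
    apply: (@le_trans _ _ (\sum_(i <- r | i \notin s) (normc (u i) + normc (u i)))).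
      by apply: ler_sum => i _; apply: le_trans (ler_normcB _ _) _; rewrite lerD2r.
    rewrite big_split /= -big_filter lerD // tail ?filter_uniq // => i;
      by rewrite mem_filter => /andP[].
  apply: (@le_trans _ _ (\sum_(i <- s) e / 2 / (size s).+1%:R)); last first.
    by apply: sum_share; rewrite ltW ?divr_gt0.
  rewrite -big_filter.
  apply: (@le_trans _ _ (\sum_(i <- [seq x <- r | x \in s]) e / 2 / (size s).+1%:R)).
    rewrite big_seq [leRHS]big_seq; apply: ler_sum => i.
    by rewrite mem_filter => /andP[si _]; move: i si; near: n.
  apply: (@ler_sum_sub _ _ _ (fun=> _)); rewrite ?filter_uniq //.
    by move=> i; rewrite mem_filter => /andP[].
  by rewrite ltW.
rewrite -(csumB hv hu); apply: le_trans (csum_le hd) _; lra.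
Unshelve. all: by end_near.
Qed.

End OneIndex.

(** It suffices that [f] reaches the support of [u]: a finite set of indices is pulled back along a
    partial inverse of [f], and what is lost contributes 0. *)
Lemma hsum_reindex (I J : eqType) (f : J -> I) (u : I -> C) z : injective f ->
  (forall i, u i != 0 -> exists j, f j = i) ->
  hsum (fun j => u (f j)) z -> hsum u z.
Proof.
move=> finj im h e e0; have [s us hs] := h e e0.
exists (map f s); first by rewrite map_inj_uniq.
move=> r ur sub.
pose g i := if pselect (exists j, f j = i) is left p then Some (projT1 (cid p)) else None.
have fK : pcancel f g.
  rewrite /g => j; case: pselect => [p|[]]; last by exists j.
  by case: cid => k /= /finj ->.
have gK i j : g i = Some j -> f j = i.
  by rewrite /g; case: pselect => // p [<-]; case: cid.
have og : ocancel g f.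
  by move=> i; rewrite /oapp; case E : (g i) => [j|] //; apply: gK.
have ut : uniq (pmap g r) by apply: (pmap_uniq og).
have := hs (pmap g r) ut; rewrite -(big_map f xpredT u) (pmap_filter og) big_filter.
rewrite big_mkcond /= (eq_bigr u) => [|i _]; last first.
  case: ifPn => // gi; have [->//|/im[j ji]] := eqVneq (u i) 0.
  by move: gi; rewrite -ji fK.
apply => j sj; rewrite mem_pmap; apply/mapP; exists (f j); last by rewrite fK.
by apply: sub; apply: map_f.
Qed.

Lemma absum_reindex (I J : eqType) (f : J -> I) (u : I -> C) M : injective f ->
  absum u M -> absum (fun j => u (f j)) M.
Proof.
move=> finj h s us; have := h (map f s); rewrite map_inj_uniq // big_map.
exact.
Qed.

Lemma csum_reindex (I J : eqType) (f : J -> I) (u : I -> C) M : injective f ->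
  (forall i, u i != 0 -> exists j, f j = i) -> absum u M ->
  csum (fun j => u (f j)) = csum u.
Proof.
move=> finj im hu; apply/esym/csumE/(hsum_reindex finj im).
exact: absum_hsum (absum_reindex finj hu).
Qed.

Lemma absum_image (I J : eqType) (f : J -> I) (u : I -> C) M :
  (forall i, u i != 0 -> exists j, f j = i) ->
  absum (fun j => u (f j)) M -> absum u M.
Proof.
move=> im h s us.
pose t := [seq i <- s | u i != 0].
have ut : uniq t by exact: filter_uniq.
have [r rt] : exists r : seq J, map f r = t.
  have : forall i, i \in t -> exists j, f j = i.
    by move=> i; rewrite mem_filter => /andP[/im].
  elim: t {ut} => [|i t IH] ht; first by exists [::].
  have [j ji] := ht i (mem_head _ _).
  have [|r rt] := IH; first by move=> k kt; apply: ht; rewrite inE kt orbT.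
  by exists (j :: r); rewrite /= ji rt.
have -> : \sum_(i <- s) normc (u i) = \sum_(i <- t) normc (u i).
  rewrite big_filter [RHS]big_mkcond; apply: eq_bigr => i _.
  by case: eqVneq => // ->; rewrite normc0.
rewrite -rt big_map; apply: h; apply: (@map_uniq _ _ f); by rewrite rt.
Qed.

(** A finite set of pairs is contained in the product of its two projections, over which the sum can
    be taken row by row. *)
Lemma absum_prod (I J : eqType) (u : I -> J -> C) (B : I -> R) M :
  (forall i, absum (u i) (B i)) -> (forall s, uniq s -> \sum_(i <- s) B i <= M) ->
  absum (fun p : I * J => u p.1 p.2) M.
Proof.
move=> hu hB s us.
have B0 i : 0 <= B i by exact: absum_ge0 (hu i).
pose s1 := undup (map fst s); pose s2 := undup (map snd s).
apply: (@le_trans _ _ (\sum_(i <- s1) \sum_(j <- s2) normc (u i j))); last first.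
  apply: le_trans (hB s1 (undup_uniq _)); apply: ler_sum => i _.
  exact: (hu i _ (undup_uniq _)).
rewrite -(big_allpairs (F := fun p : I * J => normc (u p.1 p.2))).
apply: (@ler_sum_sub _ _ _ (fun p : I * J => normc (u p.1 p.2))) => //.
- by apply: allpairs_uniq; rewrite ?undup_uniq // => -[? ?] [].
- move=> [i j] si; apply/allpairsP; exists (i, j).
  by split=> //=; rewrite mem_undup; apply/mapP; exists (i, j).
- by move=> p; exact: normc_ge0.
Qed.

Lemma hsum_fubini (I J : eqType) (u : I -> J -> C) M :
  absum (fun p : I * J => u p.1 p.2) M ->
  hsum (fun i => csum (u i)) (csum (fun p : I * J => u p.1 p.2)).
Proof.
move=> hu e e0.
have e20 : 0 < e / 2 by rewrite divr_gt0.
have [s us hs] := absum_hsum hu e20.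
have hui i : absum (u i) M.
  by apply: (absum_reindex (f := pair i) _ hu) => ? ? [].
exists (undup (map fst s)); first exact: undup_uniq.
move=> r ur sub.
have d0 : 0 < e / 2 / (size r).+1%:R by rewrite divr_gt0.
have /boolp.choice[t ht] : forall i, exists x : seq J, uniq x /\ forall t', uniq t' ->
    {subset x <= t'} -> normc (\sum_(j <- t') u i j - csum (u i)) <=
      e / 2 / (size r).+1%:R.
  move=> i; have [x ux hx] := absum_hsum (hui i) d0.
  by exists x.
(* The columns contain those of [s], so that the double sum is close to its limit, and for each row
   of [r] enough indices to bring its finite sum near [csum]; the row tolerance was divided by the
   number of rows. *)
pose k := undup (map snd s ++ flatten (map t r)).
have uk : uniq k := undup_uniq _.
have hk : normc (\sum_(i <- r) \sum_(j <- k) u i j -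
    csum (fun p : I * J => u p.1 p.2)) <= e / 2.
  rewrite -(big_allpairs (F := fun p : I * J => u p.1 p.2)).
  apply: hs; first by apply: allpairs_uniq; rewrite ?undup_uniq // => -[? ?] [].
  move=> [i j] sij; apply/allpairsP; exists (i, j); split=> //=.
    by apply: sub; rewrite mem_undup; apply/mapP; exists (i, j).
  rewrite mem_undup mem_cat; apply/orP; left; apply/mapP; by exists (i, j).
apply: le_trans (ler_normc_trans _ (\sum_(i <- r) \sum_(j <- k) u i j) _) _.
rewrite [leRHS]splitr lerD // normcBC -sumrB.
apply: le_trans (ler_normc_sum _ _ _) _.
apply: (@le_trans _ _ (\sum_(i <- r) e / 2 / (size r).+1%:R)).
  rewrite big_seq [leRHS]big_seq; apply: ler_sum => i ri.
  apply: (ht i).2 => // j tj; rewrite mem_undup mem_cat; apply/orP; right.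
  by apply/flatten_mapP; exists i.
by apply: sum_share; rewrite ltW ?divr_gt0.
Qed.

Lemma csum_fubini (I J : eqType) (u : I -> J -> C) M :
  absum (fun p : I * J => u p.1 p.2) M ->
  csum (fun i => csum (u i)) = csum (fun j => csum (fun i => u i j)).
Proof.
move=> hu; rewrite (csumE (hsum_fubini hu)).
pose sw (p : J * I) := (p.2, p.1).
have swI : injective sw by move=> [? ?] [? ?] [-> ->].
have hu' := absum_reindex swI hu.
rewrite -(csum_reindex swI _ hu) => [|[i j] _]; last by exists (j, i).
by rewrite (csumE (hsum_fubini (u := fun j i => u i j) hu')).
Qed.

Lemma absum_inner (I J : eqType) (u : I -> J -> C) M :
  absum (fun p : I * J => u p.1 p.2) M -> forall i, absum (u i) M.
Proof. by move=> hu i; apply: (absum_reindex (f := pair i) _ hu) => ? ? []. Qed.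

Lemma absum_outer (I J : eqType) (u : I -> J -> C) M :
  absum (fun p : I * J => u p.1 p.2) M -> absum (fun i => csum (u i)) M.
Proof.
move=> hu s us.
apply/ler_addgt0Pr => e e0.
have d0 : 0 < e / (size s).+1%:R by rewrite divr_gt0.
have hui := absum_inner hu.
have /boolp.choice[t ht] : forall i, exists x : seq J, uniq x /\ forall t', uniq t' ->
    {subset x <= t'} -> normc (\sum_(j <- t') u i j - csum (u i)) <=
      e / (size s).+1%:R.
  move=> i; have [x ux hx] := absum_hsum (hui i) d0.
  by exists x.
pose k := undup (flatten (map t s)).
apply: (@le_trans _ _ (\sum_(i <- s) (\sum_(j <- k) normc (u i j) + e / (size s).+1%:R))).
  rewrite big_seq [leRHS]big_seq; apply: ler_sum => i si.
  have -> : csum (u i) = \sum_(j <- k) u i j - (\sum_(j <- k) u i j - csum (u i)).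
    by ring.
  apply: le_trans (ler_normcB _ _) _; apply: lerD; first exact: ler_normc_sum.
  apply: (ht i).2; first exact: undup_uniq.
  by move=> j tj; rewrite mem_undup; apply/flatten_mapP; exists i.
rewrite big_split /=; apply: lerD.
  rewrite -(big_allpairs (F := fun p : I * J => normc (u p.1 p.2))).
  apply: hu; apply: allpairs_uniq; rewrite ?undup_uniq // => -[? ?] [] //.
by apply: sum_share; rewrite ltW ?divr_gt0.
Qed.

End UnconditionalSums.

(** * The Wiener algebra of the torus *)

Section Cis.
Variable R : realType.
Implicit Types x y : R.

Definition cis x : R[i] := (cos x +i* sin x)%C.

Lemma cis0 : cis 0 = 1.
Proof. by rewrite /cis cos0 sin0. Qed.

Lemma cisD x y : cis (x + y) = cis x * cis y.
Proof.
rewrite /cis cosD sinD; apply/eqP; rewrite eq_complex /=.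
by apply/andP; split; apply/eqP; ring.
Qed.

Lemma cisN x : cis (- x) = (cis x)^*%C.
Proof. by rewrite /cis cosN sinN. Qed.

Lemma normc_cis x : normc (cis x) = 1.
Proof. by rewrite /= cos2Dsin2 sqrtr1. Qed.

Lemma cis_period x (m : int) : cis (x + 2 * pi * m%:~R) = cis x.
Proof.
have nat_period (j : nat) y : cis (y + 2 * pi * j%:R) = cis y.
  elim: j y => [|j IH] y; first by rewrite mulr0 addr0.
  rewrite -[j.+1%:R]natr1 mulrDr mulr1 addrA /cis.
  have c2 z : cos (z + 2 * pi) = cos z :> R by rewrite mulr_natl cosD2pi.
  have s2 z : sin (z + 2 * pi) = sin z :> R by rewrite mulr_natl sinD2pi.
  by rewrite c2 s2 -/(cis _) IH.
case: m => j; first exact: nat_period.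
rewrite NegzE mulrNz mulrN.
by rewrite -[RHS](nat_period j.+1) -[in LHS](nat_period j.+1) addrNK nat_period.
Qed.

End Cis.

Section WienerAlgebra.
Variables (R : realType) (n : nat).
Local Notation C := R[i].
Local Notation K := 'rV[int]_n.
Implicit Types (a b : K -> C) (phi : 'rV[R]_n).

Lemma dotrDr (k : K) phi psi : dotr k (phi + psi) = dotr k phi + dotr k psi.
Proof. by rewrite /dotr -big_split; apply: eq_bigr => i _; rewrite mxE mulrDr. Qed.

Lemma dotrZr (k : K) t phi : dotr k (t *: phi) = t * dotr k phi.
Proof. by rewrite /dotr mulr_sumr; apply: eq_bigr => i _; rewrite mxE mulrCA. Qed.

Lemma dotrDl (k l : K) phi : dotr (k + l) phi = dotr k phi + dotr l phi.
Proof.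
by rewrite /dotr -big_split; apply: eq_bigr => i _; rewrite mxE rmorphD mulrDl.
Qed.

Lemma dotrNl (k : K) phi : dotr (- k) phi = - dotr k phi.
Proof.
by rewrite /dotr -sumrN; apply: eq_bigr => i _; rewrite mxE rmorphN mulNr.
Qed.

Lemma dotr0l phi : dotr (0 : K) phi = 0.
Proof. by rewrite /dotr big1 // => i _; rewrite mxE mul0r. Qed.

Definition eval a phi : C := csum (fun k => a k * cis (dotr k phi)).

Definition wsum (T : eqType) (c : T -> K -> C) : K -> C :=
  fun k => csum (fun t => c t k).

Definition famsum (T : eqType) (c : T -> K -> C) (M : R) :=
  absum (fun p : T * K => c p.1 p.2) M.

Definition wconst (z : C) : K -> C := fun k => if k == 0 then z else 0.

(** Written as a superposition of shifted copies of [a], a convolution inherits summability,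
    evaluation and symmetry from the lemmas on [wsum]. *)
Definition conv a b : K -> C := wsum (fun j k => b j * a (k - j)).

Fixpoint wpow a m : K -> C := if m is m'.+1 then conv a (wpow a m') else wconst 1.

(** These are the coefficients of real-valued functions. The property is kept as an invariant of the
    iteration, so that the solution found is real. *)
Definition sym a : Prop := forall k, a (- k) = ((a k)^*)%C.

Lemma absum_eval a M phi : absum a M ->
  absum (fun k => a k * cis (dotr k phi)) M.
Proof. by apply: absum_mono => k; rewrite normcM normc_cis mulr1. Qed.

Lemma eval_le a M phi : absum a M -> normc (eval a phi) <= M.
Proof. by move=> ha; apply/csum_le/absum_eval. Qed.

Lemma evalD a b M N phi : absum a M -> absum b N ->
  eval (fun k => a k + b k) phi = eval a phi + eval b phi.
Proof.
move=> ha hb; rewrite /eval -(csumD (absum_eval phi ha) (absum_eval phi hb)).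
by congr csum; apply: funext => k; rewrite mulrDl.
Qed.

Lemma evalB a b M N phi : absum a M -> absum b N ->
  eval (fun k => a k - b k) phi = eval a phi - eval b phi.
Proof.
move=> ha hb; rewrite /eval -(csumB (absum_eval phi ha) (absum_eval phi hb)).
by congr csum; apply: funext => k; rewrite mulrBl.
Qed.

Lemma evalZ a z M phi : absum a M ->
  eval (fun k => z * a k) phi = z * eval a phi.
Proof.
move=> ha; rewrite /eval -(csumZ _ (absum_eval phi ha)).
by congr csum; apply: funext => k; rewrite mulrA.
Qed.

Lemma eval_shift a phi psi :
  eval (fun k => cis (dotr k psi) * a k) phi = eval a (phi + psi).
Proof.
congr csum; apply: funext => k; rewrite dotrDr cisD.
by rewrite [cis (dotr k psi) * _]mulrC -mulrA; congr (_ * _); rewrite mulrC.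
Qed.

Lemma absum_wconst z : absum (wconst z) (normc z).
Proof.
move=> s us; have [s0|s0] := boolP (0 \in s).
  rewrite (bigD1_seq 0) //= {1}/wconst eqxx big1 ?addr0 // => k /negbTE k0.
  by rewrite /wconst k0 normc0.
rewrite big_seq big1 ?normc_ge0 // => k ks; rewrite /wconst; case: eqP => [k0|_].
  by rewrite -k0 ks in s0.
exact: normc0.
Qed.

Lemma eval_wconst z phi : eval (wconst z) phi = z.
Proof.
rewrite /eval (csum1 (i := 0)) => [|k /negbTE k0]; last by rewrite /wconst k0 mul0r.
by rewrite /wconst eqxx dotr0l cis0 mulr1.
Qed.

Section FamilySums.
Variable T : eqType.
Implicit Types c : T -> K -> C.

Lemma famsumT c M : famsum c M -> absum (fun p : K * T => c p.2 p.1) M.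
Proof.
move=> h; apply: (absum_reindex (f := fun p : K * T => (p.2, p.1)) _ h).
by move=> [? ?] [? ?] [-> ->].
Qed.

Lemma famsum_ex c (B : T -> R) M : (forall t, absum (c t) (B t)) ->
  (forall s, uniq s -> \sum_(t <- s) B t <= M) -> famsum c M.
Proof. exact: absum_prod. Qed.

Lemma absum_wsum c M : famsum c M -> absum (wsum c) M.
Proof. by move=> /famsumT h; exact: (absum_outer (u := fun k t => c t k) h). Qed.

Lemma famsum_term c M t : famsum c M -> absum (c t) M.
Proof. by move=> h; exact: (absum_inner h). Qed.

Lemma famsum_at c M k : famsum c M -> absum (fun t => c t k) M.
Proof. by move=> /famsumT h; exact: (absum_inner (u := fun k t => c t k) h). Qed.

Lemma famsum_eval c M phi : famsum c M -> absum (fun t => eval (c t) phi) M.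
Proof.
move=> h; apply: (absum_outer (u := fun t k => c t k * cis (dotr k phi))).
by apply: absum_mono h => p; rewrite normcM normc_cis mulr1.
Qed.

Lemma eval_wsum c M phi : famsum c M ->
  eval (wsum c) phi = csum (fun t => eval (c t) phi).
Proof.
move=> h; have h' : absum (fun p : T * K => c p.1 p.2 * cis (dotr p.2 phi)) M.
  by apply: absum_mono h => p; rewrite normcM normc_cis mulr1.
rewrite (csum_fubini h') /eval; congr csum; apply: funext => k.
rewrite [LHS]mulrC -(csumZ _ (famsum_at k h)); congr csum.
by apply: funext => t; rewrite mulrC.
Qed.

Lemma wsumB c c' M N : famsum c M -> famsum c' N ->
  wsum (fun t k => c t k - c' t k) = (fun k => wsum c k - wsum c' k).
Proof.
move=> h h'; apply: funext => k.
exact: (csumB (famsum_at k h) (famsum_at k h')).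
Qed.

Lemma sym_wsum c M : famsum c M -> (forall t, sym (c t)) -> sym (wsum c).
Proof.
move=> h hs k; rewrite /wsum -(csum_conj (famsum_at k h)).
by congr csum; apply: funext => t; rewrite hs.
Qed.

End FamilySums.

Lemma absum_shift a M j : absum a M -> absum (fun k => a (k - j)) M.
Proof. by move=> ha; apply: absum_reindex ha => k l /addIr. Qed.

Lemma famsum_conv a b M N : absum a M -> absum b N ->
  famsum (fun j k => b j * a (k - j)) (M * N).
Proof.
move=> ha hb; apply: (famsum_ex (B := fun j => normc (b j) * M)).
  by move=> j; apply/absumZ/absum_shift.
move=> s us; rewrite -mulr_suml mulrC ler_wpM2l ?hb //; exact: absum_ge0 ha.
Qed.

Lemma absum_conv a b M N : absum a M -> absum b N -> absum (conv a b) (M * N).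
Proof. by move=> ha hb; apply/absum_wsum/famsum_conv. Qed.

Lemma eval_conv a b M N phi : absum a M -> absum b N ->
  eval (conv a b) phi = eval a phi * eval b phi.
Proof.
move=> ha hb; rewrite (eval_wsum _ (famsum_conv ha hb)).
rewrite [RHS]mulrC [in RHS]mulrC -(csumZ (eval a phi) (absum_eval phi hb)).
congr csum; apply: funext => j.
rewrite (evalZ _ _ (absum_shift j ha)) mulrCA; congr (_ * _); rewrite mulrC.
rewrite {2}/eval -(csumZ (cis (dotr j phi)) (absum_eval phi ha)).
have aj := absum_eval phi (absum_shift j ha).
rewrite -[LHS](csum_reindex (addIr j) _ aj) => [|k _]; last by exists (k - j); rewrite subrK.
by congr csum; apply: funext => k; rewrite addrK dotrDl cisD; ring.
Qed.

Lemma sym_conv a b M N : absum a M -> absum b N -> sym a -> sym b ->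
  sym (conv a b).
Proof.
move=> ha hb sa sb k.
have h := famsum_at k (famsum_conv ha hb).
have h' := famsum_at (- k) (famsum_conv ha hb).
rewrite /conv /wsum -(csum_conj h) -(csum_reindex oppr_inj _ h') => [|j _]; last first.
  by exists (- j); rewrite opprK.
congr csum; apply: funext => j.
by rewrite sb conjcM -sa; congr (_ * a _); rewrite opprB opprK addrC.
Qed.

Lemma convBB a a' b b' M N M' N' : absum a M -> absum a' M' -> absum b N ->
  absum b' N' -> (fun k => conv a b k - conv a' b' k) =
  (fun k => conv (fun k => a k - a' k) b k + conv a' (fun k => b k - b' k) k).
Proof.
move=> ha ha' hb hb'; apply: funext => k.
have h1 := famsum_at k (famsum_conv ha hb).
have h2 := famsum_at k (famsum_conv ha' hb').
have h3 := famsum_at k (famsum_conv (absumB ha ha') hb).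
have h4 := famsum_at k (famsum_conv ha' (absumB hb hb')).
rewrite /conv /wsum -(csumB h1 h2) -(csumD h3 h4).
by congr csum; apply: funext => j; ring.
Qed.

Lemma sym_wconst (r : R) : sym (wconst r%:C%C).
Proof. by move=> k; rewrite /wconst oppr_eq0; case: eqP => _; rewrite ?conjc_real ?conjc0. Qed.

Lemma absum_wpow a M m : absum a M -> absum (wpow a m) (M ^+ m).
Proof.
move=> ha; elim: m => [|m IH] /=; last by rewrite exprS; exact: absum_conv.
by rewrite expr0 -(@normc1 R); exact: absum_wconst.
Qed.

Lemma eval_wpow a M m phi : absum a M -> eval (wpow a m) phi = eval a phi ^+ m.
Proof.
move=> ha; elim: m => [|m IH] /=; first by rewrite eval_wconst.
by rewrite (eval_conv _ ha (absum_wpow m ha)) IH exprS.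
Qed.

Lemma symD a b : sym a -> sym b -> sym (fun k => a k + b k).
Proof. by move=> sa sb k; rewrite sa sb rmorphD. Qed.

Lemma symB a b : sym a -> sym b -> sym (fun k => a k - b k).
Proof. by move=> sa sb k; rewrite sa sb rmorphB. Qed.

Lemma symZ (r : R) a : sym a -> sym (fun k => r%:C%C * a k).
Proof. by move=> sa k; rewrite sa conjcM conjc_real. Qed.

Lemma symM m a : sym m -> sym a -> sym (fun k => m k * a k).
Proof. by move=> sa sb k; rewrite sa sb conjcM. Qed.

Lemma eval_sym_conj a M phi : absum a M -> sym a ->
  ((eval a phi)^*)%C = eval a phi.
Proof.
move=> ha sa; rewrite -(csum_conj (absum_eval phi ha)).
rewrite [RHS](_ : _ = csum (fun k => a (- k) * cis (dotr (- k) phi))); last first.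
  rewrite (csum_reindex oppr_inj _ (absum_eval phi ha)) // => k _.
  by exists (- k); rewrite opprK.
by congr csum; apply: funext => k; rewrite conjcM sa dotrNl cisN.
Qed.

Lemma eval_sym_real a M phi : absum a M -> sym a ->
  ((complex.Re (eval a phi))%:C)%C = eval a phi.
Proof.
move=> ha sa; have := eval_sym_conj phi ha sa.
by case: (eval a phi) => x y /= [/eqP]; rewrite eq_sym -addr_eq0 -mulr2n mulrn_eq0 /= => /eqP ->.
Qed.

(* The Hermitian part of a coefficient family represents the real part of the
   function. *)
Definition herm a : K -> C := fun k => (a k + ((a (- k))^*)%C) / 2.

Lemma absum_oppconj a M : absum a M -> absum (fun k => ((a (- k))^*)%C) M.
Proof.
move=> ha; have := absum_reindex (@oppr_inj K) ha.
by apply: absum_mono => k; rewrite normcJ'.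
Qed.

Lemma sym_herm a : sym (herm a).
Proof.
move=> k; by rewrite /herm opprK conjcM conjcD conjcK conjc_inv conjc_nat addrC.
Qed.

Lemma famsum_hermZ (T : eqType) (r : T -> R) (c : T -> K -> C) M :
  famsum (fun t k => ((r t)%:C)%C * c t k) M ->
  famsum (fun t k => ((r t)%:C)%C * herm (c t) k) M.
Proof.
move=> h; have h' : famsum (fun t k => ((r t)%:C)%C * ((c t (- k))^*)%C) M.
  have : absum (fun p : T * K => ((r p.1)%:C)%C * c p.1 (- p.2)) M.
    apply: (absum_reindex (f := fun p : T * K => (p.1, - p.2)) _ h).
    by move=> [t k] [t' k'] [-> /oppr_inj ->].
  by apply: absum_mono => -[t k]; rewrite !normcM normcJ'.
have h2 := absumZ (2^-1) (absumD h h').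
apply: (@absum_le _ _ _ (normc (2^-1 : C) * (M + M))).
  rewrite normcV -[2]/(2%:R) -[2%:R]/(1 *+ 2) normcMn normc1; lra.
by apply: absum_mono h2 => -[t k] /=; rewrite /herm le_eqVlt; apply/orP; left;
  apply/eqP; congr normc; ring.
Qed.

Lemma eval_herm a M phi : absum a M ->
  eval (herm a) phi = ((complex.Re (eval a phi))%:C)%C.
Proof.
move=> ha.
have -> : herm a = fun k => 2^-1 * (a k + ((a (- k))^*)%C).
  by apply: funext => k; rewrite mulrC.
rewrite (evalZ _ _ (absumD ha (absum_oppconj ha))) (evalD _ ha (absum_oppconj ha)).
have -> : eval (fun k => ((a (- k))^*)%C) phi = ((eval a phi)^*)%C.
  rewrite -(csum_conj (absum_eval phi ha)) [RHS](_ : _ =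
    csum (fun k => ((a (- k) * cis (dotr (- k) phi))^*)%C)); last first.
    have hc : absum (fun k => ((a k * cis (dotr k phi))^*)%C) M.
      by apply: absum_mono (absum_eval phi ha) => k; rewrite normcJ'.
    rewrite -(csum_reindex (@oppr_inj K) _ hc) // => k _.
    by exists (- k); rewrite opprK.
  by congr csum; apply: funext => k; rewrite conjcM dotrNl cisN conjcK.
by rewrite ReJ_add mulrC.
Qed.

End WienerAlgebra.

(** * Lipschitz maps on balls of the Wiener algebra and their fixed points *)

Section Lipschitz.
Variables (R : realType) (n : nat).
Local Notation C := R[i].
Local Notation K := 'rV[int]_n.
Implicit Types (h : K -> C) (F G : (K -> C) -> K -> C).

(** Size on the ball, Lipschitz constant and preservation of reality travel together, so that one
    computation of constants for a composite map yields everything the fixed point theorem asks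
    for. *)
Definition lip (rho : R) F (B L : R) : Prop :=
  [/\ forall h, absum h rho -> absum (F h) B,
      forall h h' D, absum h rho -> absum h' rho ->
        absum (fun k => h k - h' k) D ->
        absum (fun k => F h k - F h' k) (L * D) &
      forall h, absum h rho -> sym h -> sym (F h)].

Lemma lip_ge0 rho F B L : 0 <= rho -> lip rho F B L -> 0 <= B.
Proof.
move=> r0 [h _ _]; apply: (@absum_ge0 _ _ (F (fun=> 0))); apply: h.
by apply: absum_le r0 _; exact: absum0.
Qed.

Lemma lip_weaken rho rho' F B B' L L' : rho' <= rho -> B <= B' -> L <= L' ->
  lip rho F B L -> lip rho' F B' L'.
Proof.
move=> rr BB LL [h1 h2 h3]; split.
- by move=> h hh; apply: absum_le BB _; apply: h1; apply: absum_le hh.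
- move=> h h' D hh hh' hD; apply: (@absum_le _ _ _ (L * D)).
    by rewrite ler_wpM2r // (absum_ge0 hD).
  by apply: h2 => //; [apply: absum_le hh|apply: absum_le hh'].
- by move=> h hh; apply: h3; apply: absum_le hh.
Qed.

Lemma lip_const rho a B : absum a B -> sym a -> lip rho (fun=> a) B 0.
Proof.
move=> ha sa; split=> // h h' D _ _ _; rewrite mul0r.
apply: absum_mono (@absum0 _ _) => k; by rewrite subrr.
Qed.

Lemma lip_mult rho (m : K -> C) B : 0 <= B -> (forall k, normc (m k) <= B) ->
  sym m -> lip rho (fun h k => m k * h k) (B * rho) B.
Proof.
move=> B0 mB sm; split=> [h hh|h h' D _ _ hD|h _ sh]; last exact: symM.
- exact: absumM_bounded.
- apply: absum_mono (absumM_bounded B0 mB hD) => k.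
  by rewrite mulrBr.
Qed.

Lemma lipD rho F G B B' L L' : lip rho F B L -> lip rho G B' L' ->
  lip rho (fun h k => F h k + G h k) (B + B') (L + L').
Proof.
move=> [f1 f2 f3] [g1 g2 g3]; split.
- by move=> h hh; apply: absumD; [exact: f1|exact: g1].
- move=> h h' D hh hh' hD; rewrite mulrDl.
  apply: absum_mono (absumD (f2 _ _ _ hh hh' hD) (g2 _ _ _ hh hh' hD)) => k.
  by rewrite opprD addrACA.
- by move=> h hh sh; apply: symD; [exact: f3|exact: g3].
Qed.

Lemma lipZ rho F (r : R) B L : lip rho F B L ->
  lip rho (fun h k => r%:C%C * F h k) (`|r| * B) (`|r| * L).
Proof.
move=> [f1 f2 f3]; rewrite -normc_real; split.
- by move=> h hh; apply: absumZ; exact: f1.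
- move=> h h' D hh hh' hD; rewrite -mulrA.
  apply: absum_mono (absumZ _ (f2 _ _ _ hh hh' hD)) => k.
  by rewrite mulrBr.
- by move=> h hh sh; apply: symZ; exact: f3.
Qed.

Lemma lip_conv rho F G B B' L L' : lip rho F B L -> lip rho G B' L' ->
  lip rho (fun h => conv (F h) (G h)) (B * B') (L * B' + B * L').
Proof.
move=> [f1 f2 f3] [g1 g2 g3]; split.
- by move=> h hh; apply: absum_conv; [exact: f1|exact: g1].
- move=> h h' D hh hh' hD.
  rewrite (convBB (f1 _ hh) (f1 _ hh') (g1 _ hh) (g1 _ hh')).
  have -> : (L * B' + B * L') * D = (L * D) * B' + B * (L' * D) by ring.
  apply: absumD; apply: absum_conv.
  + exact: f2.
  + exact: g1.
  + exact: f1.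
  + exact: g2.
- move=> h hh sh; apply: (sym_conv (f1 _ hh) (g1 _ hh)); [exact: f3|exact: g3].
Qed.

Lemma lip_pow rho F B L m : 0 <= rho -> lip rho F B L ->
  lip rho (fun h => wpow (F h) m) (B ^+ m) (m%:R * B ^+ m.-1 * L).
Proof.
move=> r0 hF; have B0 := lip_ge0 r0 hF.
elim: m => [|m IH] /=.
  rewrite mul0r mul0r expr0 -(@normc1 R); apply: lip_const; first exact: absum_wconst.
  exact: (sym_wconst 1).
have := lip_conv hF IH; rewrite -exprS; apply: lip_weaken => //.
case: m {IH} => [|m] /=; rewrite ?expr0 ?exprS; first by lra.
by rewrite -[m.+2%:R]natr1 le_eqVlt; apply/orP; left; apply/eqP; ring.
Qed.

(** The joint summability is returned as well, because evaluating a [wsum] term by term requires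
    it. *)
Lemma lip_wsum (T : eqType) rho (F : T -> (K -> C) -> K -> C) (B L : T -> R) B' L' :
  0 <= rho -> (forall t, lip rho (F t) (B t) (L t)) ->
  (forall s, uniq s -> \sum_(t <- s) B t <= B') ->
  (forall s, uniq s -> \sum_(t <- s) L t <= L') ->
  lip rho (fun h => wsum (F^~ h)) B' L' /\
  forall h, absum h rho -> famsum (F^~ h) B'.
Proof.
move=> r0 hF hB hL.
have fam h : absum h rho -> famsum (F^~ h) B'.
  move=> hh; apply: (famsum_ex (B := B)) => // t; by case: (hF t) => + _ _; apply.
split=> //; split.
- by move=> h hh; apply/absum_wsum/fam.
- move=> h h' D hh hh' hD; rewrite -(wsumB (fam _ hh) (fam _ hh')).
  apply/absum_wsum/(famsum_ex (B := fun t => L t * D)).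
    by move=> t; case: (hF t) => _ + _; apply.
  move=> s us; rewrite -mulr_suml ler_wpM2r ?hL //; exact: absum_ge0 hD.
- move=> h hh sh; apply: (sym_wsum (fam _ hh)) => t.
  by case: (hF t) => _ _; apply.
Qed.

Lemma sum_half_le2 (s : seq nat) : uniq s ->
  \sum_(j <- s) (2^-1 : R) ^+ j <= 2.
Proof.
move=> us; pose m := (\max_(j <- s) j).+1.
have le : \sum_(j <- s) (2^-1 : R) ^+ j <= \sum_(j <- iota 0 m) 2^-1 ^+ j.
  apply: ler_sum_sub; rewrite ?iota_uniq //.
    by move=> j sj; rewrite mem_iota /= add0n ltnS; apply: leq_bigmax_seq.
apply: le_trans le _.
have -> : forall m, \sum_(j <- iota 0 m) (2^-1 : R) ^+ j = 2 - 2 * 2^-1 ^+ m.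
  elim=> [|k IH]; first by rewrite big_nil expr0; lra.
  rewrite -[k.+1]addn1 iotaD big_cat IH /= big_seq1 add0n addn1 exprS; lra.
have : 0 <= (2^-1 : R) ^+ m by rewrite exprn_ge0.
lra.
Qed.

Lemma csum_split (u : nat -> C) M j : absum u M ->
  csum u = \sum_(i < j) u i + csum (fun i => u (j + i)%N).
Proof.
move=> hu.
pose u1 i := if (i < j)%N then u i else 0.
pose u2 i := if (i < j)%N then 0 else u i.
have h1 : absum u1 M.
  by apply: absum_mono hu => i; rewrite /u1; case: ifP => _; rewrite ?normc0 ?normc_ge0.
have h2 : absum u2 M.
  by apply: absum_mono hu => i; rewrite /u2; case: ifP => _; rewrite ?normc0 ?normc_ge0.
have -> : u = fun i => u1 i + u2 i.
  by apply: funext => i; rewrite /u1 /u2; case: ifP => _; rewrite ?addr0 ?add0r.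
rewrite (csumD h1 h2); congr (_ + _).
  rewrite (csum_seq (s := iota 0 j)) ?iota_uniq //; last first.
    by move=> i; rewrite mem_iota /= add0n /u1 => /negbTE ->.
  rewrite -[j in LHS]subn0 -/(index_iota 0 j) big_mkord; apply: eq_bigr => i _.
  by rewrite /u1 /u2 ltn_ord addr0.
rewrite -(csum_reindex (@addnI j) _ h2).
  by congr csum; apply: funext => i; rewrite /u1 /u2 ltnNge leq_addr /= add0r.
move=> i; rewrite /u2; case: ltnP => [_|ji _]; first by rewrite eqxx.
by exists (i - j)%N; rewrite subnKC.
Qed.

(** Banach's theorem with completeness made concrete: the Picard increments starting from 0 decay
    geometrically, hence form a summable family, and their [wsum] is the limit. Symmetry survives
    because it passes through [wsum]. *)
Lemma fixpoint_lip (rho : R) F : 0 <= rho -> lip rho F rho 2^-1 ->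
  exists h, [/\ absum h rho, sym h & F h = h].
Proof.
move=> r0 [f1 f2 f3].
pose h j := iter j F (fun=> 0).
have hb j : absum (h j) rho.
  by elim: j => [|j IH] /=; [exact: absum_le r0 (@absum0 _ _)|exact: f1].
have hs j : sym (h j).
  by elim: j => [|j IH] /=; [move=> k; rewrite conjc0|exact: f3].
pose d j k := h j.+1 k - h j k.
have hd j : absum (d j) (2^-1 ^+ j * rho).
  elim: j => [|j IH]; first by rewrite expr0 mul1r; apply: absum_mono (hb 1%N) => k; rewrite /d subr0.
  by rewrite exprS -mulrA; exact: (f2 (h j.+1) (h j) _ (hb _) (hb _) IH).
have fd : famsum d (2 * rho).
  apply: (famsum_ex hd) => s us.
  by rewrite -mulr_suml ler_wpM2r // sum_half_le2.
pose H := wsum d.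
have tele j k : \sum_(i < j) d i k = h j k.
  by elim: j => [|j IH]; rewrite ?big_ord0 // big_ord_recr /= IH /d addrC subrK.
have HE j k : H k - h j k = wsum (fun i => d (j + i)%N) k.
  by rewrite /H /wsum (csum_split j (famsum_at k fd)) tele addrC addKr.
have Hd j : absum (fun k => H k - h j k) (2^-1 ^+ j * (2 * rho)).
  have : famsum (fun i => d (j + i)%N) (2^-1 ^+ j * (2 * rho)).
    apply: (famsum_ex (fun i => hd (j + i)%N)) => s us.
    rewrite -mulr_suml mulrA ler_wpM2r // (eq_bigr (fun i => 2^-1 ^+ j * 2^-1 ^+ i)).
      by rewrite -mulr_sumr ler_wpM2l ?exprn_ge0 ?sum_half_le2.
    by move=> i _; rewrite exprD.
  by move=> /absum_wsum; congr absum; apply: funext => k; rewrite HE.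
have small e : 0 < e -> exists j, (2^-1 : R) ^+ j * (2 * rho) <= e.
  move=> e0; pose A := Num.bound (2 * rho / e).
  exists A; rewrite exprVn mulrC ler_pdivrMr ?exprn_gt0 // -ler_pdivrMl // mulrC.
  apply: (@le_trans _ _ (A%:R)).
    by apply/ltW/archi_boundP; rewrite divr_ge0 ?mulr_ge0 // ltW.
  by rewrite -natrX ler_nat ltnW // ltn_expl.
have Hb : absum H rho.
  move=> s us; apply/ler_addgt0Pr => e /small[j je].
  apply: le_trans (_ : _ <= \sum_(k <- s) normc (h j k) + \sum_(k <- s) normc (H k - h j k)) _.
    rewrite -big_split; apply: ler_sum => k _ /=.
    by rewrite -{1}(subrK (h j k) (H k)) addrC; exact: le_normcD.
  by apply: lerD (hb j s us) _; apply: le_trans (Hd j s us) je.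
exists H; split=> //.
  exact: (sym_wsum fd (fun j => symB (hs j.+1) (hs j))).
apply: funext => k; apply/eqP; rewrite -subr_eq0; apply/eqP/normc_eq0P => e e0.
have [j je] := small _ (divr_gt0 e0 (ltr0n _ 2)).
apply: le_trans (ler_normc_trans _ (h j.+1 k) _) _.
rewrite [leRHS]splitr lerD //.
  apply: le_trans (absum_term k (f2 _ _ _ Hb (hb j) (Hd j))) _.
  apply: le_trans je; rewrite -[leRHS]mul1r ler_wpM2r //; last lra.
  by rewrite mulr_ge0 ?exprn_ge0 ?mulr_ge0.
rewrite normcBC; apply: le_trans (absum_term k (Hd j.+1)) _.
apply: le_trans je; rewrite exprS -mulrA -[leRHS]mul1r ler_wpM2r //; last lra.
by rewrite mulr_ge0 ?exprn_ge0 ?mulr_ge0.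
Qed.

End Lipschitz.

(** * Explicit Fourier series on the circle *)

Section RealLemmas.
Variable R : realType.

Lemma mvt_bound (f df : R -> R) (a b M : R) :
  (forall x, is_derive x (1 : R) f (df x)) ->
  (forall x, Num.min a b <= x <= Num.max a b -> `|df x| <= M) ->
  `|f b - f a| <= M * `|b - a|.
Proof.
move=> fd dM.
wlog ab : a b dM / a < b.
  move=> W; have [ab|ba|->] := ltgtP a b; first exact: W.
    rewrite distrC [`|b - a|]distrC; apply: W => // x xab; apply: dM.
    by rewrite minC maxC.
  by rewrite !subrr normr0 mulr0.
have cf : {within `[a, b], continuous f}.
  apply: continuous_subspaceT => x; apply: differentiable_continuous.
  by apply/derivable1_diffP; case: (fd x).
have [c cab ->] := MVT ab (fun x _ => fd x) cf.
rewrite normrM ler_wpM2r // dM //.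
move: cab; rewrite in_itv /= => /andP[ac cb].
by rewrite ge_min le_max (ltW ac) (ltW cb) orbT.
Qed.

Lemma is_derive_cosM (k x : R) :
  is_derive x (1 : R) (fun y => cos (k * y)) (- (k * sin (k * x))).
Proof.
have h : is_derive x (1 : R) (fun y => k * y) k.
  by apply: (is_derive_eq (is_deriveZ k (is_derive_id x 1))); rewrite /GRing.scale /= mulr1.
by apply: (is_derive_eq (is_derive1_comp (is_derive_cos _) h)); rewrite mulNr mulrC.
Qed.

Lemma is_derive_sinM (k x : R) :
  is_derive x (1 : R) (fun y => sin (k * y)) (k * cos (k * x)).
Proof.
have h : is_derive x (1 : R) (fun y => k * y) k.
  by apply: (is_derive_eq (is_deriveZ k (is_derive_id x 1))); rewrite /GRing.scale /= mulr1.
by apply: (is_derive_eq (is_derive1_comp (is_derive_sin _) h)); rewrite mulrC.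
Qed.

Lemma is_derive_sum_seq (I : Type) (s : seq I) (F : I -> R -> R) (dF : I -> R) (x : R) :
  (forall i, is_derive x (1 : R) (F i) (dF i)) ->
  is_derive x (1 : R) (fun y => \sum_(i <- s) F i y) (\sum_(i <- s) dF i).
Proof.
move=> h; elim: s => [|i s IH].
  have -> : (fun y : R => \sum_(i <- [::]) F i y) = cst 0.
    by apply: funext => y; rewrite big_nil.
  by rewrite big_nil; exact: is_derive_cst.
have -> : (fun y => \sum_(j <- i :: s) F j y) = F i + (fun y => \sum_(j <- s) F j y).
  by apply: funext => y; rewrite big_cons.
by rewrite big_cons; exact: is_deriveD.
Qed.

End RealLemmas.

Section CisContinuity.
Variable R : realType.

Lemma cis_lip (x y : R) : normc (cis x - cis y) <= 2 * `|x - y|.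
Proof.
apply: le_trans (normc_ReIm _) _.
have dc z : is_derive z (1 : R) (@cos R) (- sin z) by exact: is_derive_cos.
have ds z : is_derive z (1 : R) (@sin R) (cos z) by exact: is_derive_sin.
have hc := mvt_bound (a := y) (b := x) (M := 1) dc.
have hs := mvt_bound (a := y) (b := x) (M := 1) ds.
have -> : 2 * `|x - y| = 1 * `|x - y| + 1 * `|x - y| by ring.
apply: lerD; [apply: hc|apply: hs] => z _.
  by rewrite normrN ler_norml sin_geN1 sin_le1.
by rewrite ler_norml cos_geN1 cos_le1.
Qed.

Lemma csum_cis_continuous (T : topologicalType) (I : eqType) (a : I -> R[i])
    (th : I -> T -> R) M (x : T) : absum a M ->
  (forall i, {for x, continuous (th i)}) -> forall e, 0 < e ->
  \forall y \near x, normc (csum (fun i => a i * cis (th i y)) -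
                            csum (fun i => a i * cis (th i x))) <= e.
Proof.
move=> ha hc e e0.
have M0 : 0 <= M := absum_ge0 ha.
have [s us tail] := absum_tail (divr_gt0 e0 (ltr0n _ 4)) ha.
have d0 : 0 < e / 2 / (2 * M + 1) / (size s).+1%:R.
  by rewrite !divr_gt0 // ltr_wpDl ?mulr_ge0.
have near_s : \forall y \near x, forall i, i \in s ->
    `|th i y - th i x| <= e / 2 / (2 * M + 1) / (size s).+1%:R.
  elim: s {us tail} (e / 2 / _ / _) d0 => [|j s IH] d d0; first by near=> y.
  near=> y => i; rewrite inE => /predU1P[->|]; last by move: i; near: y; exact: IH.
  near: y; have /cvgrPdist_le/(_ _ d0) := hc j.
  by apply: filterS => y; rewrite distrC.
near=> y.
have hy z : absum (fun i => a i * cis (th i z)) M.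
  by apply: absum_mono ha => i; rewrite normcM normc_cis mulr1.
rewrite -(csumB (hy y) (hy x)); apply: csum_le => r ur.
rewrite (bigID (mem s)) /= [e]splitr; apply: lerD; last first.
  apply: (@le_trans _ _ (\sum_(i <- r | i \notin s) (normc (a i) + normc (a i)))).
    apply: ler_sum => i _; apply: le_trans (ler_normcB _ _) _.
    by rewrite !normcM !normc_cis !mulr1.
  have -> : e / 2 = e / 4 + e / 4 by field.
  rewrite big_split /= -big_filter lerD // tail ?filter_uniq // => i;
    by rewrite mem_filter => /andP[].
rewrite -big_filter.
apply: (@le_trans _ _ (\sum_(i <- [seq x <- r | x \in s]) e / 2 / (size s).+1%:R)).
  rewrite big_seq [leRHS]big_seq; apply: ler_sum => i.
  rewrite mem_filter => /andP[si _]; rewrite -mulrBr normcM.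
  apply: (@le_trans _ _ (M * (2 * (e / 2 / (2 * M + 1) / (size s).+1%:R)))).
    apply: ler_pM; rewrite ?normc_ge0 ?(absum_term i ha) //.
    apply: le_trans (cis_lip _ _) _; rewrite ler_pM2l //.
    by move: i si; near: y.
  have M1 : 0 < 2 * M + 1 by rewrite ltr_wpDl ?mulr_ge0.
  have -> : M * (2 * (e / 2 / (2 * M + 1) / (size s).+1%:R)) =
      (e / 2 / (size s).+1%:R) * (2 * M / (2 * M + 1)).
    have p0 : (size s).+1%:R != 0 :> R by rewrite pnatr_eq0.
    have q0 : 2 * M + 1 != 0 by rewrite gt_eqF.
    by move: ((size s).+1%:R) p0 => p p0; field; rewrite ?p0 ?q0.
  rewrite -[leRHS]mulr1; apply: ler_wpM2l; first by apply: ltW; rewrite !divr_gt0.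
  by rewrite ler_pdivrMr // mul1r lerDl.
apply: le_trans (_ : \sum_(i <- s) e / 2 / (size s).+1%:R <= _); last first.
  by apply: sum_share; rewrite ltW ?divr_gt0.
apply: (@ler_sum_sub _ _ _ _ (fun=> _)); rewrite ?filter_uniq //.
  by move=> i; rewrite mem_filter => /andP[].
by move=> _; rewrite ltW ?divr_gt0.
Unshelve. all: by end_near.
Qed.

End CisContinuity.

Section BernoulliSeries.
Variable R : realType.
Local Notation C := R[i].

(* coefficients of [2 * \sum_(k >= 1) cos (k x) / k^2]; [bern 0 = 0] since [0^-1 = 0] *)
Definition bern (j : int) : C := (((2 * j%:~R ^+ 2)^-1 : R)%:C)%C.

Lemma sum_inv_sqr (s : seq nat) : uniq s ->
  \sum_(k <- s) ((k.+1%:R : R) ^+ 2)^-1 <= 2.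
Proof.
move=> us; pose m := (\max_(j <- s) j).+1.
apply: le_trans (_ : _ <= \sum_(k <- iota 0 m) ((k.+1%:R : R) ^+ 2)^-1) _.
  apply: (@ler_sum_sub _ _ _ _ (fun k => (k.+1%:R ^+ 2)^-1)); rewrite ?iota_uniq //.
    by move=> j sj; rewrite mem_iota /= add0n ltnS; apply: leq_bigmax_seq.
(* The bound with a correction term telescopes, since 1/(p+2)^2 is at most 1/(p+1) - 1/(p+2). *)
suff H p : \sum_(k <- iota 0 p.+1) ((k.+1%:R : R) ^+ 2)^-1 <= 2 - p.+1%:R^-1.
  by apply: le_trans (H _) _; rewrite gerBl invr_ge0.
elim: p => [|p IH]; first by rewrite /= big_seq1 expr1n invr1; lra.
rewrite -[p.+2]addn1 iotaD big_cat /= big_seq1 add0n addn1.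
have p0 : 0 < p.+1%:R :> R by [].
have q0 : 0 < p.+2%:R :> R by [].
have pq : p.+2%:R = p.+1%:R + 1 :> R by rewrite -[p.+2%:R]natr1.
apply: le_trans (lerD IH (lexx _)) _.
suff H : (p.+2%:R ^+ 2)^-1 <= p.+1%:R^-1 - p.+2%:R^-1 :> R.
  by apply: le_trans (lerD (lexx _) H) _; rewrite addrA subrK.
have -> : p.+1%:R^-1 - p.+2%:R^-1 = (p.+1%:R * p.+2%:R)^-1 :> R.
  have p1 : p.+1%:R + 1 != 0 :> R by rewrite -pq gt_eqF.
  have p2 : p.+1%:R != 0 :> R by rewrite gt_eqF.
  by rewrite pq; move: (p.+1%:R) p1 p2 => z z1 z2; field; rewrite ?z1 ?z2.
by rewrite lef_pV2 ?posrE ?mulr_gt0 ?exprn_gt0 // expr2 ler_pM2r // pq lerDl.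
Qed.

Lemma absum_bern : absum bern 2.
Proof.
pose bp (j : int) : C := if j is Posz _ then bern j else 0.
pose bn (j : int) : C := if j is Negz _ then bern j else 0.
have -> : bern = fun j => bp j + bn j.
  by apply: funext => -[] k; rewrite /bp /bn ?addr0 ?add0r.
have bound (k : nat) : normc (((2 * (k.+1%:R : R) ^+ 2)^-1)%:C)%C <=
    2^-1 * (k.+1%:R ^+ 2)^-1.
  by rewrite normc_real ger0_norm ?invr_ge0 ?mulr_ge0 ?exprn_ge0 // invfM.
have step (f : nat -> C) : (forall k, normc (f k) <= 2^-1 * ((k.+1%:R : R) ^+ 2)^-1) ->
    absum f 1.
  move=> hf s us; apply: le_trans (_ : _ <= \sum_(k <- s) 2^-1 * (k.+1%:R ^+ 2)^-1) _.
    exact: ler_sum.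
  by rewrite -mulr_sumr; have := sum_inv_sqr us; lra.
have -> : 2 = 1 + 1 :> R by [].
apply: absumD.
  apply: (absum_image (f := fun k : nat => Posz k.+1)); last first.
    by apply: step => k; exact: bound.
  case=> [] [|k]; rewrite /bp ?eqxx //; last by exists k.
  by rewrite /bern expr0n /= mulr0 invr0 eqxx.
apply: (absum_image (f := fun k : nat => Negz k)); last first.
  apply: step => k; rewrite /bn /bern NegzE mulrNz sqrrN; exact: bound.
by case=> k; rewrite /bn ?eqxx //; exists k.
Qed.

Definition fser (b : int -> C) (x : R) : C := csum (fun j => b j * cis (j%:~R * x)).

Lemma absum_fser (b : int -> C) (M x : R) : absum b M -> absum (fun j : int => b j * cis (j%:~R * x) : C) M.
Proof. by apply: absum_mono => j; rewrite normcM normc_cis mulr1. Qed.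

Lemma fser_period b x : fser b (x + 2 * pi) = fser b x.
Proof.
congr csum; apply: funext => j; rewrite mulrDr; congr (_ * _).
by rewrite [_ * (2 * pi)]mulrC cis_period.
Qed.

(** The Cesaro mean of [fser bern]. The series differentiated twice has no convergent partial sums,
    but the Cesaro weights turn it into the Fejer kernel, which tends to 0 uniformly away from the
    multiples of 2 pi. *)
Definition fejer (n : nat) (x : R) : R :=
  \sum_(i <- iota 0 n) ((1 - i.+1%:R / n.+1%:R) / i.+1%:R ^+ 2) * cos (i.+1%:R * x).

Definition dfejer (n : nat) (x : R) : R :=
  \sum_(i <- iota 0 n) - ((1 - i.+1%:R / n.+1%:R) / i.+1%:R) * sin (i.+1%:R * x).

Definition ddfejer (n : nat) (x : R) : R :=
  \sum_(i <- iota 0 n) - (1 - i.+1%:R / n.+1%:R) * cos (i.+1%:R * x).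

Lemma is_derive_fejer n x : is_derive x (1 : R) (fejer n) (dfejer n x).
Proof.
apply: is_derive_sum_seq => i.
have h := is_deriveZ (((1 - i.+1%:R / n.+1%:R) / i.+1%:R ^+ 2)) (is_derive_cosM i.+1%:R x).
apply: (is_derive_eq h); rewrite /GRing.scale /=.
have p0 : i.+1%:R != 0 :> R by rewrite pnatr_eq0.
by move: (i.+1%:R) (n.+1%:R^-1) p0 => p q p0; field; rewrite ?p0.
Qed.

Lemma is_derive_dfejer n x : is_derive x (1 : R) (dfejer n) (ddfejer n x).
Proof.
apply: is_derive_sum_seq => i.
have h := is_deriveZ (- ((1 - i.+1%:R / n.+1%:R) / i.+1%:R)) (is_derive_sinM i.+1%:R x).
apply: (is_derive_eq h); rewrite /GRing.scale /=.
have p0 : i.+1%:R != 0 :> R by rewrite pnatr_eq0.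
by move: (i.+1%:R) (n.+1%:R^-1) p0 => p q p0; field; rewrite ?p0.
Qed.

(* the Fejer kernel in closed form *)
Lemma ddfejerE n x :
  (1 - cos x) * (n.+1%:R * (1 - 2 * ddfejer n x)) = 1 - cos (n.+1%:R * x).
Proof.
(* [S m] is the Dirichlet kernel, and [E m] is the sum of the kernels from [S 0] to [S m]. *)
pose S m := 1 + 2 * \sum_(i <- iota 0 m) cos (i.+1%:R * x).
pose E m := m.+1%:R + 2 * \sum_(i <- iota 0 m) (m%:R - i%:R) * cos (i.+1%:R * x).
have SE m : (1 - cos x) * S m = cos (m%:R * x) - cos (m.+1%:R * x).
  rewrite /S; elim: m => [|m IH].
    by rewrite big_nil mulr0 addr0 mulr1 mul0r cos0 mul1r.
  rewrite -[in iota _ _]addn1 iotaD big_cat /= big_seq1 add0n.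
  have -> : m.+2%:R * x = m.+1%:R * x + x by rewrite -[m.+2%:R]natr1 mulrDl mul1r.
  have e1 : m%:R * x = m.+1%:R * x - x by rewrite -[m.+1%:R]natr1; ring.
  move: IH; rewrite {1}e1 cosB cosD => IH.
  have -> : forall a b c : R, (1 - a) * (1 + 2 * (b + c)) =
    (1 - a) * (1 + 2 * b) + 2 * (1 - a) * c by move=> *; ring.
  rewrite IH; ring.
have ES m : E m.+1 = E m + S m.+1.
  rewrite /E /S -[in iota 0 m.+1]addn1 iotaD !big_cat /= !big_seq1 add0n.
  have -> : \sum_(i <- iota 0 m) (m.+1%:R - i%:R) * cos (i.+1%:R * x) =
    \sum_(i <- iota 0 m) (m%:R - i%:R) * cos (i.+1%:R * x) +
    \sum_(i <- iota 0 m) cos (i.+1%:R * x) :> R.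
    by rewrite -big_split; apply: eq_bigr => i _ /=; rewrite -[m.+1%:R]natr1; ring.
  rewrite -[m.+2%:R]natr1 -[m.+1%:R]natr1; ring.
have EE m : (1 - cos x) * E m = 1 - cos (m.+1%:R * x).
  elim: m => [|m IH]; first by rewrite /E big_nil mulr0 addr0 mulr1 mul1r.
  by rewrite ES mulrDr IH SE; ring.
rewrite -EE; congr (_ * _); rewrite /E /ddfejer mulrBr mulr1; congr (_ + _).
rewrite mulrCA -mulrN; congr (2 * _); rewrite mulr_sumr -sumrN.
apply: eq_bigr => i _; move: (cos _) => c; have p0 : n%:R + 1 != 0 :> R by rewrite natr1 pnatr_eq0.
rewrite -[n.+1%:R]natr1 -[i.+1%:R]natr1.
by field; rewrite ?p0.
Qed.

(** The Cesaro weights lie between 0 and 1 and tend to 1 for each mode, so Tannery's theorem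
    applies. *)
Lemma fejer_fser x e : 0 < e ->
  \forall n \near \oo, normc ((fejer n x)%:C%C - fser bern x) <= e.
Proof.
move=> e0.
pose v n (j : int) : C := if (`|j| <= n)%N then
  ((1 - (`|j|%N)%:R / n.+1%:R : R)%:C)%C * (bern j * cis (j%:~R * x)) else 0.
have hu := absum_fser x absum_bern.
have hv n j : normc (v n j) <= normc (bern j * cis (j%:~R * x)).
  rewrite /v; case: ifP => jn; last by rewrite normc0 normc_ge0.
  rewrite normcM -[leRHS]mul1r ler_wpM2r ?normc_ge0 // normc_real ger0_norm.
    by rewrite gerBl divr_ge0.
  by rewrite subr_ge0 ler_pdivrMr // mul1r ler_nat (leq_trans jn).
have lim j d : 0 < d ->
    \forall n \near \oo, normc (v n j - bern j * cis (j%:~R * x)) <= d.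
  move=> d0; near=> n.
  have jn : (`|j| <= n)%N by near: n; exact: nbhs_infty_ge.
  rewrite /v jn.
  have -> : forall y z : C, y * z - z = (y - 1) * z by move=> *; ring.
  have -> : forall y : R, (y%:C)%C - 1 = ((y - 1)%:C)%C :> C by move=> y; rewrite rmorphB.
  rewrite addrAC subrr add0r normcM normc_real normrN ger0_norm ?divr_ge0 //.
  have b2 : normc (bern j * cis (j%:~R * x)) <= 2 by exact: absum_term hu.
  apply: (@le_trans _ _ ((`|j|%N)%:R / n.+1%:R * 2)).
    by rewrite ler_wpM2l ?divr_ge0.
  rewrite mulrAC ler_pdivrMr // -ler_pdivrMl //.
  apply: (@le_trans _ _ n%:R); last by rewrite ler_nat.
  near: n; exact: nbhs_infty_ger.
have := csum_dominated hu hv lim e0; apply: filterS => n.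
congr (normc (_ - _) <= _).
rewrite (csum_seq (s := map Posz (iota 1 n) ++ map Negz (iota 0 n))).
- rewrite big_cat /= !big_map -[iota 1 n]/(iota (1 + 0) n) iotaDl big_map -big_split /=.
  rewrite rmorph_sum big_seq [RHS]big_seq; apply: eq_bigr => i.
  rewrite mem_iota add0n /= => iin; rewrite /v /= add1n iin /bern NegzE.
  rewrite mulrNz sqrrN mulNr cisN -!pmulrn.
  have -> : forall (a b : R) (z : C), (a%:C)%C * ((b%:C)%C * z) + (a%:C)%C * ((b%:C)%C * (z^*)%C)
     = ((a * b * (2 * complex.Re z))%:C)%C.
    move=> a b z; rewrite -!mulrDr addcJ mulrA.
    by rewrite !rmorphM /= rmorph_nat.
  congr ((_%:C)%C); rewrite /cis /=.
  have p0 : i.+1%:R != 0 :> R by rewrite pnatr_eq0.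
  by move: (i.+1%:R) (n.+1%:R^-1) p0 => p q p0; field; rewrite ?p0.
- rewrite cat_uniq !map_inj_uniq ?iota_uniq /=; [|by move=> ? ? []|by move=> ? ? []].
  by rewrite andbT; apply/hasPn => _ /mapP[k _ ->]; apply/mapP => -[].
- move=> j; rewrite mem_cat negb_or => /andP[j1 j2].
  rewrite /v; case: ifPn => // jn; case: j jn j1 j2 => [] [|k] jn j1 j2 /=.
  + by rewrite /bern expr0n /= mulr0 invr0 [X in _ * X]mul0r mulr0.
  + by case/mapP: j1; exists k.+1 => //; rewrite mem_iota add1n ltnS.
  + by case/mapP: j2; exists 0%N => //; rewrite mem_iota add0n.
  + by case/mapP: j2; exists k.+1 => //; rewrite mem_iota add0n.
Unshelve. all: by end_near.
Qed.

(** The difference between the Cesaro mean and the parabola has a second derivative tending to 0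
    away from the endpoints and a first derivative vanishing at pi. Two applications of the mean
    value theorem from pi then give the limit. Measuring everything from the value at pi spares the
    evaluation of zeta(2). *)
Lemma bern_interior x : 0 < x < 2 * pi ->
  fser bern x = fser bern pi + ((x ^+ 2 / 4 - pi * x / 2 + pi ^+ 2 / 4)%:C)%C.
Proof.
move=> /andP[x0 x2]; apply/eqP; rewrite -subr_eq0; apply/eqP/normc_eq0P => e e0.
pose d := Num.min x (2 * pi - x).
have d0 : 0 < d by rewrite lt_min x0 subr_gt0.
have pi0 := pi_gt0 R.
have dpi : d <= pi by rewrite /d; case: (leP x (2 * pi - x)); lra.
have dI : d \in `[0, pi] by rewrite in_itv /= (ltW d0).
have oI : 0 \in `[0, pi :> R] by rewrite in_itv /= lexx ltW.
have cd : cos d < 1 by rewrite -cos0 ltr_cos.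
have cos_anti y z : 0 <= z <= y -> y <= pi -> cos y <= cos z.
  move=> /andP[z0 zy] ypi; have [->//|ne] := eqVneq y z.
  apply/ltW; rewrite ltr_cos ?lt_neqAle ?(eq_sym z) ?ne //;
    by rewrite in_itv /= ?z0 ?(le_trans z0 zy) ?(le_trans zy ypi).
have c_le y : d <= y <= 2 * pi - d -> cos y <= cos d.
  move=> /andP[dy yd]; case: (leP y pi) => ypi.
    by apply: cos_anti => //; rewrite dy ltW.
  have -> : cos y = cos (2 * pi - y).
    by rewrite cosB mulr_natl cos2pi sin2pi mul1r mul0r addr0.
  by apply: cos_anti; lra.
pose v n y := fejer n y - y ^+ 2 / 4 + pi / 2 * y.
pose dv n y := dfejer n y - y / 2 + pi / 2.
(* By [ddfejerE] this is minus one half of the Fejer kernel, hence at most 1 / ((1 - cos y) (n+1))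
   in absolute value. *)
pose ddv n y := ddfejer n y - 2^-1.
have hv n y : is_derive y (1 : R) (v n) (dv n y).
  have h1 := is_derive_fejer n y.
  have h2 : is_derive y (1 : R) (fun z => - (z ^+ 2 / 4) + pi / 2 * z) (- (y / 2) + pi / 2).
    have -> : (fun z => - (z ^+ 2 / 4) + pi / 2 * z) =
      ((- 4^-1) \*: ((@id R) * (@id R))) + ((pi / 2) \*: (@id R)) :> (R -> R).
      apply: funext => z; change (- (z ^+ 2 / 4) + pi / 2 * z = (- 4^-1) * (z * z) + (pi / 2) * z).
      by field.
    have hi := is_derive_id y (1 : R).
    apply: (is_derive_eq (is_deriveD (is_deriveZ _ (is_deriveM hi hi)) (is_deriveZ _ hi))).
    by rewrite /GRing.scale /=; field.
  have -> : v n = fejer n + (fun z => - (z ^+ 2 / 4) + pi / 2 * z).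
    by apply: funext => z; rewrite /v fctE addrA.
  by rewrite /dv -addrA; apply: is_deriveD.
have hdv n y : is_derive y (1 : R) (dv n) (ddv n y).
  have h1 := is_derive_dfejer n y.
  have h2 : is_derive y (1 : R) (fun z => - (z / 2) + pi / 2) (- 2^-1).
    have -> : (fun z => - (z / 2) + pi / 2) = ((- 2^-1) \*: (@id R)) + cst (pi / 2) :> (R -> R).
      apply: funext => z; change (- (z / 2) + pi / 2 = (- 2^-1) * z + (pi / 2)).
      by field.
    apply: (is_derive_eq (is_deriveD (is_deriveZ _ (is_derive_id y (1 : R))) (is_derive_cst (pi / 2) y 1))).
    by rewrite /GRing.scale /=; field.
  have -> : dv n = dfejer n + (fun z => - (z / 2) + pi / 2).
    by apply: funext => z; rewrite /dv fctE addrA.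
  exact: is_deriveD.
pose del n := ((1 - cos d) * n.+1%:R)^-1.
have del0 n : 0 < del n by rewrite invr_gt0 mulr_gt0 // subr_gt0.
have ddvE n y : d <= y <= 2 * pi - d -> `|ddv n y| <= del n.
  move=> /c_le yd; have := ddfejerE n y; have := cos_le1 (n.+1%:R * y).
  have := cos_geN1 (n.+1%:R * y); move: (cos (_ * y)) => c c1 c2 E.
  have p0 : 0 < (1 - cos y) * n.+1%:R by rewrite mulr_gt0 // subr_gt0; lra.
  have -> : ddv n y = - ((1 - c) / 2 / ((1 - cos y) * n.+1%:R)).
    have q1 : 1 - cos y != 0 by rewrite gt_eqF // subr_gt0; lra.
    have q2 : n.+1%:R != 0 :> R by rewrite pnatr_eq0.
    rewrite -E /ddv; move: (ddfejer n y) (1 - cos y) q1 (n.+1%:R) q2 => D A A0 B B0.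
    by field; rewrite ?A0 ?B0.
  have nn : 0 <= (1 - c) / 2 by lra.
  have n1 : (1 - c) / 2 <= 1 by lra.
  rewrite normrN ger0_norm; last by rewrite divr_ge0 // ltW.
  rewrite /del -[leRHS]mul1r; apply: ler_pM; [by []|by rewrite invr_ge0 ltW|by []|].
  have c0 : 0 < 1 - cos d by rewrite subr_gt0.
  rewrite lef_pV2 ?posrE // ?mulr_gt0 // ler_wpM2r //; lra.
have dvpi n : dv n pi = 0.
  have sinpi k : sin (k%:R * pi) = 0 :> R.
    by elim: k => [|k IH]; rewrite ?mul0r ?sin0 // -natr1 mulrDl mul1r sinDpi IH oppr0.
  rewrite /dv /dfejer big1 => [|i _]; last by rewrite sinpi mulr0.
  by rewrite add0r addrC subrr.
have dvE n y : d <= y <= 2 * pi - d -> `|dv n y| <= del n * pi.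
  move=> yd; rewrite -[dv n y]subr0 -(dvpi n).
  apply: le_trans (_ : _ <= del n * `|y - pi|) _; last first.
    by rewrite ler_pM2l // ler_norml; lra.
  apply: (mvt_bound (hdv n)) => z /andP[z1 z2]; apply: ddvE.
  move: z1 z2; rewrite ge_min le_max => /orP[] z1 /orP[] z2; lra.
have vE n : `|v n x - v n pi| <= del n * pi * pi.
  have xd : d <= x <= 2 * pi - d.
    by rewrite /d; case: (leP x (2 * pi - x)); lra.
  apply: le_trans (_ : _ <= del n * pi * `|x - pi|) _; last first.
    by rewrite ler_pM2l ?mulr_gt0 // ler_norml; lra.
  apply: (mvt_bound (hv n)) => z /andP[z1 z2]; apply: dvE.
  move: z1 z2; rewrite ge_min le_max => /orP[] z1 /orP[] z2; lra.
have e30 : 0 < e / 3 by rewrite divr_gt0.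
near \oo => n.
have h1 : normc ((fejer n x)%:C%C - fser bern x) <= e / 3.
  by near: n; exact: fejer_fser.
have h2 : normc ((fejer n pi)%:C%C - fser bern pi) <= e / 3.
  by near: n; exact: fejer_fser.
have h3 : del n * pi * pi <= e / 3.
  have c0 : 0 < 1 - cos d by rewrite subr_gt0.
  pose Q := (1 - cos d)^-1 * (pi * pi).
  have -> : del n * pi * pi = Q / n.+1%:R by rewrite /del /Q invfM; ring.
  rewrite ler_pdivrMr // mulrC -ler_pdivrMr //.
  apply: (@le_trans _ _ n%:R); last by rewrite ler_nat.
  near: n; exact: nbhs_infty_ger.
have -> : fser bern x - (fser bern pi + ((x ^+ 2 / 4 - pi * x / 2 + pi ^+ 2 / 4)%:C)%C) =
    ((fejer n pi)%:C%C - fser bern pi) - ((fejer n x)%:C%C - fser bern x)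
    + ((v n x - v n pi)%:C)%C.
  have -> : (x ^+ 2 / 4 - pi * x / 2 + pi ^+ 2 / 4) =
     fejer n x - fejer n pi - (v n x - v n pi) by rewrite /v; field.
  by rewrite !rmorphB /=; ring.
apply: le_trans (le_normcD _ _) _.
have -> : e = e / 3 + e / 3 + e / 3 by field.
apply: lerD; first by apply: le_trans (ler_normcB _ _) _; exact: lerD.
by rewrite normc_real; apply: le_trans (vE n) h3.
Unshelve. all: by end_near.
Qed.

(** Continuity of the absolutely convergent series settles the endpoint 0, and periodicity carries
    it to 2 pi. *)
Lemma bern_formula x : 0 <= x <= 2 * pi ->
  fser bern x = fser bern pi + ((x ^+ 2 / 4 - pi * x / 2 + pi ^+ 2 / 4)%:C)%C.
Proof.
have pi0 := pi_gt0 R.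
pose G (y : R) := fser bern pi + ((y ^+ 2 / 4 - pi * y / 2 + pi ^+ 2 / 4)%:C)%C.
suff h0 : fser bern 0 = G 0.
  move=> /andP[]; rewrite le_eqVlt => /predU1P[<- _|x0]; first exact: h0.
  rewrite le_eqVlt => /predU1P[->|x2]; last by apply: bern_interior; rewrite x0.
  rewrite -[2 * pi]add0r fser_period h0 /G; congr (_ + (_%:C)%C); by field.
apply/eqP; rewrite -subr_eq0; apply/eqP/normc_eq0P => e e0.
have e20 : 0 < e / 2 by rewrite divr_gt0.
have cont : \forall y \near (0 : R), normc (fser bern y - fser bern 0) <= e / 2.
  apply: (csum_cis_continuous (th := fun (j : int) (y : R) => j%:~R * y) absum_bern) => // j.
  by apply: cvgM; [exact: cvg_cst|exact: cvg_id].
have [d /= d0 hd] := cont.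
pose y := Num.min (d / 2) (Num.min 1 (e / (2 * (pi + 1)))).
have pp : 0 < 2 * (pi + 1) :> R by rewrite mulr_gt0 // addr_gt0.
have y0 : 0 < y by rewrite /y !lt_min divr_gt0 //= ltr01 divr_gt0.
have [yd [y1 ye]] : y <= d / 2 /\ y <= 1 /\ y <= e / (2 * (pi + 1)).
  by rewrite /y !ge_min !lexx !orbT.
have := hd y; rewrite /ball /= sub0r normrN gtr0_norm //.
move=> /(_ (ltac:(lra) : y < d)) hy.
rewrite bern_interior // in hy; last by apply/andP; split => //; have := pi_ge2 R; lra.
apply: le_trans (ler_normc_trans _ (G y) _) _.
rewrite [leRHS]splitr; apply: lerD; first by rewrite normcBC.
rewrite /G [X in normc X](_ : _ = ((y ^+ 2 / 4 - pi * y / 2)%:C)%C); last first.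
  have -> : y ^+ 2 / 4 - pi * y / 2 = (y ^+ 2 / 4 - pi * y / 2 + pi ^+ 2 / 4) -
    (0 ^+ 2 / 4 - pi * 0 / 2 + pi ^+ 2 / 4) by field.
  by rewrite rmorphB /=; ring.
rewrite normc_real.
have : y * (pi + 1) <= e / 2.
  by move: ye; rewrite ler_pdivlMr //; lra.
rewrite ler_norml expr2; nra.
Qed.

End BernoulliSeries.

Section CircleFunctions.
Variable R : realType.
Local Notation C := R[i].
Implicit Types (b : int -> C) (x y h : R).

Lemma fser_shift b x y : fser (fun j => cis (j%:~R * y) * b j) x = fser b (x + y).
Proof.
congr csum; apply: funext => j; rewrite mulrDr cisD.
by rewrite [cis (_ * y) * _]mulrC -mulrA; congr (_ * _); rewrite mulrC.
Qed.

Lemma absum_fshift b M y : absum b M -> absum (fun j => cis (j%:~R * y) * b j) M.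
Proof. by apply: absum_mono => j; rewrite normcM normc_cis mul1r. Qed.

Lemma fserD b b' M N x : absum b M -> absum b' N ->
  fser (fun j => b j + b' j) x = fser b x + fser b' x.
Proof.
move=> ha hb; rewrite /fser -(csumD (absum_fser x ha) (absum_fser x hb)).
by congr csum; apply: funext => k; rewrite mulrDl.
Qed.

Lemma fserZ b z M x : absum b M -> fser (fun j => z * b j) x = z * fser b x.
Proof.
move=> ha; rewrite /fser -(csumZ _ (absum_fser x ha)).
by congr csum; apply: funext => k; rewrite mulrA.
Qed.

Definition fconst (z : C) (j : int) : C := if j == 0 then z else 0.

Lemma absum_fconst z : absum (fconst z) (normc z).
Proof.
move=> s us; have [s0|s0] := boolP (0 \in s).
  rewrite (bigD1_seq 0) //= {1}/fconst eqxx big1 ?addr0 // => k /negbTE k0.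
  by rewrite /fconst k0 normc0.
rewrite big_seq big1 ?normc_ge0 // => k ks; rewrite /fconst; case: eqP => [k0|_].
  by rewrite -k0 ks in s0.
exact: normc0.
Qed.

Lemma fser_fconst z x : fser (fconst z) x = z.
Proof.
rewrite /fser (csum1 (i := 0)) => [|k /negbTE k0]; last by rewrite /fconst k0 mul0r.
by rewrite /fconst eqxx mulr0z mul0r cis0 mulr1.
Qed.

(** The triangle wave: in the difference of two translates of the periodic parabola the quadratic
    terms cancel. A discontinuous sawtooth would also equal [x] near 0, but its coefficients, of
    order 1/j, are not summable. *)
Definition tri (j : int) : C :=
  ((- (2 / pi))%:C)%C * (cis (j%:~R * (pi / 2)) * bern R j) +
  ((2 / pi)%:C)%C * (cis (j%:~R * (3 * pi / 2)) * bern R j).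

Definition tri_norm : R := 2 * (2 / pi * 2).

Lemma absum_tri : absum tri tri_norm.
Proof.
have pi0 := pi_gt0 R.
have h y := absum_fshift y (@absum_bern R).
apply: absum_le (absumD (absumZ _ (h _)) (absumZ _ (h _))).
rewrite !normc_real normrN ger0_norm; last by rewrite divr_ge0 // ltW.
rewrite /tri_norm.
by rewrite le_eqVlt; apply/orP; left; apply/eqP; ring.
Qed.

Lemma fser_tri x : `|x| <= pi / 2 -> fser tri x = (x%:C)%C.
Proof.
have pi0 := pi_gt0 R.
rewrite ler_norml => /andP[x1 x2].
have h y := absum_fshift y (@absum_bern R).
rewrite (fserD _ (absumZ _ (h _)) (absumZ _ (h _))) !(fserZ _ _ (h _)) !fser_shift.
have e1 := @bern_formula R (x + pi / 2) (ltac:(lra)).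
have e2 := @bern_formula R (x + 3 * pi / 2) (ltac:(lra)).
rewrite e1 e2; move: (fser _ _) => F.
transitivity (((2 / pi * (((x + 3 * pi / 2) ^+ 2 / 4 - pi * (x + 3 * pi / 2) / 2) -
   ((x + pi / 2) ^+ 2 / 4 - pi * (x + pi / 2) / 2)))%:C)%C); last first.
  by congr (_%:C)%C; move: (pi : R) (lt0r_neq0 pi0) => p p0; field; rewrite ?p0.
move: (_ ^+ 2 / 4 - _) => a; move: (_ ^+ 2 / 4 - _) => c; move: (pi ^+ 2 / 4) (2 / pi) => d e.
by rewrite rmorphN rmorphM !rmorphD rmorphN /=; ring.
Qed.

(** The second difference of the periodic parabola has a kink only near 0, and the constant removes
    its value elsewhere: this is the periodic tent of height and half-width [h]. Two properties of
    it serve below, its support and the sum of its translates. *)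
Definition hat h (j : int) : C :=
  fconst ((h ^+ 2 / (2 * pi))%:C)%C j - ((pi^-1)%:C)%C *
   ((cis (j%:~R * h) * bern R j + cis (j%:~R * (- h)) * bern R j) - ((2 : R)%:C)%C * bern R j).

Lemma absum_hat h : exists M, absum (hat h) M.
Proof.
have H y := absum_fshift y (@absum_bern R).
eexists; apply: absumB (absum_fconst _) _.
apply: absumZ; apply: absumB; first exact: absumD.
by apply: absumZ; exact: absum_bern.
Qed.

Lemma fser_hatE h x : fser (hat h) x = ((h ^+ 2 / (2 * pi))%:C)%C - ((pi^-1)%:C)%C *
  (fser (bern R) (x + h) + fser (bern R) (x - h) - ((2 : R)%:C)%C * fser (bern R) x).
Proof.
have H y := absum_fshift y (@absum_bern R).
have B := @absum_bern R.
rewrite /hat (_ : (fun _ => _) = fun j => fconst ((h ^+ 2 / (2 * pi))%:C)%C j +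
  (- ((pi^-1)%:C)%C) *
   ((cis (j%:~R * h) * bern R j + cis (j%:~R * (- h)) * bern R j) +
    (- ((2 : R)%:C)%C) * bern R j)); last by apply: funext => j; ring.
rewrite (fserD _ (absum_fconst _) (absumZ _ (absumD (absumD (H _) (H _)) (absumZ _ B)))).
rewrite (fserZ _ _ (absumD (absumD (H _) (H _)) (absumZ _ B))).
rewrite (fserD _ (absumD (H _) (H _)) (absumZ _ B)).
rewrite (fserD _ (H _) (H _)) (fserZ _ _ B) !fser_shift fser_fconst; ring.
Qed.

Lemma fser_hat0 h x : 0 <= h -> h <= x <= 2 * pi - h -> fser (hat h) x = 0.
Proof.
have pi0 := pi_gt0 R; move=> h0 /andP[x1 x2].
have e1 := @bern_formula R (x + h) (ltac:(lra)).
have e2 := @bern_formula R (x - h) (ltac:(lra)).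
have e3 := @bern_formula R x (ltac:(lra)).
rewrite fser_hatE e1 e2 e3; move: (fser _ _) => F.
transitivity ((((h ^+ 2 / (2 * pi)) - pi^-1 *
   (((x + h) ^+ 2 / 4 - pi * (x + h) / 2 + pi ^+ 2 / 4) +
    ((x - h) ^+ 2 / 4 - pi * (x - h) / 2 + pi ^+ 2 / 4) -
    2 * (x ^+ 2 / 4 - pi * x / 2 + pi ^+ 2 / 4)))%:C)%C); last first.
  rewrite (_ : _ - _ = 0) //; by move: (pi : R) (lt0r_neq0 pi0) => p p0; field; rewrite ?p0.
move: (_ - _ + _) => a; move: (_ - _ + _) => c; move: (_ - _ + _) (_ ^+ 2 / _) (pi^-1) => d e g.
by rewrite rmorphB rmorphM rmorphB rmorphM rmorphD /=; ring.
Qed.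

(** Each hat is a constant minus a second difference, so the sum over a full period of translates
    telescopes to the constants. *)
Lemma sum_hat (N : nat) h x : N%:R * h = 2 * pi ->
  \sum_(J < N) fser (hat h) (x - J%:R * h) = (h%:C)%C.
Proof.
move=> Nh; have pi0 := pi_gt0 R.
pose f y := fser (bern R) y.
pose d y := f (y + h) - f y.
have -> : \sum_(J < N) fser (hat h) (x - J%:R * h) =
  \sum_(J < N) (((h ^+ 2 / (2 * pi))%:C)%C - ((pi^-1)%:C)%C *
    (d (x - J%:R * h) - d (x - J.+1%:R * h))).
  apply: eq_bigr => J _; rewrite fser_hatE /d -/(f _).
  have -> : x - J.+1%:R * h + h = x - J%:R * h by rewrite -[J.+1%:R]natr1; ring.
  have -> : x - J.+1%:R * h = x - J%:R * h - h by rewrite -[J.+1%:R]natr1; ring.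
  rewrite -/(f _) -/(f _) rmorph_nat; ring.
rewrite big_split /= sumr_const card_ord sumrN -mulr_sumr.
rewrite -(big_mkord xpredT (fun J => d (x - J%:R * h) - d (x - J.+1%:R * h))).
rewrite (eq_bigr (fun J => (fun J => - d (x - J%:R * h)) J.+1 -
  (fun J => - d (x - J%:R * h)) J)); last by move=> J _ /=; ring.
rewrite telescope_sumr //=.
have per y : d (y - 2 * pi) = d y.
  have p z : f (z - 2 * pi) = f z by rewrite /f -[in RHS](subrK (2 * pi) z) fser_period.
  by rewrite /d addrAC !p.
rewrite Nh per mul0r subr0 subrr mulr0 subr0.
rewrite -[_ *+ N]mulr_natl -(rmorph_nat (real_complex R) N) -rmorphM; congr (_%:C)%C.
have -> : N%:R * (h ^+ 2 / (2 * pi)) = (N%:R * h) * h / (2 * pi) :> R by ring.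
by rewrite Nh; move: (pi : R) (lt0r_neq0 pi0) => p p0; field; rewrite ?p0.
Qed.

End CircleFunctions.

(** * From local power series to global Fourier expansions *)

Section HasSum.
Variable R : realType.
Local Notation C := R[i].

Lemma hsum_ge (I : eqType) (p : I -> R) S : (forall i, 0 <= p i) ->
  hsum (fun i => (p i)%:C%C) S%:C%C -> forall s, uniq s -> \sum_(i <- s) p i <= S.
Proof.
move=> p0 h s us; apply/ler_addgt0Pr => e e0; have [t ut ht] := h e e0.
have sub : {subset t <= undup (s ++ t)}.
  by move=> i it; rewrite mem_undup mem_cat it orbT.
have := ht (undup (s ++ t)) (undup_uniq _) sub.
rewrite -rmorph_sum -rmorphB normc_real ler_norml => /andP[_]; rewrite lerBlDr addrC => H.
apply: le_trans H; apply: ler_sum_sub; rewrite ?undup_uniq // => i si.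
by rewrite mem_undup mem_cat si.
Qed.

Lemma esum_hsum (I : choiceType) (p : I -> R) S : (forall i, 0 <= p i) ->
  hsum (fun i => (p i)%:C%C) S%:C%C -> (\esum_(i in [set: I]) (p i)%:E = S%:E)%E.
Proof.
move=> p0 h; apply/eqP; rewrite eq_le; apply/andP; split.
  apply: ub_ereal_sup => _ [X [/finite_seqP[s ->] _] <-].
  have -> : [set` s] = [set` undup s] by apply/seteqP; split=> x /=; rewrite mem_undup.
  rewrite -fsbig_seq ?undup_uniq // sumEFin lee_fin.
  exact: (hsum_ge p0 h (undup_uniq s)).
apply/lee_addgt0Pr => e e0; have [s us /(_ s us (fun _ => id))] := h e e0.
rewrite -rmorph_sum -rmorphB normc_real ler_norml => /andP[H _].
rewrite -leeBlDr //; apply: esum_ge; exists [set` s]; first by split.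
by rewrite -fsbig_seq // sumEFin -EFinB lee_fin; lra.
Qed.

Lemma has_sum_absum (I : choiceType) (u : I -> R) s : has_sum u s ->
  exists M, absum (fun i => (u i)%:C%C) M.
Proof.
case; rewrite /summable => fin _.
exists (fine (\esum_(x in [set: I]) `|(EFin \o u) x|)%E) => t ut.
rewrite -lee_fin fineK; last first.
  by rewrite ge0_fin_numE // esum_ge0.
apply: esum_ge; exists [set` t]; first by split.
rewrite -fsbig_seq // -sumEFin.
by apply: lee_sum => i _; rewrite normc_real.
Qed.

(** [has_sum] subtracts extended-real sums of the positive and negative parts. Absolute summability
    makes both finite, and each is the unordered limit of a nonnegative family. *)
Lemma has_sum_hsum (I : choiceType) (u : I -> R) s : has_sum u s ->
  hsum (fun i => (u i)%:C%C) s%:C%C.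
Proof.
move=> hu; have [M hM] := has_sum_absum hu.
have bnd (p : I -> R) : (forall i, 0 <= p i <= `|u i|) ->
    exists S, hsum (fun i => (p i)%:C%C) S%:C%C.
  move=> pu; apply: (hsum_pos_ex (M := M)); first by move=> i; case/andP: (pu i).
  move=> t ut; apply: le_trans (hM t ut); apply: ler_sum => i _.
  by rewrite normc_real; case/andP: (pu i).
have [|P hP] := bnd (fun i => Num.max (u i) 0).
  by move=> i; rewrite le_max lexx orbT ge_max ler_norm normr_ge0.
have [|Q hQ] := bnd (fun i => Num.max (- u i) 0).
  by move=> i; rewrite le_max lexx orbT ge_max normr_ge0 -normrN ler_norm.
have eP : (\esum_(i in [set: I]) ((EFin \o u)^\+ i) = P%:E)%E.
  rewrite -(esum_hsum _ hP) => [|i]; last by rewrite le_max lexx orbT.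
  by apply: eq_esum => i _; rewrite funeposE /= EFin_max.
have eQ : (\esum_(i in [set: I]) ((EFin \o u)^\- i) = Q%:E)%E.
  rewrite -(esum_hsum _ hQ) => [|i]; last by rewrite le_max lexx orbT.
  by apply: eq_esum => i _; rewrite funenegE /= EFin_max.
case: hu => _; rewrite eP eQ -EFinB => -[<-].
have := hsumB hP hQ; rewrite -rmorphB; congr hsum; apply: funext => i.
rewrite -rmorphB; congr (_%:C)%C.
by have [u0|u0] := leP 0 (u i); [rewrite max_r ?oppr_le0 ?subr0|
  rewrite max_l ?sub0r ?opprK // oppr_ge0 ltW].
Qed.

Lemma has_sum_csum (I : choiceType) (u : I -> R) s : has_sum u s ->
  csum (fun i => (u i)%:C%C) = s%:C%C.
Proof. by move=> /has_sum_hsum/csumE. Qed.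

End HasSum.

Section Embedding.
Variables (R : realType) (n : nat).
Local Notation C := R[i].
Local Notation K := 'rV[int]_n.

Definition wsingle (k0 : K) (z : C) : K -> C := fun k => if k == k0 then z else 0.

Lemma absum_wsingle k0 z : absum (wsingle k0 z) (normc z).
Proof.
have -> : wsingle k0 z = fun k => wconst z (k - k0).
  by apply: funext => k; rewrite /wconst /wsingle subr_eq0.
exact/absum_shift/absum_wconst.
Qed.

Lemma eval_wsingle k0 z phi : eval (wsingle k0 z) phi = z * cis (dotr k0 phi).
Proof.
rewrite /eval (csum1 (i := k0)) => [|k /negbTE kk]; first by rewrite /wsingle eqxx.
by rewrite /wsingle kk mul0r.
Qed.

Lemma dotr_delta (m : int) (i : 'I_n) (phi : 'rV[R]_n) :
  dotr (m *: delta_mx 0 i) phi = m%:~R * phi 0 i.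
Proof.
rewrite /dotr (bigD1 i) //= big1 => [|j ji]; rewrite !mxE eqxx /= ?eqxx.
  by rewrite mulr1 addr0.
by rewrite eq_sym in ji; rewrite eq_sym (negbTE ji) mulr0 mul0r.
Qed.

(* the function [phi |-> fser b (M (phi_i - p))] *)
Definition emb (i : 'I_n) (M : nat) (p : R) (b : int -> C) : K -> C :=
  wsum (fun j : int => wsingle ((j * M%:Z) *: delta_mx 0 i)
    (b j * cis (- (j%:~R * (M%:R * p))))).

Lemma famsum_emb i M p b B : absum b B ->
  famsum (fun j : int => wsingle ((j * M%:Z) *: delta_mx 0 i)
    (b j * cis (- (j%:~R * (M%:R * p))))) B.
Proof.
move=> hb; apply: (famsum_ex (fun j => absum_wsingle _ _)) => s us.
by under eq_bigr do rewrite normcM normc_cis mulr1; exact: hb.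
Qed.

Lemma absum_emb i M p b B : absum b B -> absum (emb i M p b) B.
Proof. by move=> hb; apply/absum_wsum/famsum_emb. Qed.

Lemma eval_emb i M p b B phi : absum b B ->
  eval (emb i M p b) phi = fser b (M%:R * (phi 0 i - p)).
Proof.
move=> hb; rewrite (eval_wsum _ (famsum_emb i M p hb)).
congr csum; apply: funext => j; rewrite eval_wsingle dotr_delta -mulrA -cisD.
congr (_ * cis _); rewrite intrM -pmulrn; ring.
Qed.

Definition wprod (s : seq (K -> C)) : K -> C := foldr (@conv R n) (wconst 1) s.

Lemma absum_wprod (I : Type) (s : seq I) (F : I -> K -> C) (B : I -> R) :
  (forall i, absum (F i) (B i)) -> absum (wprod (map F s)) (\prod_(i <- s) B i).
Proof.
move=> hF; elim: s => [|i s IH] /=; last by rewrite big_cons; exact: absum_conv.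
by rewrite big_nil -(@normc1 R); exact: absum_wconst.
Qed.

Lemma eval_wprod (I : Type) (s : seq I) (F : I -> K -> C) (B : I -> R) phi :
  (forall i, absum (F i) (B i)) ->
  eval (wprod (map F s)) phi = \prod_(i <- s) eval (F i) phi.
Proof.
move=> hF; elim: s => [|i s IH] /=; first by rewrite big_nil eval_wconst.
by rewrite big_cons (eval_conv _ (hF i) (absum_wprod s hF)) IH.
Qed.

End Embedding.

Section Expansions.
Variables (R : realType) (N : nat).
Local Notation A := {ffun 'I_N -> nat}.
Implicit Types (h : 'rV[R]_N -> R) (p z : 'rV[R]_N).

Definition monom (c : A -> R) p z (al : A) : R[i] :=
  ((c al * \prod_(i < N) (z 0 i - p 0 i) ^+ al i)%:C)%C.

Definition expansion_at h p (r : R) (c : A -> R) : Prop :=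
  forall z, (forall i, `|z 0 i - p 0 i| < r) ->
    (exists M, absum (monom c p z) M) /\ csum (monom c p z) = ((h z)%:C)%C.

Lemma analytic_expansion h p : analytic_at h p ->
  exists (r : R) (c : A -> R), 0 < r /\ expansion_at h p r c.
Proof.
case=> c [r [r0 hc]]; exists r, c; split=> // z hz; have hs := hc z hz.
by split; [exact: has_sum_absum hs|exact: has_sum_csum hs].
Qed.

End Expansions.

Section LocalToGlobal.
Variables (R : realType) (n m : nat) (h : 'rV[R]_(n + m) -> R).
Local Notation C := R[i].
Local Notation K := 'rV[int]_n.
Local Notation A := {ffun 'I_(n + m) -> nat}.

Hypothesis h_analytic : forall phi : 'rV[R]_n, exists (r : R) (c : A -> R),
  0 < r /\ expansion_at h (row_mx phi 0) r c.

(** [kappa / M] dominates together the half-width pi / (2 M) of a patch and the Wiener norm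
    [tri_norm / M] of the triangle wave that replaces the local variable there. *)
Let kappa : R := tri_norm R + pi.

Let good (M : nat) (phi : 'rV[R]_n) : Prop :=
  exists (q : 'rV[R]_n) (r : R) (c : A -> R),
    [/\ 0 < r, expansion_at h (row_mx q 0) r c &
        forall i, `|phi 0 i - q 0 i| + kappa / M%:R <= r / 2].

(** A Lebesgue number argument: compactness of the cell makes one mesh 1/M fine enough for every
    local expansion. The factor 1/2 in [good] leaves room inside the polydisc of convergence. *)
Lemma good_ex : exists2 M : nat, (0 < M)%N &
  forall phi : 'rV[R]_n, (forall i, 0 <= phi 0 i <= 2 * pi) -> good M phi.
Proof.
have kap0 : 0 < kappa.
  by have := pi_gt0 R => pi0; rewrite /kappa addr_gt0 // /tri_norm !mulr_gt0 ?invr_gt0.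
pose box := [set v : 'rV[R]_n | forall i, [set` `[0, 2 * pi]] (v ord0 i)].
have cbox : compact box.
  by apply: (@rV_compact R n (fun=> [set` `[0, 2 * pi]])) => i; exact: segment_compact.
have := compact_near_coveringP box => -[/(_ cbox) cov _].
have HM : \forall M \near \oo, box `<=` good M.
  apply: (cov nat \oo good) => q _.
  have [r [c [r0 hc]]] := h_analytic q.
  have r40 : 0 < r / 4 by rewrite divr_gt0.
  have nq : nbhs q [set phi : 'rV[R]_n | forall i, `|phi 0 i - q 0 i| < r / 4].
    have := nbhsx_ballx q _ r40; apply: filterS => phi hb i.
    by case: hb => _ /(_ 0 i); rewrite /ball /= distrC.
  have nM : \forall M \near \oo, kappa / M%:R <= r / 4.
    near=> M.
    have M0 : (0 < M%:R :> R) by rewrite ltr0n; near: M; exact: nbhs_infty_gt.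
    rewrite ler_pdivrMr // -ler_pdivrMl //.
    by near: M; exact: nbhs_infty_ger.
  exists ([set phi : 'rV[R]_n | forall i, `|phi 0 i - q 0 i| < r / 4],
    [set M | kappa / M%:R <= r / 4]) => //= -[phi M] /= [h1 h2].
  by exists q, r, c; split=> // i; have := h1 i; lra.
near \oo => M.
exists M; first by near: M; exact: nbhs_infty_gt.
move=> phi hphi; have : box `<=` good M by near: M.
by apply => i; rewrite /= in_itv; exact: hphi.
Unshelve. all: by end_near.
Qed.

Lemma fser_period_int (b : int -> C) (x : R) (k : int) :
  fser b (x + 2 * pi * k%:~R) = fser b x.
Proof.
congr csum; apply: funext => j; rewrite mulrDr; congr (_ * _).
by rewrite mulrCA -intrM cis_period.
Qed.

Lemma torus_periodic_int (f : 'rV[R]_n -> R) phi (k : 'I_n -> int) :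
  torus_periodic f -> f (phi + \row_i (2 * pi * (k i)%:~R)) = f phi.
Proof.
move=> per.
have pnat psi i (j : nat) : f (psi + (2 * pi * j%:R) *: delta_mx 0 i) = f psi.
  elim: j => [|j IH]; first by rewrite mulr0 scale0r addr0.
  by rewrite -[j.+1%:R]natr1 mulrDr mulr1 scalerDl addrA per IH.
have pint psi i (j : int) : f (psi + (2 * pi * j%:~R) *: delta_mx 0 i) = f psi.
  case: j => j; first exact: pnat.
  rewrite NegzE mulrNz mulrN scaleNr.
  by rewrite -[LHS](pnat _ i j.+1) -pmulrn subrK.
have -> : \row_i (2 * pi * (k i)%:~R) =
    \sum_(i <- enum 'I_n) (2 * pi * (k i)%:~R) *: delta_mx 0 i :> 'rV[R]_n.
  rewrite big_enum /=; apply/rowP => j; rewrite mxE summxE (bigD1 j) //= big1 => [|i ij].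
    by rewrite !mxE !eqxx mulr1 addr0.
  by rewrite !mxE eqxx /= eq_sym (negbTE ij) mulr0.
elim: (enum 'I_n) phi => [|i s IH] phi; first by rewrite big_nil addr0.
by rewrite big_cons addrA IH pint.
Qed.

Lemma csum_Re (T : eqType) (u : T -> C) B : absum u B ->
  csum (fun t => (complex.Re (u t))%:C%C) = (complex.Re (csum u))%:C%C.
Proof.
move=> hu.
have hc : absum (fun t => ((u t)^*)%C) B.
  by apply: absum_mono hu => t; rewrite normcJ'.
rewrite (ReJ_add (csum u)) -(csum_conj hu) -(csumD hu hc) mulrC.
rewrite -(csumZ _ (absumD hu hc)); congr csum; apply: funext => t.
by rewrite ReJ_add mulrC.
Qed.

(** The integer [k] translates [x] into the period starting at [- hh], on which [fser_hat0]
    describes the zeros. *)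
Lemma fser_hat_support (hh x : R) : 0 <= hh -> fser (hat hh) x != 0 ->
  exists k : int, `|x + 2 * pi * k%:~R| <= hh.
Proof.
move=> hh0 nz; have pi0 := pi_gt0 R.
have p20 : 0 < 2 * pi :> R by rewrite mulr_gt0.
pose k := Num.floor ((x + hh) / (2 * pi)); exists (- k).
have := floor_itv ((x + hh) / (2 * pi)); rewrite -/k => /andP[k1 k2].
rewrite mulrNz mulrN.
have y1 : - hh <= x - 2 * pi * k%:~R by move: k1; rewrite ler_pdivlMr //; lra.
have y2 : x - 2 * pi * k%:~R < 2 * pi - hh.
  by move: k2; rewrite ltr_pdivrMr // intrD mulr1z mulrDl mul1r; lra.
rewrite ler_norml y1 /= leNgt; apply/negP => y3.
have := fser_period_int (hat hh) x (- k); rewrite mulrNz mulrN fser_hat0 //.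
  by move=> h0; rewrite -h0 eqxx in nz.
by rewrite (ltW y3) (ltW y2).
Qed.

Definition wdeg (al : A) : nat := \sum_(j < m) al (rshift n j).

Hypothesis n_gt0 : (0 < n)%N.

Hypothesis h_periodic : exists2 e : R, 0 < e & forall w : 'rV[R]_m,
  (forall j, `|w 0 j| < e) -> torus_periodic (fun phi => h (row_mx phi w)).

(* By compactness finitely many local expansions cover the torus. On each patch
   the local variable [phi_i - p_i] is replaced by a triangle wave, which is
   globally absolutely summable, and a partition of unity made of [hat]s glues. *)
Lemma local_to_global : exists (J : finType) (c : J * A -> K -> C) (rho M : R),
  [/\ 0 < rho, famsum (fun t k => ((rho ^+ wdeg t.2)%:C)%C * c t k) M,
      forall t, sym (c t) &
      forall (phi : 'rV[R]_n) (w : 'rV[R]_m), (forall j, `|w 0 j| <= rho) ->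
        csum (fun t : J * A => eval (c t) phi *
           ((\prod_(j < m) w 0 j ^+ t.2 (rshift n j))%:C)%C) =
        ((h (row_mx phi w))%:C)%C].
Proof.
have pi0 := pi_gt0 R.
have trin0 : 0 < tri_norm R by rewrite /tri_norm !mulr_gt0 ?invr_gt0.
have [M M0 hM] := good_ex.
have [e e0 per] := h_periodic.
have MR0 : 0 < M%:R :> R by rewrite ltr0n.
(* The grid step satisfies M * hh = pi / 2, the range on which the triangle wave is linear, and N *
   hh = 2 pi, as [sum_hat] requires. *)
pose N := (4 * M)%N; pose hh : R := pi / (2 * M%:R).
have hh0 : 0 < hh by rewrite divr_gt0 // mulr_gt0.
have Nhh : N%:R * hh = 2 * pi.
  rewrite /N natrM /hh; move: (pi : R) (lt0r_neq0 MR0) => p z0.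
  by field; rewrite ?z0.
have hkap : hh + tri_norm R / M%:R <= kappa / M%:R.
  rewrite /kappa mulrDl addrC lerD2l /hh invfM mulrA ler_pM2r ?invr_gt0 //; lra.
have kap0 : 0 < kappa / M%:R by rewrite divr_gt0 // /kappa addr_gt0.
pose J := {ffun 'I_n -> 'I_N}.
pose pJ (j : 'I_N) : R := j%:R * hh.
have /boolp.choice[D hD] : forall j : J, exists D : 'rV[R]_n * R * (A -> R),
    [/\ 0 < D.1.2, expansion_at h (row_mx D.1.1 0) D.1.2 D.2 &
        forall i, `|pJ (j i) - D.1.1 0 i| + kappa / M%:R <= D.1.2 / 2].
  move=> j; have [|q [r [c [r0 hc hq]]]] := hM (\row_i pJ (j i)).
    move=> i; rewrite mxE /pJ mulr_ge0 ?(ltW hh0) //= -Nhh ler_pM2r // ler_nat.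
    by rewrite ltnW.
  by exists (q, r, c); split=> //= i; have := hq i; rewrite mxE.
pose q j := (D j).1.1; pose r j := (D j).1.2; pose cc j := (D j).2.
have [H hH] := absum_hat hh.
pose chi i j : K -> C := fun k => ((hh^-1)%:C)%C * emb i 1 (pJ j) (hat hh) k.
have chi_b i j : absum (chi i j) (normc ((hh^-1)%:C)%C * H).
  exact/absumZ/absum_emb.
(* On the patch of grid point [j] this evaluates to the local coordinate, up to periods: the wave
   gives the offset from the grid point, and [s] the offset of the grid point from the centre of
   expansion. Its Wiener norm is at most half the local radius, so the local series can be summed
   with [Y] inserted on the whole torus. *)
pose Y i j s : K -> C := fun k => ((M%:R^-1)%:C)%C * emb i M (pJ j) (@tri R) k + wconst (s%:C)%C k.
have Y_b i j s : absum (Y i j s) (tri_norm R / M%:R + `|s|).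
  have := absumD (absumZ ((M%:R^-1)%:C)%C (absum_emb i M (pJ j) (@absum_tri R))) (@absum_wconst R n (s%:C)%C).
  by rewrite !normc_real ger0_norm ?invr_ge0 ?ltW // [_ * tri_norm R]mulrC.
pose sft (j : J) i := pJ (j i) - q j 0 i.
have Y_r (j : J) i : absum (Y i (j i) (sft j i)) (r j / 2).
  apply: absum_le (Y_b _ _ _); have [_ _ /(_ i)] := hD j; rewrite -/(q j) -/(r j) /sft => hq.
  by move: hkap hh0 hq => /= *; lra.
pose chis (j : J) := wprod [seq chi i (j i) | i <- enum 'I_n].
pose mon (j : J) (al : A) := wprod [seq wpow (Y i (j i) (sft j i)) (al (lshift m i)) | i <- enum 'I_n].
pose c (t : J * A) := conv (chis t.1) (fun k => ((cc t.1 t.2)%:C)%C * mon t.1 t.2 k).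
pose BX : R := \prod_(i <- enum 'I_n) (normc ((hh^-1)%:C)%C * H).
have BX0 : 0 <= BX.
  by apply: prodr_ge0 => i _; rewrite mulr_ge0 ?normc_ge0 // (absum_ge0 hH).
have chis_b j : absum (chis j) BX by apply: absum_wprod => i; exact: chi_b.
have mon_b j al : absum (mon j al) (\prod_(i <- enum 'I_n) (r j / 2) ^+ al (lshift m i)).
  by apply: absum_wprod => i; exact: absum_wpow.
have c_b t : absum (c t) (BX * (`|cc t.1 t.2| *
    \prod_(i <- enum 'I_n) (r t.1 / 2) ^+ t.2 (lshift m i))).
  by apply: absum_conv => //; rewrite -normc_real; exact: absumZ.
(* The first entry keeps [w] inside every local polydisc, the second inside the range where
   periodicity in [phi] is known. *)
pose rho := Num.min (kappa / M%:R) (e / 2).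
have rho0 : 0 < rho by rewrite lt_min kap0 divr_gt0.
have rr0 j : 0 < r j by case: (hD j).
(* The bound on the local radius is read off at one coordinate of [phi]; here [n > 0] enters. *)
have rho_r j : rho <= r j / 2.
  have [_ _ /(_ (Ordinal n_gt0))] := hD j; rewrite -/(r j) => hq.
  have : rho <= kappa / M%:R by rewrite /rho ge_min lexx.
  have := normr_ge0 (pJ (j (Ordinal n_gt0)) - (D j).1.1 0 (Ordinal n_gt0)); lra.
(* Convergence of the local series at the point with every offset equal to r/2 majorizes all the
   products of norms at once. *)
pose full j (al : A) : R := cc j al * \prod_(i < n + m) (r j / 2) ^+ al i.
have /boolp.choice[Bm hBm] : forall j, exists B, absum (fun al => (full j al)%:C%C) B.
  move=> j; have [_ hexp _] := hD j.
  have zE i : (row_mx (q j) 0 + const_mx (r j / 2)) 0 i - (row_mx (q j) 0 : 'rV_(n + m)) 0 i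
      = r j / 2 by rewrite [X in X - _]mxE [const_mx _ _ _]mxE addrAC subrr add0r.
  have lt_r : r j / 2 < r j by have := rr0 j; lra.
  have hs := hexp (row_mx (q j) 0 + const_mx (r j / 2)).
  have [|[B hB] _] := hs; first by move=> i; rewrite zE gtr0_norm // divr_gt0.
  exists B; apply: absum_mono hB => al; rewrite /full /monom.
  by under [in leRHS]eq_bigr do rewrite zE.
have Bm0 j : 0 <= Bm j := absum_ge0 (hBm j).
have absF : absum (fun t : J * A => (full t.1 t.2)%:C%C) (\sum_(j <- enum J) Bm j).
  apply: (absum_prod (u := fun j al => (full j al)%:C%C) hBm) => s us.
  apply: ler_sum_sub => //; first exact: enum_uniq.
  by move=> j _; rewrite mem_enum.
pose Mt := BX * (\sum_(j <- enum J) Bm j).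
have rho_deg j (al : A) : rho ^+ wdeg al <= \prod_(i < m) (r j / 2) ^+ al (rshift n i).
  rewrite /wdeg -prodrXr; apply: ler_prod => i _.
  by rewrite exprn_ge0 ?(ltW rho0) //= lerXn2r ?nnegrE ?(ltW rho0) // ltW // divr_gt0.
have fam : famsum (fun t k => ((rho ^+ wdeg t.2)%:C)%C * c t k) Mt.
  apply: (famsum_ex (B := fun t => BX * normc (full t.1 t.2)%:C%C)); last first.
    by move=> s us; rewrite -mulr_sumr ler_wpM2l // absF.
  move=> t; apply: absum_le (absumZ _ (c_b t)).
  rewrite !normc_real [`|full _ _|]normrM mulrCA ler_wpM2l // mulrCA ler_wpM2l //.
  rewrite big_split_ord /= big_enum /= ger0_norm ?exprn_ge0 ?(ltW rho0) //.
  have P0 : 0 <= \prod_(i < n) (r t.1 / 2) ^+ t.2 (lshift m i).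
    by apply: prodr_ge0 => i _; rewrite exprn_ge0 // ltW // divr_gt0.
  have P1 : 0 <= \prod_(i < m) (r t.1 / 2) ^+ t.2 (rshift n i).
    by apply: prodr_ge0 => i _; rewrite exprn_ge0 // ltW // divr_gt0.
  by rewrite ger0_norm ?mulr_ge0 // mulrC ler_wpM2l.
(* The function is real, so passing to Hermitian parts changes no value, and symmetry of the
   individual factors need not be tracked. *)
exists J, (fun t => herm (c t)), rho, Mt; split => //.
- apply: (famsum_hermZ fam).
- by move=> t; exact: sym_herm.
move=> phi w hw.
pose W (al : A) : R := \prod_(j < m) w 0 j ^+ al (rshift n j).
have W_rho al : `|W al| <= rho ^+ wdeg al.
  rewrite /W normr_prod /wdeg -prodrXr; apply: ler_prod => i _.
  by rewrite normr_ge0 /= normrX lerXn2r ?nnegrE ?(ltW rho0).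
pose u j al := eval (c (j, al)) phi * (W al)%:C%C.
have hu : absum (fun t : J * A => u t.1 t.2) Mt.
  apply: absum_mono (famsum_eval phi fam) => -[j al] /=.
  rewrite (evalZ _ _ (c_b (j, al))) !normcM mulrC ler_wpM2r ?normc_ge0 // !normc_real.
  by rewrite [leRHS]ger0_norm ?exprn_ge0 ?(ltW rho0).
transitivity (csum (fun t : J * A => (complex.Re (u t.1 t.2))%:C%C)).
  congr csum; apply: funext => -[j al]; rewrite (eval_herm _ (c_b (j, al))) /u.
  by rewrite -rmorphM; congr (_%:C)%C; case: (eval _ _) => a b /=; rewrite mulr0 subr0.
rewrite (csum_Re hu).
suff -> : csum (fun t : J * A => u t.1 t.2) = (h (row_mx phi w))%:C%C by [].
rewrite -(csumE (hsum_fubini hu)).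
have evc j al : eval (c (j, al)) phi = eval (chis j) phi * ((cc j al)%:C%C *
   \prod_(i < n) eval (Y i (j i) (sft j i)) phi ^+ al (lshift m i)).
  rewrite (eval_conv _ (chis_b j) (absumZ _ (mon_b j al))) (evalZ _ _ (mon_b j al)).
  rewrite (eval_wprod _ _ (fun i => absum_wpow _ (Y_r j i))) big_enum /=; congr (_ * (_ * _)).
  by apply: eq_bigr => i _; exact: eval_wpow (Y_r j i).
have evchis j : eval (chis j) phi = \prod_(i < n) eval (chi i (j i)) phi.
  by rewrite (eval_wprod _ _ (fun i => chi_b i (j i))) big_enum.
have evchi i j : eval (chi i j) phi = (hh^-1)%:C%C * fser (hat hh) (phi 0 i - pJ j).
  by rewrite (evalZ _ _ (absum_emb _ _ _ hH)) (eval_emb _ _ _ _ hH) mul1r.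
(* Where [chis j] vanishes both sides are 0. Elsewhere [phi] lies within [hh] of the grid point up
   to periods, and [psi] is the translate at which the local expansion holds. *)
have piece j : csum (u j) = eval (chis j) phi * (h (row_mx phi w))%:C%C.
  have [z0|nz] := eqVneq (eval (chis j) phi) 0.
    rewrite z0 mul0r (_ : u j = fun=> 0) ?csum0 //.
    by apply: funext => al; rewrite /u evc z0 !mul0r.
  have /boolp.choice[k hk] : forall i, exists k : int,
      `|phi 0 i - pJ (j i) + 2 * pi * k%:~R| <= hh.
    move=> i; apply: fser_hat_support; first exact: ltW.
    apply: contraNneq nz => z0; rewrite evchis (bigD1 i) //= evchi z0 mulr0 mul0r //.
  pose psi := phi + \row_i (2 * pi * (k i)%:~R).
  have Yev i : eval (Y i (j i) (sft j i)) phi = (psi 0 i - q j 0 i)%:C%C.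
    rewrite (evalD _ (absumZ _ (absum_emb _ _ _ (@absum_tri R))) (@absum_wconst R n _)).
    rewrite eval_wconst (evalZ _ _ (absum_emb _ _ _ (@absum_tri R))) (eval_emb _ _ _ _ (@absum_tri R)).
    pose y := phi 0 i - pJ (j i) + 2 * pi * (k i)%:~R.
    have -> : M%:R * (phi 0 i - pJ (j i)) = M%:R * y + 2 * pi * (- (M%:Z * k i))%:~R.
      by rewrite /y intrN intrM -pmulrn; ring.
    rewrite fser_period_int fser_tri; last first.
      rewrite normrM ger0_norm //; have := hk i; rewrite -/y /hh => hy.
      apply: le_trans (ler_wpM2l (ltW MR0) hy) _.
      by rewrite le_eqVlt; apply/orP; left; apply/eqP;
         move: (pi : R) (lt0r_neq0 MR0) => p z0; field; rewrite ?z0.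
    rewrite -rmorphM -rmorphD; congr (_%:C)%C.
    rewrite mulrA mulVf ?lt0r_neq0 // mul1r /y /sft /psi !mxE; ring.
  have [_ hexp hq] := hD j.
  have hs := hexp (row_mx psi w).
  have -> : h (row_mx phi w) = h (row_mx psi w).
    rewrite -(torus_periodic_int phi k (per w _)) // => i.
    apply: le_lt_trans (hw i) _; apply: le_lt_trans (_ : e / 2 < e); last by lra.
    by rewrite /rho ge_min lexx orbT.
  have lt_r : r j / 2 < r j by have := rr0 j; lra.
  case: hs => [|_ <-].
    move=> i; rewrite -(splitK i); case: (fintype.split i) => i' /=.
      rewrite !row_mxEl; apply: le_lt_trans lt_r.
      apply: le_trans (_ : hh + `|pJ (j i') - q j 0 i'| <= _).
        have -> : psi 0 i' - (D j).1.1 0 i' = (phi 0 i' - pJ (j i') + 2 * pi * (k i')%:~R) +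
          (pJ (j i') - q j 0 i') by rewrite /psi /q !mxE; ring.
        by apply: le_trans (ler_normD _ _) _; rewrite lerD2r.
      have := hq i'; rewrite -/(q j) -/(r j).
      by have : 0 <= tri_norm R / M%:R; [rewrite divr_ge0 // ltW|lra].
    rewrite !row_mxEr mxE subr0; apply: le_lt_trans lt_r.
    by apply: le_trans (hw i') (rho_r j).
  have hB := hBm j.
  rewrite -csumZf.
  congr csum; apply: funext => al; rewrite /u /monom evc -!mulrA; congr (_ * _).
  rewrite (eq_bigr (fun i => ((psi 0 i - q j 0 i) ^+ al (lshift m i))%:C%C)); last first.
    by move=> i _; rewrite Yev rmorphXn.
  rewrite -rmorph_prod -!rmorphM /=; congr (_%:C)%C; congr (_ * _).
  rewrite big_split_ord /=; congr (_ * _).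
    by apply: eq_bigr => i _; rewrite !row_mxEl.
  by apply: eq_bigr => i _; rewrite !row_mxEr mxE subr0.
have -> : (fun j => csum (u j)) = fun j => eval (chis j) phi * (h (row_mx phi w))%:C%C.
  exact: funext.
rewrite (csum_seq (s := enum J)) ?enum_uniq //; last by move=> j; rewrite mem_enum.
rewrite big_enum /= -mulr_suml.
under eq_bigr do rewrite evchis.
(* The sum over all grid points of products over the coordinates is the product of the
   one-dimensional sums, each equal to 1. *)
rewrite -(bigA_distr_bigA (fun i j => eval (chi i j) phi)) /=.
rewrite big1 ?mul1r // => i _.
under eq_bigr do rewrite evchi.
rewrite -mulr_sumr (sum_hat _ Nhh) -rmorphM mulVf ?lt0r_neq0 //.
Qed.

End LocalToGlobal.

(** * The characteristic function *)

Section TrigBounds.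
Variable R : realType.
Implicit Types x y : R.

Lemma sin_lip0 x : `|sin x| <= `|x|.
Proof.
have ds z : is_derive z (1 : R) (@sin R) (cos z) by exact: is_derive_sin.
have := mvt_bound (a := 0) (b := x) (M := 1) ds.
rewrite sin0 !subr0 mul1r; apply => z _.
by rewrite ler_norml cos_geN1 cos_le1.
Qed.

Lemma cos_half x : 1 - cos x = 2 * sin (x / 2) ^+ 2.
Proof.
have {1}-> : x = x / 2 + x / 2 by field.
by rewrite cosD -!expr2 cos2sin2; ring.
Qed.

Lemma cos_quad x : 0 <= 1 - cos x <= x ^+ 2 / 2.
Proof.
rewrite cos_half; apply/andP; split; first by rewrite mulr_ge0 ?sqr_ge0.
have := sin_lip0 (x / 2); rewrite -ler_sqr ?nnegrE // !real_normK ?num_real //.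
move=> h; have -> : x ^+ 2 / 2 = 2 * (x / 2) ^+ 2 by field.
by rewrite ler_pM2l.
Qed.

Lemma sin_cubic x : `|sin x - x| <= x ^+ 2 / 2 * `|x|.
Proof.
have ds z : is_derive z (1 : R) (fun y => sin y - y) (cos z - 1).
  have := is_deriveB (is_derive_sin z) (is_derive_id z (1 : R)).
  exact.
have := mvt_bound (a := 0) (b := x) (M := x ^+ 2 / 2) ds.
rewrite sin0 !subr0; apply => z hz.
have /andP[c1 c2] := cos_quad z.
rewrite distrC ger0_norm //; apply: le_trans c2 _; rewrite ler_pM2r //.
rewrite -[leLHS]real_normK ?num_real // -[leRHS]real_normK ?num_real //.
rewrite lerXn2r ?nnegrE //; move: hz; rewrite ge_min le_max ler_norml.
case: (lerP 0 x) => x0; rewrite ?(ger0_norm x0) ?(ltr0_norm x0);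
  move=> /andP[/orP[] h1 /orP[] h2]; lra.
Qed.

Lemma cos_taylor x y : `|y| <= 1 -> `|cos (x + y) - cos x + y * sin x| <= y ^+ 2.
Proof.
move=> y1; have -> : cos (x + y) - cos x + y * sin x =
  - (cos x * (1 - cos y)) - sin x * (sin y - y) by rewrite cosD; ring.
have /andP[c1 c2] := cos_quad y; have s := sin_cubic y.
have y2 : y ^+ 2 / 2 * `|y| <= y ^+ 2 / 2.
  by rewrite -[leRHS]mulr1 ler_wpM2l // divr_ge0 ?sqr_ge0.
have A : `|cos x * (1 - cos y)| <= y ^+ 2 / 2.
  rewrite normrM (ger0_norm c1) -[leRHS]mul1r ler_pM //.
  by rewrite ler_norml cos_geN1 cos_le1.
have B : `|sin x * (sin y - y)| <= y ^+ 2 / 2.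
  rewrite normrM -[leRHS]mul1r ler_pM ?(le_trans s) //.
  by rewrite ler_norml sin_geN1 sin_le1.
apply: le_trans (ler_normB _ _) _; rewrite normrN; lra.
Qed.

Lemma sin_taylor x y : `|y| <= 1 -> `|sin (x + y) - sin x - y * cos x| <= y ^+ 2.
Proof.
move=> y1; have -> : sin (x + y) - sin x - y * cos x =
  - (sin x * (1 - cos y)) + cos x * (sin y - y) by rewrite sinD; ring.
have /andP[c1 c2] := cos_quad y; have s := sin_cubic y.
have y2 : y ^+ 2 / 2 * `|y| <= y ^+ 2 / 2.
  by rewrite -[leRHS]mulr1 ler_wpM2l // divr_ge0 ?sqr_ge0.
have A : `|sin x * (1 - cos y)| <= y ^+ 2 / 2.
  rewrite normrM (ger0_norm c1) -[leRHS]mul1r ler_pM //.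
  by rewrite ler_norml sin_geN1 sin_le1.
have B : `|cos x * (sin y - y)| <= y ^+ 2 / 2.
  rewrite normrM -[leRHS]mul1r ler_pM ?(le_trans s) //.
  by rewrite ler_norml cos_geN1 cos_le1.
apply: le_trans (ler_normD _ _) _; rewrite normrN; lra.
Qed.

Lemma cos_lip x y : `|cos (x + y) - cos x| <= `|y|.
Proof.
have dc z : is_derive z (1 : R) (@cos R) (- sin z) by exact: is_derive_cos.
have := mvt_bound (a := x) (b := x + y) (M := 1) dc.
rewrite (_ : x + y - x = y); last by ring.
rewrite mul1r; apply => z _.
by rewrite normrN ler_norml sin_geN1 sin_le1.
Qed.

Lemma sin_lip x y : `|sin (x + y) - sin x| <= `|y|.
Proof.
have ds z : is_derive z (1 : R) (@sin R) (cos z) by exact: is_derive_sin.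
have := mvt_bound (a := x) (b := x + y) (M := 1) ds.
rewrite (_ : x + y - x = y); last by ring.
rewrite mul1r; apply => z _.
by rewrite ler_norml cos_geN1 cos_le1.
Qed.

End TrigBounds.

Section CharacteristicFunction.
Variable R : realType.

(* [w0] is the Hopf frequency and [tau] the critical delay of [a]. *)
Definition critical (a w0 tau : R) : Prop :=
  [/\ 1 / 4 <= a <= 5 / 4, 0 < w0, w0 ^+ 2 = 2 - a ^+ 2, 0 < w0 * tau < pi &
      cos (w0 * tau) = a ^+ 2 - 1 /\ sin (w0 * tau) = a * w0].

(* real and imaginary part of
   [1 - w^2 - i a w - e^(-i w tau) + d (i p w + q + r e^(-i w tau))] *)
Definition lamRe (tau q r d w : R) : R :=
  1 - w ^+ 2 - cos (w * tau) + d * (q + r * cos (w * tau)).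
Definition lamIm (a tau p r d w : R) : R :=
  - (a * w) + sin (w * tau) + d * (p * w - r * sin (w * tau)).

Definition lamN (a tau p q r d w : R) : R :=
  `|lamRe tau q r d w| + `|lamIm a tau p r d w|.

(* distance to the zeros [0], [w0], [-w0] of the unperturbed function *)
Definition rdist (w0 w : R) : R := Num.min `|w| `| `|w| - w0|.

(* the component of the perturbation at [w0] transversal to the derivative of
   the unperturbed function there *)
Definition transv (a w0 tau p q r : R) : R :=
  (q + r * (a ^+ 2 - 1)) * (tau * (a ^+ 2 - 1) - a) +
  w0 ^+ 2 * (p - r * a) * (2 - a * tau).

Variables a w0 tau : R.
Hypothesis crit : critical a w0 tau.

Lemma crit_bounds : [/\ 1 / 2 <= w0, w0 <= 3 / 2, 0 < tau & tau <= 8].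
Proof.
case: crit => /andP[a1 a2] w00 w02 /andP[t0 t1] _.
have A1 : 1 / 16 <= a ^+ 2 by rewrite expr2; nra.
have A2 : a ^+ 2 <= 25 / 16 by rewrite expr2; nra.
have b1 : 1 / 2 <= w0.
  rewrite leNgt; apply/negP => w; have : w0 ^+ 2 < 1 / 4 by rewrite expr2; nra.
  by rewrite w02; lra.
have b2 : w0 <= 3 / 2.
  rewrite leNgt; apply/negP => w; have : 9 / 4 < w0 ^+ 2 by rewrite expr2; nra.
  by rewrite w02; lra.
have t00 : 0 < tau by move: t0; rewrite pmulr_rgt0.
split=> //; have p4 : pi <= 4 :> R.
  have := pihalf_lt2 R; lra.
rewrite leNgt; apply/negP => t8; have : 4 < w0 * tau by nra.
lra.
Qed.

(** [tau - a] is the slope of the imaginary part at 0, so this makes 0 a simple zero, uniformly in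
    [a]. With th = w0 tau one has w0 (tau - a) = th - sin th, and cos th = a^2 - 1 keeps th away
    from 0. Halving the angle twice bounds sin th by th (1 - th^2 / 32). *)
Lemma tau_gap : 1 / 100 <= tau - a.
Proof.
have [b1 b2 t00 t8] := crit_bounds.
case: crit => /andP[a1 a2] w00 w02 /andP[t0 t1] [ec es].
set th := w0 * tau in t0 t1 ec es *.
have p4 : pi <= 4 :> R by have := pihalf_lt2 R; lra.
have th78 : 7 / 8 <= th ^+ 2.
  have /andP[_] := cos_quad th; rewrite ec.
  have : a ^+ 2 <= 25 / 16 by rewrite expr2; nra.
  lra.
have th9 : 9 / 10 <= th.
  rewrite leNgt; apply/negP => w; have : th ^+ 2 < 81 / 100 by rewrite expr2; nra.
  lra.
have s4 : th / 8 <= sin (th / 4).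
  have := sin_cubic (th / 4); rewrite [`|th / 4|]ger0_norm ?divr_ge0 ?(ltW t0) // ler_norml => /andP[+ _].
  have : th ^+ 2 <= 16 by rewrite expr2; nra.
  move=> q1; have -> : (th / 4) ^+ 2 / 2 * (th / 4) = th ^+ 2 / 32 * (th / 4) by field.
  move=> q2; have : th ^+ 2 / 32 * (th / 4) <= 1 / 2 * (th / 4).
    by rewrite ler_wpM2r ?divr_ge0 ?(ltW t0) //; lra.
  lra.
have c2 : cos (th / 2) <= 1 - th ^+ 2 / 32.
  have := cos_half (th / 2); have -> : th / 2 / 2 = th / 4 by field.
  have : (th / 8) ^+ 2 <= sin (th / 4) ^+ 2 by rewrite lerXn2r ?nnegrE ?(le_trans _ s4) // divr_ge0 // ltW.
  rewrite exprMn (_ : (8^-1 : R) ^+ 2 = 1 / 64); last by field.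
  lra.
have c20 : 0 <= cos (th / 2) by apply: cos_ge0_pihalf; apply/andP; split; lra.
have ss : sin th <= th * cos (th / 2).
  have {1}-> : th = th / 2 + th / 2 by field.
  rewrite sinD; have := sin_lip0 (th / 2); rewrite [`|th / 2|]ger0_norm ?divr_ge0 ?(ltW t0) //.
  by rewrite ler_norml => /andP[_ s2]; nra.
have gap : 9 / 400 <= th - sin th.
  have : th * cos (th / 2) <= th * (1 - th ^+ 2 / 32) by rewrite ler_wpM2l // ltW.
  have : th * (7 / 8) <= th * th ^+ 2 by rewrite ler_wpM2l // ltW.
  lra.
rewrite es in gap; have : 9 / 400 <= w0 * (tau - a) by rewrite /th in gap; lra.
by nra.
Qed.

(** Away from 0 the bound rests on |1 - w^2 - i a w|^2 - 1 = w^2 (w^2 - w0^2): the left side factors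
    into the real and imaginary parts of L times terms of size at most 3 (1 + w^2). Near 0, where
    the factor w^2 is too small, the slope [tau - a] takes over. *)
Lemma lam_lower c1 p q r w : 0 < c1 -> c1 * 1000 * 1000 <= 1 ->
  c1 * rdist w0 w * (1 + `|w|) <= lamN a tau p q r 0 w.
Proof.
move=> c10 c1s; have [b1 b2 t00 t8] := crit_bounds; have gap := tau_gap.
case: crit => /andP[a1 a2] w00 w02 /andP[t0 t1] [ec es].
rewrite /lamN /lamRe /lamIm !mul0r !addr0.
set c := cos _; set s := sin _.
have w0' := normr_ge0 w.
have d1 : rdist w0 w <= `|w| by rewrite /rdist ge_min lexx.
have d2 : rdist w0 w <= `| `|w| - w0| by rewrite /rdist ge_min lexx orbT.
(* Below this threshold the cubic error of the sine costs at most a third of the slope 1/100. *)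
have [ws|wl] := leP `|w| (1 / 300).
  have h : `|w| / 200 <= `|- (a * w) + s|.
    have := sin_cubic (w * tau); rewrite -/s => hs.
    have -> : - (a * w) + s = (tau - a) * w + (s - w * tau) by ring.
    have : `|(tau - a) * w| - `|s - w * tau| <= `|(tau - a) * w + (s - w * tau)|.
      by have := ler_normD ((tau - a) * w + (s - w * tau)) (- (s - w * tau)); rewrite addrK normrN; lra.
    apply: le_trans; rewrite normrM [`|tau - a|]ger0_norm; last lra.
    have : (w * tau) ^+ 2 / 2 * `|w * tau| <= 1 / 300 * `|w|.
      rewrite normrM (gtr0_norm t00) -real_normK ?num_real // normrM (gtr0_norm t00).
      have q1 : `|w| * tau <= 8 / 300 by nra.
      have q0 : 0 <= `|w| * tau by rewrite mulr_ge0 // ltW.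
      have q2 : (`|w| * tau) ^+ 2 <= 8 / 300 * (8 / 300) by rewrite expr2; nra.
      have q3 : (`|w| * tau) <= 8 * `|w| by nra.
      apply: le_trans (_ : _ <= 8 / 300 * (4 / 300) * (8 * `|w|)) _; last lra.
      by apply: ler_pM => //; rewrite ?divr_ge0 ?sqr_ge0 //; lra.
    have : 1 / 100 * `|w| <= (tau - a) * `|w| by rewrite ler_wpM2r.
    lra.
  apply: le_trans (_ : `|w| / 200 <= _); last by have := normr_ge0 (1 - w ^+ 2 - c); lra.
  apply: le_trans (_ : c1 * `|w| * 2 <= _); last by nra.
  have rd0 : 0 <= rdist w0 w by rewrite /rdist le_min !normr_ge0.
  apply: ler_pM; first by rewrite mulr_ge0 // ltW.
  - lra.
  - by rewrite ler_pM2l.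
  - lra.
have key : `|w| ^+ 2 * (`| `|w| - w0| * (`|w| + w0)) <=
    (`|1 - w ^+ 2 - c| + `|- (a * w) + s|) * (3 * (1 + `|w| ^+ 2)).
  have -> : `|w| ^+ 2 * (`| `|w| - w0| * (`|w| + w0)) =
     `|(1 - w ^+ 2 - c) * (1 - w ^+ 2 + c) + (- (a * w) + s) * (- (a * w) - s)|.
    have -> : (1 - w ^+ 2 - c) * (1 - w ^+ 2 + c) + (- (a * w) + s) * (- (a * w) - s) =
       w ^+ 2 * (w ^+ 2 - w0 ^+ 2).
      have cs : c ^+ 2 + s ^+ 2 = 1 by exact: cos2Dsin2.
      rewrite w02; have -> : forall A B : R, (A - c) * (A + c) + (B + s) * (B - s) =
        A ^+ 2 + B ^+ 2 - (c ^+ 2 + s ^+ 2) by move=> *; ring.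
      by rewrite cs; ring.
    rewrite -[w ^+ 2]real_normK ?num_real // normrM [`|_ ^+ 2|]ger0_norm ?sqr_ge0 //.
    by rewrite subr_sqr normrM [`| `|w| + w0|]ger0_norm // addr_ge0 // ltW.
  apply: le_trans (ler_normD _ _) _; rewrite !normrM mulrDl.
  have cb : `|c| <= 1 by rewrite ler_norml cos_geN1 cos_le1.
  have sb : `|s| <= 1 by rewrite ler_norml sin_geN1 sin_le1.
  have wq : `|w| <= (1 + `|w| ^+ 2) / 2.
    by have : 0 <= (1 - `|w|) ^+ 2 := sqr_ge0 _; rewrite sqrrB expr1n mul1r; lra.
  apply: lerD; rewrite ler_wpM2l //.
    apply: le_trans (ler_normD _ _) _; apply: le_trans (lerD (ler_normB _ _) cb) _.
    rewrite normr1 normrX; have := sqr_ge0 `|w|; lra.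
  apply: le_trans (ler_normB _ _) _; rewrite normrN normrM (ger0_norm (x := a)); last lra.
  have : a * `|w| <= 5 / 4 * `|w| by rewrite ler_wpM2r.
  have := sqr_ge0 `|w|; lra.
have fac : 1 / 1000 * (1 / 100) * (1 + `|w| ^+ 2) <= `|w| ^+ 2.
  have : 1 / 300 * (1 / 300) <= `|w| ^+ 2 by rewrite expr2; nra.
  lra.
set Nn := (`|_| + `|_|) in key *.
have D0 := normr_ge0 (`|w| - w0).
have S2 : (1 + `|w|) / 2 <= `|w| + w0 by lra.
have W1 : 0 < 1 + `|w| ^+ 2 by rewrite ltr_pwDl ?sqr_ge0.
pose k := c1 * 10; have k0 : 0 < k by rewrite mulr_gt0.
have kfac : k * (1 + `|w| ^+ 2) <= `|w| ^+ 2.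
  by apply: le_trans fac; rewrite ler_pM2r // /k; lra.
set X := `| `|w| - w0| in key D0 d2 *; set y := `|w| in key S2 W1 kfac w0' *.
have : k * (1 + y ^+ 2) * (X * ((1 + y) / 2)) <= Nn * 3 * (1 + y ^+ 2).
  apply: le_trans (_ : _ <= y ^+ 2 * (X * (y + w0))) _; last by lra.
  apply: ler_pM => //.
  - by rewrite mulr_ge0 // ltW.
  - by rewrite mulr_ge0 // divr_ge0 // addr_ge0.
  - by rewrite ler_wpM2l.
have -> : k * (1 + y ^+ 2) * (X * ((1 + y) / 2)) = (k / 2 * (X * (1 + y))) * (1 + y ^+ 2).
  by field.
rewrite ler_pM2r // => fin.
have h1 : rdist w0 w * (1 + y) <= X * (1 + y) by rewrite ler_wpM2r // addr_ge0.
have h2 : c1 * (rdist w0 w * (1 + y)) <= c1 * (X * (1 + y)) by rewrite ler_pM2l.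
have h3 : 0 <= c1 * (X * (1 + y)) by rewrite !mulr_ge0 ?addr_ge0 // ltW.
rewrite /k in fin; rewrite -mulrA; lra.
Qed.

End CharacteristicFunction.

(** * The shifted characteristic function far from its zeros, near 0 and near the Hopf frequency *)

Section PerturbedCharacteristicFunction.
Variable R : realType.
Variables a w0 tau : R.
Hypothesis crit : critical a w0 tau.

Lemma lamN_perturb p q r d w S : 0 <= d -> `|q| + 2 * `|r| + `|p| <= S ->
  lamN a tau p q r 0 w - d * (S * (1 + `|w|)) <= lamN a tau p q r d w.
Proof.
move=> d0 hS; rewrite /lamN /lamRe /lamIm !mul0r !addr0.
set A := 1 - _ - _; set B := - _ + _; set c := cos _; set s := sin _.
have cb : `|c| <= 1 by rewrite ler_norml cos_geN1 cos_le1.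
have sb : `|s| <= 1 by rewrite ler_norml sin_geN1 sin_le1.
have h1 : `|A| - d * (`|q| + `|r|) <= `|A + d * (q + r * c)|.
  have := ler_normB (A + d * (q + r * c)) (d * (q + r * c)); rewrite addrK.
  have : `|d * (q + r * c)| <= d * (`|q| + `|r|).
    rewrite normrM ger0_norm // ler_wpM2l // (le_trans (ler_normD _ _)) // lerD2l normrM.
    by rewrite -[leRHS]mulr1 ler_wpM2l.
  lra.
have h2 : `|B| - d * (`|p| * `|w| + `|r|) <= `|B + d * (p * w - r * s)|.
  have := ler_normB (B + d * (p * w - r * s)) (d * (p * w - r * s)); rewrite addrK.
  have : `|d * (p * w - r * s)| <= d * (`|p| * `|w| + `|r|).
    rewrite normrM ger0_norm // ler_wpM2l // (le_trans (ler_normB _ _)) // !normrM lerD2l.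
    by rewrite -[leRHS]mulr1 ler_wpM2l.
  lra.
have : d * (`|q| + `|r|) + d * (`|p| * `|w| + `|r|) <= d * (S * (1 + `|w|)).
  rewrite -mulrDr ler_wpM2l //; have q0 := normr_ge0 q; have r0 := normr_ge0 r.
  have p0 := normr_ge0 p; have w1 := normr_ge0 w.
  have : `|p| * `|w| <= S * `|w| by rewrite ler_wpM2r //; lra.
  lra.
lra.
Qed.

(** The unshifted real part is quadratic in [w], hence O(d^2) here, while the shift contributes d (q
    + r). The constant 130 makes the error at most half of it. *)
Lemma lamN_near0 p q r d w S K : 0 < d -> d <= 1 -> 1 <= S -> 0 <= K -> `|r| <= S ->
  `|w| <= K * d -> 130 * d * (S * K ^+ 2) <= `|q + r| ->
  d * (`|q + r| / 2) <= lamN a tau p q r d w.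
Proof.
move=> d0 d1 S1 K0 rS wK hd.
have [b1 b2 t00 t8] := crit_bounds crit.
apply: le_trans (_ : _ <= `|lamRe tau q r d w|) _; last first.
  by rewrite /lamN lerDl.
rewrite /lamRe; have := cos_quad (w * tau); set c := cos _ => /andP[c1 c2].
have w2 : w ^+ 2 <= (K * d) ^+ 2.
  by rewrite -[w ^+ 2]real_normK ?num_real // lerXn2r ?nnegrE // mulr_ge0 // ltW.
have c3 : 1 - c <= 32 * (K * d) ^+ 2.
  apply: le_trans c2 _; rewrite exprMn.
  have t2 : tau ^+ 2 <= 64 by rewrite expr2; nra.
  have : w ^+ 2 * tau ^+ 2 <= (K * d) ^+ 2 * 64 by apply: ler_pM; rewrite ?sqr_ge0.
  lra.
have -> : 1 - w ^+ 2 - c + d * (q + r * c) = d * (q + r) + ((1 - c) - w ^+ 2 - d * (r * (1 - c))).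
  by ring.
have e1 : `|(1 - c) - w ^+ 2 - d * (r * (1 - c))| <= d * (`|q + r| / 2).
  apply: le_trans (_ : _ <= (32 + 1 + S * 32) * (K * d) ^+ 2) _.
    apply: le_trans (ler_normB _ _) _; rewrite 2!mulrDl; apply: lerD.
      by apply: le_trans (ler_normB _ _) _; rewrite ger0_norm // ger0_norm ?sqr_ge0 //; lra.
    rewrite !normrM (gtr0_norm d0) (ger0_norm c1) -[S * 32 * _]mul1r -mulrA.
    apply: ler_pM; [exact: ltW|by rewrite mulr_ge0|by []|exact: ler_pM].
  have k2 : 0 <= (K * d) ^+ 2 := sqr_ge0 _.
  apply: le_trans (_ : _ <= 65 * S * (K * d) ^+ 2) _; first by rewrite ler_wpM2r //; lra.
  have -> : 65 * S * (K * d) ^+ 2 = d * (130 * d * (S * K ^+ 2) / 2) by rewrite exprMn; field.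
  by rewrite ler_pM2l //; lra.
have := ler_normB (d * (q + r) + ((1 - c) - w ^+ 2 - d * (r * (1 - c)))) ((1 - c) - w ^+ 2 - d * (r * (1 - c))).
rewrite addrK normrM (gtr0_norm d0); lra.
Qed.

(** Detuning [w] can cancel the shift only along the derivative of L at [w0]; the component
    transversal to it is d times [transv] up to O(d^2). One factor 2 pays for this error, and 18
    bounds the derivative, whence 36. *)
Lemma lamN_nearHopf p q r d w S K : 0 < d -> 1 <= S -> 1 <= K -> `|r| <= S ->
  `|p| <= S -> `|w - w0| <= K * d -> 8 * (K * d) <= 1 ->
  d * (50 * 90 * (S * K ^+ 2)) <= `|transv a w0 tau p q r| ->
  d * (`|transv a w0 tau p q r| / 36) <= lamN a tau p q r d w.
Proof.
move=> d0 S1 K1 rS pS wK kd hd.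
have [b1 b2 t00 t8] := crit_bounds crit.
case: crit => /andP[a1 a2] w00 w02 /andP[t0 t1] [ec es].
set h := w - w0 in wK; have hw : w = w0 + h by rewrite /h; ring.
(* [V1] and [V2] are the derivatives at [w0] of the real and imaginary parts of the unperturbed
   function. *)
pose V1 := - (w0 * (2 - a * tau)); pose V2 := tau * (a ^+ 2 - 1) - a.
have a20 : a ^+ 2 <= 2 by rewrite expr2; nra.
have V1b : `|V1| <= 18.
  rewrite /V1 normrN normrM (gtr0_norm w00) -[18](_ : 3 / 2 * 12 = _); last by lra.
  apply: ler_pM; [exact: ltW|by []|by []|rewrite ler_norml; nra].
have V2b : `|V2| <= 10 by rewrite /V2 ler_norml; have := sqr_ge0 a; nra.
have wt : w * tau = w0 * tau + h * tau by rewrite hw; ring.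
have ht1 : `|h * tau| <= 8 * `|h|.
  by rewrite normrM (gtr0_norm t00) mulrC ler_wpM2r.
have ht2 : `|h * tau| <= 1 by lra.
have hh : h ^+ 2 <= (K * d) ^+ 2.
  by rewrite -[h ^+ 2]real_normK ?num_real // lerXn2r ?nnegrE // (le_trans (normr_ge0 h) wK).
have ht3 : (h * tau) ^+ 2 <= 64 * (K * d) ^+ 2.
  rewrite exprMn; have t2 : tau ^+ 2 <= 64 by rewrite expr2; nra.
  have : h ^+ 2 * tau ^+ 2 <= (K * d) ^+ 2 * 64 by apply: ler_pM; rewrite ?sqr_ge0.
  lra.
have ct := cos_taylor (w0 * tau) ht2; have st := sin_taylor (w0 * tau) ht2.
have cl := cos_lip (w0 * tau) (h * tau); have sl := sin_lip (w0 * tau) (h * tau).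
rewrite ec es -wt in ct st cl sl.
set c := cos (w * tau) in ct cl *; set s := sin (w * tau) in st sl *.
pose E1 := - h ^+ 2 - (c - (a ^+ 2 - 1) + h * tau * (a * w0)).
pose E2 := s - a * w0 - h * tau * (a ^+ 2 - 1).
have E1b : `|E1| <= 65 * (K * d) ^+ 2.
  apply: le_trans (ler_normB _ _) _; rewrite normrN (ger0_norm (sqr_ge0 h)); move: ct ht3 hh; clear; lra.
have E2b : `|E2| <= 64 * (K * d) ^+ 2 by apply: le_trans st ht3.
pose E3 := r * (c - (a ^+ 2 - 1)); pose E4 := p * h - r * (s - a * w0).
have r0 := normr_ge0 r; have hn := normr_ge0 h.
have E3b : `|E3| <= 8 * (S * (K * d)).
  rewrite /E3 normrM; apply: le_trans (_ : _ <= S * (8 * (K * d))) _; last by lra.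
  apply: ler_pM => //; lra.
have E4b : `|E4| <= 9 * (S * (K * d)).
  apply: le_trans (ler_normB _ _) _; rewrite !normrM.
  have : `|p| * `|h| <= S * (K * d) by apply: ler_pM.
  have : `|r| * `|s - a * w0| <= S * (8 * (K * d)) by apply: ler_pM => //; lra.
  lra.
(* this combination cancels the linear part in [h] of the unperturbed function *)
have cross : V2 * lamRe tau q r d w - V1 * lamIm a tau p r d w =
    d * transv a w0 tau p q r + (V2 * E1 - V1 * E2 + d * (V2 * E3 - V1 * E4)).
  rewrite /lamRe /lamIm -/c -/s /E1 /E2 /E3 /E4 /transv -/V2.
  have -> : w ^+ 2 = w0 ^+ 2 + 2 * w0 * h + h ^+ 2 by rewrite hw; ring.
  have -> : w0 ^+ 2 * (p - r * a) * (2 - a * tau) = - V1 * (w0 * (p - r * a)) by rewrite /V1; ring.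
  rewrite w02 /V1 /V2 hw; ring.
have Eb : `|V2 * E1 - V1 * E2 + d * (V2 * E3 - V1 * E4)| <=
    d * (`|transv a w0 tau p q r| / 2).
  have KK : 0 <= (K * d) ^+ 2 := sqr_ge0 _.
  have S0 : 0 <= S by exact: le_trans S1.
  have K0 : 0 <= K by exact: le_trans K1.
  have SKd : 0 <= S * (K * d) by rewrite !mulr_ge0 // ltW.
  apply: le_trans (_ : _ <= (650 * (K * d) ^+ 2 + 18 * 64 * (K * d) ^+ 2) +
    d * (80 * (S * (K * d)) + 18 * 9 * (S * (K * d)))) _.
    apply: le_trans (ler_normD _ _) _; apply: lerD.
      apply: le_trans (ler_normB _ _) _; apply: lerD; rewrite normrM.
        have -> : 650 * (K * d) ^+ 2 = 10 * (65 * (K * d) ^+ 2) by ring.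
        exact: ler_pM.
      rewrite -mulrA; exact: ler_pM.
    rewrite normrM (gtr0_norm d0) ler_wpM2l ?(ltW d0) //.
    apply: le_trans (ler_normB _ _) _; apply: lerD; rewrite normrM.
      have -> : 80 * (S * (K * d)) = 10 * (8 * (S * (K * d))) by ring.
      exact: ler_pM.
    rewrite -mulrA; exact: ler_pM.
  apply: le_trans (_ : _ <= d * (d * (50 * 90 * (S * K ^+ 2)) / 2)) _; last first.
    by rewrite ler_pM2l //; lra.
  have e1 : (K * d) ^+ 2 <= d * (d * (S * K ^+ 2)).
    have -> : d * (d * (S * K ^+ 2)) = S * (K * d) ^+ 2 by ring.
    by rewrite -[leLHS]mul1r ler_wpM2r.
  have e2 : d * (S * (K * d)) <= d * (d * (S * K ^+ 2)).
    have -> : d * (S * (K * d)) = S * d * d * K by ring.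
    have -> : d * (d * (S * K ^+ 2)) = S * d * d * K ^+ 2 by ring.
    by rewrite ler_wpM2l ?mulr_ge0 ?(ltW d0) // expr2 ler_peMl.
  rewrite (_ : d * (d * (50 * 90 * (S * K ^+ 2)) / 2) = 25 * 90 * (d * (d * (S * K ^+ 2)))); last by field.
  have -> : d * (80 * (S * (K * d)) + 18 * 9 * (S * (K * d))) = 242 * (d * (S * (K * d))) by ring.
  have X0 : 0 <= d * (d * (S * K ^+ 2)) by apply: le_trans e1.
  by move: e1 e2 KK X0; clear; lra.
have NB : `|V2 * lamRe tau q r d w - V1 * lamIm a tau p r d w| <= 18 * lamN a tau p q r d w.
  rewrite /lamN; move: (lamRe _ _ _ _ _) (lamIm _ _ _ _ _ _) => A B.
  rewrite [leRHS]mulrDr; apply: le_trans (ler_normB _ _) _; rewrite (normrM V2) (normrM V1).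
  apply: lerD; rewrite ler_wpM2r //.
  by apply: le_trans V2b _; rewrite ler_nat.
have := ler_normB (V2 * lamRe tau q r d w - V1 * lamIm a tau p r d w)
  (V2 * E1 - V1 * E2 + d * (V2 * E3 - V1 * E4)).
rewrite {1}cross addrK normrM (gtr0_norm d0).
by move: Eb NB; clear; lra.
Qed.

End PerturbedCharacteristicFunction.

Section UniformLowerBound.
Variable R : realType.

Lemma lamN_opp (a tau p q r d w : R) : lamN a tau p q r d (- w) = lamN a tau p q r d w.
Proof.
rewrite /lamN /lamRe /lamIm mulNr cosN sinN sqrrN; congr (_ + _).
by rewrite -normrN; congr (`|_|); ring.
Qed.

(** Three regions: far from the zeros the unperturbed bound absorbs the shift, and within K d of 0
    or of +-w0 the shift itself gives the bound. The constants depend on [a] only through the bounds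
    of [critical] and through [F0], which makes the smallness of epsilon uniform in the
    parameter. *)
Lemma lamN_uniform (p0 q r F0 : R) : 0 < F0 -> q + r != 0 ->
  exists d0 c2 : R, [/\ 0 < d0, 0 < c2 &
    forall a w0 tau, critical a w0 tau -> F0 <= `|transv a w0 tau (a * p0) q r| ->
    forall d w, 0 < d <= d0 ->
      c2 * (Num.max d (rdist w0 w) * (1 + `|w|)) <= lamN a tau (a * p0) q r d w].
Proof.
move=> F00 qr0.
pose S := 1 + `|q| + 2 * `|r| + 2 * `|p0|.
have q0 := normr_ge0 q; have r0 := normr_ge0 r; have p00 := normr_ge0 p0.
have S1 : 1 <= S by rewrite /S; lra.
have [c1 [c10 c1s c11]] : exists c1 : R, [/\ 0 < c1, c1 * 1000 * 1000 <= 1 & c1 <= 1].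
  have [x x1 ->] : exists2 x : R, 1 <= x & 1000 = x by exists 1000; rewrite // ler1n.
  have x0 : 0 < x by exact: lt_le_trans x1.
  exists (x^-1 * x^-1); split; first by rewrite mulr_gt0 ?invr_gt0.
    by rewrite mulfVK ?mulVf // gt_eqF.
  by rewrite -[leRHS]mulr1 ler_pM ?invr_ge0 ?(ltW x0) // invf_le1.
(* With this choice, beyond distance K d the loss d S (1 + |w|) is at most half of the unperturbed
   lower bound. *)
pose K := 2 * S / c1.
have K1 : 1 <= K by rewrite /K ler_pdivlMr // mul1r; lra.
have K0 : 0 < K by lra.
have SK : 1 <= S * K ^+ 2 by rewrite -[1]mulr1 ler_pM ?exprn_ege1.
have KSK : K <= S * K ^+ 2.
  by rewrite -[leLHS]mul1r ler_pM //; [lra|rewrite expr2 ler_peMl // ltW].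
pose m := Num.min 1 (Num.min `|q + r| F0).
have m0 : 0 < m by rewrite !lt_min ltr01 F00 normr_gt0 qr0.
have [m1 [m2 m3]] : m <= 1 /\ m <= `|q + r| /\ m <= F0.
  by rewrite /m !ge_min !lexx !orbT.
pose C := 50 * 100 * (S * K ^+ 2).
have SK0 : 0 < S * K ^+ 2 by exact: lt_le_trans SK.
have C0 : 0 < C by apply: mulr_gt0 => //; exact: mulr_gt0.
(* Near a zero, 36 comes from the Hopf estimate, 4 bounds 1 + |w|, and [K] bounds the maximum of d
   and the distance in units of d. *)
pose c2 := Num.min (c1 / 2) (m / (36 * 4 * K)).
have K4 : 0 < 36 * 4 * K by apply: mulr_gt0 => //; exact: mulr_gt0.
have c20 : 0 < c2 by rewrite lt_min; apply/andP; split; exact: divr_gt0.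
exists (m / C), c2; split=> //; first by rewrite divr_gt0.
move=> a w0 tau crit trF d w /andP[d0 dC].
have [b1 b2 t00 t8] := crit_bounds crit.
have ab : `|a| <= 2 by case: crit => /andP[a1 a2] _ _ _ _; rewrite ler_norml; move: a1 a2; clear; lra.
have pS : `|a * p0| <= 2 * `|p0| by rewrite normrM ler_wpM2r.
have qS : `|q| + 2 * `|r| + `|a * p0| <= S by rewrite /S; move: pS; clear; lra.
have rS : `|r| <= S by rewrite /S; move: q0 r0 p00; clear; lra.
have dCm : d * C <= m by rewrite -ler_pdivlMr.
have dK : d * (50 * 100 * K) <= m.
  apply: le_trans dCm; rewrite ler_pM2l // /C ler_pM2l // mulr_gt0 //.
have d1 : d <= 1.
  have : d * 1 <= d * C by rewrite ler_pM2l // /C; move: SK; clear; lra.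
  by move: dCm m1; clear; lra.
have rd0 : 0 <= rdist w0 w by rewrite /rdist le_min !normr_ge0.
have w1 := normr_ge0 w.
have [far|near] := leP (K * d) (rdist w0 w).
  have dr : d <= rdist w0 w by apply: le_trans far; rewrite ler_peMl // ltW.
  rewrite (max_r dr).
  have h1 := lam_lower crit (a * p0) q r w c10 c1s.
  have h2 := @lamN_perturb R a tau (a * p0) q r d w S (ltW d0) qS.
  have h3 : d * (S * (1 + `|w|)) <= c1 / 2 * (rdist w0 w * (1 + `|w|)).
    rewrite !mulrA ler_wpM2r ?addr_ge0 //.
    have : c1 / 2 * (K * d) <= c1 / 2 * rdist w0 w by rewrite ler_pM2l // divr_gt0.
    have -> : c1 / 2 * (K * d) = d * S by rewrite /K; field; rewrite gt_eqF.
    by [].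
  have h4 : c2 * (rdist w0 w * (1 + `|w|)) <= c1 / 2 * (rdist w0 w * (1 + `|w|)).
    by rewrite ler_wpM2r ?mulr_ge0 ?addr_ge0 // /c2 ge_min lexx.
  by move: h1 h2 h3 h4; clear; lra.
have mx : Num.max d (rdist w0 w) <= K * d.
  by rewrite ge_max (ltW near) andbT ler_peMl // ltW.
have mx0 : 0 <= Num.max d (rdist w0 w) by rewrite le_max rd0 orbT.
have Kd0 : 0 < K * d by rewrite mulr_gt0.
have Kd : 8 * (K * d) <= 1 by move: dK Kd0 m1; clear; lra.
have w4 : 1 + `|w| <= 4.
  move: near; rewrite /rdist gt_min => /orP[|]; first by move: Kd; clear; lra.
  by rewrite ltr_norml => /andP[_]; move: Kd b2; clear; lra.
apply: le_trans (_ : _ <= d * (m / 36)) _.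
  apply: le_trans (_ : _ <= m / (36 * 4 * K) * (K * d * 4)) _.
    apply: ler_pM; [exact: ltW|by rewrite mulr_ge0 // addr_ge0|by rewrite /c2 ge_min lexx orbT|].
    by apply: ler_pM; rewrite ?addr_ge0.
  by rewrite le_eqVlt; apply/orP; left; apply/eqP; field; rewrite gt_eqF.
move: near; rewrite /rdist gt_min => /orP[wK|wK].
  apply: le_trans (@lamN_near0 R a w0 tau crit (a * p0) q r d w S K d0 d1 S1 (ltW K0) _ (ltW wK) _).
  - by rewrite ler_pM2l //; move: m0 m1 m2; clear; lra.
  - exact: rS.
  - apply: le_trans m2; apply: le_trans dCm.
    have dX : 0 <= d * (S * K ^+ 2) by rewrite mulr_ge0 ?ltW.
    have -> : 130 * d * (S * K ^+ 2) = 130 * (d * (S * K ^+ 2)) by ring.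
    have -> : d * C = 50 * 100 * (d * (S * K ^+ 2)) by rewrite /C; ring.
    by rewrite ler_wpM2r //; clear; lra.
apply: le_trans (_ : _ <= d * (`|transv a w0 tau (a * p0) q r| / 36)) _.
  by rewrite ler_pM2l //; move: m3 trF; clear; lra.
have hop w' : `|w' - w0| < K * d -> d * (`|transv a w0 tau (a * p0) q r| / 36) <= lamN a tau (a * p0) q r d w'.
  move=> w'K; apply: (@lamN_nearHopf R a w0 tau crit (a * p0) q r d w' S K) => //.
  - by apply: le_trans pS _; rewrite /S; move: q0 r0; clear; lra.
  - exact: ltW.
  - apply: le_trans trF; apply: le_trans m3; apply: le_trans dCm.
    by rewrite ler_pM2l // /C; move: SK0; clear; lra.
have [w00|w00] := leP 0 w.
  by apply: hop; rewrite (ger0_norm w00) in wK.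
by rewrite -lamN_opp; apply: hop; rewrite (ltr0_norm w00) in wK.
Qed.

End UniformLowerBound.

(** * Averages, uniqueness and decay of Fourier coefficients *)

Section TermwiseDerivative.
Variable R : realType.
Local Notation C := R[i].

(** The minimum combines the quadratic bound for small [y] with the linear bound for large [y]; the
    latter lets termwise differentiation work with a single summable derivative. *)
Lemma cis_quad (y : R) :
  normc (cis y - 1 - 'i%C * (y%:C)%C) <= 3 * Num.min 1 `|y| * `|y|.
Proof.
have [y1|y1] := leP `|y| 1.
  have c := cos_quad y; have s := sin_cubic y.
  have s' : `|sin y - y| <= `|y| ^+ 2 / 2.
    apply: le_trans s _; rewrite -[y ^+ 2]real_normK ?num_real // -[leRHS]mulr1.
    by rewrite ler_wpM2l // divr_ge0 ?sqr_ge0.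
  apply: le_trans (normc_ReIm _) _ => /=.
  rewrite !(mul0r, mulr0, subr0, sub0r, mul1r, addr0, oppr0, add0r).
  rewrite distrC ger0_norm; last by case/andP: c.
  rewrite -[y ^+ 2]real_normK ?num_real // in c; case/andP: c => _ c.
  rewrite -mulrA -expr2; have := sqr_ge0 `|y|; lra.
apply: le_trans (ler_normcB _ _) _; rewrite normcM normc_real [normc 'i%C]/= expr0n add0r expr1n sqrtr1 mul1r.
have h : normc (cis y - 1) <= 2 * `|y| by have := cis_lip y 0; rewrite cis0 subr0.
lra.
Qed.

Lemma derive_of_bound (f : R -> R) (t df : R) :
  (forall e, 0 < e -> exists2 d, 0 < d & forall h, `|h| < d ->
    `|f (t + h) - f t - h * df| <= e * `|h|) -> is_derive t (1 : R) f df.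
Proof.
move=> H.
have lim : h^-1 *: ((f \o shift t) (h *: (1 : R)) - f t) @[h --> 0^'] --> df.
  apply/cvgrPdist_le => e e0; have [d d0 hd] := H e e0.
  near=> h.
  have h0 : h != 0 by near: h; exact: nbhs_dnbhs_neq.
  have hs : `|h| < d.
    near: h; apply: dnbhs0_lt; exact: d0.
  rewrite /= /GRing.scale /= mulr1 [h + t]addrC distrC.
  have -> : h^-1 * (f (t + h) - f t) - df = h^-1 * (f (t + h) - f t - h * df).
    by field.
  by rewrite normrM normfV ler_pdivrMl ?normr_gt0 // [`|h| * e]mulrC hd.
by apply: DeriveDef; [exact: cvgP lim|exact: cvg_lim lim].
Unshelve. all: by end_near.
Qed.

(** Finitely many modes obey the quadratic bound of [cis_quad], with their largest frequency as a
    factor; the tail obeys the linear bound, summable by the second hypothesis. *)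
Lemma csum_cis_derive (I : eqType) (a : I -> C) (nu : I -> R) M M' (t : R) :
  absum a M' -> absum (fun i => ((nu i)%:C)%C * a i) M ->
  is_derive t (1 : R) (fun s => complex.Re (csum (fun i => a i * cis (nu i * s))))
    (complex.Re (csum (fun i => ('i%C * ((nu i)%:C)%C * a i) * cis (nu i * t)))).
Proof.
move=> ha hn; have M0 := absum_ge0 hn.
apply: derive_of_bound => e e0.
have [s us tail] := absum_tail (divr_gt0 e0 (ltr0n _ 6)) hn.
pose V := \sum_(i <- s) `|nu i| + 1.
have V0 : 0 < V by rewrite ltr_wpDl ?sumr_ge0.
have Vs i : i \in s -> `|nu i| <= V.
  move=> si; rewrite /V (bigD1_seq i) //= -addrA lerDl addr_ge0 ?sumr_ge0 //.
have M10 : 0 < M + 1 by rewrite ltr_wpDl.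
have VM0 : 0 < 3 * (V * (M + 1)) by rewrite !mulr_gt0.
exists (e / 2 / (3 * (V * (M + 1)))); first by rewrite !divr_gt0.
move=> h hd.
have habs x : absum (fun i => a i * cis (nu i * x)) M'.
  by apply: absum_mono ha => i; rewrite normcM normc_cis mulr1.
have hder : absum (fun i => ('i%C * ((nu i)%:C)%C * a i) * cis (nu i * t)) M.
  apply: absum_mono hn => i; rewrite normcM normc_cis mulr1 -mulrA normcM.
  by rewrite [normc 'i%C]/= expr0n add0r expr1n sqrtr1 mul1r.
pose A := csum (fun i => a i * cis (nu i * (t + h))).
pose B := csum (fun i => a i * cis (nu i * t)).
pose D := csum (fun i => ('i%C * ((nu i)%:C)%C * a i) * cis (nu i * t)).
apply: le_trans (_ : _ <= normc (A - B - (h%:C)%C * D)) _.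
  apply: le_trans (ler_Re_normc _); rewrite -/A -/B -/D.
  by case: A B D => [? ?] [? ?] [? ?] /=; rewrite mul0r subr0.
rewrite /A /B /D -(csumB (habs _) (habs _)) -csumZf.
rewrite -(csumB (absumB (habs _) (habs _)) (absumZ _ hder)).
apply: csum_le => r ur.
have term i : normc (a i * cis (nu i * (t + h)) - a i * cis (nu i * t) -
    h%:C%C * ('i%C * (nu i)%:C%C * a i * cis (nu i * t))) <=
    3 * Num.min 1 `|nu i * h| * `|h| * normc (((nu i)%:C)%C * a i).
  rewrite mulrDr cisD.
  have -> : a i * (cis (nu i * t) * cis (nu i * h)) - a i * cis (nu i * t) -
    h%:C%C * ('i%C * (nu i)%:C%C * a i * cis (nu i * t)) =
    a i * cis (nu i * t) * (cis (nu i * h) - 1 - 'i%C * ((nu i * h)%:C)%C).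
    by rewrite rmorphM; ring.
  rewrite !normcM normc_cis mulr1 !normc_real.
  apply: le_trans (ler_wpM2l (normc_ge0 _) (cis_quad _)) _.
  by rewrite normrM le_eqVlt; apply/orP; left; apply/eqP; ring.
apply: le_trans (_ : _ <= \sum_(i <- r) 3 * Num.min 1 `|nu i * h| * `|h| * normc (((nu i)%:C)%C * a i)) _.
  exact: ler_sum.
rewrite (bigID (mem s)) /= mulrC [e]splitr mulrDr; apply: lerD.
  apply: le_trans (_ : _ <= \sum_(i <- r | i \in s) 3 * (V * `|h|) * `|h| * normc (((nu i)%:C)%C * a i)) _.
    apply: ler_sum => i si; rewrite ler_wpM2r ?normc_ge0 // ler_wpM2r //.
    by rewrite ler_pM2l // ge_min normrM [X in _ || X]ler_wpM2r ?Vs // orbT.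
  rewrite -mulr_sumr -big_filter.
  apply: le_trans (ler_wpM2l _ (hn _ (filter_uniq _ ur))) _; first by rewrite !mulr_ge0 // ltW.
  have -> : 3 * (V * `|h|) * `|h| * M = `|h| * (`|h| * (3 * (V * M))) by ring.
  rewrite ler_wpM2l //; move: hd; rewrite ltr_pdivlMr // => hd.
  apply: le_trans (ltW hd); rewrite ler_wpM2l // ler_pM2l // ler_pM2l //; lra.
apply: le_trans (_ : _ <= \sum_(i <- r | i \notin s) 3 * `|h| * normc (((nu i)%:C)%C * a i)) _.
  apply: ler_sum => i _; rewrite ler_wpM2r ?normc_ge0 // ler_wpM2r //.
  by rewrite -[leRHS]mulr1 ler_pM2l // ge_min lexx.
rewrite -mulr_sumr -big_filter.
have := tail [seq i <- r | i \notin s] (filter_uniq _ ur).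
move=> /(_ (fun i => ltac:(by rewrite mem_filter => /andP[]))) ht.
move: (\sum_(i <- _) _) ht => X ht.
have -> : 3 * `|h| * X = `|h| * (3 * X) by ring.
by rewrite ler_wpM2l //; move: ht; clear; lra.
Qed.

End TermwiseDerivative.

Section TorusAverage.
Variable R : realType.
Local Notation C := R[i].

(** The fundamental theorem of calculus is applied to b_0 t plus the series of the b_j / (i j); the
    periodic part contributes nothing over a full period. *)
Lemma integral_fser (b : int -> C) M : absum b M ->
  \int[@lebesgue_measure R]_(t in `[0, 2 * pi]%classic) complex.Re (fser b t) =
    2 * pi * complex.Re (b 0).
Proof.
move=> hb; have pi0 := pi_gt0 R; have p20 : 0 < 2 * pi :> R by rewrite mulr_gt0.
pose b' (j : int) : C := if j == 0 then 0 else (- 'i%C * ((j%:~R^-1 : R)%:C)%C) * b j.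
have hb' : absum b' M.
  apply: absum_mono hb => j; rewrite /b'; case: eqP => [_|/eqP j0]; first by rewrite normc0 normc_ge0.
  rewrite 2!normcM normcN [normc 'i%C]/= expr0n add0r expr1n sqrtr1 mul1r normc_real.
  rewrite -[leRHS]mul1r ler_wpM2r ?normc_ge0 // normfV invf_le1 ?normr_gt0 ?intr_eq0 //.
  by rewrite -intr_norm ler1z -gtz0_ge1 normr_gt0.
pose F (t : R) := complex.Re (b 0) * t + complex.Re (fser b' t).
pose f (t : R) := complex.Re (fser b t).
have Fd t : is_derive t (1 : R) F (f t).
  have h1 : absum (fun j : int => ((j%:~R : R)%:C)%C * b' j) M.
    apply: absum_mono hb => j; rewrite /b'; case: eqP => [_|/eqP j0].
      by rewrite mulr0 normc0 normc_ge0.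
    rewrite !normcM normcN [normc 'i%C]/= expr0n add0r expr1n sqrtr1 mul1r !normc_real.
    by rewrite mulrA normfV mulfV ?mul1r // normr_eq0 intr_eq0.
  have h2 := csum_cis_derive t hb' h1.
  have h3 : is_derive t (1 : R) (complex.Re (b 0) \*: (@id R)) (complex.Re (b 0)).
    by apply: (is_derive_eq (is_deriveZ _ (is_derive_id t (1 : R)))); rewrite /GRing.scale /= mulr1.
  apply: (is_derive_eq (is_deriveD h3 h2)).
  rewrite /f /fser.
  have hz := absum_fser t (absum_fconst (b 0)).
  have hd : absum (fun j : int => 'i%C * (j%:~R)%:C%C * b' j * cis (j%:~R * t)) M.
    apply: absum_mono h1 => j; rewrite normcM normc_cis mulr1 -mulrA normcM.
    by rewrite [normc 'i%C]/= expr0n add0r expr1n sqrtr1 mul1r.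
  have -> : (fun j => b j * cis (j%:~R * t)) = fun j : int =>
    fconst (b 0) j * cis (j%:~R * t) + 'i%C * (j%:~R)%:C%C * b' j * cis (j%:~R * t).
    apply: funext => j; rewrite /b' /fconst; case: eqP => [->|/eqP j0]; first by rewrite mulr0 mul0r addr0.
    rewrite mul0r add0r; congr (_ * _).
    have -> : 'i%C * (j%:~R)%:C%C * (- 'i%C * ((j%:~R^-1 : R)%:C)%C * b j) =
       - 'i%C ^+ 2 * ((j%:~R * j%:~R^-1 : R)%:C)%C * b j by rewrite rmorphM; ring.
    by rewrite sqr_i opprK mul1r divff ?intr_eq0 // mul1r.
  rewrite (csumD hz hd).
  rewrite -[X in X + csum _]/(fser (fconst (b 0)) t) fser_fconst.
  by case: (b 0) (csum _) => [? ?] [? ?].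
have fc : continuous f.
  move=> t; apply/cvgrPdist_le => e e0.
  have := csum_cis_continuous (T := R) (th := fun (j : int) (y : R) => j%:~R * y) (x := t) hb.
  move=> /(_ (fun j => ltac:(by apply: cvgM; [exact: cvg_cst|exact: cvg_id])) e e0).
  apply: filterS => y hy; apply: le_trans (_ : _ <= normc (fser b y - fser b t)) hy.
  apply: le_trans (ler_Re_normc _); rewrite distrC /f.
  by case: (fser b y) (fser b t) => [? ?] [? ?].
rewrite /Rintegral (@continuous_FTC2 _ f F 0 (2 * pi)) //.
- rewrite -EFinB /= /F -[in fser b' (2 * pi)](add0r (2 * pi)) fser_period; ring.
- exact: continuous_subspaceT.
- split.
  + by move=> t _; case: (Fd t).
  + apply: cvg_at_right_filter; apply: differentiable_continuous; apply/derivable1_diffP; by case: (Fd 0).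
  + apply: cvg_at_left_filter; apply: differentiable_continuous; apply/derivable1_diffP; by case: (Fd (2 * pi)).
- by move=> t _; rewrite derive1E; case: (Fd t).
Qed.

Lemma dotr_row_mx (p q : nat) (k : 'rV[int]_p) (l : 'rV[int]_q)
    (phi : 'rV[R]_p) (psi : 'rV[R]_q) :
  dotr (row_mx k l) (row_mx phi psi) = dotr k phi + dotr l psi.
Proof.
rewrite /dotr big_split_ord /=; congr (_ + _); apply: eq_bigr => i _.
  by rewrite !row_mxEl.
by rewrite !row_mxEr.
Qed.

(** Freezing the first variable gives an absolutely summable series in the others, with coefficients
    [at_ t]; the remaining integral over [t] is one-dimensional. *)
Lemma torus_integral_eval (n : nat) (a : 'rV[int]_n -> C) M : absum a M ->
  torus_integral (fun phi => complex.Re (eval a phi)) =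
  (2 * pi) ^+ n * complex.Re (a 0) :> R.
Proof.
elim: n a => [|n IH] a ha.
  rewrite /= expr0 mul1r /eval (csum1 (i := 0)) => [|k]; last by rewrite [k]thinmx0 eqxx.
  by rewrite dotr0l cis0 mulr1.
pose at_ (t : R) (k : 'rV[int]_n) : C :=
  csum (fun j : int => a (row_mx (j%:M : 'M[int]_1) k : 'rV_(1 + n)) * cis (j%:~R * t)).
pose pr (p : 'rV[int]_n * int) : 'rV[int]_(1 + n) := row_mx (p.2%:M : 'M[int]_1) p.1.
have prI : injective pr.
  move=> [k j] [k' j'] /= /eq_row_mx[/matrixP/(_ 0 0)].
  by rewrite !mxE /= !mulr1n => -> ->.
have prS k : exists p, pr p = k.
  exists (rsubmx (k : 'rV_(1 + n)), (lsubmx (k : 'rV_(1 + n))) 0 0).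
  by rewrite /pr /= -mx11_scalar hsubmxK.
have hp : absum (fun p => a (pr p)) M by exact: absum_reindex prI ha.
have hpt t : absum (fun p : 'rV[int]_n * int => a (pr p) * cis (p.2%:~R * t)) M.
  by apply: absum_mono hp => p; rewrite normcM normc_cis mulr1.
have hat_ t : absum (at_ t) M.
  exact: (absum_outer (u := fun k j => a (pr (k, j)) * cis (j%:~R * t)) (hpt t)).
have ev (t : R) (phi : 'rV[R]_n) : eval a (row_mx t%:M phi : 'rV_(1 + n)) = eval (at_ t) phi.
  rewrite /eval -(csum_reindex prI _ (absum_eval (row_mx t%:M phi : 'rV_(1 + n)) ha)); last first.
    by move=> k _; exact: prS.
  have hu : absum (fun p : 'rV[int]_n * int => (fun k j => a (pr (k, j)) * cis (j%:~R * t) * cis (dotr k phi)) p.1 p.2) M.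
    by apply: absum_mono (hpt t) => -[k j]; rewrite !normcM !normc_cis !mulr1.
  rewrite (_ : (fun p => _) = fun p : 'rV[int]_n * int => a (pr (p.1, p.2)) * cis (p.2%:~R * t) * cis (dotr p.1 phi)).
    rewrite -(csumE (hsum_fubini (u := fun k j => a (pr (k, j)) * cis (j%:~R * t) * cis (dotr k phi)) hu)).
    congr csum; apply: funext => k; rewrite /at_ [RHS]mulrC -csumZf.
    by congr csum; apply: funext => j; rewrite mulrC.
  apply: funext => -[k j]; rewrite /= -mulrA -cisD; congr (_ * cis _).
  rewrite /pr /= (dotr_row_mx (j%:M : 'M[int]_1) k t%:M phi); congr (_ + _).
  by rewrite /dotr big_ord1 !mxE /= !mulr1n.
rewrite /=.
have -> : (fun t : R => torus_integral (fun phi : 'rV[R]_n => complex.Re (eval a (row_mx t%:M phi : 'rV_(1 + n))))) =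
   fun t => complex.Re (fser (fun j => ((2 * pi) ^+ n : R)%:C%C * a (pr (0, j))) t).
  apply: funext => t.
  rewrite (_ : (fun phi => _) = fun phi => complex.Re (eval (at_ t) phi)); last first.
    by apply: funext => phi; rewrite ev.
  rewrite IH // (fserZ _ _ (absum_reindex (f := fun j => (0, j)) _ hp)); last by move=> ? ? [].
  rewrite /at_ /fser; move: ((2 * pi) ^+ n) => x.
  by case: (csum _) => y z /=; rewrite mul0r subr0.
rewrite (integral_fser (absumZ _ (absum_reindex (f := fun j => (0, j)) _ hp))); last by move=> ? ? [].
have -> : pr (0, 0) = 0.
  rewrite /pr /= (_ : 0%:M = 0) ?row_mx0 //.
  by apply/matrixP => i j; rewrite !mxE mul0rn.
by rewrite exprS; case: (a 0) => y z /=; rewrite mul0r subr0; ring.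
Qed.

Lemma torus_average_eval (n : nat) (a : 'rV[int]_n -> C) M : absum a M ->
  torus_average (fun phi => complex.Re (eval a phi)) = complex.Re (a 0) :> R.
Proof.
move=> ha; rewrite /torus_average (torus_integral_eval ha) mulKf // expf_neq0 //.
by rewrite mulf_neq0 // lt0r_neq0 // pi_gt0.
Qed.

(** Shifting the indices by [k] moves the coefficient to the zero mode, where the average reads off
    its real part; multiplying by i gives the imaginary part. *)
Lemma eval_inj0 (n : nat) (a : 'rV[int]_n -> C) M : absum a M ->
  (forall phi, eval a phi = 0) -> forall k, a k = 0.
Proof.
move=> ha a0 k.
have av0 (d : 'rV[int]_n -> C) N : absum d N -> (forall phi, eval d phi = 0) ->
    complex.Re (d 0) = 0.
  move=> hd d0; rewrite -(torus_average_eval hd) /torus_average.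
  have -> : (fun phi => complex.Re (eval d phi)) = fun phi => complex.Re (eval (fun=> 0) phi : C).
    apply: funext => phi; rewrite d0 /eval (_ : (fun k => _) = fun=> 0) ?csum0 //.
    by apply: funext => l; rewrite mul0r.
  by rewrite (torus_integral_eval (@absum0 R _)) mulr0 mulr0.
pose d l := a (l + k).
have hd : absum d M by apply: absum_reindex ha => ? ? /addIr.
have d0 phi : eval d phi = 0.
  have := a0 phi; rewrite /eval -(csum_reindex (addIr k) _ (absum_eval phi ha)); last first.
    by move=> l _; exists (l - k); rewrite subrK.
  have -> : (fun l => a (l + k) * cis (dotr (l + k) phi)) =
     fun l => cis (dotr k phi) * (d l * cis (dotr l phi)).
    by apply: funext => l; rewrite /d dotrDl cisD; ring.
  rewrite csumZf => /eqP; rewrite mulf_eq0 => /orP[/eqP c0|/eqP //].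
  by have := normc_cis (dotr k phi); rewrite c0 normc0 => /esym/eqP; rewrite oner_eq0.
have r0 := av0 _ _ hd d0.
have i0 : complex.Re ((fun l => 'i%C * d l) 0) = 0.
  by apply: (av0 _ _ (absumZ 'i%C hd)) => phi; rewrite (evalZ _ _ hd) d0 mulr0.
move: r0 i0; rewrite /d add0r; case: (a k) => x y /=.
by rewrite mul0r mul1r sub0r => -> /eqP; rewrite oppr_eq0 => /eqP ->.
Qed.

End TorusAverage.

(** * Termwise partial derivatives of power series *)

Section PowerEstimates.
Variable R : realType.
Implicit Types x t s : R.

(** Cauchy's estimate for a monomial, here and in the next two lemmas: derivatives and Taylor
    remainders at [x] are controlled by the value at |x| + s, uniformly in the exponent, so
    convergence on a larger polydisc dominates the differentiated series. *)
Lemma pow_deriv0 x s m : 0 <= s -> m%:R * `|x| ^+ m.-1 * s <= (`|x| + s) ^+ m.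
Proof.
move=> s0; elim: m => [|m IH]; first by rewrite !mul0r expr0.
have Q0 : 0 <= (`|x| + s) ^+ m by rewrite exprn_ge0 // addr_ge0.
have xQ : `|x| ^+ m <= (`|x| + s) ^+ m by rewrite lerXn2r ?nnegrE ?addr_ge0 // lerDl.
rewrite /= exprS mulrDl -[m.+1%:R]natr1 !mulrDl mul1r; apply: lerD; last first.
  by rewrite [s * _]mulrC ler_wpM2r.
case: m IH {Q0 xQ} => [|m] IH; first by rewrite !mul0r mulr_ge0.
rewrite /= in IH; rewrite exprS.
have -> : m.+1%:R * (`|x| * `|x| ^+ m) * s = `|x| * (m.+1%:R * `|x| ^+ m * s) by ring.
by rewrite ler_wpM2l.
Qed.

Lemma pow_diff1 x t s m : `|t| <= s ->
  `|(x + t) ^+ m - x ^+ m| * s <= `|t| * (`|x| + s) ^+ m.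
Proof.
move=> ts; have s0 : 0 <= s by exact: le_trans ts.
elim: m => [|m IH]; first by rewrite !expr0 subrr normr0 mul0r mulr_ge0.
have Q0 : 0 <= (`|x| + s) ^+ m by rewrite exprn_ge0 // addr_ge0.
have -> : (x + t) ^+ m.+1 - x ^+ m.+1 = x * ((x + t) ^+ m - x ^+ m) + t * (x + t) ^+ m.
  by rewrite !exprS; ring.
apply: le_trans (ler_wpM2r s0 (ler_normD _ _)) _.
have -> : `|t| * (`|x| + s) ^+ m.+1 = `|x| * (`|t| * (`|x| + s) ^+ m) + `|t| * (`|x| + s) ^+ m * s.
  by rewrite exprS; ring.
rewrite mulrDl; apply: lerD; first by rewrite normrM -mulrA ler_wpM2l.
rewrite ler_wpM2r // normrM ler_wpM2l // normrX lerXn2r ?nnegrE ?addr_ge0 //.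
by apply: le_trans (ler_normD _ _) _; rewrite lerD2l.
Qed.

Lemma pow_diff2 x t s m : `|t| <= s ->
  `|(x + t) ^+ m - x ^+ m - t * (m%:R * x ^+ m.-1)| * s ^+ 2 <= t ^+ 2 * (`|x| + s) ^+ m.
Proof.
move=> ts; have s0 : 0 <= s by exact: le_trans ts.
elim: m => [|m IH].
  by rewrite !expr0 subrr mul0r mulr0 subr0 normr0 mul0r mulr1 sqr_ge0.
have Q0 : 0 <= (`|x| + s) ^+ m by rewrite exprn_ge0 // addr_ge0.
have -> : (x + t) ^+ m.+1 - x ^+ m.+1 - t * (m.+1%:R * x ^+ m.+1.-1) =
  x * ((x + t) ^+ m - x ^+ m - t * (m%:R * x ^+ m.-1)) + t * ((x + t) ^+ m - x ^+ m).
  rewrite /= -[m.+1%:R]natr1 !exprS; case: m {IH Q0} => [|m] /=; first by rewrite !expr0; ring.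
  by rewrite !exprS; ring.
apply: le_trans (ler_wpM2r (sqr_ge0 s) (ler_normD _ _)) _.
have -> : t ^+ 2 * (`|x| + s) ^+ m.+1 = `|x| * (t ^+ 2 * (`|x| + s) ^+ m) +
   t ^+ 2 * (`|x| + s) ^+ m * s by rewrite [(_ + s) ^+ m.+1]exprS; ring.
rewrite mulrDl; apply: lerD; first by rewrite normrM -mulrA ler_wpM2l.
have h := pow_diff1 x m ts.
rewrite normrM -[t ^+ 2]real_normK ?num_real //.
have -> : `|t| * `|(x + t) ^+ m - x ^+ m| * s ^+ 2 =
  `|t| * s * (`|(x + t) ^+ m - x ^+ m| * s) by ring.
have -> : `|t| ^+ 2 * (`|x| + s) ^+ m * s = `|t| * s * (`|t| * (`|x| + s) ^+ m) by ring.
by rewrite ler_wpM2l // mulr_ge0.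
Qed.

End PowerEstimates.

Section PartialDerivative.
Variables (R : realType) (N : nat).
Local Notation C := R[i].
Local Notation A := {ffun 'I_N -> nat}.
Implicit Types (h : 'rV[R]_N -> R) (p z : 'rV[R]_N) (j : 'I_N).

Definition pder j h z : R := (fun t : R => h (z + t *: delta_mx 0 j))^`()%classic 0.

Lemma delta_lineE z j t i :
  (z + t *: delta_mx 0 j) 0 i = if i == j then z 0 i + t else z 0 i :> R.
Proof. by rewrite !mxE eqxx /=; case: eqP => _; rewrite ?mulr1 ?mulr0 ?addr0. Qed.

Definition bump_index j (be : A) : A := [ffun i => (be i + (i == j))%N].

(** The radius is halved to leave a margin s = r/4 in direction [j] for the Cauchy estimates. *)
Lemma expansion_pder h p r c j : 0 < r -> expansion_at h p r c ->
  expansion_at (pder j h) p (r / 2) (fun be => (be j).+1%:R * c (bump_index j be)) /\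
  forall z, (forall i, `|z 0 i - p 0 i| < r / 2) ->
    is_derive (0 : R) (1 : R) (fun t : R => h (z + t *: delta_mx 0 j)) (pder j h z).
Proof.
move=> r0 hc.
have bumpI : injective (bump_index j).
  move=> b b' /ffunP e; apply/ffunP => i; have := e i; rewrite !ffunE; exact: addIn.
suff H z : (forall i, `|z 0 i - p 0 i| < r / 2) ->
    [/\ exists M, absum (monom (fun be => (be j).+1%:R * c (bump_index j be)) p z) M &
      exists2 D, csum (monom (fun be => (be j).+1%:R * c (bump_index j be)) p z) = (D%:C)%C &
        is_derive (0 : R) (1 : R) (fun t : R => h (z + t *: delta_mx 0 j)) D].
  have DE z D : is_derive (0 : R) (1 : R) (fun t : R => h (z + t *: delta_mx 0 j)) D -> pder j h z = D.
    by move=> hD; rewrite /pder derive1E; case: hD.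
  split=> z /H[hM [D e hD]]; first by rewrite (DE _ _ hD).
  by rewrite (DE _ _ hD).
move=> hz.
pose x i := z 0 i - p 0 i.
pose s := r / 4; have s0 : 0 < s by rewrite divr_gt0.
pose W (al : A) : R := c al * \prod_(i < N | i != j) x i ^+ al i.
(* Moving the [j]-th coordinate to distance |x_j| + s, still below [r], produces the dominating
   series. *)
pose z' : 'rV[R]_N := \row_i (if i == j then p 0 i + (`|x i| + s) else z 0 i).
have z'E i : z' 0 i = if i == j then p 0 i + (`|x i| + s) else z 0 i by rewrite mxE.
have [|[B hB] _] := hc z'.
  move=> i; rewrite z'E; case: eqP => [_|_]; last by apply: lt_trans (hz i) _; lra.
  rewrite addrAC subrr add0r ger0_norm; last by rewrite addr_ge0 // ltW.
  by have := hz i; rewrite -/(x i) /s; lra.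
have hW : absum (fun al => ((W al * (`|x j| + s) ^+ al j)%:C)%C) B.
  have mE al : monom c p z' al = ((W al * (`|x j| + s) ^+ al j)%:C)%C.
    rewrite /monom (bigD1 j) //= z'E eqxx addrAC subrr add0r.
    rewrite (eq_bigr (fun i => x i ^+ al i)) => [|i /negbTE ij]; last by rewrite z'E ij.
    by congr (_%:C)%C; rewrite /W; ring.
  by apply: absum_mono hB => al; rewrite mE.
pose dt (al : A) : C := ((W al * ((al j)%:R * x j ^+ (al j).-1))%:C)%C.
have hdt : absum dt (s^-1 * B).
  rewrite -[s^-1]ger0_norm ?invr_ge0 ?ltW // -normc_real.
  apply: absum_mono (absumZ _ hW) => al; rewrite /dt -rmorphM !normc_real.
  rewrite !normrM normfV (gtr0_norm s0) [leRHS]mulrCA ler_wpM2l ?normr_ge0 // ler_pdivlMl //.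
  rewrite normr_nat normrX [leRHS]ger0_norm ?exprn_ge0 ?addr_ge0 // ?(ltW s0) //.
  by rewrite mulrC; apply: pow_deriv0; rewrite ltW.
have monE t : (forall al, monom c p (z + t *: delta_mx 0 j) al =
    ((W al * (x j + t) ^+ al j)%:C)%C).
  move=> al; rewrite /monom (bigD1 j) //= delta_lineE eqxx.
  rewrite (eq_bigr (fun i => x i ^+ al i)) => [|i /negbTE ij]; last by rewrite delta_lineE ij.
  by congr (_%:C)%C; rewrite /W /x addrAC; ring.
have bumpE : (monom (fun be => (be j).+1%:R * c (bump_index j be)) p z) =
    fun be => dt (bump_index j be).
  apply: funext => be; rewrite /monom /dt /W ffunE eqxx addn1 /=; congr (_%:C)%C.
  rewrite (bigD1 j) //= -/(x j).
  rewrite (eq_bigr (fun i => x i ^+ bump_index j be i)) => [|i /negbTE ij]; first by ring.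
  by rewrite ffunE ij addn0.
have dtS al : dt al != 0 -> exists be, bump_index j be = al.
  move=> nz; exists [ffun i => (al i - (i == j))%N]; apply/ffunP => i; rewrite !ffunE.
  rewrite subnK //; case: eqP => // ->; rewrite lt0n; apply: contra nz => /eqP aj0.
  by rewrite /dt aj0 mul0r mulr0.
rewrite bumpE; split; first by exists (s^-1 * B); exact: absum_reindex bumpI hdt.
exists (complex.Re (csum dt)).
  rewrite (csum_reindex bumpI dtS hdt) -(csum_Re hdt).
  by congr csum; apply: funext => al.
apply: derive_of_bound => e e0.
have B0 : 0 <= B := absum_ge0 hW.
pose d := Num.min s (e * s ^+ 2 / (B + 1)).
have B1 : 0 < B + 1 by rewrite ltr_wpDl.
have d0 : 0 < d by rewrite lt_min s0 divr_gt0 // mulr_gt0 // exprn_gt0.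
exists d => // t td.
have ts : `|t| < s by apply: lt_le_trans td _; rewrite /d ge_min lexx.
have te : `|t| * (B + 1) <= e * s ^+ 2.
  rewrite -ler_pdivlMr //; apply/ltW/(lt_le_trans td); by rewrite /d ge_min lexx orbT.
have sub u : `|u| < s -> (forall i, `|(z + u *: delta_mx 0 j) 0 i - p 0 i| < r).
  move=> us i; rewrite delta_lineE; case: eqP => _; last by apply: lt_trans (hz i) _; lra.
  rewrite addrAC -/(x i); apply: le_lt_trans (ler_normD _ _) _.
  by have := hz i; rewrite -/(x i) /s in us *; lra.
have [_ e1] := hc _ (sub t ts).
have [|_ e2] := hc _ (sub 0 _); first by rewrite normr0.
have [[M1 hM1] _] := hc _ (sub t ts).
have [|[M2 hM2] _] := hc _ (sub 0 _); first by rewrite normr0.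
rewrite add0r.
set D := complex.Re (csum dt).
suff : normc (((h (z + t *: delta_mx 0 j) - h (z + 0 *: delta_mx 0 j) - t * D)%:C)%C) <= e * `|t|.
  by rewrite normc_real.
have DE : (D%:C)%C = csum dt.
  by rewrite /D -(csum_Re hdt); congr csum; apply: funext => al.
have -> : ((h (z + t *: delta_mx 0 j) - h (z + 0 *: delta_mx 0 j) - t * D)%:C)%C =
    csum (monom c p (z + t *: delta_mx 0 j)) - csum (monom c p (z + 0 *: delta_mx 0 j)) -
    csum (fun al => (t%:C)%C * dt al).
  by rewrite csumZf e1 e2 -DE !rmorphB rmorphM.
rewrite -(csumB hM1 hM2) -(csumB (absumB hM1 hM2) (absumZ _ hdt)).
apply: (@le_trans _ _ (t ^+ 2 / s ^+ 2 * B)); last first.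
  rewrite mulrAC ler_pdivrMr ?exprn_gt0 // -[t ^+ 2]real_normK ?num_real // expr2.
  have -> : `|t| * `|t| * B = `|t| * (`|t| * B) by ring.
  have -> : e * `|t| * s ^+ 2 = `|t| * (e * s ^+ 2) by ring.
  by rewrite ler_wpM2l //; move: te; rewrite mulrDr; have := normr_ge0 t; lra.
apply: csum_le; rewrite -[t ^+ 2 / _]ger0_norm ?divr_ge0 ?sqr_ge0 // -normc_real.
apply: absum_mono (absumZ _ hW) => al.
rewrite !monE /dt -!rmorphM -!rmorphB !normc_real addr0.
have -> : W al * (x j + t) ^+ al j - W al * x j ^+ al j - t * (W al * ((al j)%:R * x j ^+ (al j).-1)) =
  W al * ((x j + t) ^+ al j - x j ^+ al j - t * ((al j)%:R * x j ^+ (al j).-1)) by ring.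
have Y0 : 0 <= (`|x j| + s) ^+ al j by rewrite exprn_ge0 // addr_ge0 // ltW.
have T0 : 0 <= t ^+ 2 / s ^+ 2 by rewrite divr_ge0 ?sqr_ge0.
have := pow_diff2 (x j) (al j) (ltW ts).
move: (_ - _ - _) (_ ^+ al j) Y0 => X Y Y0 hX.
rewrite (normrM (W al) X) [leRHS]normrM (normrM (W al) Y) (ger0_norm T0) (ger0_norm Y0).
by rewrite mulrCA ler_wpM2l // mulrAC ler_pdivlMr ?exprn_gt0.
Qed.

End PartialDerivative.

Lemma is_derive_translate (R : realType) (f : R -> R) (t d : R) :
  is_derive (0 : R) (1 : R) (fun u => f (t + u)) d -> is_derive t (1 : R) f d.
Proof.
rewrite -(subrr t) => hg.
have hs : is_derive t (1 : R) (fun s : R => s - t) 1.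
  have := is_deriveB (is_derive_id t (1 : R)) (is_derive_cst t t (1 : R)).
  by rewrite subr0.
have := @is_derive1_comp R (fun u => f (t + u)) (fun s => s - t) t d 1 hg hs; rewrite mulr1; congr (is_derive _ _ _ _).
by apply: funext => s /=; rewrite addrC subrK.
Qed.

Section FourierDecay.
Variables (R : realType) (n m : nat).
Hypothesis n_gt0 : (0 < n)%N.
Local Notation C := R[i].
Local Notation K := 'rV[int]_n.
Local Notation A := {ffun 'I_(n + m) -> nat}.
Implicit Type h : 'rV[R]_(n + m) -> R.

Definition torus_analytic h : Prop :=
  (forall phi : 'rV[R]_n, exists (r : R) (c : A -> R),
    0 < r /\ expansion_at h (row_mx phi 0) r c) /\
  exists2 e : R, 0 < e & forall w : 'rV[R]_m,
    (forall j, `|w 0 j| < e) -> torus_periodic (fun phi => h (row_mx phi w)).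

Lemma row_mx_line (phi : 'rV[R]_n) (w : 'rV[R]_m) t j :
  row_mx phi w + t *: delta_mx 0 (lshift m j) = row_mx (phi + t *: delta_mx 0 j) w.
Proof.
apply/rowP => i; rewrite delta_lineE -(splitK i); case: (fintype.split i) => k /=.
  rewrite !row_mxEl delta_lineE (inj_eq (@lshift_inj _ _)) //.
by rewrite !row_mxEr eq_rlshift.
Qed.

Lemma torus_analytic_pder h j : torus_analytic h ->
  torus_analytic (pder (lshift m j) h).
Proof.
case=> ha [e e0 per]; split.
  move=> phi; have [r [c [r0 hc]]] := ha phi.
  have [hd _] := expansion_pder (lshift m j) r0 hc.
  by exists (r / 2); eexists; split; [rewrite divr_gt0|exact: hd].
exists e => // w hw phi i; rewrite /pder.
rewrite (_ : (fun t : R => _) = fun t => h (row_mx phi w + t *: delta_mx 0 (lshift m j))) //.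
apply: funext => t; rewrite !row_mx_line addrAC; exact: per.
Qed.

(** At w = 0 only the members of degree 0 in [w] survive in the global expansion. *)
Lemma torus_analytic_coef h : torus_analytic h ->
  exists (a : K -> C) (M : R), [/\ absum a M, sym a &
    forall phi, eval a phi = ((h (row_mx phi 0))%:C)%C].
Proof.
case=> ha hp; have [J [c [rho [M [rho0 fam sc hE]]]]] := local_to_global ha n_gt0 hp.
pose c0 (t : J * A) : K -> C := if wdeg t.2 == 0%N then c t else fun=> 0.
have fam0 : famsum c0 M.
  apply: absum_mono fam => -[t k] /=; rewrite /c0; case: eqP => [e|_].
    by rewrite e expr0 mul1r.
  by rewrite normc0 normc_ge0.
exists (wsum c0), M; split; first exact: absum_wsum.
  apply: (sym_wsum fam0) => t; rewrite /c0; case: ifP => _ //.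
  by move=> k; rewrite conjc0.
move=> phi; rewrite (eval_wsum _ fam0) -(hE phi 0) => [|j]; last by rewrite mxE normr0 ltW.
congr csum; apply: funext => -[t al]; rewrite /c0 /=; case: eqP => [e|/eqP e].
  rewrite big1 ?mulr1 // => j _; move/eqP: e; rewrite /wdeg sum_nat_eq0 => /forallP/(_ j)/eqP ->.
  by rewrite expr0.
move: e; rewrite /wdeg sum_nat_eq0 negb_forall => /existsP[j /= aj].
rewrite (bigD1 j) //= mxE expr0n (negbTE aj) mul0r mulr0.
by rewrite /eval (_ : (fun k => _) = fun=> 0) ?csum0 //; apply: funext => k; rewrite mul0r.
Qed.

(** The coefficients of the derivative are integrated instead: [b'] divides by i k_j. Along the
    direction [j] the difference of [h] and this primitive has a constant slope, which periodicity
    forces to be 0. The difference is then invariant in that direction, so it has no modes with k_j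
    != 0. *)
Lemma coef_pder h j (a b : K -> C) M N : torus_analytic h ->
  absum a M -> sym a -> absum b N -> sym b ->
  (forall phi, eval a phi = ((h (row_mx phi 0))%:C)%C) ->
  (forall phi, eval b phi = ((pder (lshift m j) h (row_mx phi 0))%:C)%C) ->
  forall k : K, k 0 j != 0 -> normc (a k) * `|(k 0 j)%:~R : R| = normc (b k).
Proof.
move=> [han hper] ha sa hb sb ea eb.
have pi0 := pi_gt0 R.
pose b' (k : K) : C := (- 'i%C * (((k 0 j)%:~R^-1 : R)%:C)%C) * b k.
have b'0 (k : K) : k 0 j = 0 -> b' k = 0 by rewrite /b' => ->; rewrite invr0 mulr0 mul0r.
have i1 : normc ('i%C : C) = 1 by rewrite /= expr0n add0r expr1n sqrtr1.
have hb' : absum b' N.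
  apply: absum_mono hb => k; have [k0|k0] := eqVneq (k 0 j) 0; first by rewrite b'0 // normc0 normc_ge0.
  rewrite /b' 2!normcM normcN i1 mul1r normc_real.
  rewrite -[leRHS]mul1r ler_wpM2r ?normc_ge0 // normfV invf_le1 ?normr_gt0 ?intr_eq0 //.
  by rewrite -intr_norm ler1z -gtz0_ge1 normr_gt0.
have sb' : sym b'.
  move=> k; rewrite /b' sb !conjcM conjc_real mxE rmorphN invrN rmorphN mulrNN; congr (_ * _ * _).
  by rewrite /= ; apply/eqP; rewrite eq_complex /= !oppr0 opprK !eqxx.
have hnu : absum (fun k : K => (((k 0 j)%:~R : R)%:C)%C * b' k) N.
  apply: absum_mono hb => k; have [k0|k0] := eqVneq (k 0 j) 0.
    by rewrite b'0 // mulr0 normc0 normc_ge0.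
  rewrite /b' !normcM normcN i1 mul1r !normc_real mulrA normfV mulfV ?mul1r // normr_eq0 intr_eq0 //.
pose e_ : 'rV[R]_n := delta_mx 0 j.
have dotl (k : K) phi t : dotr k (phi + t *: e_) = (k 0 j)%:~R * t + dotr k phi.
  rewrite dotrDr dotrZr addrC; congr (_ + _); rewrite mulrC; congr (_ * _).
  rewrite /dotr (bigD1 j) //= big1 => [|i ij]; rewrite !mxE ?eqxx /=; first by rewrite mulr1 addr0.
  by rewrite (negbTE ij) mulr0.
pose bz (k : K) : C := if k 0 j == 0 then b k else 0.
have hbz : absum bz N.
  by apply: absum_mono hb => k; rewrite /bz; case: ifP => _; rewrite ?normc0 ?normc_ge0.
pose F phi (t : R) := complex.Re (eval a (phi + t *: e_)) - complex.Re (eval b' (phi + t *: e_)).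
have dF phi t : is_derive t (1 : R) (F phi) (complex.Re (eval bz phi)).
  have d0 : is_derive (0 : R) (1 : R) (fun u : R => h (row_mx (phi + t *: e_) 0 + u *: delta_mx 0 (lshift m j)))
      (pder (lshift m j) h (row_mx (phi + t *: e_) 0)).
    have [r [c [r0 hc]]] := han (phi + t *: e_).
    have [_] := expansion_pder (lshift m j) r0 hc; apply => i.
    by rewrite subrr normr0 divr_gt0.
  have d1 : is_derive t (1 : R) (fun s : R => complex.Re (eval a (phi + s *: e_))) (complex.Re (eval b (phi + t *: e_))).
    apply: is_derive_translate.
    have := d0.
    congr (is_derive _ _ _ _); first apply: funext => u.
      by rewrite row_mx_line ea -addrA -scalerDl.
    by rewrite eb.
  have d2 : is_derive t (1 : R) (fun s : R => complex.Re (eval b' (phi + s *: e_)))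
     (complex.Re (csum (fun k : K => ('i%C * (((k 0 j)%:~R : R)%:C)%C * (b' k * cis (dotr k phi))) * cis ((k 0 j)%:~R * t)))).
    have h1 : absum (fun k => b' k * cis (dotr k phi)) N by exact: absum_eval.
    have h2 : absum (fun k : K => (((k 0 j)%:~R : R)%:C)%C * (b' k * cis (dotr k phi))) N.
      by apply: absum_mono hnu => k; rewrite mulrA [in leLHS]normcM normc_cis mulr1.
    have := csum_cis_derive t h1 h2.
    congr (is_derive _ _ _ _); apply: funext => s; congr (complex.Re (csum _)).
    by apply: funext => k; rewrite dotl cisD mulrA -[in RHS]mulrA [cis _ * cis _]mulrC mulrA.
  apply: (is_derive_eq (is_deriveB d1 d2)).
  have h3 : absum (fun k : K => ('i%C * (((k 0 j)%:~R : R)%:C)%C * (b' k * cis (dotr k phi))) * cis ((k 0 j)%:~R * t)) N.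
    apply: absum_mono hnu => k; rewrite normcM normc_cis mulr1 !normcM normc_cis mulr1 i1 mul1r; exact: lexx.
  rewrite -raddfB /= /eval -(csumB (absum_eval (phi + t *: e_) hb) h3).
  congr (complex.Re (csum _)); apply: funext => k.
  rewrite dotl cisD /bz; case: eqP => [k0|/eqP k0].
    by rewrite b'0 // k0 mulr0z !mul0r cis0 mulr0 mul0r subr0 mul1r.
  have -> : 'i%C * (((k 0 j)%:~R : R)%:C)%C * (b' k * cis (dotr k phi)) * cis ((k 0 j)%:~R * t) =
     (- 'i%C ^+ 2) * ((((k 0 j)%:~R : R) * (k 0 j)%:~R^-1)%:C)%C * (b k * cis (dotr k phi) * cis ((k 0 j)%:~R * t)).
    by rewrite /b' rmorphM; ring.
  by rewrite sqr_i opprK mul1r divff ?intr_eq0 // mul1r mul0r; ring.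
have per (d : K -> C) phi : eval d (phi + (2 * pi) *: e_) = eval d phi.
  congr csum; apply: funext => k; rewrite dotl addrC [_ * (2 * pi)]mulrC.
  by rewrite cis_period.
have kap phi : complex.Re (eval bz phi) = 0.
  have cF : {within `[(0 : R), 2 * pi], continuous (F phi)}.
    apply: continuous_subspaceT => x; apply: differentiable_continuous.
    by apply/derivable1_diffP; case: (dF phi x).
  have p20 : 0 < 2 * pi :> R by rewrite mulr_gt0.
  have [c _] := MVT p20 (fun x _ => dF phi x) cF.
  rewrite /F !per !scale0r !addr0 subrr subr0 => /esym/eqP; rewrite mulf_eq0 => /orP[/eqP //|].
  by rewrite gt_eqF.
have constF phi t : F phi t = F phi 0.
  apply/eqP; rewrite -subr_eq0 -normr_le0.
  have := mvt_bound (a := 0) (b := t) (M := 0) (dF phi); rewrite mul0r; apply => x _.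
  by rewrite kap normr0.
pose d k := a k - b' k.
have hd : absum d (M + N) := absumB ha hb'.
have sd : sym d by exact: symB.
have evd phi t : eval d (phi + t *: e_) = eval d phi.
  rewrite -(eval_sym_real _ hd sd) -[RHS](eval_sym_real _ hd sd); congr (_%:C)%C.
  have := constF phi t; rewrite /F scale0r addr0 !(evalB _ ha hb').
  by case: (eval a _) (eval b' _) (eval a _) (eval b' _) => [? ?] [? ?] [? ?] [? ?].
move=> k k0.
(* Translation by [t0] multiplies the [k]-th coefficient by cis pi = -1; invariance then makes it
   vanish. *)
pose t0 := pi / (k 0 j)%:~R : R.
have hd2 : absum (fun l => cis (dotr l (t0 *: e_)) * d l) (M + N).
  by apply: absum_mono hd => l; rewrite normcM normc_cis mul1r.
have z0 := eval_inj0 (absumB hd2 hd) _ k.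
have : cis (dotr k (t0 *: e_)) * d k - d k = 0.
  by apply: z0 => phi; rewrite (evalB _ hd2 hd) eval_shift evd subrr.
rewrite -[t0 *: e_]add0r dotl; have -> : dotr k (0 : 'rV[R]_n) = 0.
  by rewrite /dotr big1 // => i _; rewrite mxE mulr0.
rewrite addr0 /t0 mulrCA mulfV ?intr_eq0 // mulr1 /cis cospi sinpi.
have -> : (-1 +i* 0)%C * d k - d k = - (2 : C) * d k.
  have -> : ((-1 : R) +i* 0)%C = -1 :> C by apply/eqP; rewrite eq_complex /= oppr0 !eqxx.
  by ring.
move=> /eqP; rewrite mulf_eq0 oppr_eq0 pnatr_eq0 /= subr_eq0 => /eqP ->.
rewrite /b' 2!normcM normcN i1 mul1r normc_real normfV mulrAC mulVf ?mul1r //.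
by rewrite normr_eq0 intr_eq0.
Qed.

(** Partial derivatives stay in the class [torus_analytic], so [coef_pder] can be iterated to gain
    any power. *)
Lemma fourier_decay h (a : K -> C) M (s : nat) j : torus_analytic h ->
  absum a M -> sym a -> (forall phi, eval a phi = ((h (row_mx phi 0))%:C)%C) ->
  exists N, absum (fun k : K => ((`|(k 0 j)%:~R : R| ^+ s)%:C)%C * a k) N.
Proof.
elim: s h a M => [|s IH] h a M hh ha sa ea.
  by exists M; apply: absum_mono ha => k; rewrite expr0 mul1r.
have hp := torus_analytic_pder j hh.
have [b [N [hb sb eb]]] := torus_analytic_coef hp.
have [N' hN'] := IH _ _ _ hp hb sb eb.
exists N'; apply: absum_mono hN' => k; have [k0|k0] := eqVneq (k 0 j) 0.
  by rewrite k0 mulr0z normr0 exprS !mul0r normc0 normc_ge0.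
have := coef_pder hh ha sa hb sb ea eb k0.
rewrite !normcM !normc_real => <-.
rewrite [`|_ ^+ s.+1|]ger0_norm ?exprn_ge0 // [`|_ ^+ s|]ger0_norm ?exprn_ge0 // exprSr.
by rewrite le_eqVlt; apply/orP; left; apply/eqP; ring.
Qed.

End FourierDecay.

(** * Excluded parameters *)

Section Weights.
Variable R : realType.
Local Notation C := R[i].

Definition iwt (j : int) : R := ((1 + `|j%:~R|) ^+ 2)^-1.

Lemma iwt_gt0 j : 0 < iwt j.
Proof. by rewrite invr_gt0 exprn_gt0 // ltr_pwDl. Qed.

Lemma absum_iwt : absum (fun j : int => ((iwt j)%:C)%C) 5.
Proof.
have h := absumD (absum_fconst (1 : C)) (absumZ ((2 : R)%:C)%C (@absum_bern R)).
have -> : (5 : R) = normc (1 : C) + normc (((2 : R)%:C)%C) * 2.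
  by rewrite normc1 normc_real ger0_norm //; lra.
apply: absum_mono h => j.
rewrite /fconst /bern -[(_%:C)%C * (_%:C)%C]rmorphM; have [->|j0] := eqVneq j 0.
  by rewrite /iwt mulr0z normr0 addr0 expr1n invr1 normc_real normr1 expr0n mulr0 invr0 mulr0 addr0 normc1.
rewrite add0r; rewrite !normc_real /iwt ger0_norm ?invr_ge0 ?sqr_ge0 // [2 * _^-1 in leRHS](_ : _ = (j%:~R ^+ 2)^-1 :> R); last first.
  by rewrite invfM mulrA divff ?pnatr_eq0 // mul1r.
have j1 : 0 < `|j%:~R : R| by rewrite normr_gt0 intr_eq0.
rewrite [leRHS]ger0_norm ?invr_ge0 ?sqr_ge0 // lef_pV2 ?posrE ?[0 < (1 + _) ^+ 2]exprn_gt0 ?ltr_pwDl //; last first.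
  by rewrite -[ltRHS]real_normK ?num_real // exprn_gt0.
by rewrite -[leLHS]real_normK ?num_real // lerXn2r ?nnegrE ?addr_ge0 // lerDr.
Qed.

(** As a product of one-dimensional weights it is summable over Z^n by induction on the dimension;
    [mwt_lower] later compares it with a power of |k|. *)
Definition mwt n (k : 'rV[int]_n) : R := \prod_(i < n) iwt (k 0 i).

Lemma mwt_gt0 n (k : 'rV[int]_n) : 0 < mwt k.
Proof. by apply: prodr_gt0 => i _; exact: iwt_gt0. Qed.

Lemma absum_mwt n : absum (fun k : 'rV[int]_n => ((mwt k)%:C)%C) (5 ^+ n).
Proof.
elim: n => [|n IH].
  move=> s us; rewrite expr0.
  have mE (k : 'rV[int]_0) : normc (((mwt k)%:C)%C) = 1 by rewrite normc_real /mwt big_ord0 normr1.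
  rewrite (eq_bigr (fun=> 1)) => [|k _]; last exact: mE.
  rewrite big_const_seq iter_addr_0 count_predT -[leRHS]/(1%:R) ler_nat.
  case: s us => [|x [|y s]] //= /andP[+ _].
  by rewrite inE negb_or => /andP[/eqP h _]; case: h; apply/rowP => -[].
have hp : absum (fun p : int * 'rV[int]_n => ((iwt p.1)%:C * (mwt p.2)%:C)%C) (5 ^+ n.+1).
  apply: (@absum_prod _ _ _ (fun j k => ((iwt j)%:C * (mwt k)%:C)%C) (fun j => iwt j * 5 ^+ n)).
    move=> j; have -> : iwt j * 5 ^+ n = normc (((iwt j)%:C)%C) * 5 ^+ n.
      by rewrite normc_real ger0_norm // ltW // iwt_gt0.
    exact: absumZ.
  move=> s us; rewrite -mulr_suml exprS ler_wpM2r ?exprn_ge0 //.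
  apply: le_trans (absum_iwt us); apply: ler_sum => j _.
  by rewrite normc_real ler_norm.
pose f (k : 'rV[int]_n.+1) := (k 0 0, \row_(i < n) k 0 (lift 0 i)).
have fi : injective f.
  move=> k k' [e0 /rowP e]; apply/rowP => i; case: (unliftP 0 i) => [j ->|-> //].
  by have := e j; rewrite !mxE.
have -> : (fun k : 'rV[int]_n.+1 => ((mwt k)%:C)%C) =
    fun k => ((iwt (f k).1)%:C * (mwt (f k).2)%:C)%C.
  apply: funext => k; rewrite -rmorphM /mwt big_ord_recl; congr ((_ * _)%:C)%C.
  by apply: eq_bigr => i _; rewrite mxE.
exact: (absum_reindex fi hp).
Qed.

End Weights.

Section Transversality.
Variable R : realType.

Lemma poly_roots_seq (p : {poly R}) : p != 0 -> exists s : seq R, forall x, root p x -> x \in s.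
Proof.
have [m] := ubnP (size p); elim: m p => // m IH p sp p0.
have [[x rx]|nx] := pselect (exists x, root p x); last first.
  by exists [::] => x rx; case: nx; exists x.
have [q pq] := factor_theorem p x rx.
have q0 : q != 0 by apply: contra p0 => /eqP q0; rewrite pq q0 mul0r.
have [|s hs] := IH q _ q0.
  by move: sp; rewrite pq size_Mmonic ?monicXsubC // size_XsubC addn2 /=.
exists (x :: s) => y; rewrite pq rootM root_XsubC inE => /orP[/hs ->|->] //.
by rewrite orbT.
Qed.

Variables p0 q r : R.
(** In the variable c = a^2 - 1 = cos (w0 tau) one has w0 tau = acos c and a w0 = sqrt (1 - c^2),
    and w0 times [transv] becomes a function of [c] alone with polynomial coefficients. *)
Definition hopfP (c : R) : R := p0 * c ^+ 2 + q * c + (r - p0).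
Definition hopfQ (c : R) : R := (2 * p0 - r) * c + (q + 2 * r - 2 * p0).
Definition hopfE (c : R) : R := acos c * hopfP c - Num.sqrt (1 - c ^+ 2) * hopfQ c.

Lemma transvE (a w0 tau : R) : critical a w0 tau ->
  w0 * transv a w0 tau (a * p0) q r = hopfE (a ^+ 2 - 1).
Proof.
case=> ha hw w2 /andP[t0 t1] [ec es].
rewrite /hopfE -ec cosK; last by rewrite in_itv /= !ltW.
have -> : 1 - cos (w0 * tau) ^+ 2 = sin (w0 * tau) ^+ 2 by rewrite -sin2cos2.
rewrite sqrtr_sqr ger0_norm; last by apply: sin_ge0_pi; rewrite !ltW.
rewrite es ec /transv /hopfP /hopfQ.
have -> : (w0 ^+ 2 * (a * p0 - r * a) * (2 - a * tau)) = (w0 ^+ 2 * (p0 - r) * (2 * a - a ^+ 2 * tau)) by ring.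
have -> : a ^+ 2 = 2 - w0 ^+ 2 by rewrite w2; ring.
by ring.
Qed.

(** Minus sqrt (1 - c^2) hopfP^2 times the derivative of acos c - sqrt (1 - c^2) hopfQ / hopfP. *)
Definition hopfZ (c : R) : R := hopfP c ^+ 2 - c * hopfQ c * hopfP c +
  (1 - c ^+ 2) * ((2 * p0 - r) * hopfP c - hopfQ c * (2 * p0 * c + q)).

(* Between consecutive roots of the polynomials [hopfP] and [hopfZ] the function
   [acos - sqrt (1 - c^2) hopfQ / hopfP] has a nonvanishing derivative, so that
   [hopfE] has at most one zero there. *)
Lemma countable_hopfE : p0 != 0 \/ q + r != 0 ->
  countable [set c | -1 < c < 1 /\ hopfE c = 0].
Proof.
move=> nz.
pose Pp : {poly R} := Poly [:: r - p0; q; p0].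
have PE c : Pp.[c] = hopfP c by rewrite /Pp horner_Poly /= /hopfP; ring.
have P0 : Pp != 0.
  apply/eqP => /polyP P0; have := P0 0%N; have := P0 1%N; have := P0 2%N.
  rewrite !coef_Poly /= !coef0 => e2 e1 e0; case: nz; first by rewrite e2 eqxx.
  by move: e0; rewrite e2 subr0 e1 => ->; rewrite addr0 eqxx.
pose A := 2 * p0 - r; pose B := q + 2 * r - 2 * p0; pose D := r - p0.
pose Zp : {poly R} := Poly [:: D ^+ 2 + A * D - B * q; 2 * q * D - 2 * p0 * B - B * D;
  q ^+ 2 + 2 * p0 * D - 2 * A * D - A * p0; 2 * p0 * q + p0 * B - A * q; p0 ^+ 2].
have ZE c : Zp.[c] = hopfZ c.
  by rewrite /Zp horner_Poly /= /hopfZ /hopfP /hopfQ /A /B /D; ring.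
(* The coefficient of degree 4 is p0^2. If it vanishes, the one of degree 2 reduces to q^2 + 2 r^2,
   so that q + r would vanish too. *)
have Z0 : Zp != 0.
  apply/eqP => /polyP Z0; have := Z0 4%N; have := Z0 2%N; rewrite !coef_Poly /= !coef0 => e2 /eqP.
  rewrite sqrf_eq0 => /eqP p00; move: e2; rewrite /A /D p00 => e2.
  case: nz; first by rewrite p00 eqxx.
  have : q ^+ 2 + 2 * r ^+ 2 = 0 by rewrite -e2; ring.
  have := sqr_ge0 q; have := sqr_ge0 r => r2 q2 e.
  have /eqP : q ^+ 2 = 0 by lra.
  have /eqP : r ^+ 2 = 0 by lra.
  by rewrite !sqrf_eq0 => /eqP -> /eqP ->; rewrite addr0 eqxx.
have [rs hrs] := poly_roots_seq (mulf_neq0 P0 Z0).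
pose h (c : R) := acos c - Num.sqrt (1 - c ^+ 2) * hopfQ c * (hopfP c)^-1.
pose dh (c : R) := - (Num.sqrt (1 - c ^+ 2) * hopfP c ^+ 2)^-1 * hopfZ c.
have dhE c : -1 < c < 1 -> hopfP c != 0 -> is_derive c (1 : R) h (dh c).
  move=> hc Pc; have c2 : 0 < 1 - c ^+ 2 by case/andP: hc => u1 u2; rewrite expr2; nra.
  have ds : is_derive c (1 : R) (fun c : R => Num.sqrt (1 - c ^+ 2)) ((2 * Num.sqrt (1 - c ^+ 2))^-1 * (- (2 * c))).
    apply: (@is_derive1_comp _ Num.sqrt (fun c : R => 1 - c ^+ 2) c).
      exact: is_derive1_sqrt.
    have := is_deriveB (is_derive_cst (1 : R) c (1 : R)) (is_deriveX 2 (is_derive_id c (1 : R))).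
    move/is_derive_eq; apply; rewrite /= sub0r expr1 -mulr_natl /GRing.scale /=; ring.
  have dP : is_derive c (1 : R) hopfP (2 * p0 * c + q).
    have := is_deriveD (is_deriveD (is_deriveZ p0 (is_deriveX 2 (is_derive_id c (1 : R)))) (is_deriveZ q (is_derive_id c (1 : R)))) (is_derive_cst (r - p0) c (1 : R)).
    by move/is_derive_eq; apply; rewrite /GRing.scale /= expr1; ring.
  have dQ : is_derive c (1 : R) hopfQ (2 * p0 - r).
    have := is_deriveD (is_deriveZ (2 * p0 - r) (is_derive_id c (1 : R))) (is_derive_cst (q + 2 * r - 2 * p0) c (1 : R)).
    by move/is_derive_eq; apply; rewrite /GRing.scale /=; ring.
  have dV := is_deriveV Pc dP.
  have := is_deriveB (is_derive1_acos hc) (is_deriveM (is_deriveM ds dQ) dV).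
  move/is_derive_eq; apply; rewrite /dh /hopfZ /GRing.scale /=.
  have s0 : Num.sqrt (1 - c ^+ 2) != 0 by rewrite gt_eqF // sqrtr_gt0.
  have -> : (1 - c ^+ 2) * ((2 * p0 - r) * hopfP c - hopfQ c * (2 * p0 * c + q)) = Num.sqrt (1 - c ^+ 2) ^+ 2 * ((2 * p0 - r) * hopfP c - hopfQ c * (2 * p0 * c + q)) by rewrite sqr_sqrtr // ltW.
  rewrite [X in X * (- _ * _)](_ : _ = Num.sqrt (1 - c ^+ 2) * hopfQ c) //.
  move: (Num.sqrt _) s0 (hopfP c) Pc (hopfQ c) => s s0 P P0' Q; field; by rewrite s0 P0'.
(* Counting both the roots below [c] and those at most [c] separates every root from the intervals
   beside it, so [idx] grows strictly whenever a root lies between two zeros or at one of them. *)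
pose idx c : nat := \sum_(x <- rs) ((x < c)%R + (x <= c)%R)%N.
have idx_lt c1 c2 x : c1 < c2 -> x \in rs -> c1 <= x <= c2 -> (idx c1 < idx c2)%N.
  move=> c12 xrs /andP[x1 x2]; rewrite /idx !(big_rem x xrs) /= -addSn leq_add //.
    rewrite [x < c1]ltNge x1 x2 add0n; have [->|xc2] := eqVneq x c2; first by rewrite [c2 <= c1]leNgt c12 ltxx.
    by rewrite [x < c2]lt_neqAle xc2 x2 addn1 ltnS; case: (x <= c1).
  apply: leq_sum => y _; apply: leq_add.
    by case: (ltP y c1) => // y1; rewrite (lt_trans y1 c12).
  by case: (leP y c1) => // y1; rewrite (le_trans y1 (ltW c12)).
apply/countable_injP; exists idx.
suff main c1 c2 : c1 < c2 -> -1 < c1 -> c2 < 1 -> hopfE c1 = 0 -> hopfE c2 = 0 ->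
    (idx c1 < idx c2)%N.
  move=> c1 c2; rewrite !inE => -[/andP[h1 h1'] e1] [/andP[h2 h2'] e2] e.
  apply/eqP; apply: contraT; rewrite neq_lt => /orP[l|l].
    by have := main _ _ l h1 h2' e1 e2; rewrite e ltnn.
  by have := main _ _ l h2 h1' e2 e1; rewrite e ltnn.
move=> c12 h1 h2 e1 e2.
have [[x xrs /idx_lt]|nx] := pselect (exists2 x, x \in rs & c1 <= x <= c2); first exact.
have Wx x : c1 <= x <= c2 -> hopfP x != 0 /\ hopfZ x != 0.
  move=> hx; apply/andP; rewrite -negb_or -mulf_eq0 -PE -ZE -hornerM.
  apply/negP => /hrs xrs; apply: nx; by exists x.
have inx x : c1 <= x <= c2 -> -1 < x < 1.
  by move=> /andP[x1 x2]; rewrite (lt_le_trans h1) // (le_lt_trans x2).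
have h0 c : c1 <= c <= c2 -> hopfE c = 0 -> h c = 0.
  move=> hc /eqP; rewrite subr_eq0 => /eqP e; have [Pc _] := Wx _ hc.
  by rewrite /h -e mulfK // subrr.
have /Rolle : c1 < c2 by [].
move=> /(_ h); case.
- move=> x; rewrite in_itv /= => /andP[x1 x2]; have hx : c1 <= x <= c2 by rewrite !ltW.
  by have [Px _] := Wx _ hx; case: (dhE _ (inx _ hx) Px).
- apply: derivable_within_continuous => x; rewrite in_itv /= => hx.
  by have [Px _] := Wx _ hx; case: (dhE _ (inx _ hx) Px).
- by rewrite !h0 // lexx ltW.
move=> x; rewrite in_itv /= => /andP[x1 x2]; have hx : c1 <= x <= c2 by rewrite !ltW.
have [Px Zx] := Wx _ hx; have dx := dhE _ (inx _ hx) Px.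
case=> dd /eqP; case: dx => _ ->; rewrite /dh mulf_eq0 oppr_eq0 invr_eq0 mulf_eq0 (negbTE Zx) orbF.
rewrite sqrf_eq0 (negbTE Px) orbF sqrtr_eq0 leNgt.
have := inx _ hx; case/andP => u1 u2.
by have -> : 0 < 1 - x ^+ 2 by rewrite expr2; nra.
Qed.

End Transversality.

(** * Measure of the excluded parameters *)

Section GoodParameters.
Variable R : realType.
Local Notation mu := (@lebesgue_measure R).

Lemma omega0_Pi0 (a : R) : Pi0 R a ->
  [/\ 1 / 4 <= a <= 5 / 4, 1 / 2 <= omega0 a <= 3 / 2 & omega0 a ^+ 2 = 2 - a ^+ 2].
Proof.
rewrite /Pi0 /= in_itv /= => ha; split=> //.
  have a2 : 1 / 16 <= a ^+ 2 <= 25 / 16.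
    by case/andP: ha => a1 a2; rewrite expr2; apply/andP; split; nra.
  have -> : (1 / 2 : R) = Num.sqrt ((1 / 2) ^+ 2) by rewrite sqrtr_sqr ger0_norm //; lra.
  have -> : (3 / 2 : R) = Num.sqrt ((3 / 2) ^+ 2) by rewrite sqrtr_sqr ger0_norm //; lra.
  by case/andP: a2 => u1 u2; rewrite /omega0 !ler_wsqrtr // expr2; lra.
rewrite sqr_sqrtr //; case/andP: ha => a1 a2; rewrite expr2; nra.
Qed.

(** The two branches of [tau0] follow the sign of cos (w0 tau) = a^2 - 1: for a > 1 the angle is
    acute, for a <= 1 it is the supplement of the arcsine. *)
Lemma critical_tau0 (a : R) : Pi0 R a -> critical a (omega0 a) (tau0 a).
Proof.
move=> /omega0_Pi0[ha /andP[w1 w2] wE].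
have [a1 a2] := andP ha.
have w0 : 0 < omega0 a by lra.
have -> : tau0 a = (omega0 a)^-1 * (omega0 a * tau0 a) by rewrite mulKf // gt_eqF.
have thE : omega0 a * tau0 a = if 1 < a then asin (a * omega0 a) else pi - asin (a * omega0 a).
  by rewrite /tau0 mulVKf // gt_eqF.
have x2 : (a * omega0 a) ^+ 2 = 1 - (a ^+ 2 - 1) ^+ 2 by rewrite exprMn wE; ring.
have x0 : 0 < a * omega0 a by rewrite mulr_gt0 //; lra.
have x1 : a * omega0 a <= 1.
  rewrite leNgt; apply/negP => h; have : 1 < (a * omega0 a) ^+ 2 by rewrite expr2; nra.
  by rewrite x2; have := sqr_ge0 (a ^+ 2 - 1); lra.
have xI : -1 <= a * omega0 a <= 1 by rewrite x1 andbT; lra.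
have pi0 := pi_gt0 R.
have [/andP[s1 s2] s3] := asin_def xI.
have s0 : 0 < asin (a * omega0 a).
  rewrite ltNge; apply/negP => h.
  have : 0 <= sin (- asin (a * omega0 a)) by apply: sin_ge0_pi; lra.
  by rewrite sinN s3; lra.
have c3 := cos_asin xI; rewrite x2 opprB addrC subrK sqrtr_sqr in c3.
rewrite /critical mulVKf ?gt_eqF // thE; split=> //.
  by case: ifP => _; apply/andP; split; lra.
case: ltP => h.
  rewrite s3 c3 ger0_norm //; have : 1 <= a ^+ 2 by rewrite expr2; nra.
  by lra.
rewrite sinB cosB sinpi cospi s3 c3 ler0_norm; last first.
  have : a ^+ 2 <= 1 by rewrite expr2; nra.
  by lra.
by rewrite !mul0r; split; ring.
Qed.

Lemma continuous_omega0 : {within Pi0 R, continuous (@omega0 R)}.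
Proof.
apply: continuous_in_subspaceT => a; rewrite inE => /omega0_Pi0[_ _ wE].
apply: continuous_comp; last exact: sqrt_continuous.
by apply: cvgB; [exact: cvg_cst|exact: exprn_continuous].
Qed.

Lemma measurable_Pi0 : measurable (Pi0 R).
Proof. by rewrite /Pi0; exact: measurable_itv. Qed.

Definition strip (nu eta : R) : set R := Pi0 R `&` [set a | `|nu - omega0 a| < eta].

Lemma measurable_strip nu eta : measurable (strip nu eta).
Proof.
have mf : measurable_fun (Pi0 R) (fun a => nu - omega0 a).
  apply: measurable_realfun.measurable_funB => //.
  exact: measurable_realfun.subspace_continuous_measurable_fun measurable_Pi0 continuous_omega0.
have -> : strip nu eta = Pi0 R `&` (fun a => nu - omega0 a) @^-1` [set` `]-eta, eta[].
  by apply/seteqP; split=> a [h1 h2]; split=> //; move: h2; rewrite /= in_itv /= ltr_norml.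
by apply: mf => //; exact: measurable_Pi0.
Qed.

(** From a^2 + omega0(a)^2 = 2, differences of [a] times the sum of the two parameters equal
    differences of omega0 times the sum of the two frequencies. The first sum is at least 1/2 and
    the second at most 3, so the strip lies within 12 eta of each of its points. *)
Lemma strip_measure nu eta : 0 < eta -> (mu (strip nu eta) <= (24 * eta)%:E)%E.
Proof.
move=> e0; have [[a [ha ra]]|ne] := pselect (exists a, strip nu eta a); last first.
  have -> : strip nu eta = set0.
    by apply/seteqP; split=> // a sa; case: ne; exists a.
  by rewrite measure0 lee_fin mulr_ge0 // ltW.
have sub : strip nu eta `<=` [set` `[a - 12 * eta, a + 12 * eta]].
  move=> b [hb rb]; rewrite /= in_itv /= -ler_distlC.
  have [/andP[a1 a2] /andP[u1 u2] uE] := omega0_Pi0 ha.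
  have [/andP[b1 b2] /andP[v1 v2] vE] := omega0_Pi0 hb.
  have h1 : `|omega0 a - omega0 b| <= 2 * eta.
    rewrite /= in ra rb; move: ra rb; rewrite !ltr_norml => /andP[? ?] /andP[? ?].
    by rewrite ler_norml; apply/andP; split; lra.
  have h2 : `|a - b| * (a + b) = `|omega0 a - omega0 b| * (omega0 a + omega0 b).
    rewrite -[a + b]ger0_norm ?addr_ge0 //; last 2 first.
    - by lra.
    - by lra.
    rewrite -[X in _ = _ * X]ger0_norm ?addr_ge0 //; last 2 first.
    - by lra.
    - by lra.
    by rewrite -!normrM -!subr_sqr uE vE [in RHS]distrC; congr `|_|; ring.
  have h3 : `|omega0 a - omega0 b| * (omega0 a + omega0 b) <= 2 * eta * 3.
    by apply: ler_pM => //; lra.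
  have := normr_ge0 (a - b); rewrite -h2 in h3; nra.
apply: le_trans (le_measure mu _ _ sub) _; rewrite ?inE.
- exact: measurable_strip.
- exact: measurable_itv.
rewrite [X in (X <= _)%E](lebesgue_measure_itv `[a - 12 * eta, a + 12 * eta]) /= lte_fin; case: ifP => _; last by rewrite lee_fin mulr_ge0 // ltW.
by rewrite lee_fin; lra.
Qed.

Lemma continuous_hopfE p0 q r : {within Pi0 R, continuous (fun a : R => hopfE p0 q r (a ^+ 2 - 1))}.
Proof.
apply: continuous_in_subspaceT => a; rewrite inE /Pi0 /= in_itv /= => /andP[a1 a2].
have hc : -1 < a ^+ 2 - 1 < 1 by rewrite expr2; apply/andP; split; nra.
apply: (@continuous_comp _ _ _ (fun a : R => a ^+ 2 - 1) (hopfE p0 q r)).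
  by apply: cvgB; [exact: exprn_continuous|exact: cvg_cst].
have cX (d : nat) (c : R) : {for c, continuous (fun c : R => c ^+ d)} by exact: exprn_continuous.
have cP : {for a ^+ 2 - 1, continuous (hopfP p0 q r)}.
  rewrite /hopfP; apply: cvgD; last exact: cvg_cst.
  by apply: cvgD; apply: cvgM; try exact: cvg_cst; [exact: exprn_continuous|exact: cvg_id].
have cQ : {for a ^+ 2 - 1, continuous (hopfQ p0 q r)}.
  by rewrite /hopfQ; apply: cvgD; try exact: cvg_cst; apply: cvgM; [exact: cvg_cst|exact: cvg_id].
apply: cvgB; apply: cvgM => //; first exact: continuous_acos.
apply: (@continuous_comp _ _ _ (fun c : R => 1 - c ^+ 2) Num.sqrt); last exact: sqrt_continuous.
by apply: cvgB; [exact: cvg_cst|exact: exprn_continuous].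
Qed.

Definition degen p0 q r e : set R :=
  Pi0 R `&` [set a | `|hopfE p0 q r (a ^+ 2 - 1)| < e].

Lemma measurable_degen p0 q r e : measurable (degen p0 q r e).
Proof.
have mf := measurable_realfun.subspace_continuous_measurable_fun measurable_Pi0 (@continuous_hopfE p0 q r).
have -> : degen p0 q r e = Pi0 R `&` (fun a => hopfE p0 q r (a ^+ 2 - 1)) @^-1` [set` `]-e, e[].
  by apply/seteqP; split=> a [h1 h2]; split=> //; move: h2; rewrite /= in_itv /= ltr_norml.
by apply: mf => //; exact: measurable_Pi0.
Qed.

(** Continuity of the measure along decreasing neighbourhoods of a countable set; a^2 - 1 is
    injective on Pi0, so countability in [c] passes to [a]. The argument gives no relation between
    [e] and [d]. *)
Lemma degen_measure p0 q r d : p0 != 0 \/ q + r != 0 -> 0 < d ->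
  exists2 e, 0 < e & (mu (degen p0 q r e) < d%:E)%E.
Proof.
move=> nz d0.
pose F (i : nat) := degen p0 q r (i.+1%:R^-1).
have FE : \bigcap_i F i = Pi0 R `&` [set a | hopfE p0 q r (a ^+ 2 - 1) = 0].
  apply/seteqP; split=> a h.
    have [ha _] := h 0%N I; split=> //=; apply/eqP; rewrite -normr_eq0 eq_le normr_ge0 andbT.
    apply/ler_addgt0Pr => e e0; rewrite add0r.
    have := h (Num.truncn e^-1) I; case=> _ /= /ltW/le_trans; apply.
    rewrite -[leRHS]invrK lef_pV2 ?posrE ?invr_gt0 //.
    by apply/ltW; exact: truncnS_gt.
  by case: h => ha /= h i _; split=> //=; rewrite h normr0 invr_gt0.
have cF : countable (\bigcap_i F i).
  have /countable_injP[f fi] := countable_hopfE nz.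
  apply/countable_injP; exists (fun a => f (a ^+ 2 - 1)) => a b; rewrite FE !inE => -[ha ea] [hb eb] e.
  have inI (x : R) : Pi0 R x -> 0 < x /\ -1 < x ^+ 2 - 1 < 1.
    by rewrite /Pi0 /= in_itv /= => /andP[x1 x2]; split; [lra|rewrite expr2; apply/andP; split; nra].
  have [a0 a1] := inI _ ha; have [b0 b1] := inI _ hb.
  have /addIr/eqP : a ^+ 2 - 1 = b ^+ 2 - 1 by apply: fi => //; rewrite inE.
  by rewrite eqrXn2 ?ltW // => /eqP.
have : (mu \o F) x @[x --> \oo] --> mu (\bigcap_i F i).
  apply: nonincreasing_cvg_mu.
  - apply: le_lt_trans (le_measure mu _ _ (@subIsetl _ _ _)) _; rewrite ?inE.
    + exact: measurable_degen.
    + exact: measurable_Pi0.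
    by rewrite [X in (X < _)%E](lebesgue_measure_itv `[(1 / 4), (5 / 4)]) /=; case: ifP => _; rewrite ltry.
  - by move=> i; exact: measurable_degen.
  - by apply: bigcapT_measurable => i; exact: measurable_degen.
  - move=> i j ij; apply/subsetPset => a [ha /= h2]; split=> //=; apply: lt_le_trans h2 _.
    by rewrite lef_pV2 ?posrE // ler_nat.
rewrite (countable_lebesgue_measure0 cF) => /fine_cvgP[fF /cvgr_lt/(_ _ d0) ltF].
have [i [fi hi]] : exists i, mu (F i) \is a fin_num /\ fine (mu (F i)) < d.
  have [N _ hN] := filterI fF ltF; by exists N; apply: hN => /=.
exists i.+1%:R^-1; first by rewrite invr_gt0.
by rewrite -(fineK fi) lte_fin.
Qed.

Section Resonances.
Variables (n : nat) (nu : 'rV[int]_n -> R).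
Local Notation K := 'rV[int]_n.

(** The strip at |nu k| keeps nu k away from +-omega0; the one at half of it keeps nu k away from
    +-2 omega0, as needed when two modes are both nearly resonant. *)
Let bad (g : R) (k : K) : set R :=
  strip `|nu k| (g * mwt R k) `|` strip (`|nu k| / 2) (g * mwt R k).

Let badn g (i : nat) : set R := if pickle_inv i is Some k then bad g k else set0.

Lemma measurable_badn g i : measurable (badn g i).
Proof.
rewrite /badn; case: pickle_inv => [k|]; last exact: measurable0.
by apply: measurableU; exact: measurable_strip.
Qed.

Lemma measure_bad g : 0 < g -> (mu (\bigcup_i badn g i) <= (48 * g * 5 ^+ n)%:E)%E.
Proof.
move=> g0; apply: le_trans (measure_sigma_subadditive mu (measurable_badn g) _ (@subset_refl _ _)) _.
  by apply: bigcupT_measurable; exact: measurable_badn.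
pose w (i : nat) : R := if @pickle_inv K i is Some k then mwt R k else 0.
have hw i : (mu (badn g i) <= (48 * g * w i)%:E)%E.
  rewrite /badn /w; case: pickle_inv => [k|]; last by rewrite measure0 mulr0.
  have e0 : 0 < g * mwt R k by rewrite mulr_gt0 // mwt_gt0.
  apply: le_trans (measureU2 _ _ _) _; try exact: measurable_strip.
  apply: le_trans (leeD (strip_measure _ e0) (strip_measure _ e0)) _.
  by rewrite -EFinD lee_fin; lra.
apply: lime_le; first by apply: is_cvg_nneseries => i _ _; exact: measure_ge0.
apply: nearW => N.
apply: le_trans (lee_sum _ (fun i _ => hw i)) _.
rewrite sumEFin lee_fin -mulr_sumr ler_wpM2l //; first by rewrite mulr_ge0 // ltW.
have us : uniq (pmap (@pickle_inv K) (index_iota 0 N)).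
  by apply: pmap_uniq (iota_uniq _ _) => i; exact: pickle_invK.
apply: le_trans (_ : _ <= \sum_(k <- pmap (@pickle_inv K) (index_iota 0 N)) normc (((mwt R k)%:C)%C)) _; last exact: (@absum_mwt R n).
rewrite big_pmap.
by apply: ler_sum => i _; rewrite /w; case: pickle_inv => [k|]; rewrite [leRHS]/oapp ?normc_real ?ler_norm.
Qed.

(** Of the constant C1, the 1 pays for the neighbourhood of the degenerate parameters, whose measure
    is required to be below [g], and 48 * 5^n for the two strips of width g mwt(k) per mode. C1 is
    fixed before [g], whereas [F0] depends on it. *)
Lemma good_parameters p0 q r : p0 != 0 \/ q + r != 0 ->
  exists C1 : R, forall g : R, 0 < g -> exists F0 : R, exists Pi : set R,
  [/\ 0 < F0, measurable Pi, Pi `<=` Pi0 R, (mu (Pi0 R) - (C1 * g)%:E <= mu Pi)%E &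
   forall a, Pi a -> [/\ critical a (omega0 a) (tau0 a),
      F0 <= `|transv a (omega0 a) (tau0 a) (a * p0) q r| &
      forall k : K, g * mwt R k <= `| `|nu k| - omega0 a| /\
                    g * mwt R k <= `| `|nu k| - 2 * omega0 a| ]].
Proof.
move=> nz; exists (1 + 48 * 5 ^+ n) => g g0.
have [e e0 he] := degen_measure nz g0.
pose B := degen p0 q r e `|` \bigcup_i badn g i.
have mB : measurable B.
  by apply: measurableU; [exact: measurable_degen|apply: bigcupT_measurable; exact: measurable_badn].
have BP : B `<=` Pi0 R.
  move=> a [[]//|[i _]]; rewrite /badn; case: pickle_inv => // k; by case=> -[].
(* Dividing |hopfE| >= e by omega0 <= 3/2 leaves at least e / 2. *)
exists (e / 2), (Pi0 R `\` B); split.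
- by rewrite divr_gt0.
- by apply: measurableD => //; exact: measurable_Pi0.
- exact: subDsetl.
- have mP := measurable_Pi0.
  have hB : (mu B <= ((1 + 48 * 5 ^+ n) * g)%:E)%E.
    apply: le_trans (measureU2 _ _ _) _.
    + exact: measurable_degen.
    + by apply: bigcupT_measurable; exact: measurable_badn.
    apply: le_trans (leeD (ltW he) (measure_bad g0)) _.
    by rewrite -EFinD lee_fin le_eqVlt; apply/orP; left; apply/eqP; ring.
  rewrite leeBlDr //; apply: le_trans (leeD (lexx _) hB).
  rewrite -[in leLHS](setDUK BP) setUC; apply: measureU2 => //.
  exact: measurableD.
move=> a [ha nB]; have cr := critical_tau0 ha; split=> //.
  have : ~ degen p0 q r e a by move=> h; apply: nB; left.
  rewrite /degen => /not_andP[//|/negP]; rewrite -leNgt -(transvE _ _ _ cr) normrM.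
  have [_ /andP[w1 w2] _] := omega0_Pi0 ha.
  rewrite ger0_norm; last by lra.
  have := normr_ge0 (transv a (omega0 a) (tau0 a) (a * p0) q r); nra.
move=> k; have nk : ~ bad g k a.
  move=> h; apply: nB; right; exists (pickle k) => //.
  by rewrite /badn pickleK_inv.
split; rewrite leNgt; apply/negP => h; apply: nk; first by left.
right; split=> //=; apply: le_lt_trans h.
have -> : `|nu k| - 2 * omega0 a = 2 * (`|nu k| / 2 - omega0 a) by field.
by rewrite normrM ger0_norm // ler_peMl // ler1n.
Qed.

End Resonances.
End GoodParameters.

(** * Reduction to a fixed point *)

Section Remainder.
Variables (R : realType) (n : nat).
Local Notation C := R[i].
Local Notation K := 'rV[int]_n.

(** [lip_wsum] asks for one bound per member with bounded total, whereas [famsum] is a joint bound;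
    the exact norms of the members serve. *)
Lemma famsum_norms (T : eqType) (c : T -> K -> C) M : famsum c M ->
  exists N : T -> R, (forall t, absum (c t) (N t)) /\
    (forall s, uniq s -> \sum_(t <- s) N t <= M).
Proof.
move=> hc; pose p (t : T) (k : K) : C := ((normc (c t k))%:C)%C.
have hp : famsum p M.
  by apply: absum_mono hc => q; rewrite /p normc_real ger0_norm ?normc_ge0.
have hS t : exists S : R, hsum (p t) (S%:C)%C.
  by apply: (hsum_pos_ex (M := M)) => [k|]; [exact: normc_ge0|exact: (famsum_term t hc)].
have [N hN] := boolp.choice hS.
exists N; split=> [t s us|s us].
  exact: (hsum_ge (fun k => normc_ge0 (c t k)) (hN t)).
apply: le_trans (absum_outer hp us); apply: ler_sum => t _.
by rewrite (csumE (hN t)) normc_real ler_norm.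
Qed.

Variables (T : eqType) (G : T -> K -> C) (E0 E1 E2 : T -> nat) (rho M : R).
Let deg t := (E0 t + E1 t + E2 t)%N.
Hypothesis rho_gt0 : 0 < rho.
Hypothesis famG : famsum (fun t k => ((rho ^+ deg t)%:C)%C * G t k) M.
Hypothesis symG : forall t, sym (G t).

Definition pmonom (w0 w1 w2 : K -> C) t : K -> C :=
  conv (wpow w0 (E0 t)) (conv (wpow w1 (E1 t)) (wpow w2 (E2 t))).

Lemma absum_pmonom w0 w1 w2 B t : absum w0 B -> absum w1 B -> absum w2 B ->
  absum (pmonom w0 w1 w2 t) (B ^+ deg t).
Proof.
move=> h0 h1 h2; rewrite /deg !exprD -mulrA.
by apply: absum_conv; [exact: absum_wpow|apply: absum_conv; exact: absum_wpow].
Qed.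

Lemma eval_pmonom w0 w1 w2 B t phi : absum w0 B -> absum w1 B -> absum w2 B ->
  eval (pmonom w0 w1 w2 t) phi = eval w0 phi ^+ E0 t * eval w1 phi ^+ E1 t * eval w2 phi ^+ E2 t.
Proof.
move=> h0 h1 h2.
have a0 := absum_wpow (E0 t) h0; have a1 := absum_wpow (E1 t) h1; have a2 := absum_wpow (E2 t) h2.
by rewrite (eval_conv _ a0 (absum_conv a1 a2)) (eval_conv _ a1 a2)
  (eval_wpow _ _ h0) (eval_wpow _ _ h1) (eval_wpow _ _ h2) mulrA.
Qed.

(** A term of the Taylor remainder of order [D] divided by s^D. The test on the degree is essential:
    truncated subtraction would give terms of lower degree the factor s^0 = 1. *)
Definition remterm D (s : R) (w0 w1 w2 : K -> C) t : K -> C := fun k =>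
  (((if (D <= deg t)%N then s ^+ (deg t - D) else 0) : R)%:C)%C * conv (G t) (pmonom w0 w1 w2 t) k.

Definition rem D s (w0 w1 w2 : K -> C) : K -> C := wsum (remterm D s w0 w1 w2).

Lemma lip_wpow1 r (F : (K -> C) -> K -> C) B L m : 0 <= r -> 1 <= B -> 0 <= L -> lip r F B L ->
  lip r (fun h => wpow (F h) m) (B ^+ m) (m%:R * B ^+ m * L).
Proof.
move=> r0 B1 L0 hF; have B0 : 0 <= B by apply: le_trans B1.
apply: lip_weaken (lexx _) (lexx _) _ (lip_pow m r0 hF).
by rewrite ler_wpM2r // ler_wpM2l // ler_weXn2l // leq_pred.
Qed.

(** Since s B <= rho / 2, a term of degree [deg] carries the factor 2^-(deg - D). This absorbs the
    degree that differentiation of powers brings into the Lipschitz constant, as deg <= 2^D 2^(deg -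
    D), and the constants no longer depend on [s]. *)
Lemma lip_rem D s r B L (F0 F1 F2 : (K -> C) -> K -> C) : 0 <= r -> 0 < s -> 1 <= B -> 0 <= L ->
  s * B <= rho / 2 -> lip r F0 B L -> lip r F1 B L -> lip r F2 B L ->
  lip r (fun h => rem D s (F0 h) (F1 h) (F2 h)) ((B / rho) ^+ D * M) ((2 * B / rho) ^+ D * M * L) /\
  forall h, absum h r -> famsum (remterm D s (F0 h) (F1 h) (F2 h)) ((B / rho) ^+ D * M).
Proof.
move=> r0 s0 B1 L0 sB l0 l1 l2.
have B0 : 0 <= B by apply: le_trans B1.
have [N [hN sN]] := famsum_norms famG.
have N0 t : 0 <= N t := absum_ge0 (hN t).
have hG t : absum (G t) (rho ^- deg t * N t).
  have rp : 0 < rho ^+ deg t by rewrite exprn_gt0.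
  have := absumZ (((rho ^- deg t)%:C)%C) (hN t); rewrite normc_real ger0_norm ?invr_ge0 ?(ltW rp) //.
  by apply: absum_mono => k; rewrite mulrA -rmorphM mulVf ?gt_eqF // mul1r.
pose S D' t : R := if (D' <= deg t)%N then s ^+ (deg t - D') else 0.
have S0 t : 0 <= S D t by rewrite /S; case: ifP => // _; rewrite exprn_ge0 // ltW.
have lt t : lip r (fun h => remterm D s (F0 h) (F1 h) (F2 h) t)
    (S D t * ((rho ^- deg t * N t) * B ^+ deg t))
    (S D t * ((rho ^- deg t * N t) * ((deg t)%:R * B ^+ deg t * L))).
  have h1 := lip_conv (lip_wpow1 (E1 t) r0 B1 L0 l1) (lip_wpow1 (E2 t) r0 B1 L0 l2).
  have h0 := lip_conv (lip_wpow1 (E0 t) r0 B1 L0 l0) h1.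
  have h := lipZ (S D t) (lip_conv (lip_const r (hG t) (symG t)) h0).
  rewrite ger0_norm // in h.
  apply: (lip_weaken (lexx _) _ _ h).
    by rewrite /deg !exprD !mulrA.
  by rewrite /deg !exprD !natrD le_eqVlt; apply/orP; left; apply/eqP; ring.
have key t : S D t * (rho ^- deg t * B ^+ deg t) * 2 ^+ (deg t - D) <= (B / rho) ^+ D.
  rewrite /S; case: leqP => Dt; last by rewrite !mul0r exprn_ge0 // divr_ge0 // ltW.
  rewrite -exprVn -[in X in _ * (X * _)](subnK Dt) -[in X in _ * (_ * X)](subnK Dt) !exprD.
  have -> : s ^+ (deg t - D) * (rho^-1 ^+ (deg t - D) * rho^-1 ^+ D * (B ^+ (deg t - D) * B ^+ D)) *
    2 ^+ (deg t - D) = (s * B * rho^-1 * 2) ^+ (deg t - D) * (B / rho) ^+ D.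
    by rewrite !exprMn; ring.
  rewrite -[leRHS]mul1r ler_wpM2r ?exprn_ge0 ?divr_ge0 ?(ltW rho_gt0) //.
  rewrite exprn_ile1 //; first by rewrite !mulr_ge0 ?invr_ge0 ?(ltW s0) ?(ltW rho_gt0).
  rewrite mulrAC ler_pdivrMr // mul1r; lra.
have Br : 0 <= (B / rho) ^+ D by rewrite exprn_ge0 // divr_ge0 // ltW.
apply: lip_wsum r0 lt _ _ => q uq.
  apply: le_trans (_ : _ <= \sum_(t <- q) (B / rho) ^+ D * N t) _; last first.
    by rewrite -mulr_sumr ler_wpM2l // sN.
  apply: ler_sum => t _; rewrite (_ : S D t * _ = S D t * (rho ^- deg t * B ^+ deg t) * N t); last by ring.
  rewrite ler_wpM2r //; apply: le_trans (key t); rewrite ler_peMr //.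
    by rewrite !mulr_ge0 ?exprn_ge0 ?invr_ge0 ?exprn_ge0 ?(ltW rho_gt0).
  by rewrite exprn_ege1 // ler1n.
apply: le_trans (_ : _ <= \sum_(t <- q) (2 * B / rho) ^+ D * L * N t) _; last first.
  by rewrite -mulr_sumr mulrAC ler_wpM2r // ler_wpM2l ?sN // -mulrA exprMn mulr_ge0 // exprn_ge0.
apply: ler_sum => t _.
rewrite (_ : S D t * _ = S D t * (rho ^- deg t * B ^+ deg t) * (deg t)%:R * (L * N t)); last by ring.
rewrite -[leRHS]mulrA ler_wpM2r ?mulr_ge0 // -[2 * B / rho]mulrA exprMn.
have [Dt|Dt] := leqP D (deg t); last first.
  have -> : S D t = 0 by rewrite /S leqNgt Dt.
  by rewrite !mul0r; apply: mulr_ge0 => //; apply: exprn_ge0.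
apply: le_trans (_ : _ <= S D t * (rho ^- deg t * B ^+ deg t) * (2 ^+ D * 2 ^+ (deg t - D))) _.
  rewrite ler_wpM2l ?mulr_ge0 ?exprn_ge0 ?invr_ge0 ?exprn_ge0 ?(ltW rho_gt0) //.
  by rewrite -exprD subnKC // -natrX ler_nat ltnW // ltn_expl.
by rewrite mulrCA ler_wpM2l ?exprn_ge0.
Qed.

Lemma famsum_sel (P : pred T) d : (forall t, P t -> deg t = d) ->
  famsum (fun t k => if P t then G t k else 0) (M / rho ^+ d).
Proof.
move=> Pd; have rp : 0 < rho ^+ d by rewrite exprn_gt0.
have := absumZ (((rho ^- d)%:C)%C) famG; rewrite normc_real ger0_norm ?invr_ge0 ?(ltW rp) // mulrC.
apply: absum_mono => -[t k] /=; case: ifP => [/Pd ->|_]; last by rewrite normc0 normc_ge0.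
by rewrite mulrA -rmorphM mulVf ?gt_eqF // mul1r.
Qed.

Definition wsel (P : pred T) : K -> C := wsum (fun t k => if P t then G t k else 0).

Lemma absum_wsel (P : pred T) d : (forall t, P t -> deg t = d) -> absum (wsel P) (M / rho ^+ d).
Proof. by move=> Pd; apply/absum_wsum/famsum_sel. Qed.

Lemma sym_wsel (P : pred T) d : (forall t, P t -> deg t = d) -> sym (wsel P).
Proof.
move=> Pd; apply: (sym_wsum (famsum_sel Pd)) => t k; case: ifP => _; last by rewrite conjc0.
exact: symG.
Qed.

Lemma eval_sel (P : pred T) d phi (z : T -> C) (z0 : C) : (forall t, P t -> deg t = d) ->
  (forall t, P t -> z t = z0) ->
  absum (fun t => if P t then eval (G t) phi * z t else 0) (normc z0 * (M / rho ^+ d)) /\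
  csum (fun t => if P t then eval (G t) phi * z t else 0) = z0 * eval (wsel P) phi.
Proof.
move=> Pd Pz; have h := famsum_sel Pd.
have eq : (fun t => if P t then eval (G t) phi * z t else 0) =
    fun t => z0 * eval (fun k => if P t then G t k else 0) phi.
  apply: funext => t; case: ifP => [Pt|_]; first by rewrite (Pz _ Pt) mulrC.
  by rewrite /eval (_ : (fun k => 0 * _) = fun=> 0) ?csum0 ?mulr0 //; apply: funext => k; rewrite mul0r.
rewrite eq; split; first by apply: absumZ; exact: famsum_eval.
by rewrite csumZf (eval_wsum _ h).
Qed.

Lemma eval_rem D s B w0 w1 w2 phi : 0 < s -> 1 <= B -> s * B <= rho / 2 ->
  absum w0 B -> absum w1 B -> absum w2 B -> sym w0 -> sym w1 -> sym w2 ->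
  let u t := eval (G t) phi * ((s%:C%C * eval w0 phi) ^+ E0 t *
      (s%:C%C * eval w1 phi) ^+ E1 t * (s%:C%C * eval w2 phi) ^+ E2 t) in
  (exists M', absum (fun t => if (D <= deg t)%N then u t else 0) M') /\
  csum (fun t => if (D <= deg t)%N then u t else 0) = (s ^+ D)%:C%C * eval (rem D s w0 w1 w2) phi.
Proof.
move=> s0 B1 sB h0 h1 h2 s0' s1 s2 u.
have [_ /(_ (fun=> 0))] := lip_rem D (lexx 0) s0 B1 (lexx 0) sB (lip_const 0 h0 s0') (lip_const 0 h1 s1) (lip_const 0 h2 s2).
move=> /(_ (@absum0 _ _)) fam.
have eq : (fun t => if (D <= deg t)%N then u t else 0) =
    fun t => (s ^+ D)%:C%C * eval (remterm D s w0 w1 w2 t) phi.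
  apply: funext => t.
  have [N [hN _]] := famsum_norms famG.
  have hG : absum (G t) (rho ^- deg t * N t).
    have rp : 0 < rho ^+ deg t by rewrite exprn_gt0.
    have := absumZ (((rho ^- deg t)%:C)%C) (hN t); rewrite normc_real ger0_norm ?invr_ge0 ?(ltW rp) //.
    by apply: absum_mono => k; rewrite mulrA -rmorphM mulVf ?gt_eqF // mul1r.
  have hp := absum_pmonom t h0 h1 h2.
  rewrite (evalZ _ _ (absum_conv hG hp)) (eval_conv _ hG hp) (eval_pmonom _ _ h0 h1 h2).
  case: ifP => Dt; last by rewrite mul0r mulr0.
  rewrite mulrA -rmorphM -exprD subnKC // /u /deg !exprMn !exprD !rmorphM !rmorphXn /=.
  by ring.
rewrite eq; split; first by exists (normc ((s ^+ D)%:C%C) * ((B / rho) ^+ D * M)); apply: absumZ; exact: famsum_eval.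
by rewrite csumZf (eval_wsum _ fam).
Qed.

End Remainder.

(** * Smallness of multipliers on mean-free functions, and fixed points through the square *)

Section FixedPoint.
Variables (R : realType) (n : nat).
Local Notation C := R[i].
Local Notation K := 'rV[int]_n.
Implicit Types (h : K -> C).

(** The tail of [a] is small under the uniform bound, and the finitely many other modes gain the
    factor d / r k. The zero mode, where the multiplier need not be small, is excluded by a 0 = 0.
    The threshold [d1] is chosen before [w], hence uniformly in the parameters of the equation. *)
Lemma small_mult (a : K -> C) M (r : K -> R) (Cm e : R) : absum a M -> a 0 = 0 ->
  (forall k, k != 0 -> 0 < r k) -> 0 < Cm -> 0 < e ->
  exists2 d1 : R, 0 < d1 & forall d (w : K -> C), 0 < d <= d1 ->
    (forall k, k != 0 -> normc (w k) <= Cm) ->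
    (forall k, k != 0 -> normc (w k) <= Cm * d / r k) -> absum (fun k => w k * a k) e.
Proof.
move=> ha a0 r0 C0 e0.
have e1 : 0 < e / 2 / Cm by rewrite !divr_gt0.
have [s0 us0 hs0] := absum_tail e1 ha.
pose S := \sum_(k <- s0 | k != 0) Cm * normc (a k) / r k.
have S0 : 0 <= S.
  by apply: sumr_ge0 => k k0; rewrite divr_ge0 ?(ltW (r0 _ k0)) // mulr_ge0 ?normc_ge0 // ltW.
exists (e / 2 / (S + 1)); first by rewrite !divr_gt0 // ltr_wpDl.
move=> d w /andP[d0 dd] hw1 hw2 s us.
rewrite (bigID (mem s0)) /=.
have -> : e = e / 2 + e / 2 by field.
apply: lerD; last first.
  rewrite -big_filter; apply: le_trans (_ : _ <= Cm * (e / 2 / Cm)) _; last first.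
    by rewrite mulrCA divff ?gt_eqF // mulr1.
  apply: le_trans (ler_wpM2l (ltW C0) (hs0 [seq k <- s | k \notin s0] _ _)).
  - rewrite mulr_sumr; apply: ler_sum => k _; rewrite normcM.
    have [->|k0] := eqVneq k 0; first by rewrite a0 normc0 !mulr0.
    by rewrite ler_wpM2r ?normc_ge0 // hw1.
  - exact: filter_uniq.
  - by move=> k; rewrite mem_filter => /andP[].
have {dd} : d * (S + 1) <= e / 2 by rewrite -ler_pdivlMr // ltr_wpDl.
apply: le_trans; apply: le_trans (_ : d * S <= _); last by rewrite ler_wpM2l ?(ltW d0) // lerDl.
rewrite -big_filter.
apply: le_trans (_ : _ <= \sum_(k <- s0) normc (w k * a k)) _.
  apply: ler_sum_sub; rewrite ?filter_uniq //.
    by move=> k; rewrite mem_filter => /andP[].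
  by move=> k; exact: normc_ge0.
rewrite /S mulr_sumr [leRHS]big_mkcond; apply: ler_sum => k _; rewrite normcM.
case: eqP => [->|/eqP k0] /=; first by rewrite a0 normc0 mulr0.
have -> : d * (Cm * normc (a k) / r k) = Cm * d / r k * normc (a k) by ring.
by rewrite ler_wpM2r ?normc_ge0 // hw2.
Qed.

(** On summable sequences the norm of an operator is the supremum of its column sums; the hypothesis
    is the [j]-th column after shifting [k] by [j]. *)
Lemma conv_small (a w1 v1 : K -> C) h D e : 0 <= e ->
  (forall j, absum (fun k => w1 (k + j) * v1 j * a k) e) -> absum h D ->
  absum (fun k => w1 k * conv a (fun j => v1 j * h j) k) (e * D).
Proof.
move=> e0 he hh.
have fam : famsum (fun j k => w1 k * ((v1 j * h j) * a (k - j))) (D * e).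
  apply: (famsum_ex (B := fun j => normc (h j) * e)) => [j|s us]; last first.
    by rewrite -mulr_suml ler_wpM2r // hh.
  have := absumZ (h j) (absum_shift j (he j)).
  by apply: absum_mono => k; rewrite subrK le_eqVlt; apply/orP; left; apply/eqP; congr normc; ring.
rewrite mulrC.
have -> : (fun k => w1 k * conv a (fun j => v1 j * h j) k) =
    wsum (fun j k => w1 k * ((v1 j * h j) * a (k - j))).
  by apply: funext => k; rewrite /wsum csumZf.
exact: absum_wsum.
Qed.

(* [B] need not be a contraction: only [B \o B] is, and a fixed point of
   [h = B (B h + v h) + v h] is one of [h = B h + v h]. *)
Lemma fixpoint_square (B v : (K -> C) -> K -> C) (rho be Lb Bv Lv : R) :
  0 <= rho -> 0 <= be -> 0 <= Lb -> 0 <= Lv ->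
  (forall h D, absum h D -> absum (B h) (Lb * D)) ->
  (forall h D, absum h D -> absum (B (B h)) (be * D)) ->
  (forall h h' D D', absum h D -> absum h' D' ->
     B (fun k => h k + h' k) = (fun k => B h k + B h' k)) ->
  (forall h D, absum h D -> sym h -> sym (B h)) ->
  lip rho v Bv Lv -> be * rho + (Lb + 1) * Bv <= rho -> be + (Lb + 1) * Lv <= 1 / 2 ->
  exists h, [/\ absum h rho, sym h & forall k, h k = B h k + v h k].
Proof.
move=> r0 be0 Lb0 Lv0 hB hBB BD sB hv hval hlip.
have [v1 v2 v3] := hv; have Bv0 := lip_ge0 r0 hv.
have BB h h' D D' : absum h D -> absum h' D' ->
    B (fun k => h k - h' k) = (fun k => B h k - B h' k).
  move=> hh hh'; have := BD _ _ _ _ (absumB hh hh') hh'.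
  rewrite (_ : (fun k => h k - h' k + h' k) = h); last by apply: funext => k; rewrite subrK.
  by move=> ->; apply: funext => k; rewrite addrK.
pose P h k := B (B h) k + (B (v h) k + v h k).
have [|h [hh sh Ph]] := @fixpoint_lip R n rho P r0.
  split.
  - move=> h hh; apply: (absum_le _ (absumD (hBB _ _ hh) (absumD (hB _ _ (v1 _ hh)) (v1 _ hh)))).
    by move: hval; rewrite mulrDl mul1r.
  - move=> h h' D hh hh' hD; have D0 := absum_ge0 hD.
    have a1 := hBB _ _ hD; rewrite (BB _ _ _ _ hh hh') (BB _ _ _ _ (hB _ _ hh) (hB _ _ hh')) in a1.
    have hvD := v2 _ _ _ hh hh' hD.
    have a2 := hB _ _ hvD; rewrite (BB _ _ _ _ (v1 _ hh) (v1 _ hh')) in a2.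
    have := absumD a1 (absumD a2 hvD); rewrite /P.
    have -> : (fun k => B (B h) k - B (B h') k + (B (v h) k - B (v h') k + (v h k - v h' k))) =
      (fun k => B (B h) k + (B (v h) k + v h k) - (B (B h') k + (B (v h') k + v h' k))).
      by apply: funext => k; ring.
    apply: absum_le; rewrite mulrA -!mulrDl ler_wpM2r //.
    by move: hlip; rewrite div1r mulrDl mul1r.
  - move=> h hh sh; apply: symD; first by apply: (sB _ _ (hB _ _ hh)); exact: (sB _ _ hh).
    by apply: symD; [apply: (sB _ _ (v1 _ hh)); exact: v3|exact: v3].
exists h; split=> // k.
(* The defect [e] of the desired equation satisfies e = - B e, hence e = B (B e), and the small
   square forces it to vanish. *)
pose g k := B h k + v h k; pose e k := h k - g k.
have hg := absumD (hB _ _ hh) (v1 _ hh).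
have he : absum e _ := absumB hh hg.
have eB : e = fun k => B g k - B h k.
  apply: funext => l; rewrite /e -[in X in X - _]Ph /P /g (BD _ _ _ _ (hB _ _ hh) (v1 _ hh)); ring.
have eN : e = fun k => - B e k.
  by rewrite {1}eB (BB _ _ _ _ hh hg); apply: funext => l; rewrite opprB.
have eBB : e = B (B e).
  have z0 : B (fun k => (fun=> 0) k + (fun=> 0 : C) k) = fun k => B (fun=> 0) k + B (fun=> 0) k.
    by apply: (BD _ _ 0 0); exact: absum0.
  have z : B (fun=> 0) = fun=> 0.
    apply: funext => l; have := congr1 (fun f => f l) z0.
    rewrite (_ : (fun k : K => (fun=> 0 : C) k + (fun=> 0 : C) k) = fun=> 0); last by apply: funext => ?; rewrite addr0.
    by move=> /(congr1 (fun x => x - B (fun=> 0) l)); rewrite addrK subrr => <-.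
  have := BB _ _ _ _ (@absum0 _ _) (hB _ _ he); rewrite z.
  rewrite (_ : (fun k => 0 - B e k) = e); last by rewrite [RHS]eN; apply: funext => l; rewrite sub0r.
  move=> /(congr1 (fun f : K -> C => f _)) BeN; transitivity (fun k => - B e k) => //.
  by apply: funext => l; rewrite BeN sub0r opprK.
(* The exact norm of [e] is needed here: S <= be * S with be <= 1/2 gives S = 0. *)
have [S hS] := hsum_pos_ex (fun k => normc_ge0 (e k)) he.
have hS2 : absum e S by move=> s us; exact: (hsum_ge (fun k => normc_ge0 (e k)) hS).
have S0 := absum_ge0 hS2.
have hS3 := hBB _ _ hS2; rewrite -eBB in hS3.
have be1 : be <= 1 / 2 by apply: le_trans hlip; rewrite lerDl mulr_ge0 // addr_ge0.
have : normc (S%:C%C) <= be * S.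
  apply: hsum_le hS; move=> s us; apply: le_trans (hS3 _ us).
  by apply: ler_sum => l _; rewrite normc_real ger0_norm ?normc_ge0.
rewrite normc_real ger0_norm // => SS.
have S1 : S = 0 by nra.
apply/eqP; rewrite -subr_eq0 -/(g k) -/(e k); apply/eqP/eq0_normc/eqP.
by rewrite eq_le normc_ge0 andbT -S1 (absum_term k hS2).
Qed.
End FixedPoint.

Lemma continuous_Re_csum (R : realType) (T : topologicalType) (I : eqType) (a : I -> R[i])
    (th : I -> T -> R) M : absum a M -> (forall i, continuous (th i)) ->
  continuous (fun y => complex.Re (csum (fun i => a i * cis (th i y)))).
Proof.
move=> ha hth x; apply/cvgrPdist_le => e e0.
have := csum_cis_continuous ha (fun i => hth i x) e0; apply: filterS => y; rewrite normcBC.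
by apply: le_trans; rewrite -raddfB; exact: ler_Re_normc.
Qed.

(** * Fourier multipliers of the linear part *)

Section Multiplier.
Variables (R : realType) (n : nat) (om : 'rV[R]_n).
Local Notation C := R[i].
Local Notation K := 'rV[int]_n.
Local Notation nu := (fun k : K => dotr k om).

Definition dM (k : K) : C := 'i%C * ((nu k)%:C)%C.
Definition tauM (tau : R) (k : K) : C := cis (- (nu k * tau)).

Lemma normc_i : normc ('i%C : C) = 1.
Proof. by rewrite /= expr0n add0r expr1n sqrtr1. Qed.

Lemma normc_dM k : normc (dM k) = `|nu k|.
Proof. by rewrite normcM normc_i mul1r normc_real. Qed.

Lemma sym_dM : sym dM.
Proof.
by move=> k; rewrite /dM dotrNl; apply/eqP; rewrite eq_complex /=; apply/andP; split; apply/eqP; ring.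
Qed.

Lemma sym_tauM tau : sym (tauM tau).
Proof. by move=> k; rewrite /tauM dotrNl mulNr -cisN. Qed.

Lemma absum_tauM tau (a : K -> C) M : absum a M -> absum (fun k => tauM tau k * a k) M.
Proof. by apply: absum_mono => k; rewrite normcM normc_cis mul1r. Qed.

Variables (a tau p q r d : R).

Definition lamC k : C := (lamRe tau q r d (nu k) +i* lamIm a tau p r d (nu k))%C.

Lemma lamCE k : lamC k = ((1 - nu k ^+ 2)%:C)%C - (a%:C)%C * dM k - tauM tau k +
  (d%:C)%C * ((p%:C)%C * dM k + (q%:C)%C + (r%:C)%C * tauM tau k).
Proof.
rewrite /lamC /dM /tauM /cis cosN sinN /lamRe /lamIm; apply/eqP; rewrite eq_complex /=.
by apply/andP; split; apply/eqP; ring.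
Qed.

Lemma sym_lamC : sym lamC.
Proof.
move=> k; rewrite /lamC dotrNl /lamRe /lamIm mulNr cosN sinN sqrrN; apply/eqP; rewrite eq_complex /=.
by apply/andP; split; apply/eqP; ring.
Qed.

Lemma lamN_normc k : lamN a tau p q r d (nu k) <= 2 * normc (lamC k).
Proof.
rewrite mulr2n mulrDl mul1r; apply: lerD; [exact: (ler_Re_normc (lamC k))|exact: (ler_Im_normc (lamC k))].
Qed.

Definition mult k : C := (d%:C)%C / lamC k.

Lemma sym_mult : sym mult.
Proof. by move=> k; rewrite /mult sym_lamC conjcM conjc_real conjc_inv. Qed.

Variables (w0 c2 : R).
Hypothesis c2_gt0 : 0 < c2.
Hypothesis d_gt0 : 0 < d.
Hypothesis lamL : forall w, c2 * (Num.max d (rdist w0 w) * (1 + `|w|)) <= lamN a tau p q r d w.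

Lemma lamC_neq0 k : lamC k != 0.
Proof.
apply/eqP => l0; have := lamN_normc k; rewrite l0 normc0 mulr0.
apply/negP; rewrite -ltNge; apply: lt_le_trans (lamL _).
by rewrite !mulr_gt0 // ?lt_max ?d_gt0 // ltr_pwDl.
Qed.

Lemma lam_mult k : lamC k * mult k = (d%:C)%C.
Proof. by rewrite /mult mulrCA divff ?mulr1 // lamC_neq0. Qed.

Lemma mult_bound k e : 0 < e -> e <= Num.max d (rdist w0 (nu k)) ->
  normc (mult k) * (1 + `|nu k|) <= 2 / c2 * d / e.
Proof.
move=> e0 he; rewrite /mult normcM normc_real gtr0_norm // normcV.
have l0 : 0 < normc (lamC k) by rewrite lt_def normc_ge0 andbT; apply: contra (lamC_neq0 k) => /eqP /eq0_normc ->.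
have -> : 2 / c2 * d / e = 2 * d / (c2 * e) by field; rewrite !gt_eqF.
rewrite mulrAC ler_pdivrMr // mulrAC ler_pdivlMr ?mulr_gt0 //.
have := le_trans (lamL (nu k)) (lamN_normc k).
have n0 : 0 < 1 + `|nu k| by rewrite ltr_pwDl.
have : c2 * (e * (1 + `|nu k|)) <= c2 * (Num.max d (rdist w0 (nu k)) * (1 + `|nu k|)).
  by rewrite !ler_pM2l // ler_pM2r.
move=> h1 h2; have h3 := le_trans h1 h2.
have -> : d * (1 + `|nu k|) * (c2 * e) = d * (c2 * (e * (1 + `|nu k|))) by ring.
have -> : 2 * d * normc (lamC k) = d * (2 * normc (lamC k)) by ring.
by rewrite ler_pM2l.
Qed.

Lemma mult_bounds k (e : R) : 0 < e -> e <= Num.max d (rdist w0 (nu k)) ->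
  normc (mult k) <= 2 / c2 * d / e /\ normc (dM k * mult k) <= 2 / c2 * d / e.
Proof.
move=> e0 he; have := mult_bound e0 he; have := normc_ge0 (mult k); have := normr_ge0 (nu k).
by rewrite [normc (dM k * _)]normcM normc_dM; split; nra.
Qed.

Lemma mult_bounded k : normc (mult k) <= 2 / c2 /\ normc (dM k * mult k) <= 2 / c2.
Proof.
have := @mult_bounds k d d_gt0; rewrite mulfK ?gt_eqF //; apply.
by rewrite le_max lexx.
Qed.

End Multiplier.

Section Solution.
Variables (R : realType) (n : nat) (om : 'rV[R]_n).
Local Notation C := R[i].
Local Notation K := 'rV[int]_n.
Local Notation nu := (fun k : K => dotr k om).

Lemma is_derive_hull (X : K -> C) M M' t : absum X M -> absum (fun k => dM om k * X k) M' ->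
  is_derive t (1 : R) (fun t : R => complex.Re (eval X (t *: om)))
    (complex.Re (eval (fun k => dM om k * X k) (t *: om))).
Proof.
move=> hX hd.
have hd' : absum (fun k : K => ((nu k)%:C)%C * X k) M'.
  by apply: absum_mono hd => k; rewrite !normcM normc_i mul1r.
have := csum_cis_derive t hX hd'.
congr (is_derive _ _ _ _); last congr complex.Re.
  by apply: funext => s; congr (complex.Re (csum _)); apply: funext => k; rewrite dotrZr [s * _]mulrC.
by congr csum; apply: funext => k; rewrite dotrZr [t * _]mulrC.
Qed.

(** The coefficient equation inverts only 1 - nu^2 - i a nu; the delay and all other terms sit in
    [Rh] and are compared pointwise on the torus. *)
Lemma solution_of_coeffs (f : R -> R) (g : 'rV[R]_n -> R -> R -> R -> R) (a tau eps : R)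
    (X Rh : K -> C) M1 M2 M3 :
  absum X M1 -> absum (fun k => dM om k * X k) M2 -> absum Rh M3 -> sym X ->
  (forall k, (((1 - nu k ^+ 2)%:C)%C - (a%:C)%C * dM om k) * X k = Rh k) ->
  (forall phi, complex.Re (eval Rh phi) =
     f (complex.Re (eval (fun k => tauM om tau k * X k) phi)) +
     eps * g phi (complex.Re (eval X phi)) (complex.Re (eval (fun k => tauM om tau k * X k) phi)) eps -
     a * complex.Re (eval X phi) ^+ 2 * complex.Re (eval (fun k => dM om k * X k) phi)) ->
  let x := fun t : R => complex.Re (eval X (t *: om)) in
  [/\ vdp_solution f g om a tau eps x, quasi_periodic om x & forall t, `|x t| <= M1].
Proof.
move=> hX hdX hR sX eqk eqv x.
(* Summability of the second derivative comes from the equation, which expresses nu^2 X through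
   [Rh], [X] and its first derivative. *)
have hddX : absum (fun k => dM om k * (dM om k * X k)) (M3 + M1 + `|a| * M2).
  have := absumD (absumB hR hX) (absumZ (a%:C)%C hdX); rewrite normc_real.
  apply: absum_mono => k; rewrite -eqk.
  have ii : ('i%C : C) * 'i%C = -1 by rewrite -expr2 sqr_i.
  have nn : ((nu k ^+ 2)%:C)%C = ((nu k)%:C)%C * ((nu k)%:C)%C by rewrite -rmorphM expr2.
  have -> : (((1 - nu k ^+ 2)%:C)%C - (a%:C)%C * dM om k) * X k - X k + (a%:C)%C * (dM om k * X k) =
    ('i%C * 'i%C) * ((nu k ^+ 2)%:C)%C * X k by rewrite ii rmorphB rmorph1; ring.
  rewrite /dM nn; move: ('i%C : C) ((nu k)%:C)%C (X k) => z1 z2 z3.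
  by rewrite le_eqVlt; apply/orP; left; apply/eqP; congr normc; ring.
pose V k := dM om k * X k.
have d1 t := is_derive_hull t hX hdX.
have d2 t := is_derive_hull (X := V) t hdX hddX.
have x1 : x^`()%classic = fun t => complex.Re (eval V (t *: om)).
  by apply: funext => t; rewrite derive1E; case: (d1 t).
have x2 t : x^`(2)%classic t = complex.Re (eval (fun k => dM om k * V k) (t *: om)).
  by rewrite derive1Sn /= /derive1n /= x1 derive1E; case: (d2 t).
have xtau t : x (t - tau) = complex.Re (eval (fun k => tauM om tau k * X k) (t *: om)).
  rewrite /x scalerBl -scaleNr -eval_shift; congr (complex.Re (eval _ _)); apply: funext => k.
  by rewrite dotrZr mulNr [tau * _]mulrC.
split.
- move=> t; split.
  + by case: (d1 t).
  + by rewrite x1; case: (d2 t).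
  rewrite x2 x1 xtau.
  have := eqv (t *: om).
  have -> : eval Rh (t *: om) = eval (fun k => dM om k * V k) (t *: om) - (a%:C)%C * eval V (t *: om) + eval X (t *: om).
    rewrite -(evalZ _ _ hdX) -(evalB _ hddX (absumZ _ hdX)) -(evalD _ (absumB hddX (absumZ _ hdX)) hX).
    congr eval; apply: funext => k; rewrite -eqk /V.
    have ii : ('i%C : C) * 'i%C = -1 by rewrite -expr2 sqr_i.
    have -> : dM om k * (dM om k * X k) = ('i%C * 'i%C) * ((nu k ^+ 2)%:C)%C * X k.
      have nn : ((nu k ^+ 2)%:C)%C = ((nu k)%:C)%C * ((nu k)%:C)%C by rewrite -rmorphM expr2.
      by rewrite /dM nn; move: ('i%C : C) ((nu k)%:C)%C (X k) => z1 z2 z3; ring.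
    by rewrite ii rmorphB rmorph1; ring.
  rewrite -/(x t) -/V /x; move: (f _ + _) => F.
  case: (eval (fun k => dM om k * V k) _) (eval V _) (eval X _) => u1 u2 [v1 v2] [z1 z2] /=.
  by move=> e; have -> : F = u1 - (a * v1 - 0 * v2) + z1 + a * z1 ^+ 2 * v1; [rewrite e|]; ring.
- exists (fun phi => complex.Re (eval X phi)); split=> //.
  + apply: (continuous_Re_csum hX) => k.
    rewrite /dotr; apply: continuous_big => [|i _ phi]; first exact: add_continuous.
    by apply: (@continuous_comp _ _ _ (fun M : 'rV[R]_n => M 0 i) (fun y : R => (k 0 i)%:~R * y)); [exact: coord_continuous|exact: mulrl_continuous].
  + move=> phi i; congr complex.Re; congr csum; apply: funext => k; congr (_ * _).
    rewrite dotrDr dotrZr (_ : dotr k (delta_mx 0 i) = (k 0 i)%:~R) ?cis_period //.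
    rewrite /dotr (bigD1 i) //= big1 => [|j ji]; rewrite !mxE ?eqxx /=; first by rewrite mulr1 addr0.
    by rewrite (negbTE ji) mulr0.
move=> t; apply: le_trans (ler_Re_normc _) _; exact: eval_le.
Qed.

End Solution.

(** * Scaled Taylor expansions of the delayed term and of the forcing *)

Section Nonlinearities.
Variables (R : realType) (n : nat).
Local Notation C := R[i].
Local Notation K := 'rV[int]_n.

Section Delayed.
Variables (f : R -> R) (fc : nat -> R) (rho M b1 : R).
Hypothesis rho_gt0 : 0 < rho.
Hypothesis fc_sum : absum (fun m : nat => ((fc m * rho ^+ m)%:C)%C) M.
Hypothesis f_eq : forall y, `|y| <= rho -> (f y)%:C%C = csum (fun m : nat => ((fc m * y ^+ m)%:C)%C).
Hypotheses (fc0 : fc 0%N = 0) (fc1 : fc 1%N = 1) (fc2 : fc 2%N = 0) (fc3 : fc 3%N = b1).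

Definition fG (m : nat) : K -> C := wconst ((fc m)%:C)%C.
(** The order is 4 because f''(0) = 0 and the linear and cubic terms of [f] are kept explicitly. *)
Definition remf s (w : K -> C) : K -> C := rem fG (fun=> 0%N) id (fun=> 0%N) 4 s w w w.

Lemma sym_fG m : sym (fG m).
Proof. exact: sym_wconst. Qed.

Lemma famsum_fG : famsum (fun t k => ((rho ^+ (0 + id t + 0))%:C)%C * fG t k) M.
Proof.
apply: (famsum_ex (B := fun m => normc (((fc m * rho ^+ m)%:C)%C))) => [m|s us]; last exact: fc_sum.
rewrite add0n addn0 mulrC rmorphM normcM /fG.
exact: (absumZ _ (absum_wconst _)).
Qed.

Lemma lip_remf s r B L (F : (K -> C) -> K -> C) : 0 <= r -> 0 < s -> 1 <= B -> 0 <= L ->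
  s * B <= rho / 2 -> lip r F B L ->
  lip r (fun h => remf s (F h)) ((B / rho) ^+ 4 * M) ((2 * B / rho) ^+ 4 * M * L).
Proof.
move=> r0 s0 B1 L0 sB lF.
by have [] := lip_rem rho_gt0 famsum_fG sym_fG 4 r0 s0 B1 L0 sB lF lF lF.
Qed.

Lemma eval_remf s B (w : K -> C) phi : 0 < s -> 1 <= B -> s * B <= rho / 2 -> absum w B -> sym w ->
  (f (s * complex.Re (eval w phi)))%:C%C = s%:C%C * eval w phi + (b1%:C * s%:C ^+ 3)%C * eval w phi ^+ 3 +
    (s%:C%C) ^+ 4 * eval (remf s w) phi.
Proof.
move=> s0 B1 sB hw sw.
have yr := eval_sym_real phi hw sw.
set y := complex.Re (eval w phi) in yr *.
have yB : `|s * y| <= rho.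
  rewrite normrM gtr0_norm //; apply: le_trans (_ : s * B <= _); last by apply: le_trans sB _; rewrite ler_pdivrMr // ler_peMr ?ler1n // ltW.
  by rewrite ler_pM2l //; apply: le_trans (ler_Re_normc _) _; exact: eval_le.
rewrite f_eq //.
have [[M' hM'] e4] := eval_rem rho_gt0 famsum_fG sym_fG 4 phi s0 B1 sB hw hw hw sw sw sw.
rewrite rmorphXn in e4; rewrite /remf -e4 -yr.
pose u1 (m : nat) : C := if (m < 4)%N then ((fc m * (s * y) ^+ m)%:C)%C else 0.
have hu1 : absum u1 (\sum_(m <- iota 0 4) normc (u1 m)).
  move=> q uq; rewrite (bigID (mem (iota 0 4))) /= [X in _ + X]big1 ?addr0.
    rewrite -big_filter; apply: ler_sum_sub; rewrite ?filter_uniq //.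
      by move=> k; rewrite mem_filter => /andP[].
    by move=> k; exact: normc_ge0.
  by move=> [|[|[|[|k]]]] //; rewrite /u1 normc0.
have -> : (fun m : nat => ((fc m * (s * y) ^+ m)%:C)%C) = fun m => u1 m +
    (if (4 <= 0 + id m + 0)%N then eval (fG m) phi * ((s%:C%C * eval w phi) ^+ 0 *
      (s%:C%C * eval w phi) ^+ m * (s%:C%C * eval w phi) ^+ 0) else 0).
  apply: funext => m; rewrite /u1 add0n addn0 ltnNge; case: leqP => _ /=; rewrite ?addr0 ?add0r //.
  by rewrite !expr0 mul1r mulr1 /fG eval_wconst -yr -rmorphM -rmorphXn -rmorphM.
rewrite (csumD hu1 hM') yr; congr (_ + _).
rewrite (@csum_seq _ _ _ (iota 0 4)) //; last first.
  by move=> [|[|[|[|k]]]].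
rewrite /= !big_cons big_nil /u1 /= fc0 fc1 fc2 fc3 -yr !(rmorphM, rmorphXn, rmorph0, rmorph1) /=.
by ring.
Qed.

End Delayed.

Section Forcing.
Variables (g : 'rV[R]_n -> R -> R -> R -> R) (T : eqType) (G : T -> K -> C).
Variables (E0 E1 E2 : T -> nat) (rho M : R).
Let deg t := (E0 t + E1 t + E2 t)%N.
Hypothesis rho_gt0 : 0 < rho.
Hypothesis famG : famsum (fun t k => ((rho ^+ (E0 t + E1 t + E2 t))%:C)%C * G t k) M.
Hypothesis symG : forall t, sym (G t).
Hypothesis g_eq : forall phi x y e, `|x| <= rho -> `|y| <= rho -> `|e| <= rho ->
  (g phi x y e)%:C%C = csum (fun t => eval (G t) phi * ((x ^+ E0 t * y ^+ E1 t * e ^+ E2 t)%:C)%C).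

Definition expo i j l (t : T) : bool := [&& E0 t == i, E1 t == j & E2 t == l].
(** The coefficient of x^i y^j eps^l in [g]: several members of the glued family share an exponent,
    one or more per patch, and are added up. *)
Definition gsel i j l : K -> C := wsel G (expo i j l).
Definition remg D s := rem G E0 E1 E2 D s.

Lemma expo_deg i j l t : expo i j l t -> (E0 t + E1 t + E2 t)%N = (i + j + l)%N.
Proof. by case/and3P => /eqP -> /eqP -> /eqP ->. Qed.

Lemma absum_gsel i j l : absum (gsel i j l) (M / rho ^+ (i + j + l)).
Proof. exact: (absum_wsel rho_gt0 famG (@expo_deg i j l)). Qed.

Lemma sym_gsel i j l : sym (gsel i j l).
Proof. exact: (sym_wsel rho_gt0 famG symG (@expo_deg i j l)). Qed.

Lemma eval_gsel i j l phi (z : T -> C) z0 : (forall t, expo i j l t -> z t = z0) ->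
  (exists M', absum (fun t => if expo i j l t then eval (G t) phi * z t else 0) M') /\
  csum (fun t => if expo i j l t then eval (G t) phi * z t else 0) = z0 * eval (gsel i j l) phi.
Proof.
by move=> hz; have [h1 h2] := eval_sel rho_gt0 famG phi (@expo_deg i j l) hz; split=> //; eexists; exact: h1.
Qed.

Section Eval.
Variables (s B : R) (wx wy we : K -> C) (phi : 'rV[R]_n).
Hypotheses (s0 : 0 < s) (B1 : 1 <= B) (sB : s * B <= rho / 2).
Hypotheses (hx : absum wx B) (hy : absum wy B) (he : absum we B).
Hypotheses (sx : sym wx) (sy : sym wy) (se : sym we).
Local Notation x := (complex.Re (eval wx phi)).
Local Notation y := (complex.Re (eval wy phi)).
Local Notation e := (complex.Re (eval we phi)).
Let u t := eval (G t) phi * ((s%:C%C * eval wx phi) ^+ E0 t *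
      (s%:C%C * eval wy phi) ^+ E1 t * (s%:C%C * eval we phi) ^+ E2 t).

Let gE : (g phi (s * x) (s * y) (s * e))%:C%C = csum u.
Proof.
have bd (w : K -> C) : absum w B -> `|s * complex.Re (eval w phi)| <= rho.
  move=> hw; rewrite normrM gtr0_norm //; apply: le_trans (_ : s * B <= _); last by apply: le_trans sB _; rewrite ler_pdivrMr // ler_peMr ?ler1n // ltW.
  by rewrite ler_pM2l //; apply: le_trans (ler_Re_normc _) _; exact: eval_le.
rewrite g_eq ?bd //; congr csum; apply: funext => t; congr (_ * _).
by rewrite -(eval_sym_real phi hx sx) -(eval_sym_real phi hy sy) -(eval_sym_real phi he se) !(rmorphM, rmorphXn).
Qed.

(** Epsilon is scaled as a third variable, eps = s e: the forced case uses the constant e = s^2, the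
    averaged case e = 1. *)
Lemma eval_remg1 : (g phi (s * x) (s * y) (s * e))%:C%C =
  eval (gsel 0 0 0) phi + s%:C%C * eval (remg 1 s wx wy we) phi.
Proof.
have [[M1 h1] e1] := eval_rem rho_gt0 famG symG 1 phi s0 B1 sB hx hy he sx sy se.
have [|[M0 h0] e0] := @eval_gsel 0 0 0 phi (fun t => (s%:C%C * eval wx phi) ^+ E0 t *
      (s%:C%C * eval wy phi) ^+ E1 t * (s%:C%C * eval we phi) ^+ E2 t) 1.
  by move=> t /and3P[/eqP -> /eqP -> /eqP ->]; rewrite !expr0 !mulr1.
rewrite expr1 in e1; rewrite gE /remg -e1 -[eval (gsel _ _ _) _]mul1r -e0 -(csumD h0 h1).
congr csum; apply: funext => t; rewrite /expo /u.
by case: (E0 t) => [|?]; case: (E1 t) => [|?]; case: (E2 t) => [|?]; rewrite /= ?addr0 ?add0r.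
Qed.

Lemma eval_remg2 : (g phi (s * x) (s * y) (s * e))%:C%C =
  eval (gsel 0 0 0) phi + s%:C%C * (eval wx phi * eval (gsel 1 0 0) phi +
    eval wy phi * eval (gsel 0 1 0) phi + eval we phi * eval (gsel 0 0 1) phi) +
  (s%:C%C) ^+ 2 * eval (remg 2 s wx wy we) phi.
Proof.
have [[M1 h1] e1] := eval_rem rho_gt0 famG symG 2 phi s0 B1 sB hx hy he sx sy se.
pose z t := (s%:C%C * eval wx phi) ^+ E0 t *
      (s%:C%C * eval wy phi) ^+ E1 t * (s%:C%C * eval we phi) ^+ E2 t.
have zE i j l t : expo i j l t -> z t = (s%:C%C * eval wx phi) ^+ i *
      (s%:C%C * eval wy phi) ^+ j * (s%:C%C * eval we phi) ^+ l.
  by rewrite /z => /and3P[/eqP -> /eqP -> /eqP ->].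
have sel i j l := @eval_gsel i j l phi z _ (zE i j l).
have [[N0 k0] f0] := sel 0%N 0%N 0%N; have [[N1 k1] f1] := sel 1%N 0%N 0%N.
have [[N2 k2] f2] := sel 0%N 1%N 0%N; have [[N3 k3] f3] := sel 0%N 0%N 1%N.
transitivity (csum (fun t => if expo 0 0 0 t then eval (G t) phi * z t else 0) +
  (csum (fun t => if expo 1 0 0 t then eval (G t) phi * z t else 0) +
  csum (fun t => if expo 0 1 0 t then eval (G t) phi * z t else 0) +
  csum (fun t => if expo 0 0 1 t then eval (G t) phi * z t else 0)) +
  csum (fun t => if (2 <= E0 t + E1 t + E2 t)%N then eval (G t) phi * z t else 0)); last first.
  by rewrite f0 f1 f2 f3 e1 /remg !expr0 !expr1 rmorphXn; ring.
rewrite -(csumD k1 k2) -(csumD (absumD k1 k2) k3) -(csumD k0 (absumD (absumD k1 k2) k3)).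
rewrite -(csumD (absumD k0 (absumD (absumD k1 k2) k3)) h1) gE.
congr csum; apply: funext => t; rewrite /expo /u -/(z t).
by case: (E0 t) => [|[|?]]; case: (E1 t) => [|[|?]]; case: (E2 t) => [|[|?]]; rewrite /= ?addr0 ?add0r.
Qed.

End Eval.
End Forcing.
End Nonlinearities.

Section Closing.
Variables (R : realType) (n : nat) (om : 'rV[R]_n).
Local Notation C := R[i].
Local Notation K := 'rV[int]_n.

Lemma lip_field r (u m : K -> C) Bu Cm : absum u Bu -> sym u -> 0 <= Cm ->
  (forall k, normc (m k) <= Cm) -> sym m ->
  lip r (fun h k => u k + m k * h k) (Bu + Cm * r) Cm.
Proof.
move=> hu su C0 hm sm.
by have := lipD (lip_const r hu su) (lip_mult r C0 hm sm); rewrite add0r.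
Qed.

Variables (f : R -> R) (g : 'rV[R]_n -> R -> R -> R -> R).
Variables (a tau p q r d w0 c2 s eps : R).
Hypotheses (c2_gt0 : 0 < c2) (d_gt0 : 0 < d) (s_gt0 : 0 < s).
Hypothesis lamL : forall w, c2 * (Num.max d (rdist w0 w) * (1 + `|w|)) <= lamN a tau p q r d w.
Local Notation m := (mult om a tau p q r d).
Variables (U RU H Z : K -> C) (M2 M3 M4 B : R).
Hypothesis ZE : forall k, Z k = m k * H k.
Hypotheses (hdU : absum (fun k => dM om k * U k) M2) (hRU : absum RU M3).
Hypotheses (hH : absum H M4) (sU : sym U) (sH : sym H).
Hypothesis hX : absum (fun k => U k + Z k) B.
Hypothesis eqU : forall k, (((1 - dotr k om ^+ 2)%:C)%C - (a%:C)%C * dM om k - tauM om tau k) * U k = RU k.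

(** The ansatz is X = s (U + m H), with [m] the multiplier d / L_d. As L_d (m H) = d H, the
    unshifted operator gives d H minus the shift applied to m H; this is the bracket in the
    hypothesis, and the artificial shift is thereby removed. *)
Lemma solution_of_fixpoint :
  (forall phi,
    let x := eval (fun k => U k + Z k) phi in
    let y := eval (fun k => tauM om tau k * (U k + Z k)) phi in
    let v := eval (fun k => dM om k * (U k + Z k)) phi in
    s%:C%C * (y + (eval RU phi + d%:C%C * (eval H phi - (p%:C%C * eval (fun k => dM om k * Z k) phi +
       q%:C%C * eval Z phi + r%:C%C * eval (fun k => tauM om tau k * Z k) phi)))) =
    (f (s * complex.Re y))%:C%C + eps%:C%C * (g phi (s * complex.Re x) (s * complex.Re y) eps)%:C%C -
      a%:C%C * s%:C%C ^+ 3 * x ^+ 2 * v) ->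
  exists x : R -> R, [/\ vdp_solution f g om a tau eps x, quasi_periodic om x &
    forall t, `|x t| <= s * B].
Proof.
move=> key.
have c20 : 0 <= 2 / c2 by rewrite divr_ge0 // ltW.
have mb k := mult_bounded om c2_gt0 d_gt0 lamL k.
have hZ : absum Z (2 / c2 * M4).
  apply: absum_mono (absumM_bounded c20 (fun k => (mb k).1) hH) => k; by rewrite ZE.
have hdZ : absum (fun k => dM om k * Z k) (2 / c2 * M4).
  by apply: absum_mono (absumM_bounded c20 (fun k => (mb k).2) hH) => k; rewrite ZE mulrA.
have sZ : sym Z by move=> k; rewrite !ZE; exact: (symM (sym_mult om a tau p q r d) sH).
pose W k := U k + Z k.
have sW : sym W := symD sU sZ.
have hdW : absum (fun k => dM om k * W k) (M2 + 2 / c2 * M4).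
  by apply: absum_mono (absumD hdU hdZ) => k; rewrite /W mulrDr.
have htW := absum_tauM om tau hX; have htZ := absum_tauM om tau hZ.
pose X k := s%:C%C * W k.
pose Rh k := s%:C%C * (tauM om tau k * W k + (RU k + d%:C%C * (H k - (p%:C%C * (dM om k * Z k) +
  q%:C%C * Z k + r%:C%C * (tauM om tau k * Z k))))).
have hL := absumD (absumD (absumZ p%:C%C hdZ) (absumZ q%:C%C hZ)) (absumZ r%:C%C htZ).
have hHL := absumZ d%:C%C (absumB hH hL).
have hRh : absum Rh _ := absumZ s%:C%C (absumD htW (absumD hRU hHL)).
have hXX : absum X (s * B) by have := absumZ s%:C%C hX; rewrite normc_real gtr0_norm.
have hdX : absum (fun k => dM om k * X k) (normc (s%:C%C) * (M2 + 2 / c2 * M4)).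
  by apply: absum_mono (absumZ s%:C%C hdW) => k; rewrite /X mulrCA.
have eqk k : (((1 - dotr k om ^+ 2)%:C)%C - (a%:C)%C * dM om k) * X k = Rh k.
  rewrite /X /Rh /W -eqU; have := lam_mult om c2_gt0 d_gt0 lamL k; rewrite lamCE ZE.
  set w := ((1 - _)%:C)%C; move: (m k) w (dM om k) (tauM om tau k) => mk w dk tk.
  move: (a%:C%C) (p%:C%C) (q%:C%C) (r%:C%C) (d%:C%C) (s%:C%C) => a' p' q' r' d' s' e.
  have -> : d' * (H k - (p' * (dk * (mk * H k)) + q' * (mk * H k) + r' * (tk * (mk * H k)))) =
    d' * H k - d' * (p' * dk + q' + r' * tk) * mk * H k by ring.
  by rewrite -[in d' * H k]e; ring.
have [|v1 v2 v3] := solution_of_coeffs hXX hdX hRh (symZ s sW) eqk (f := f) (g := g) (tau := tau) (eps := eps).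
  move=> phi.
  have re (u : K -> C) Mu : absum u Mu -> sym u -> complex.Re (eval (fun k => s%:C%C * u k) phi) = s * complex.Re (eval u phi).
    move=> hu su; rewrite (evalZ _ _ hu) -(eval_sym_real phi hu su) -rmorphM //.
  have st : sym (fun k => tauM om tau k * W k) by apply: symM => //; exact: sym_tauM.
  have sd : sym (fun k => dM om k * W k) by apply: symM => //; exact: sym_dM.
  rewrite (_ : (fun k => tauM om tau k * X k) = fun k => s%:C%C * (tauM om tau k * W k)); last by apply: funext => k; rewrite /X mulrCA.
  rewrite (_ : (fun k => dM om k * X k) = fun k => s%:C%C * (dM om k * W k)); last by apply: funext => k; rewrite /X mulrCA.
  rewrite (re _ _ htW st) (re _ _ hdW sd) (re _ _ hX sW).
  rewrite /Rh (evalZ _ _ (absumD htW (absumD hRU hHL))) (evalD _ htW (absumD hRU hHL)) (evalD _ hRU hHL).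
  rewrite (evalZ _ _ (absumB hH hL)) (evalB _ hH hL).
  rewrite (evalD _ (absumD (absumZ p%:C%C hdZ) (absumZ q%:C%C hZ)) (absumZ r%:C%C htZ)).
  rewrite (evalD _ (absumZ p%:C%C hdZ) (absumZ q%:C%C hZ)) (evalZ _ _ hdZ) (evalZ _ _ hZ) (evalZ _ _ htZ).
  rewrite key -(eval_sym_real phi hX sW) -(eval_sym_real phi hdW sd) -!rmorphM -!rmorphXn -!rmorphM -rmorphD -rmorphB /=.
  by ring.
by exists (fun t => complex.Re (eval X (t *: om))).
Qed.

End Closing.

(** * The two bifurcation scalings *)

Lemma critical_le2 (R : realType) (a w0 tau : R) : critical a w0 tau -> `|a| <= 2.
Proof. by case=> /andP[a1 a2] _ _ _ _; rewrite ger0_norm; lra. Qed.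

Section ForcedArithmetic.
Variables (R : realType) (A be Kc Cm rho b a : R).
Hypotheses (A0 : 0 <= A) (be0 : 0 <= be) (KcE : Kc = 2 * (2 * A + 1) + be * (3 * A + 1)).
Hypotheses (Cm1 : 1 <= Cm) (b0 : 0 < b) (bE : 12 * Kc * Cm * b = 1).
Hypotheses (a0 : 0 <= a) (a2 : a <= 2).

Let Kc2 : 2 <= Kc.
Proof. by have := mulr_ge0 be0 A0; rewrite KcE mulrDr; move: be0 A0; lra. Qed.

Lemma forced_radius : b <= 1 / 24.
Proof.
have h : 2 * 1 <= Kc * Cm by apply: ler_pM.
have : 2 * 1 * b <= Kc * Cm * b by rewrite ler_pM2r.
move: bE; rewrite (_ : 12 * Kc * Cm * b = 12 * (Kc * Cm * b)); last by ring.
by lra.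
Qed.

Let b1 : b <= 1.
Proof. by apply: le_trans forced_radius _; lra. Qed.

(** [A] stands for |c|, [be] for |b1|, and [b] bounds the oscillation together with its derivative
    and its delayed copy. The left side is quadratic in [b], and [Kc] collects its coefficients; 12
    Kc Cm b = 1 leaves half of the ball to the Taylor remainders. *)
Lemma forced_value : b = 2 * (Cm * rho) ->
  a * ((2 * A * b + b * b) * b) + be * (3 * A * (b * b) + b * (b * b)) <= rho / 2.
Proof.
move=> bR.
have bb : 0 <= b * b by rewrite mulr_ge0 // ltW.
have h1 : (2 * A * b + b * b) * b <= (2 * A + 1) * (b * b).
  have : b * (b * b) <= 1 * (b * b) by rewrite ler_wpM2r.
  have -> : (2 * A * b + b * b) * b = 2 * A * (b * b) + b * (b * b) by ring.
  by move=> ?; rewrite [leRHS]mulrDl lerD2l.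
have h2 : 3 * A * (b * b) + b * (b * b) <= (3 * A + 1) * (b * b).
  by rewrite -mulrDl ler_wpM2r // lerD2l.
have h3 : a * ((2 * A * b + b * b) * b) <= 2 * ((2 * A + 1) * (b * b)).
  by apply: ler_pM => //; rewrite mulr_ge0 // ?addr_ge0 // ?mulr_ge0 // ltW.
have h4 := ler_wpM2l be0 h2.
have h5 : 2 * ((2 * A + 1) * (b * b)) + be * ((3 * A + 1) * (b * b)) = Kc * (b * b) by rewrite KcE; ring.
have h6 : 12 * Kc * Cm * b * b = 2 * (Cm * rho) by rewrite bE mul1r.
have h7 : Cm * (6 * (Kc * (b * b))) = Cm * rho by move: h6; rewrite (_ : 12 * Kc * Cm * b * b = 2 * (Cm * (6 * (Kc * (b * b))))); [lra|ring].
have Cm0 : Cm != 0 by rewrite gt_eqF // (lt_le_trans ltr01).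
have h8 : 6 * (Kc * (b * b)) = rho by apply: (mulfI Cm0).
have h9 : 0 <= Kc * (b * b) by rewrite mulr_ge0 // (le_trans _ Kc2).
move: h3 h4 h5 h8 h9; lra.
Qed.

Lemma forced_lip : a * ((2 * A * Cm + (Cm * b + b * Cm)) * b + (2 * A * b + b * b) * Cm) +
  be * (3 * A * (Cm * b + b * Cm) + (Cm * (b * b) + b * (Cm * b + b * Cm))) <= 1 / 4.
Proof.
pose t := Cm * b; have t0 : 0 < t by rewrite mulr_gt0 // (lt_le_trans ltr01).
have At : 0 <= A * t by rewrite mulr_ge0 // ltW.
have bt : b * t <= t by rewrite ler_piMl // ltW.
have bt0 : 0 <= b * t by rewrite mulr_ge0 // ltW.
have h1 : (2 * A * Cm + (Cm * b + b * Cm)) * b + (2 * A * b + b * b) * Cm <= 3 * ((2 * A + 1) * t).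
  rewrite (_ : _ + _ = 4 * (A * t) + 3 * (b * t)); last by rewrite /t; ring.
  rewrite (_ : 3 * ((2 * A + 1) * t) = 6 * (A * t) + 3 * t); last by ring.
  by move: At bt; lra.
have h10 : 0 <= (2 * A * Cm + (Cm * b + b * Cm)) * b + (2 * A * b + b * b) * Cm.
  rewrite (_ : _ + _ = 4 * (A * t) + 3 * (b * t)); last by rewrite /t; ring.
  by move: At bt0; lra.
have h2 : 3 * A * (Cm * b + b * Cm) + (Cm * (b * b) + b * (Cm * b + b * Cm)) <= 3 * ((3 * A + 1) * t).
  rewrite (_ : _ + _ = 6 * (A * t) + 3 * (b * t)); last by rewrite /t; ring.
  rewrite (_ : 3 * ((3 * A + 1) * t) = 9 * (A * t) + 3 * t); last by ring.
  by move: At bt; lra.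
have h3 := ler_pM a0 h10 a2 h1; have h4 := ler_wpM2l be0 h2.
have h5 : 2 * (3 * ((2 * A + 1) * t)) + be * (3 * ((3 * A + 1) * t)) = 3 * (Kc * t) by rewrite KcE; ring.
have h6 : 12 * (Kc * t) = 1 by rewrite -[RHS]bE /t; ring.
by move: h3 h4 h5 h6; lra.
Qed.

End ForcedArithmetic.

Section ConstantModes.
Variables (R : realType) (n : nat) (om : 'rV[R]_n).
Local Notation C := R[i].

Lemma tauM_wconst tau (z : C) k : tauM om tau k * wconst z k = wconst z k.
Proof.
rewrite /wconst; case: eqP => [->|_]; last by rewrite mulr0.
by rewrite /tauM dotr0l mul0r oppr0 cis0 mul1r.
Qed.

Lemma dM_wconst (z : C) k : dM om k * wconst z k = 0.
Proof.
rewrite /wconst; case: eqP => [->|_]; last by rewrite mulr0.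
by rewrite /dM dotr0l mulr0 mul0r.
Qed.

End ConstantModes.

(** If both points were within e / 2 of the set {0, w0, -w0}, their difference would be within e of
    0, +-w0 or +-2 w0. *)
Lemma rdist_diff (R : realType) (w0 x y e : R) : 0 <= w0 -> e <= rdist w0 (x - y) ->
  e <= `| `|x - y| - 2 * w0| -> e / 2 <= rdist w0 x \/ e / 2 <= rdist w0 y.
Proof.
move=> w00 h1 h2.
have near (z : R) : rdist w0 z < e / 2 -> exists c : R, [/\ [\/ c = 0, c = w0 | c = - w0] & `|z - c| < e / 2].
  rewrite /rdist gt_min => /orP[h|h]; first by exists 0; split; [constructor 1|rewrite subr0].
  have [z0|z0] := leP 0 z.
    by exists w0; split; [constructor 2|rewrite (ger0_norm z0) in h].
  exists (- w0); split; first by constructor 3.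
  by rewrite (ltr0_norm z0) in h; rewrite opprK -normrN opprD.
have far (c : R) : [\/ c = 0, `|c| = w0 | `|c| = 2 * w0] -> e <= `|x - y - c|.
  move: h1; rewrite /rdist le_min => /andP[h0 h1].
  case=> cE; first by rewrite cE subr0.
    by apply: le_trans h1 _; rewrite -cE; exact: ler_dist_dist.
  by apply: le_trans h2 _; rewrite -cE; exact: ler_dist_dist.
have [|lx] := leP (e / 2) (rdist w0 x); first by left.
have [|ly] := leP (e / 2) (rdist w0 y); first by right.
have [c [hc cx]] := near _ lx; have [c' [hc' cy]] := near _ ly.
have : e <= `|x - y - (c - c')|.
  apply: far; have w2 : `|2 * w0| = 2 * w0 by rewrite ger0_norm // mulr_ge0.
  have w1 := ger0_norm w00.
  case: hc => ->; case: hc' => ->; rewrite ?subr0 ?sub0r ?opprK ?subrr ?normrN ?oppr0 ?w1.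
  all: try by [constructor 1|constructor 2].
  - by constructor 3; rewrite -[RHS]w2; congr `|_|; ring.
  - by constructor 3; rewrite -[RHS]w2 -normrN; congr `|_|; ring.
  - by constructor 1; ring.
have -> : x - y - (c - c') = (x - c) - (y - c') by ring.
have := ler_normB (x - c) (y - c'); lra.
Qed.

Lemma lipschitz_share (R : realType) (x y : R) : 0 <= y -> 4 * x + 4 * y <= 1 -> x <= 1 / 4.
Proof. lra. Qed.

Lemma value_share (R : realType) (x y z t : R) :
  t = 2 * z -> 0 < t -> x <= 1 / 4 * t -> y <= z -> x + y <= t.
Proof. lra. Qed.

Lemma conv_addr (R : realType) (n : nat) (a b b' : 'rV[int]_n -> R[i]) M N N' k :
  absum a M -> absum b N -> absum b' N' ->
  conv a (fun j => b j + b' j) k = conv a b k + conv a b' k.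
Proof.
move=> ha hb hb'; rewrite /conv /wsum -(csumD (famsum_at k (famsum_conv ha hb)) (famsum_at k (famsum_conv ha hb'))).
by congr csum; apply: funext => j; rewrite mulrDl.
Qed.

Lemma normc_response (R : realType) (c1 r t : R) (z l : R[i]) : 0 < c1 -> 0 < r -> 0 < normc l ->
  c1 * r * (1 + `|t|) <= 2 * normc l ->
  normc (z / l) * (1 + `|t|) <= normc ((2 / c1)%:C%C * ((r^-1)%:C%C * z)).
Proof.
move=> c0 r0 l0; rewrite normcM normcV !normcM !normc_real.
have c1p : 0 <= 2 / c1 by rewrite divr_ge0 // ltW.
have rp : 0 <= r^-1 by rewrite invr_ge0 ltW.
rewrite (ger0_norm c1p) (ger0_norm rp).
move: (normc l) l0 (normc z) (normc_ge0 z) => m m0 y y0 h.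
rewrite mulrAC ler_pdivrMr //.
have -> : 2 / c1 * (r^-1 * y) * m = y * (2 * m / (c1 * r)) by field; rewrite !gt_eqF.
by rewrite ler_wpM2l // ler_pdivlMr ?mulr_gt0 // mulrC.
Qed.

Section Continuation.
Variables (R : realType) (n : nat) (om : 'rV[R]_n).
Local Notation C := R[i].
Local Notation K := 'rV[int]_n.

Variables (f : R -> R) (fc : nat -> R) (rf Mf b1 : R).
Hypothesis rf_gt0 : 0 < rf.
Hypothesis fc_sum : absum (fun m : nat => ((fc m * rf ^+ m)%:C)%C) Mf.
Hypothesis f_eq : forall y, `|y| <= rf -> (f y)%:C%C = csum (fun m : nat => ((fc m * y ^+ m)%:C)%C).
Hypotheses (fc0 : fc 0%N = 0) (fc1 : fc 1%N = 1) (fc2 : fc 2%N = 0) (fc3 : fc 3%N = b1).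

Variables (g : 'rV[R]_n -> R -> R -> R -> R) (T : eqType) (G : T -> K -> C).
Variables (E0 E1 E2 : T -> nat) (rg Mg : R).
Hypothesis rg_gt0 : 0 < rg.
Hypothesis famG : famsum (fun t k => ((rg ^+ (E0 t + E1 t + E2 t))%:C)%C * G t k) Mg.
Hypothesis symG : forall t, sym (G t).
Hypothesis g_eq : forall phi x y e, `|x| <= rg -> `|y| <= rg -> `|e| <= rg ->
  (g phi x y e)%:C%C = csum (fun t => eval (G t) phi * ((x ^+ E0 t * y ^+ E1 t * e ^+ E2 t)%:C)%C).

Let Mf0 : 0 <= Mf := absum_ge0 fc_sum.
Let Mg0 : 0 <= Mg := absum_ge0 famG.

Notation gs i j l := (gsel G E0 E1 E2 i j l).

(* Scaling x = s (c + z), eps = s^3: the constant c balances the average of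
   g_00 against b1 c^3, and z is the new unknown. *)
Lemma forced_case (c F0 : R) (r : K -> R) : b1 != 0 -> c != 0 -> 0 < F0 ->
  (forall k, k != 0 -> 0 < r k) ->
  (b1 * c ^+ 3)%:C%C + gs 0 0 0 0 = 0 ->
  exists s1 Cx : R, 0 < s1 /\ forall s a w0 tau, 0 < s <= s1 -> critical a w0 tau ->
    F0 <= `|transv a w0 tau (a * c ^+ 2) 0 (- (3 * b1 * c ^+ 2))| ->
    (forall k, k != 0 -> r k <= rdist w0 (dotr k om)) ->
  exists x : R -> R, [/\ vdp_solution f g om a tau (s ^+ 3) x, quasi_periodic om x &
    forall t, `|x t| <= s * Cx].
Proof.
move=> b10 c0 F00 r0 bal.
(* The shift is the linearization at the constant [c]: the damping a x^2 x' gives p = a c^2, and b1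
   y^3, moved to the left side, gives - 3 b1 c^2 on the delayed term. *)
pose q : R := 0; pose rr : R := - (3 * b1 * c ^+ 2).
have qr : q + rr != 0 by rewrite add0r oppr_eq0 !mulf_neq0 ?expf_neq0 ?pnatr_eq0.
have [d0 [c2 [d00 c20 lamU]]] := lamN_uniform (c ^+ 2) F00 qr.
pose Cm := 2 / c2 + 1; have c2p : 0 < 2 / c2 by rewrite divr_gt0.
have Cm1 : 1 <= Cm by rewrite lerDr ltW.
have Cm0 : 0 < Cm by lra.
pose A := `|c|; have A0 : 0 <= A := normr_ge0 c.
pose be := `|b1|; have be0 : 0 <= be := normr_ge0 b1.
pose Kc := 2 * (2 * A + 1) + be * (3 * A + 1).
have beA : 0 <= be * A by rewrite mulr_ge0.
have Kc2 : 2 <= Kc by rewrite /Kc mulrDr; lra.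
pose rho := (24 * Kc * Cm ^+ 2)^-1.
have rho0 : 0 < rho by rewrite invr_gt0 !mulr_gt0 // ?exprn_gt0 //; lra.
have rhoE : 24 * Kc * Cm * (Cm * rho) = 1.
  by rewrite /rho; field; rewrite (gt_eqF Cm0) gt_eqF //; lra.
(* The oscillation bound [b] is shared equally between the response to the forcing, at most [eta],
   and the multiplier applied to the unknown, at most Cm * rho. *)
pose eta := Cm * rho; have eta0 : 0 < eta by rewrite mulr_gt0.
pose b := eta + Cm * rho.
have bE : 12 * Kc * Cm * b = 1 by apply: etrans rhoE; rewrite /b /eta; ring.
have b0 : 0 < b by rewrite addr_gt0 // mulr_gt0.
have bR : b = 2 * (Cm * rho) by rewrite /b /eta; ring.
have b1' : b <= 1.
  by apply: le_trans (forced_radius A0 be0 (erefl Kc) Cm1 b0 bE) _; lra.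
pose B := A + 1; have B1 : 1 <= B by rewrite lerDr.
(* The balance condition removes the zero mode of the forcing, so [small_mult] makes its response
   smaller than [eta]. *)
pose h0 k := wconst ((b1 * c ^+ 3)%:C%C) k + gs 0 0 0 k.
have hG0 := absum_gsel rg_gt0 famG 0 0 0.
have sG0 := sym_gsel rg_gt0 famG symG 0 0 0.
have hh0 : absum h0 _ := absumD (absum_wconst _) hG0.
have sh0 : sym h0 := symD (sym_wconst _) sG0.
have h00 : h0 0 = 0 by rewrite /h0 /wconst eqxx.
have [d1 d10 small] := small_mult hh0 h00 r0 Cm0 eta0.
pose K4 := (B / rf) ^+ 4 * Mf; pose L4 := (2 * B / rf) ^+ 4 * Mf * Cm.
pose K1 := (B / rg) ^+ 1 * Mg; pose L1 := (2 * B / rg) ^+ 1 * Mg * Cm.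
have Bn0 : 0 <= B by lra.
have pos x e D : 0 <= x -> 0 < e -> 0 <= (x / e) ^+ D :> R.
  by move=> x0 e0; rewrite exprn_ge0 // divr_ge0 // ltW.
have B20 : 0 <= 2 * B by rewrite mulr_ge0.
have K40 : 0 <= K4 by apply: mulr_ge0 => //; exact: pos.
have K10 : 0 <= K1 by apply: mulr_ge0 => //; exact: pos.
have L40 : 0 <= L4 by apply: mulr_ge0 (ltW Cm0); apply: mulr_ge0 => //; exact: pos.
have L10 : 0 <= L1 by apply: mulr_ge0 (ltW Cm0); apply: mulr_ge0 => //; exact: pos.
pose D := 1 + K4 + K1 + L4 + L1.
have D1 : 1 <= D by rewrite /D; lra.
(* The entries serve in turn the normalization s <= 1, the lower bound on L_d, the response to [h0],
   convergence of the Taylor series of [f] and [g], and the size and Lipschitz constant of the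
   remainders. *)
pose s1 := Num.min (Num.min (Num.min 1 d0) (Num.min d1 (rf / 2 / B)))
  (Num.min (rg / 2 / B) (Num.min (rho / 2 / D) (1 / 4 / D))).
have D0 : 0 < D by exact: lt_le_trans ltr01 D1.
have B0 : 0 < B by exact: lt_le_trans ltr01 B1.
exists s1, B; split; first by rewrite /s1 !lt_min ltr01 d00 d10 !divr_gt0.
move=> s a w0 tau /andP[s0 ss] crit hF nonres.
move: ss; rewrite /s1 !le_min => /andP[/andP[/andP[sle1 sd0] /andP[sd1 srf]] /andP[srg /andP[srho sL]]].
rewrite (ler_pdivlMr _ _ B0) in srf; rewrite (ler_pdivlMr _ _ B0) in srg.
rewrite (ler_pdivlMr _ _ D0) in srho; rewrite (ler_pdivlMr _ _ D0) in sL.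
pose d := s ^+ 2; have dp : 0 < d by rewrite exprn_gt0.
have ds : d <= s by rewrite /d expr2 ler_piMl // ltW.
have lamL w : c2 * (Num.max d (rdist w0 w) * (1 + `|w|)) <= lamN a tau (a * c ^+ 2) q rr d w.
  by apply: lamU crit hF _ _ _; rewrite dp (le_trans ds).
pose m := mult om a tau (a * c ^+ 2) q rr d.
have sm : sym m := sym_mult om a tau (a * c ^+ 2) q rr d.
have mb k : normc (m k) <= Cm /\ normc (dM om k * m k) <= Cm.
  by have [h1 h2] := mult_bounded om c20 dp lamL k; split; [apply: le_trans h1 _|apply: le_trans h2 _]; rewrite lerDl.
have mb' k : k != 0 -> normc (m k) <= Cm * d / r k /\ normc (dM om k * m k) <= Cm * d / r k.
  move=> k0; have rk := r0 _ k0.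
  have [|h1 h2] := @mult_bounds _ _ om a tau (a * c ^+ 2) q rr d w0 c2 c20 dp lamL k (r k) rk.
    by rewrite le_max nonres ?orbT.
  have le : 2 / c2 * d / r k <= Cm * d / r k.
    by rewrite ler_pM2r ?invr_gt0 // ler_pM2r // /Cm lerDl.
  by split; [exact: le_trans h1 le|exact: le_trans h2 le].
have dd1 : 0 < d <= d1 by rewrite dp (le_trans ds).
have hz0 := small d m dd1 (fun k _ => (mb k).1) (fun k k0 => (mb' k k0).1).
have hv0 := small d (fun k => dM om k * m k) dd1 (fun k _ => (mb k).2) (fun k k0 => (mb' k k0).2).
have sd := @sym_dM _ _ om; have st := sym_tauM om tau.
pose Z (h : K -> C) k := m k * h0 k + m k * h k.
pose V (h : K -> C) k := dM om k * m k * h0 k + dM om k * m k * h k.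
pose Y (h : K -> C) k := tauM om tau k * (m k * h0 k) + tauM om tau k * m k * h k.
have lZ : lip rho Z b Cm.
  by apply: lip_field => //; [exact: symM|exact: ltW|move=> k; case: (mb k)].
have lV : lip rho V b Cm.
  apply: lip_field => //; [|exact: ltW|by move=> k; case: (mb k)|exact: symM].
  by apply: symM => //; exact: symM.
have lY : lip rho Y b Cm.
  apply: lip_field; [exact: absum_tauM|by apply: symM => //; exact: symM|exact: ltW| |exact: symM].
  by move=> k; rewrite normcM normc_cis mul1r; case: (mb k).
have hcc : absum (wconst c%:C%C : K -> C) A by rewrite /A -normc_real; exact: absum_wconst.
have scc : sym (wconst c%:C%C : K -> C) := sym_wconst c.
have ltot (F : (K -> C) -> K -> C) : lip rho F b Cm -> lip rho (fun h k => wconst c%:C%C k + F h k) B Cm.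
  move=> lF; apply: (@lip_weaken _ _ rho rho _ (A + b) B (0 + Cm) Cm (lexx _) _ _ (lipD (lip_const rho hcc scc) lF)).
    by rewrite lerD2l.
  by rewrite add0r.
pose X (h : K -> C) k := wconst c%:C%C k + Z h k.
pose Yt (h : K -> C) k := wconst c%:C%C k + Y h k.
have lX : lip rho X B Cm := ltot _ lZ.
have lYt : lip rho Yt B Cm := ltot _ lY.
have hE : absum (wconst (s ^+ 2)%:C%C : K -> C) B.
  apply: absum_le _ (absum_wconst _); rewrite normc_real ger0_norm ?exprn_ge0 ?(ltW s0) //.
  by apply: le_trans B1; rewrite exprn_ile1 // ltW.
have lE : lip rho (fun=> wconst (s ^+ 2)%:C%C : K -> C) B Cm.
  exact: (@lip_weaken _ _ rho rho _ B B 0 Cm (lexx _) (lexx _) (ltW Cm0) (lip_const rho hE (sym_wconst _))).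
pose Q1 h := conv (fun k => (2 * c)%:C%C * Z h k + conv (Z h) (Z h) k) (V h).
pose Q2 h k := (3 * c)%:C%C * conv (Y h) (Y h) k + conv (Y h) (conv (Y h) (Y h)) k.
(* What is left of the equation after division by s^3, with the linear part and [h0] removed. *)
pose v h k := (- a)%:C%C * Q1 h k + b1%:C%C * Q2 h k +
  s%:C%C * (remf fc s (Yt h) k + remg G E0 E1 E2 1 s (X h) (Yt h) (wconst (s ^+ 2)%:C%C) k).
have a2 : `|a| <= 2 := critical_le2 crit.
have lQ1 := lip_conv (lipD (lipZ (2 * c) lZ) (lip_conv lZ lZ)) lV.
have lQ2 := lipD (lipZ (3 * c) (lip_conv lY lY)) (lip_conv lY (lip_conv lY lY)).
have lf : lip rho (fun h => remf fc s (Yt h)) K4 L4.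
  exact: (lip_remf rf_gt0 fc_sum (ltW rho0) s0 B1 (ltW Cm0) srf lYt).
have [lg _] := lip_rem rg_gt0 famG symG 1 (ltW rho0) s0 B1 (ltW Cm0) srg lX lYt lE.
have lv : lip rho v rho 2^-1.
  apply: (lip_weaken (lexx _) _ _ (lipD (lipD (lipZ (- a) lQ1) (lipZ b1 lQ2)) (lipZ s (lipD lf lg))));
    rewrite -/K1 -/L1 normrN (gtr0_norm s0) !normrM !(ger0_norm (ler0n _ _)) -/A -/be.
    have h1 := forced_value A0 be0 (erefl Kc) Cm1 b0 bE (normr_ge0 a) a2 (bR : b = 2 * (Cm * rho)).
    have -> : rho = rho / 2 + rho / 2 by field.
    apply: lerD h1 (le_trans _ srho); rewrite ler_wpM2l ?(ltW s0) //.
    apply: le_trans (_ : 1 + K4 + K1 <= _); first by rewrite -[leRHS]addrA lerDr.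
    by rewrite /D -[leRHS]addrA lerDl addr_ge0.
  have h1 := forced_lip A0 be0 (erefl Kc) Cm1 b0 bE (normr_ge0 a) a2.
  have -> : 2^-1 = 1 / 4 + 1 / 4 :> R by field.
  apply: lerD h1 (le_trans _ sL); rewrite ler_wpM2l ?(ltW s0) // -/L4 -/L1.
  by rewrite /D -[leRHS]addrA lerDr !addr_ge0.
have [h [hh sh vh]] := fixpoint_lip (ltW rho0) lv.
pose H k := h0 k + h k.
have sh' : sym H := symD sh0 sh.
have hH : absum H _ := absumD hh0 hh.
have [/(_ _ hh) hZ _ _] := lZ; have [/(_ _ hh) hV _ _] := lV; have [/(_ _ hh) hY _ _] := lY.
have [/(_ _ hh) hX _ /(_ _ hh sh) sX] := lX; have [/(_ _ hh) hYt _ /(_ _ hh sh) sYt] := lYt.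
have XE : (fun k => wconst c%:C%C k + m k * H k) = X h.
  by apply: funext => k; rewrite /X /Z /H mulrDr.
have YE : (fun k => tauM om tau k * (wconst c%:C%C k + m k * H k)) = Yt h.
  by apply: funext => k; rewrite /Yt /Y /H mulrDr tauM_wconst !mulrDr -mulrA.
have VE : (fun k => dM om k * (m k * H k)) = V h.
  by apply: funext => k; rewrite /V /H !mulrDr !mulrA.
apply: (@solution_of_fixpoint _ _ om f g a tau (a * c ^+ 2) q rr d w0 c2 s (s ^+ 3) c20 dp s0 lamL
  (wconst c%:C%C) (fun=> 0) H (fun k => m k * H k) 0 0 _ B (fun k => erefl) _ _ hH scc sh').
- by apply: absum_mono (@absum0 _ _) => k; rewrite dM_wconst.
- exact: absum0.
- by rewrite XE.
- move=> k; rewrite /wconst; case: eqP => [->|_]; rewrite ?mulr0 //.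
  by rewrite /dM /tauM dotr0l mul0r oppr0 cis0 expr0n subr0 !mulr0 subr0 subrr mul0r.
move=> phi; cbv zeta; rewrite XE YE.
have -> : (fun k => dM om k * (wconst c%:C%C k + m k * H k)) = V h.
  by rewrite -VE; apply: funext => k; rewrite mulrDr dM_wconst add0r.
have -> : (fun k => tauM om tau k * (m k * H k)) = Y h.
  by apply: funext => k; rewrite /Y /H !mulrDr !mulrA.
have -> : (fun k => m k * H k) = Z h by apply: funext => k; rewrite /Z /H mulrDr.
rewrite VE (eval_remf rf_gt0 fc_sum f_eq fc0 fc1 fc2 fc3 phi s0 B1 srf hYt sYt).
have eE : s * complex.Re (eval (wconst (s ^+ 2)%:C%C : K -> C) phi) = s ^+ 3.
  by rewrite eval_wconst /= -exprS.
have gE := eval_remg1 rg_gt0 famG symG g_eq phi s0 B1 srg hX hYt hE sX sYt (sym_wconst _).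
rewrite eE in gE; rewrite gE.
have -> : eval H phi = (b1 * c ^+ 3)%:C%C + eval (gs 0 0 0) phi + eval (v h) phi.
  by rewrite vh (evalD _ hh0 hh) (evalD _ (absum_wconst _) hG0) eval_wconst.
have hcZ := absumZ (2 * c)%:C%C hZ; have hZZ := absum_conv hZ hZ.
have hYY := absum_conv hY hY; have hYYY := absum_conv hY hYY; have hcY := absumZ (3 * c)%:C%C hYY.
have hQ1 : absum (Q1 h) _ := absum_conv (absumD hcZ hZZ) hV.
have hQ2 : absum (Q2 h) _ := absumD hcY hYYY.
have [/(_ _ hh) hF4 _ _] := lf; have [/(_ _ hh) hF1 _ _] := lg.
have -> : eval (v h) phi = (- a)%:C%C * ((2 * c)%:C%C * eval (Z h) phi + eval (Z h) phi ^+ 2) * eval (V h) phi +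
   b1%:C%C * ((3 * c)%:C%C * eval (Y h) phi ^+ 2 + eval (Y h) phi ^+ 3) +
   s%:C%C * (eval (remf fc s (Yt h)) phi + eval (remg G E0 E1 E2 1 s (X h) (Yt h) (wconst (s ^+ 2)%:C%C)) phi).
  rewrite /v (evalD _ (absumD (absumZ _ hQ1) (absumZ _ hQ2)) (absumZ _ (absumD hF4 hF1))).
  rewrite (evalD _ (absumZ _ hQ1) (absumZ _ hQ2)) (evalZ _ _ hQ1) (evalZ _ _ hQ2) (evalZ _ _ (absumD hF4 hF1)).
  rewrite (evalD _ hF4 hF1) /Q1 (eval_conv _ (absumD hcZ hZZ) hV) (evalD _ hcZ hZZ) (evalZ _ _ hZ) (eval_conv _ hZ hZ).
  rewrite /Q2 (evalD _ hcY hYYY) (evalZ _ _ hYY) (eval_conv _ hY hYY) (eval_conv _ hY hY).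
  by rewrite mulrA !exprS !expr0 !mulr1.
have -> : eval (X h) phi = c%:C%C + eval (Z h) phi by rewrite (evalD _ hcc hZ) eval_wconst.
have -> : eval (Yt h) phi = c%:C%C + eval (Y h) phi by rewrite (evalD _ hcc hY) eval_wconst.
have -> : eval (fun=> 0) phi = 0 :> C.
  by rewrite /eval (_ : (fun k => 0 * _) = fun=> 0) ?csum0 //; apply: funext => k; rewrite mul0r.
rewrite /q /rr /d !(rmorphM, rmorphXn, rmorphN, rmorph0, rmorph_nat).
by ring.
Qed.

(* Scaling x = s (u + z), eps = s, with u the response of the linear part to
   g_00; the averages of g_10 and g_01 make the linear part invertible. *)
Lemma averaged_case (q rr F0 N : R) (r : K -> R) : q + rr != 0 -> 0 < F0 ->
  (forall k, k != 0 -> 0 < r k) ->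
  gs 0 0 0 0 = 0 -> gs 1 0 0 0 = (- q)%:C%C -> gs 0 1 0 0 = (- rr)%:C%C ->
  absum (fun k => ((r k)^-1)%:C%C * gs 0 0 0 k) N ->
  exists s1 Cx : R, 0 < s1 /\ forall s a w0 tau, 0 < s <= s1 -> critical a w0 tau ->
    F0 <= `|transv a w0 tau (a * 0) q rr| ->
    (forall k, k != 0 -> r k <= rdist w0 (dotr k om) /\ r k <= `| `|dotr k om| - 2 * w0|) ->
  exists x : R -> R, [/\ vdp_solution f g om a tau s x, quasi_periodic om x &
    forall t, `|x t| <= s * Cx].
Proof.
move=> qr F00 r0 g0 g1 g2 decay.
have [d0 [c2 [d00 c20 lamU]]] := lamN_uniform 0 F00 qr.
pose Cm := 2 / c2 + 1; have c2p : 0 < 2 / c2 by rewrite divr_gt0.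
have Cm1 : 1 <= Cm by rewrite lerDr ltW.
have Cm0 : 0 < Cm by exact: lt_le_trans Cm1.
have [c1 c10 c1b] : exists2 c1 : R, 0 < c1 & c1 * 1000 * 1000 <= 1.
  have ex (x : R) : 0 < x -> exists2 c1 : R, 0 < c1 & c1 * x * x <= 1.
    by move=> x0; exists (x^-1 * x^-1); [rewrite mulr_gt0 ?invr_gt0|rewrite -!mulrA mulKf ?mulVf ?gt_eqF].
  by apply: ex; rewrite ltr0n.
pose Nu := 2 / c1 * N.
have N0 : 0 <= N := absum_ge0 decay.
have c1p : 0 <= 2 / c1 by rewrite divr_ge0 // ltW.
have Nu0 : 0 <= Nu by rewrite mulr_ge0.
have hG0 := absum_gsel rg_gt0 famG 0 0 0; have sG0 := sym_gsel rg_gt0 famG symG 0 0 0.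
have hG1 := absum_gsel rg_gt0 famG 1 0 0; have sG1 := sym_gsel rg_gt0 famG symG 1 0 0.
have hG2 := absum_gsel rg_gt0 famG 0 1 0; have sG2 := sym_gsel rg_gt0 famG symG 0 1 0.
have hG3 := absum_gsel rg_gt0 famG 0 0 1; have sG3 := sym_gsel rg_gt0 famG symG 0 0 1.
(* The averages of g_10 and g_01 have been moved into the shift through [q] and [rr]; the mean-free
   parts remain as the linear operator [Bop]. *)
pose A1 k := gs 1 0 0 k + wconst q%:C%C k; pose A2 k := gs 0 1 0 k + wconst rr%:C%C k.
have hA1 : absum A1 _ := absumD hG1 (absum_wconst _).
have hA2 : absum A2 _ := absumD hG2 (absum_wconst _).
have sA1 : sym A1 := symD sG1 (sym_wconst _).
have sA2 : sym A2 := symD sG2 (sym_wconst _).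
have A10 : A1 0 = 0 by rewrite /A1 /wconst eqxx g1 -rmorphD addNr.
have A20 : A2 0 = 0 by rewrite /A2 /wconst eqxx g2 -rmorphD addNr.
move: hA1 hA2; set MA1 := (_ + _); set MA2 := (_ + _) => hA1 hA2.
have MA10 := absum_ge0 hA1; have MA20 := absum_ge0 hA2.
pose MA := MA1 + MA2; have MA0 : 0 <= MA by rewrite addr_ge0.
pose e := (8 * (MA + 1))^-1.
have MA1' : 0 < MA + 1 by rewrite ltr_wpDl.
have e0 : 0 < e by rewrite invr_gt0 mulr_gt0.
(* Products of two multipliers are estimated with this constant; the factor 2 comes from the halved
   distance in [rdist_diff]. *)
have CC0 : 0 < 2 * Cm ^+ 2 by rewrite mulr_gt0 // exprn_gt0.
have [d1 d10 small1] := small_mult hA1 A10 r0 CC0 e0.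
have [d2 d20 small2] := small_mult hA2 A20 r0 CC0 e0.
pose be := MA * (e + e).
have be4 : be <= 1 / 4.
  have -> : be = 1 / 4 * (MA / (MA + 1)) by rewrite /be /e; field; rewrite gt_eqF.
  by rewrite ler_piMr // ler_pdivrMr // mul1r lerDl.
have be0 : 0 <= be by rewrite mulr_ge0 // addr_ge0 // ltW.
pose Lb := MA * Cm; have Lb0 : 0 <= Lb by rewrite mulr_ge0 // ltW.
have Lb1 : 0 < Lb + 1 by rewrite ltr_wpDl.
move: hG1 hG2 hG3; set N1 := _ / _ => hG1 hG2 hG3.
have N10 := absum_ge0 hG1.
pose Nw := N1 * Nu + N1 * Nu + N1.
have Nw0 : 0 <= Nw by apply: addr_ge0 => //; apply: addr_ge0; exact: mulr_ge0.
(* The inhomogeneity after one application of [Bop] takes up half of the ball, and the square of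
   [Bop] at most a quarter. *)
pose rho := 2 * ((Lb + 1) * (Nw + 1)).
have rho0 : 0 < rho by rewrite !mulr_gt0 // ltr_wpDl.
pose b := Nu + Cm * rho; have b0 : 0 <= b by rewrite addr_ge0 // ltW // mulr_gt0.
pose B := b + 1; have B1 : 1 <= B by rewrite lerDr.
have Bn0 : 0 <= B by rewrite addr_ge0.
have B0 : 0 < B by exact: lt_le_trans B1.
have pos x z D : 0 <= x -> 0 < z -> 0 <= (x / z) ^+ D :> R.
  by move=> x0 z0; rewrite exprn_ge0 // divr_ge0 // ltW.
have B20 : 0 <= 2 * B by rewrite mulr_ge0.
pose K4 := (B / rf) ^+ 4 * Mf; pose L4 := (2 * B / rf) ^+ 4 * Mf * Cm.
pose K2 := (B / rg) ^+ 2 * Mg; pose L2 := (2 * B / rg) ^+ 2 * Mg * Cm.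
have K40 : 0 <= K4 by apply: mulr_ge0 => //; exact: pos.
have K20 : 0 <= K2 by apply: mulr_ge0 => //; exact: pos.
have L40 : 0 <= L4 by apply: mulr_ge0 (ltW Cm0); apply: mulr_ge0 => //; exact: pos.
have L20 : 0 <= L2 by apply: mulr_ge0 (ltW Cm0); apply: mulr_ge0 => //; exact: pos.
pose KR := 2 * (B * B * B) + `|b1| * (B * (B * B)) + (K4 + K2).
pose LR := 2 * ((Cm * B + B * Cm) * B + B * B * Cm) + `|b1| * (Cm * (B * B) + B * (Cm * B + B * Cm)) + (L4 + L2).
have BB : 0 <= B * B by exact: mulr_ge0.
have CB : 0 <= Cm * B + B * Cm by apply: addr_ge0; apply: mulr_ge0 => //; exact: ltW.
have BBB : 0 <= B * B * B by exact: mulr_ge0.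
have LQ1 : 0 <= (Cm * B + B * Cm) * B + B * B * Cm.
  by apply: addr_ge0; apply: mulr_ge0 => //; exact: ltW.
have LQ2 : 0 <= Cm * (B * B) + B * (Cm * B + B * Cm).
  by apply: addr_ge0; apply: mulr_ge0 => //; exact: ltW.
have KR0 : 0 <= KR.
  exact: addr_ge0 (addr_ge0 (mulr_ge0 (ler0n R 2) BBB) (mulr_ge0 (normr_ge0 b1) (mulr_ge0 Bn0 BB))) (addr_ge0 K40 K20).
have LR0 : 0 <= LR.
  exact: addr_ge0 (addr_ge0 (mulr_ge0 (ler0n R 2) LQ1) (mulr_ge0 (normr_ge0 b1) LQ2)) (addr_ge0 L40 L20).
pose D1 := KR + 1; have D10 : 0 < D1 by rewrite ltr_wpDl.
pose D2 := 4 * (Lb + 1) * (LR + 1); have D20 : 0 < D2 by rewrite !mulr_gt0 // ltr_wpDl.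
pose s1 := Num.min (Num.min (Num.min 1 d0) (Num.min d1 (rf / 2 / B)))
  (Num.min (Num.min (rg / 2 / B) d2) (Num.min D1^-1 D2^-1)).
exists s1, B; split; first by rewrite /s1 !lt_min ltr01 d00 d10 d20 !divr_gt0 // !invr_gt0 D10.
move=> s a w0 tau /andP[s0 ss] crit hF nonres.
move: ss; rewrite /s1 !le_min => /andP[/andP[/andP[sle1 sd0] /andP[sd1 srf]] /andP[/andP[srg sd2] /andP[sD1 sD2]]].
rewrite (ler_pdivlMr _ _ B0) in srf; rewrite (ler_pdivlMr _ _ B0) in srg.
have dd1 : 0 < s <= d1 by rewrite s0.
have dd2 : 0 < s <= d2 by rewrite s0.
have sd := @sym_dM _ _ om; have st := sym_tauM om tau.
pose p := a * 0.
have lamL w : c2 * (Num.max s (rdist w0 w) * (1 + `|w|)) <= lamN a tau p q rr s w.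
  by apply: lamU crit hF _ _ _; rewrite s0.
pose m := mult om a tau p q rr s.
have sm : sym m := sym_mult om a tau p q rr s.
have mb k : normc (m k) <= Cm /\ normc (dM om k * m k) <= Cm.
  by have [h1 h2] := mult_bounded om c20 s0 lamL k; rewrite /Cm; split; [apply: le_trans h1 _|apply: le_trans h2 _]; rewrite lerDl.
have me k z : 0 < z -> z <= rdist w0 (dotr k om) -> normc (m k) <= Cm * s / z.
  move=> z0 zr; have [|h1 _] := @mult_bounds _ _ om a tau p q rr s w0 c2 c20 s0 lamL k z z0.
    by rewrite le_max zr orbT.
  by apply: le_trans h1 _; rewrite ler_pM2r ?invr_gt0 // ler_pM2r // /Cm lerDl.
have w00 : 0 <= w0 by case: crit => _ /ltW.
(* One of the two modes is at distance at least r k / 2 from the zeros and gains the factor s; the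
   other is bounded by [Cm]. *)
have mm j k : k != 0 -> normc (m (k + j) * m j) <= 2 * Cm ^+ 2 * s / r k.
  move=> k0; have [n1 n2] := nonres _ k0; have rk := r0 _ k0; have r2 : 0 < r k / 2 by rewrite divr_gt0.
  have E : Cm * s / (r k / 2) * Cm = 2 * Cm ^+ 2 * s / r k by field; rewrite gt_eqF.
  have nd : dotr k om = dotr (k + j) om - dotr j om by rewrite dotrDl addrK.
  rewrite nd in n1 n2; have [h|h] := rdist_diff w00 n1 n2.
  - by rewrite normcM -E ler_pM ?normc_ge0 ?me //; case: (mb j).
  - by rewrite normcM -E mulrC ler_pM ?normc_ge0 ?me //; case: (mb (k + j)).
have mm2 j k : normc (m (k + j) * m j) <= 2 * Cm ^+ 2.
  rewrite normcM mulr2n mulrDl mul1r; apply: le_trans (_ : Cm ^+ 2 <= _); last by rewrite lerDl sqr_ge0.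
  by rewrite expr2 ler_pM ?normc_ge0 //; [case: (mb (k + j))|case: (mb j)].
pose tm k := tauM om tau k * m k.
have stm : sym tm := symM st sm.
have ntm k : normc (tm k) = normc (m k) by rewrite normcM normc_cis mul1r.
have sq (w1 v1 : K -> C) h D : (forall k, normc (w1 k) = normc (m k)) ->
    (forall k, normc (v1 k) = normc (m k)) -> absum h D ->
    absum (fun k => w1 k * conv A1 (fun j => v1 j * h j) k) (e * D) /\
    absum (fun k => w1 k * conv A2 (fun j => v1 j * h j) k) (e * D).
  move=> hw hv hh; have nE j k : normc (w1 (k + j) * v1 j) = normc (m (k + j) * m j).
    by rewrite [LHS]normcM [RHS]normcM hw hv.
  split; apply: conv_small => //; try exact: ltW.
    by move=> j; apply: (small1 s (fun k => w1 (k + j) * v1 j) dd1) => k k0; rewrite nE; [exact: mm2|exact: mm].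
  by move=> j; apply: (small2 s (fun k => w1 (k + j) * v1 j) dd2) => k k0; rewrite nE; [exact: mm2|exact: mm].
pose Bop (h : K -> C) k := conv A1 (fun j => m j * h j) k + conv A2 (fun j => tm j * h j) k.
have hm h D : absum h D -> absum (fun k => m k * h k) (Cm * D).
  by apply: absumM_bounded; [exact: ltW|move=> k; case: (mb k)].
have htm h D : absum h D -> absum (fun k => tm k * h k) (Cm * D).
  by apply: absumM_bounded; [exact: ltW|move=> k; rewrite ntm; case: (mb k)].
have hB h D : absum h D -> absum (Bop h) (Lb * D).
  move=> hh; apply: absum_le (absumD (absum_conv hA1 (hm _ _ hh)) (absum_conv hA2 (htm _ _ hh))).
  by rewrite -mulrDl mulrA.
have hBB h D : absum h D -> absum (Bop (Bop h)) (be * D).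
  move=> hh.
  have hw w1 : (forall k, normc (w1 k) = normc (m k)) -> absum (fun k => w1 k * Bop h k) (e * D + e * D).
    move=> nw; have [h1 _] := sq w1 m h D nw (fun k => erefl) hh; have [_ h2] := sq w1 tm h D nw ntm hh.
    by apply: absum_mono (absumD h1 h2) => k; rewrite /Bop mulrDr.
  apply: absum_le (absumD (absum_conv hA1 (hw m (fun k => erefl))) (absum_conv hA2 (hw tm ntm))).
  by rewrite -mulrDl -mulrDl mulrA.
have BD h h' D D' : absum h D -> absum h' D' ->
    Bop (fun k => h k + h' k) = (fun k => Bop h k + Bop h' k).
  move=> hh hh'; apply: funext => k; rewrite /Bop.
  rewrite (_ : (fun j => m j * (h j + h' j)) = fun j => m j * h j + m j * h' j); last by apply: funext => j; rewrite mulrDr.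
  rewrite (_ : (fun j => tm j * (h j + h' j)) = fun j => tm j * h j + tm j * h' j); last by apply: funext => j; rewrite mulrDr.
  rewrite (conv_addr _ hA1 (hm _ _ hh) (hm _ _ hh')) (conv_addr _ hA2 (htm _ _ hh) (htm _ _ hh')).
  by rewrite addrACA.
have sB h D : absum h D -> sym h -> sym (Bop h).
  by move=> hh sh; apply: symD; [apply: sym_conv hA1 (hm _ _ hh) _ _|apply: sym_conv hA2 (htm _ _ hh) _ _] => //; exact: symM.
(* The unshifted symbol vanishes at mode 0, where the response can be set to 0 because g_00 has zero
   average. *)
pose u k : C := if k == 0 then 0 else gs 0 0 0 k / lamC om a tau p q rr 0 k.
have nlam k : k != 0 -> c1 * r k * (1 + `|dotr k om|) <= 2 * normc (lamC om a tau p q rr 0 k).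
  move=> k0; apply: le_trans (lamN_normc _ _ _ _ _ _ _ _).
  apply: le_trans (lam_lower crit _ _ _ _ c10 c1b).
  by rewrite ler_pM2r ?ltr_pwDl // ler_pM2l //; case: (nonres _ k0).
have lam0 k : k != 0 -> 0 < normc (lamC om a tau p q rr 0 k).
  move=> k0; have := nlam _ k0; have : 0 < c1 * r k * (1 + `|dotr k om|) by rewrite !mulr_gt0 ?ltr_pwDl ?r0.
  by move=> h1 /(lt_le_trans h1); rewrite pmulr_rgt0.
have nu_u k : normc (u k) * (1 + `|dotr k om|) <= normc ((2 / c1)%:C%C * (((r k)^-1)%:C%C * gs 0 0 0 k)).
  rewrite /u; case: eqP => [_|/eqP k0]; first by rewrite normc0 mul0r normc_ge0.
  exact: (normc_response _ c10 (r0 _ k0) (lam0 _ k0) (nlam _ k0)).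
have hNu := absumZ (2 / c1)%:C%C decay; rewrite normc_real ger0_norm // -/Nu in hNu.
have hu : absum u Nu.
  apply: absum_mono hNu => k; apply: le_trans (nu_u k); rewrite ler_peMr ?normc_ge0 // lerDl //.
have hdu : absum (fun k => dM om k * u k) Nu.
  apply: absum_mono hNu => k; apply: le_trans (nu_u k).
  by rewrite normcM normc_dM mulrC ler_wpM2l ?normc_ge0 // lerDr.
have su : sym u.
  move=> k; rewrite /u oppr_eq0; case: eqP => _; first by rewrite conjc0.
  by rewrite sG0 sym_lamC conjcM conjc_inv.
have eqU k : (((1 - dotr k om ^+ 2)%:C)%C - (a%:C)%C * dM om k - tauM om tau k) * u k = gs 0 0 0 k.
  rewrite /u; case: eqP => [->|/eqP k0]; first by rewrite mulr0 g0.
  have := lam0 _ k0; rewrite {2}/lamC -/(lamC om a tau p q rr 0 k) => l0.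
  rewrite (_ : _ - _ - _ = lamC om a tau p q rr 0 k); last by rewrite lamCE rmorph0 mul0r addr0.
  by rewrite mulrCA divff ?mulr1 //; apply: contraTneq l0 => ->; rewrite normc0 ltxx.
pose X (h : K -> C) k := u k + m k * h k.
pose V (h : K -> C) k := dM om k * u k + dM om k * m k * h k.
pose Yt (h : K -> C) k := tauM om tau k * u k + tm k * h k.
have lX : lip rho X b Cm by apply: lip_field => //; [exact: ltW|move=> k; case: (mb k)].
have lV : lip rho V b Cm.
  by apply: lip_field => //; [exact: symM|exact: ltW|move=> k; case: (mb k)|exact: symM].
have lY : lip rho Yt b Cm.
  apply: lip_field => //; [exact: absum_tauM|exact: symM|exact: ltW|].
  by move=> k; rewrite ntm; case: (mb k).
have bB : b <= B by rewrite lerDl.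
have wk (F : (K -> C) -> K -> C) : lip rho F b Cm -> lip rho F B Cm.
  exact: lip_weaken (lexx _) bB (lexx _).
have lXB := wk _ lX; have lVB := wk _ lV; have lYB := wk _ lY.
have hE : absum (wconst 1%:C%C : K -> C) B.
  by apply: absum_le _ (absum_wconst _); rewrite normc_real normr1.
have lE : lip rho (fun=> wconst 1%:C%C : K -> C) B Cm.
  exact: (@lip_weaken _ _ rho rho _ B B 0 Cm (lexx _) (lexx _) (ltW Cm0) (lip_const rho hE (sym_wconst _))).
pose Q1 h := conv (conv (X h) (X h)) (V h).
pose Q2 h := conv (Yt h) (conv (Yt h) (Yt h)).
(* The terms independent of the unknown: g_10 and g_01 acting on the response [u], and the
   epsilon-derivative of g_00. *)
pose w k := conv (gs 1 0 0) u k + conv (gs 0 1 0) (fun k => tauM om tau k * u k) k + gs 0 0 1 k.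
pose Rm h k := (- a)%:C%C * Q1 h k + b1%:C%C * Q2 h k +
  (s%:C%C * remf fc s (Yt h) k + remg G E0 E1 E2 2 s (X h) (Yt h) (wconst 1%:C%C) k).
pose v h k := w k + s%:C%C * Rm h k.
have a2 : `|a| <= 2 := critical_le2 crit.
have lQ1 := lip_conv (lip_conv lXB lXB) lVB.
have lQ2 := lip_conv lYB (lip_conv lYB lYB).
have lf : lip rho (fun h => remf fc s (Yt h)) K4 L4.
  exact: (lip_remf rf_gt0 fc_sum (ltW rho0) s0 B1 (ltW Cm0) srf lYB).
have [lg _] := lip_rem rg_gt0 famG symG 2 (ltW rho0) s0 B1 (ltW Cm0) srg lXB lYB lE.
have lR : lip rho Rm KR LR.
  apply: (lip_weaken (lexx _) _ _ (lipD (lipD (lipZ (- a) lQ1) (lipZ b1 lQ2)) (lipD (lipZ s lf) lg))) => //;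
    rewrite -/K2 -/L2 normrN (gtr0_norm s0) /KR /LR; apply: lerD; apply: lerD => //.
  - by rewrite ler_wpM2r.
  - by rewrite ler_piMl.
  - by rewrite ler_wpM2r.
  - by rewrite ler_piMl.
have htu := absum_tauM om tau hu; have stu : sym (fun k => tauM om tau k * u k) by exact: symM.
have hw1 := absum_conv hG1 hu; have hw2 := absum_conv hG2 htu.
have hw : absum w Nw := absumD (absumD hw1 hw2) hG3.
have sw : sym w := symD (symD (sym_conv hG1 hu sG1 su) (sym_conv hG2 htu sG2 stu)) sG3.
have lv : lip rho v (Nw + s * KR) (0 + s * LR).
  by have := lipD (lip_const rho hw sw) (lipZ s lR); rewrite (gtr0_norm s0).
have sKR : s * KR <= 1.
  apply: le_trans (_ : D1^-1 * D1 <= _); last by rewrite mulVf // gt_eqF.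
  by apply: ler_pM => //; [exact: ltW|rewrite lerDl].
have sLR : (Lb + 1) * (0 + s * LR) <= 1 / 4.
  have : s * D2 <= 1 by rewrite -ler_pdivlMr // div1r.
  rewrite add0r /D2; have : 0 <= s * (Lb + 1) by rewrite mulr_ge0 // ltW.
  have -> : s * (4 * (Lb + 1) * (LR + 1)) = 4 * ((Lb + 1) * (s * LR)) + 4 * (s * (Lb + 1)) by ring.
  exact: lipschitz_share.
have hval : be * rho + (Lb + 1) * (Nw + s * KR) <= rho.
  have h1 : be * rho <= 1 / 4 * rho by rewrite ler_pM2r.
  have h2 : (Lb + 1) * (Nw + s * KR) <= (Lb + 1) * (Nw + 1) by rewrite ler_pM2l // lerD2l.
  exact: value_share (erefl rho) rho0 h1 h2.
have hlip : be + (Lb + 1) * (0 + s * LR) <= 1 / 2.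
  by rewrite (_ : 1 / 2 = 1 / 4 + 1 / 4 :> R); [exact: lerD|field].
have Lv0 : 0 <= 0 + s * LR by rewrite add0r mulr_ge0 // ltW.
have [h [hh sh vh]] := fixpoint_square (ltW rho0) be0 Lb0 Lv0 hB hBB BD sB lv hval hlip.
have [/(_ _ hh) hX _ /(_ _ hh sh) sX] := lXB; have [/(_ _ hh) hV _ _] := lVB.
have [/(_ _ hh) hY _ /(_ _ hh sh) sY] := lYB.
have YE : (fun k => tauM om tau k * (u k + m k * h k)) = Yt h.
  by apply: funext => k; rewrite /Yt mulrDr mulrA.
have VE : (fun k => dM om k * (u k + m k * h k)) = V h.
  by apply: funext => k; rewrite /V mulrDr mulrA.
apply: (@solution_of_fixpoint _ _ om f g a tau p q rr s w0 c2 s s c20 s0 s0 lamL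
  u (gs 0 0 0) h (fun k => m k * h k) Nu _ _ B (fun k => erefl) hdu hG0 hh su sh hX eqU).
move=> phi; cbv zeta; rewrite -/(X h) YE VE.
have gE := eval_remg2 rg_gt0 famG symG g_eq phi s0 B1 srg hX hY hE sX sY (sym_wconst _).
rewrite [eval (wconst _) _]eval_wconst mulr1 in gE.
rewrite (eval_remf rf_gt0 fc_sum f_eq fc0 fc1 fc2 fc3 phi s0 B1 srf hY sY) gE.
have hZ := hm _ _ hh; have hT := htm _ _ hh.
rewrite (_ : (fun k => tauM om tau k * (m k * h k)) = fun k => tm k * h k); last by apply: funext => k; rewrite mulrA.
have XX := absum_conv hX hX; have YY := absum_conv hY hY.
have hQ1 : absum (Q1 h) _ := absum_conv XX hV.
have hQ2 : absum (Q2 h) _ := absum_conv hY YY.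
have [/(_ _ hh) hF4 _ _] := lf; have [/(_ _ hh) hF2 _ _] := lg.
have c1A := absum_conv hA1 hZ; have c2A := absum_conv hA2 hT.
have hRm : absum (Rm h) _ := absumD (absumD (absumZ _ hQ1) (absumZ _ hQ2)) (absumD (absumZ _ hF4) hF2).
have -> : eval h phi = (eval (gs 1 0 0) phi + q%:C%C) * eval (fun k => m k * h k) phi +
    (eval (gs 0 1 0) phi + rr%:C%C) * eval (fun k => tm k * h k) phi +
    (eval (gs 1 0 0) phi * eval u phi + eval (gs 0 1 0) phi * eval (fun k => tauM om tau k * u k) phi +
     eval (gs 0 0 1) phi) +
    s%:C%C * (- a%:C%C * eval (X h) phi ^+ 2 * eval (V h) phi + b1%:C%C * eval (Yt h) phi ^+ 3 +
      (s%:C%C * eval (remf fc s (Yt h)) phi + eval (remg G E0 E1 E2 2 s (X h) (Yt h) (wconst 1%:C%C)) phi)).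
  have -> : eval h phi = eval (fun k => Bop h k + v h k) phi by congr eval; apply: funext.
  rewrite (evalD _ (absumD c1A c2A) (absumD hw (absumZ _ hRm))) (evalD _ hw (absumZ _ hRm)) (evalZ _ _ hRm).
  rewrite (evalD _ c1A c2A) (eval_conv _ hA1 hZ) (eval_conv _ hA2 hT).
  rewrite (evalD _ hG1 (absum_wconst _)) (evalD _ hG2 (absum_wconst _)) !eval_wconst.
  rewrite (evalD _ (absumD hw1 hw2) hG3) (evalD _ hw1 hw2) (eval_conv _ hG1 hu) (eval_conv _ hG2 htu).
  rewrite (evalD _ (absumD (absumZ _ hQ1) (absumZ _ hQ2)) (absumD (absumZ _ hF4) hF2)).
  rewrite (evalD _ (absumZ _ hQ1) (absumZ _ hQ2)) (evalD _ (absumZ _ hF4) hF2) (evalZ _ _ hQ1) (evalZ _ _ hQ2) (evalZ _ _ hF4).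
  rewrite (eval_conv _ XX hV) (eval_conv _ hX hX) (eval_conv _ hY YY) (eval_conv _ hY hY) rmorphN.
  by ring.
have eX : eval (X h) phi = eval u phi + eval (fun k => m k * h k) phi by rewrite (evalD _ hu hZ).
have eY : eval (Yt h) phi = eval (fun k => tauM om tau k * u k) phi + eval (fun k => tm k * h k) phi.
  by rewrite (evalD _ htu hT).
rewrite eX eY /p mulr0 rmorph0 rmorph1.
by ring.
Qed.
End Continuation.

(** * Expansion coefficients of the data *)

Section TaylorCoefficients.
Variable R : realType.
Local Notation C := R[i].
Local Notation A1 := {ffun 'I_1 -> nat}.

Lemma pder_line (F : R -> R) (z : 'rV[R]_1) :
  pder 0 (fun z : 'rV[R]_1 => F (z 0 0)) z = F^`()%classic (z 0 0).
Proof.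
rewrite /pder (_ : (fun t : R => _) = fun t => F (t + z 0 0)); last first.
  by apply: funext => t; rewrite delta_lineE eqxx addrC.
rewrite !derive1E /derive add0r.
rewrite (_ : (fun t => F (t + z 0 0)) \o shift 0 = F \o shift (z 0 0)) //.
by apply: funext => t /=; rewrite addr0.
Qed.

Lemma expansion_at0 N (h : 'rV[R]_N -> R) p r c : 0 < r -> expansion_at h p r c ->
  h p = c [ffun=> 0%N].
Proof.
move=> r0 hc; have [|_] := hc p; first by move=> i; rewrite subrr normr0.
rewrite (csum1 (i := [ffun=> 0%N])) => [|al nz].
  have -> : monom c p p [ffun=> 0%N] = (c [ffun=> 0%N])%:C%C.
    by rewrite /monom big1 ?mulr1 // => i _; rewrite ffunE expr0.
  by move=> /(congr1 (@complex.Re R)) /= ->.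
have [i ai] : exists i, al i != 0%N.
  apply/existsP; apply: contraNT nz; rewrite negb_exists => /forallP h0.
  by apply/eqP/ffunP => i; rewrite ffunE; apply/eqP; have := h0 i; rewrite negbK.
by rewrite /monom (bigD1 i) //= subrr expr0n (negbTE ai) mul0r mulr0 rmorph0.
Qed.

(** The derivatives are read off at 0 after differentiating the series termwise up to three times,
    each time on half the radius. *)
Lemma analytic1_taylor (f : R -> R) : analytic1 f ->
  exists (fc : nat -> R) (rf Mf : R),
  [/\ 0 < rf, absum (fun m : nat => ((fc m * rf ^+ m)%:C)%C) Mf,
      forall y, `|y| <= rf -> (f y)%:C%C = csum (fun m : nat => ((fc m * y ^+ m)%:C)%C) &
      [/\ fc 0%N = f 0, fc 1%N = f^`()%classic 0, 2 * fc 2%N = f^`(2)%classic 0 &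
          6 * fc 3%N = f^`(3)%classic 0] ].
Proof.
move=> fa; have [r [c [r0 hc]]] := analytic_expansion (fa 0).
pose al (m : nat) : A1 := [ffun=> m].
have ali : injective al by move=> m m' /ffunP/(_ 0); rewrite !ffunE.
have als (b : A1) : exists m, al m = b.
  by exists (b 0); apply/ffunP => i; rewrite ffunE (ord1 i).
pose fc m := c (al m).
have mE y m : monom c 0 (const_mx y) (al m) = ((fc m * y ^+ m)%:C)%C.
  by rewrite /monom big_ord_recl big_ord0 ffunE !mxE subr0 mulr1.
have yr y : `|y| < r -> forall i, `|(const_mx y : 'rV[R]_1) 0 i - (0 : 'rV[R]_1) 0 i| < r.
  by move=> hy i; rewrite !mxE subr0.
have r2 : `|r / 2| < r by rewrite ger0_norm ?divr_ge0 ?(ltW r0) //; lra.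
have [[M hM] _] := hc _ (yr _ r2).
exists fc, (r / 2), M; split.
- by rewrite divr_gt0.
- by have := absum_reindex ali hM; apply: absum_mono => m; rewrite mE.
- move=> y hy; have hyr : `|y| < r by apply: le_lt_trans hy _; lra.
  have [[M' hM'] e] := hc _ (yr _ hyr).
  rewrite mxE in e; rewrite -e -(csum_reindex ali (fun b _ => als b) hM').
  by congr csum; apply: funext => m; rewrite mE.
have bE m : bump_index 0 (al m) = al m.+1.
  by apply/ffunP => i; rewrite !ffunE (ord1 i) eqxx addn1.
have aE m (i : 'I_1) : al m i = m by rewrite ffunE.
have [e1 _] := expansion_pder 0 r0 hc.
have r20 : 0 < r / 2 by rewrite divr_gt0.
have [e2 _] := expansion_pder 0 r20 e1.
have r40 : 0 < r / 2 / 2 by rewrite divr_gt0.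
have [e3 _] := expansion_pder 0 r40 e2.
have h1 : pder 0 (fun z : 'rV[R]_1 => f (z 0 0)) = fun z => f^`()%classic (z 0 0).
  by apply: funext => z; exact: pder_line.
have h2 : pder 0 (fun z : 'rV[R]_1 => f^`()%classic (z 0 0)) = fun z => f^`(2)%classic (z 0 0).
  by apply: funext => z; rewrite pder_line derive1Sn.
have h3 : pder 0 (fun z : 'rV[R]_1 => f^`(2)%classic (z 0 0)) = fun z => f^`(3)%classic (z 0 0).
  by apply: funext => z; rewrite pder_line [in RHS]derive1Sn.
rewrite h1 in e1 e2 e3; rewrite h2 in e2 e3; rewrite h3 in e3.
have := expansion_at0 r0 hc; have := expansion_at0 r20 e1.
have := expansion_at0 r40 e2; have := expansion_at0 (divr_gt0 r40 (ltr0n R 2)) e3.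
rewrite -/(al 0%N) !bE !aE !mxE /fc => -> -> -> ->.
by split; [by []|rewrite mul1r|rewrite mul1r|ring].
Qed.

End TaylorCoefficients.

(** * Comparison of the weights with powers of |k| *)

Section Weights.
Variables (R : realType) (n : nat).
Hypothesis n_gt0 : (0 < n)%N.
Local Notation C := R[i].
Local Notation K := 'rV[int]_n.

Lemma l1normE (k : K) : l1norm R k = \sum_(i < n) `|(k 0 i)%:~R|.
Proof. by rewrite /l1norm rmorph_sum; apply: eq_bigr => i _; rewrite -intr_norm. Qed.

Lemma l1norm_ge1 (k : K) : k != 0 -> 1 <= l1norm R k.
Proof.
move=> k0; have [i ki] : exists i, k 0 i != 0.
  apply/existsP; apply: contraNT k0; rewrite negb_exists => /forallP h0.
  by apply/eqP/rowP => i; rewrite mxE; apply/eqP; have := h0 i; rewrite negbK.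
rewrite l1normE (bigD1 i) //= -[leLHS]addr0; apply: lerD; last by apply: sumr_ge0.
by rewrite -intr_norm ler1z -gtz0_ge1 normr_gt0.
Qed.

(** Each factor obeys 1 + |k_i| <= 2 |k|, because |k| >= 1 for a nonzero integer vector. *)
Lemma mwt_lower (k : K) : k != 0 -> (4 ^+ n * l1norm R k ^+ (2 * n))^-1 <= mwt R k.
Proof.
move=> k0; have l1 := l1norm_ge1 k0; have l0 : 0 < l1norm R k by exact: lt_le_trans l1.
rewrite exprM -exprMn -exprVn /mwt.
have -> : (4 * l1norm R k ^+ 2)^-1 ^+ n = \prod_(i < n) (4 * l1norm R k ^+ 2)^-1.
  by rewrite prodr_const card_ord.
apply: ler_prod => i _; rewrite invr_ge0 mulr_ge0 ?sqr_ge0 //= /iwt lef_pV2 ?posrE ?mulr_gt0 ?exprn_gt0 ?ltr_pwDl //.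
have -> : 4 * l1norm R k ^+ 2 = (2 * l1norm R k) ^+ 2 by rewrite exprMn; congr (_ * _); ring.
rewrite lerXn2r ?nnegrE ?addr_ge0 ?mulr_ge0 ?(ltW l0) // mulr2n mulrDl mul1r; apply: lerD => //.
by rewrite l1normE (bigD1 i) //= lerDl; apply: sumr_ge0.
Qed.

Lemma powR_lower (x y : R) (S : nat) : 1 <= x -> y <= S%:R -> (x ^+ S)^-1 <= x `^ (- y).
Proof.
move=> x1 yS; have x0 : 0 < x by exact: lt_le_trans x1.
rewrite powRN lef_pV2 ?posrE ?exprn_gt0 ?powR_gt0 // -powR_mulrn ?(ltW x0) //.
exact: ler_powR.
Qed.

Lemma l1norm_pow (k : K) S : l1norm R k ^+ S <= n%:R ^+ S * \sum_(j < n) `|(k 0 j)%:~R| ^+ S.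
Proof.
pose j0 := [arg max_(j > Ordinal n_gt0) `|(k 0 j)%:~R : R| ]%O.
have hj j : `|(k 0 j)%:~R : R| <= `|(k 0 j0)%:~R|.
  by rewrite /j0; case: arg_maxP => // i _ /(_ j isT).
have h1 : l1norm R k <= n%:R * `|(k 0 j0)%:~R|.
  rewrite l1normE; apply: le_trans (ler_sum _ (fun j _ => hj j)) _.
  by rewrite sumr_const card_ord mulr_natl.
have l0 : 0 <= l1norm R k by rewrite l1normE; apply: sumr_ge0.
apply: le_trans (_ : _ <= (n%:R * `|(k 0 j0)%:~R|) ^+ S) _.
  by rewrite lerXn2r ?nnegrE ?mulr_ge0.
rewrite exprMn ler_wpM2l ?exprn_ge0 // (bigD1 j0) //= lerDl.
by apply: sumr_ge0 => j _; rewrite exprn_ge0.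
Qed.

Lemma absum_l1norm (a : K -> C) S :
  (forall j, exists N, absum (fun k : K => ((`|(k 0 j)%:~R : R| ^+ S)%:C)%C * a k) N) ->
  exists N, absum (fun k : K => ((l1norm R k ^+ S)%:C)%C * a k) N.
Proof.
move=> /boolp.choice[N hN]; exists (n%:R ^+ S * \sum_(j < n) N j) => s us.
apply: le_trans (_ : _ <= \sum_(k <- s) n%:R ^+ S *
  \sum_(j < n) normc (((`|(k 0 j)%:~R : R| ^+ S)%:C)%C * a k)) _.
  apply: ler_sum => k _; rewrite normcM normc_real ger0_norm; last first.
    by rewrite exprn_ge0 // l1normE; apply: sumr_ge0.
  rewrite (eq_bigr (fun j => `|(k 0 j)%:~R : R| ^+ S * normc (a k))) => [|j _]; last first.
    by rewrite normcM normc_real ger0_norm ?exprn_ge0.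
  by rewrite -mulr_suml mulrA ler_wpM2r ?normc_ge0 // l1norm_pow.
rewrite -mulr_sumr ler_wpM2l ?exprn_ge0 // exchange_big.
by apply: ler_sum => j _; exact: hN.
Qed.

End Weights.

Section ForcingCoefficients.
Variables (R : realType) (n : nat).
Hypothesis n_gt0 : (0 < n)%N.
Local Notation C := R[i].
Local Notation K := 'rV[int]_n.
Local Notation A := {ffun 'I_(n + 3) -> nat}.

Definition pack (g : 'rV[R]_n -> R -> R -> R -> R) (z : 'rV[R]_(n + 3)) : R :=
  g (lsubmx z) (rsubmx z 0 0) (rsubmx z 0 1) (rsubmx z 0 2%:R).

Lemma torus_analytic_pack g eps0 : 0 < eps0 -> analytic_perturbation eps0 g ->
  (forall x y eps : R, `|eps| < eps0 -> torus_periodic (fun phi => g phi x y eps)) ->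
  torus_analytic (pack g).
Proof.
move=> e0 ga gp; split.
  move=> phi; have [|r [c [r0 hc]]] := analytic_expansion (ga (row_mx phi 0) _).
    by rewrite row_mxKr mxE normr0.
  by exists r, c.
exists eps0 => // w hw phi i; rewrite /pack !row_mxKl !row_mxKr.
exact: gp.
Qed.

Lemma forcing_family g eps0 : 0 < eps0 -> analytic_perturbation eps0 g ->
  (forall x y eps : R, `|eps| < eps0 -> torus_periodic (fun phi => g phi x y eps)) ->
  exists (J : finType) (G : J * A -> K -> C) (E0 E1 E2 : J * A -> nat) (rg Mg : R),
  [/\ 0 < rg, famsum (fun t k => ((rg ^+ (E0 t + E1 t + E2 t))%:C)%C * G t k) Mg,
      forall t, sym (G t) &
      forall phi x y e, `|x| <= rg -> `|y| <= rg -> `|e| <= rg ->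
       (g phi x y e)%:C%C = csum (fun t => eval (G t) phi * ((x ^+ E0 t * y ^+ E1 t * e ^+ E2 t)%:C)%C)].
Proof.
move=> e0 ga gp; have [ha hp] := torus_analytic_pack e0 ga gp.
have [J [c [rho [M [rho0 fam sc hE]]]]] := local_to_global ha n_gt0 hp.
pose E (j : 'I_3) (t : J * A) := t.2 (rshift n j).
exists J, c, (E 0), (E 1), (E 2%:R), rho, M; split=> //.
  apply: absum_mono fam => -[t k] /=.
  rewrite (_ : (E 0%R t + E 1%R t + E 2%:R%R t)%N = wdeg t.2) ?lexx // /wdeg !big_ord_recl big_ord0 addn0 addnA.
  by rewrite /E; congr (t.2 (rshift n _) + t.2 (rshift n _) + t.2 (rshift n _))%N; apply/val_inj.
move=> phi x y e hx hy he.
pose w : 'rV[R]_3 := \row_j (if j == 0 then x else if j == 1 then y else e).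
have [w0 w1 w2] : [/\ w 0 0 = x, w 0 1 = y & w 0 2%:R = e] by split; rewrite mxE.
have -> : g phi x y e = pack g (row_mx phi w) by rewrite /pack row_mxKl row_mxKr w0 w1 w2.
rewrite -hE; last by move=> j; rewrite mxE; case: eqP => _ //; case: eqP.
congr csum; apply: funext => t; congr (_ * _).
rewrite !big_ord_recl big_ord0 mulr1 /E.
have -> : lift ord0 ord0 = 1 :> 'I_3 by apply/val_inj.
have -> : lift ord0 (lift ord0 ord0) = 2%:R :> 'I_3 by apply/val_inj.
have -> : ord0 = 0 :> 'I_3 by apply/val_inj.
by rewrite w0 w1 w2 mulrA.
Qed.

Section Averages.
Variables (g : 'rV[R]_n -> R -> R -> R -> R) (T : eqType) (G : T -> K -> C).
Variables (E0 E1 E2 : T -> nat) (rg Mg : R).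
Hypothesis rg_gt0 : 0 < rg.
Hypothesis famG : famsum (fun t k => ((rg ^+ (E0 t + E1 t + E2 t))%:C)%C * G t k) Mg.
Hypothesis symG : forall t, sym (G t).
Hypothesis g_eq : forall phi x y e, `|x| <= rg -> `|y| <= rg -> `|e| <= rg ->
  (g phi x y e)%:C%C = csum (fun t => eval (G t) phi * ((x ^+ E0 t * y ^+ E1 t * e ^+ E2 t)%:C)%C).
Local Notation gs i j l := (gsel G E0 E1 E2 i j l).

Lemma eval_g00 phi : (g phi 0 0 0)%:C%C = eval (gs 0 0 0) phi.
Proof.
have r0 : `|0 : R| <= rg by rewrite normr0 ltW.
rewrite g_eq // -[RHS]mul1r.
have [|_ <-] := @eval_gsel _ _ _ _ E0 E1 E2 _ _ rg_gt0 famG 0 0 0 phi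
   (fun t => ((0 ^+ E0 t * 0 ^+ E1 t * 0 ^+ E2 t)%:C)%C) 1.
  by move=> t /and3P[/eqP -> /eqP -> /eqP ->]; rewrite !expr0 !mulr1.
congr csum; apply: funext => t; rewrite /expo !expr0n.
by case: (E0 t) => [|?]; case: (E1 t) => [|?]; case: (E2 t) => [|?]; rewrite /= ?(mulr0, mul0r, mulr1) ?rmorph0 ?mulr0.
Qed.

(* Along x = y = s the second-order remainder is O(s^2). *)
Lemma diagonal_expansion : exists s0 B : R, 0 < s0 /\ forall s phi, 0 < s <= s0 ->
  normc ((g phi s s 0)%:C%C - eval (gs 0 0 0) phi - s%:C%C * (eval (gs 1 0 0) phi + eval (gs 0 1 0) phi))
    <= s ^+ 2 * B.
Proof.
exists (rg / 2), ((1 / rg) ^+ 2 * Mg); split; first by rewrite divr_gt0.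
move=> s phi /andP[s0 ss].
have h1 : absum (wconst 1%:C%C : K -> C) 1.
  by apply: absum_le _ (absum_wconst _); rewrite normc_real normr1.
have h0 : absum (wconst 0%:C%C : K -> C) 1.
  by apply: absum_le _ (absum_wconst _); rewrite normc_real normr0.
have s1 : sym (wconst 1%:C%C : K -> C) := sym_wconst 1.
have s0' : sym (wconst 0%:C%C : K -> C) := sym_wconst 0.
have sB : s * 1 <= rg / 2 by rewrite mulr1.
have := eval_remg2 rg_gt0 famG symG g_eq phi s0 (lexx 1) sB h1 h1 h0 s1 s1 s0'.
rewrite !eval_wconst [complex.Re _]/(1 : R) [complex.Re _]/(0 : R) !mulr1 mulr0 => ->.
have [_ /(_ (fun=> 0))] := lip_rem rg_gt0 famG symG 2 (lexx 0) s0 (lexx 1) (lexx 0) sB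
  (lip_const 0 h1 s1) (lip_const 0 h1 s1) (lip_const 0 h0 s0').
move=> /(_ (@absum0 _ _)) fam.
have -> (a b c d e : C) : a + e * (1%:C%C * b + 1%:C%C * c + 0%:C%C * d) + e ^+ 2 * eval (remg G E0 E1 E2 2 s (wconst 1%:C%C) (wconst 1%:C%C) (wconst 0%:C%C)) phi - a - e * (b + c) =
   e ^+ 2 * eval (remg G E0 E1 E2 2 s (wconst 1%:C%C) (wconst 1%:C%C) (wconst 0%:C%C)) phi.
  by rewrite rmorph1 rmorph0; ring.
rewrite normcM -rmorphXn normc_real ger0_norm ?sqr_ge0 // ler_wpM2l ?sqr_ge0 //.
by apply: eval_le; exact: absum_wsum.
Qed.

End Averages.
End ForcingCoefficients.

Section PowerSeriesCoefficients.
Variables (R : realType) (n : nat) (g : 'rV[R]_n -> R -> R -> R -> R).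
Variables (gc : nat -> nat -> 'rV[R]_n -> R -> R) (phi : 'rV[R]_n) (r : R).
Hypothesis r_gt0 : 0 < r.
Hypothesis g_exp : forall x y : R, `|x| < r -> `|y| < r ->
  has_sum (fun mn : nat * nat => gc mn.1 mn.2 phi 0 * x ^+ mn.1 * y ^+ mn.2) (g phi x y 0).
Local Notation C := R[i].
Local Notation K := 'rV[int]_n.

Let Gc (mn : nat * nat) : K -> C := wconst ((gc mn.1 mn.2 phi 0)%:C)%C.

Let gcE x y : `|x| < r -> `|y| < r -> (g phi x y 0)%:C%C =
  csum (fun mn : nat * nat => ((gc mn.1 mn.2 phi 0 * x ^+ mn.1 * y ^+ mn.2)%:C)%C).
Proof. by move=> hx hy; have := has_sum_csum (g_exp hx hy) => ->. Qed.

Let hr2 : `|r / 2| < r.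
Proof. by rewrite ger0_norm ?divr_ge0 ?(ltW r_gt0) // ltr_pdivrMr // ltr_pMr // ltr1n. Qed.

(** The given coefficients are tied to [g] only through pointwise series. With [phi] frozen they
    form a family constant on the torus, so the diagonal expansion applies to them, and comparison
    with the global family identifies g_00 and the sum g_10 + g_01. *)
Lemma gc_expansion : gc 0%N 0%N phi 0 = g phi 0 0 0 /\
  exists s0 B : R, 0 < s0 /\ forall s, 0 < s <= s0 ->
  normc ((g phi s s 0)%:C%C - (gc 0%N 0%N phi 0)%:C%C - s%:C%C * (gc 1%N 0%N phi 0 + gc 0%N 1%N phi 0)%:C%C)
    <= s ^+ 2 * B.
Proof.
have [M hM] := has_sum_absum (g_exp hr2 hr2).
have r20 : 0 < r / 2 by rewrite divr_gt0.
pose F0 (mn : nat * nat) := mn.1; pose F1 (mn : nat * nat) := mn.2; pose F2 (_ : nat * nat) := 0%N.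
have fam : famsum (fun t k => (((r / 2) ^+ (F0 t + F1 t + F2 t))%:C)%C * Gc t k) M.
  apply: (famsum_ex (B := fun mn => normc (((gc mn.1 mn.2 phi 0 * (r / 2) ^+ mn.1 * (r / 2) ^+ mn.2)%:C)%C))) => [mn|s us]; last exact: hM.
  have -> : gc mn.1 mn.2 phi 0 * (r / 2) ^+ mn.1 * (r / 2) ^+ mn.2 =
      (r / 2) ^+ (F0 mn + F1 mn + F2 mn) * gc mn.1 mn.2 phi 0.
    by rewrite /F0 /F1 /F2 addn0 exprD; ring.
  by rewrite [X in normc X]rmorphM normcM; exact: (absumZ _ (absum_wconst _)).
have sG t : sym (Gc t) by exact: sym_wconst.
have geq psi x y e : `|x| <= r / 2 -> `|y| <= r / 2 -> `|e| <= r / 2 ->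
    (g phi x y 0)%:C%C = csum (fun t => eval (Gc t) psi * ((x ^+ F0 t * y ^+ F1 t * e ^+ F2 t)%:C)%C).
  move=> hx hy _; have lr z : `|z| <= r / 2 -> `|z| < r.
    by move=> hz; apply: le_lt_trans hz _; move: hr2; rewrite ger0_norm // ltW.
  rewrite gcE ?lr //; congr csum; apply: funext => mn.
  by rewrite /Gc eval_wconst -rmorphM /F2 expr0 mulr1 mulrA.
have sel i j : eval (gsel Gc F0 F1 F2 i j 0) 0 = (gc i j phi 0)%:C%C.
  have [|_ e] := @eval_gsel _ _ _ Gc F0 F1 F2 _ _ r20 fam i j 0 0 (fun=> 1) 1; first by [].
  rewrite mul1r in e; rewrite -e (csum1 (i := (i, j))) => [|[i' j'] ne].
    by rewrite /expo /F0 /F1 /F2 /= !eqxx /= mulr1 /Gc eval_wconst.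
  by rewrite /expo /F0 /F1 /F2 /= andbT -pair_eqE /= in ne *; rewrite (negbTE ne).
split.
  have := eval_g00 (g := fun _ x y _ => g phi x y 0) r20 fam geq 0; rewrite sel.
  by move=> /(congr1 (@complex.Re R)).
have [s0 [B [s00 hB]]] := diagonal_expansion (g := fun _ x y _ => g phi x y 0) r20 fam sG geq.
by exists s0, B; split=> // s hs; have := hB s 0 hs; rewrite !sel rmorphD.
Qed.

End PowerSeriesCoefficients.

Lemma linear_coef_unique (R : realType) (F : R -> R[i]) (a b b' : R[i]) (s1 s2 B1 B2 : R) :
  0 < s1 -> 0 < s2 ->
  (forall s, 0 < s <= s1 -> normc (F s - a - s%:C%C * b) <= s ^+ 2 * B1) ->
  (forall s, 0 < s <= s2 -> normc (F s - a - s%:C%C * b') <= s ^+ 2 * B2) -> b = b'.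
Proof.
move=> s10 s20 h1 h2; apply/eqP; rewrite -subr_eq0; apply/eqP; apply: normc_eq0P => e e0.
pose D := `|B1| + `|B2| + 1; have D0 : 0 < D by rewrite ltr_wpDl // addr_ge0.
pose s := Num.min (Num.min s1 s2) (e / D).
have s0 : 0 < s by rewrite !lt_min s10 s20 divr_gt0.
have l1 : 0 < s <= s1 by rewrite s0 /s !ge_min lexx.
have l2 : 0 < s <= s2 by rewrite s0 /s !ge_min lexx orbT.
have l3 : s * D <= e by rewrite -ler_pdivlMr // /s ge_min lexx orbT.
have : normc (s%:C%C * (b - b')) <= s ^+ 2 * B2 + s ^+ 2 * B1.
  have -> : s%:C%C * (b - b') = (F s - a - s%:C%C * b') - (F s - a - s%:C%C * b) by ring.
  by apply: le_trans (ler_normcB _ _) _; apply: lerD; [exact: h2|exact: h1].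
rewrite normcM normc_real gtr0_norm // expr2 -!mulrA -mulrDr ler_pM2l // -mulrDr => h.
apply: le_trans h (le_trans _ l3); rewrite ler_pM2l // /D.
by have := ler_norm B1; have := ler_norm B2; lra.
Qed.

Lemma powR_third_cubed (R : realType) (eps : R) : 0 <= eps -> (eps `^ (1 / 3)) ^+ 3 = eps.
Proof.
by move=> e0; rewrite -powR_mulrn ?powR_ge0 // -powRrM div1r mulVf ?pnatr_eq0 // powRr1.
Qed.

Lemma cubic_root (R : realType) (x : R) : exists c : R, c ^+ 3 = x.
Proof.
have pos (y : R) : 0 <= y -> exists c : R, c ^+ 3 = y.
  by move=> y0; exists (y `^ (1 / 3)); exact: powR_third_cubed.
have [/pos //|x0] := leP 0 x.
have [|c hc] := pos (- x); first by rewrite oppr_ge0 ltW.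
by exists (- c); rewrite exprNn hc -signr_odd /= expr1 mulN1r opprK.
Qed.

Lemma sym0_real (R : realType) n (a : 'rV[int]_n -> R[i]) : sym a -> (complex.Re (a 0))%:C%C = a 0.
Proof.
move=> sa; have := sa 0; rewrite oppr0; case: (a 0) => x y /= [/eqP].
by rewrite -addr_eq0 -mulr2n mulrn_eq0 /= => /eqP ->.
Qed.

Section SmallDivisors.
Variables (R : realType) (n : nat).
Hypothesis n_gt0 : (0 < n)%N.
Local Notation K := 'rV[int]_n.

(** A single lower bound implied both by the Diophantine condition and by the excluded strips, once
    [S] exceeds iota and 2 n. *)
Definition divisor_bound (gam : R) S (k : K) : R := gam / (4 ^+ n * l1norm R k ^+ S).

Lemma divisor_bound_gt0 gam S k : 0 < gam -> k != 0 -> 0 < divisor_bound gam S k.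
Proof.
move=> g0 k0; rewrite divr_gt0 // mulr_gt0 // exprn_gt0 //.
exact: lt_le_trans (l1norm_ge1 R k0).
Qed.

Lemma divisor_bound_mwt gam S k : 0 < gam -> k != 0 -> (2 * n <= S)%N ->
  divisor_bound gam S k <= gam * mwt R k.
Proof.
move=> g0 k0 nS; have l1 := l1norm_ge1 R k0.
have l0 : 0 < l1norm R k by exact: lt_le_trans l1.
rewrite ler_pM2l //; apply: le_trans (mwt_lower R k0).
rewrite lef_pV2 ?posrE ?mulr_gt0 ?exprn_gt0 // ler_pM2l ?exprn_gt0 //.
by rewrite ler_weXn2l.
Qed.

Lemma divisor_bound_dioph (om : 'rV[R]_n) gam iota S k : 0 < gam -> k != 0 -> iota <= S%:R ->
  diophantine om gam iota -> divisor_bound gam S k <= `|dotr k om|.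
Proof.
move=> g0 k0 iS dio; have l1 := l1norm_ge1 R k0.
have l0 : 0 < l1norm R k by exact: lt_le_trans l1.
apply: le_trans (dio k k0); rewrite ler_pM2l //; apply: le_trans (powR_lower l1 iS).
rewrite lef_pV2 ?posrE ?mulr_gt0 ?exprn_gt0 // ler_peMl ?exprn_ge0 ?(ltW l0) //.
by rewrite exprn_ege1 // ler1n.
Qed.

End SmallDivisors.

Theorem theorem3 (R : realType) (n0 : nat) (n0_gt0 : (0 < n0)%N)
  (f : R -> R) (eps0 : R) (g : 'rV[R]_n0 -> R -> R -> R -> R)
  (b b1 : R) (omega' : 'rV[R]_n0) (iota : R)
  (gc : nat -> nat -> 'rV[R]_n0 -> R -> R)
  (eps0_gt0 : 0 < eps0)
  (f_analytic : analytic1 f)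
  (g_analytic : analytic_perturbation eps0 g)
  (g_periodic : forall x y eps : R, `|eps| < eps0 ->
     torus_periodic (fun phi => g phi x y eps))
  (f0 : f 0 = 0) (f''0 : f^`(2)%classic 0 = 0)
  (f'0 : f^`()%classic 0 = b) (f'''0 : f^`(3)%classic 0 = 6 * b1)
  (b_eq1 : b = 1) (b1_neq0 : b1 != 0)
  (iota_ge : n0.+1%:R <= iota)
  (* g(phi,x,y,eps) = sum_{m,n} g_{mn}(phi;eps) x^m y^n near x = y = 0 *)
  (g_expansion : forall (phi : 'rV[R]_n0) (eps : R), `|eps| < eps0 ->
     exists2 r : R, 0 < r & forall x y : R, `|x| < r -> `|y| < r ->
       has_sum (fun mn : nat * nat =>
                  gc mn.1 mn.2 phi eps * x ^+ mn.1 * y ^+ mn.2)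
               (g phi x y eps))
  (g_average :
     torus_average (fun phi => gc 0%N 0%N phi 0) != 0 \/
     torus_average (fun phi => gc 1%N 0%N phi 0 + gc 0%N 1%N phi 0) != 0) :
  exists C1 gamma_max : R, 0 < gamma_max /\
  forall gamma0 : R, 0 < gamma0 <= gamma_max ->
  diophantine omega' gamma0 iota ->
  exists eps_max C2 : R, 0 < eps_max /\
  forall eps : R, 0 < eps <= eps_max ->
  exists Pi : set R,
    [/\ measurable Pi,
        Pi `<=` Pi0 R,
        (lebesgue_measure (Pi0 R) - (C1 * gamma0)%:E
           <= lebesgue_measure Pi)%E
      & forall a : R, Pi a ->
        exists x : R -> R,
          [/\ vdp_solution f g omega' a (tau0 a) eps x,
              quasi_periodic omega' x
            & forall t : R, `|x t| <= C2 * eps `^ (1 / 3)]].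

Proof.
have [J [G [E0 [E1 [E2 [rg [Mg [rg0 famG symG g_eq]]]]]]]] :=
  forcing_family n0_gt0 eps0_gt0 g_analytic g_periodic.
have [fc [rf [Mf [rf0 fc_sum f_eq [fc0 fc1 fc2 fc3]]]]] := analytic1_taylor f_analytic.
have {}fc0 : fc 0%N = 0 by rewrite fc0.
have {}fc1 : fc 1%N = 1 by rewrite fc1 f'0.
have {}fc2 : fc 2%N = 0 by apply/eqP; rewrite -(inj_eq (mulfI (_ : 2 != 0 :> R))) ?pnatr_eq0 // mulr0 fc2 f''0.
have {}fc3 : fc 3%N = b1 by apply: (mulfI (_ : 6 != 0 :> R)); rewrite ?pnatr_eq0 // fc3 f'''0.
have e00 : `|0 : R| < eps0 by rewrite normr0.
have gc0 phi : gc 0%N 0%N phi 0 = g phi 0 0 0.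
  by have [r r0 hr] := g_expansion phi 0 e00; have [] := gc_expansion r0 hr.
have gc1 phi : (gc 1%N 0%N phi 0 + gc 0%N 1%N phi 0)%:C%C =
    eval (gsel G E0 E1 E2 1 0 0) phi + eval (gsel G E0 E1 E2 0 1 0) phi.
  have [r r0 hr] := g_expansion phi 0 e00; have [_ [s1 [B1 [s10 h1]]]] := gc_expansion r0 hr.
  have [s2 [B2 [s20 h2]]] := diagonal_expansion rg0 famG symG g_eq.
  apply: (@linear_coef_unique _ (fun s => (g phi s s 0)%:C%C) (gc 0%N 0%N phi 0)%:C%C _ _ s1 s2 B1 B2) => // s hs.
  by rewrite gc0 (eval_g00 rg0 famG g_eq); exact: h2.
pose G0 := gsel G E0 E1 E2 0 0 0; pose G1 := gsel G E0 E1 E2 1 0 0; pose G2 := gsel G E0 E1 E2 0 1 0.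
have hG0 : absum G0 _ := absum_gsel rg0 famG 0 0 0; have sG0 : sym G0 := sym_gsel rg0 famG symG 0 0 0.
have hG1 : absum G1 _ := absum_gsel rg0 famG 1 0 0; have sG1 : sym G1 := sym_gsel rg0 famG symG 1 0 0.
have hG2 : absum G2 _ := absum_gsel rg0 famG 0 1 0; have sG2 : sym G2 := sym_gsel rg0 famG symG 0 1 0.
have av0 : torus_average (fun phi => gc 0%N 0%N phi 0) = complex.Re (G0 0).
  rewrite -(torus_average_eval hG0); congr torus_average; apply: funext => phi.
  by rewrite gc0 -(eval_g00 rg0 famG g_eq).
have av1 : torus_average (fun phi => gc 1%N 0%N phi 0 + gc 0%N 1%N phi 0) = complex.Re (G1 0) + complex.Re (G2 0).
  apply: etrans (etrans (torus_average_eval (absumD hG1 hG2)) (raddfD _ _ _)).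
  by congr torus_average; apply: funext => phi; rewrite (evalD _ hG1 hG2) -gc1.
rewrite av0 av1 in g_average.
have [S0 iS] : exists S0 : nat, iota <= S0%:R.
  by exists (Num.truncn iota).+1; apply/ltW/truncnS_gt.
pose S := maxn S0 (2 * n0).
have {}iS : iota <= S%:R by apply: le_trans iS _; rewrite ler_nat leq_maxl.
have nS : (2 * n0 <= S)%N by rewrite leq_maxr.
(* If g_00 has zero average, the hypothesis leaves g_10 + g_01, which supplies q + rr != 0 and hence
   the averaged case. *)
have [G00|G00] := eqVneq (complex.Re (G0 0)) 0.
- pose q := - complex.Re (G1 0); pose rr := - complex.Re (G2 0).
  have qr : q + rr != 0.
    by rewrite -opprD oppr_eq0; case: g_average => //; rewrite G00 eqxx.
  have [C1 hC1] := good_parameters (fun k => dotr k omega') (or_intror qr : (0 : R) != 0 \/ q + rr != 0).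
  exists C1, 1; split=> // gam /andP[gam0 _] dio.
  have [F0 [Pi [F00 mP PP mu_P hP]]] := hC1 _ gam0.
  pose r := divisor_bound (n := n0) gam S.
  have r0 k : k != 0 -> 0 < r k by exact: divisor_bound_gt0.
  have z0 : G0 0 = 0 by rewrite -(sym0_real sG0) G00.
  have z1 : G1 0 = (- q)%:C%C by rewrite opprK sym0_real.
  have z2 : G2 0 = (- rr)%:C%C by rewrite opprK sym0_real.
  have ta := torus_analytic_pack eps0_gt0 g_analytic g_periodic.
  have ev phi : eval G0 phi = (pack g (row_mx phi 0))%:C%C.
    by rewrite /pack row_mxKl row_mxKr !mxE (eval_g00 rg0 famG g_eq).
  (* Analyticity beats the small divisors: the coefficients of g_00 remain summable against |k|^S,
     which is 1 / r k up to a constant. *)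
  have [N hN] := absum_l1norm n0_gt0 (fun j => fourier_decay n0_gt0 S j ta hG0 sG0 ev).
  have decay : absum (fun k => ((r k)^-1)%:C%C * G0 k) (normc ((4 ^+ n0 / gam)%:C%C) * N).
    apply: absum_mono (absumZ _ hN) => k; rewrite mulrA -rmorphM /r /divisor_bound invf_div.
    by rewrite mulrAC.
  have [s1 [Cx [s10 H]]] := averaged_case omega' rf0 fc_sum f_eq fc0 fc1 fc2 fc3 rg0 famG symG g_eq
    qr F00 r0 z0 z1 z2 decay.
  (* Here x = O(eps); the restriction eps <= 1 turns this into O(eps^(1/3)). *)
  exists (Num.min s1 1), Cx; split; first by rewrite lt_min s10 ltr01.
  move=> eps /andP[e0]; rewrite le_min => /andP[es e1].
  exists Pi; split=> // a Pa; have [crit hF res] := hP _ Pa.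
  have [|k k0|x [x1 x2 x3]] := H eps a (omega0 a) (tau0 a) _ crit hF; first by rewrite e0.
    have db := divisor_bound_mwt gam0 k0 nS; have [h1 h2] := res k.
    split; last exact: le_trans db h2.
    by rewrite /rdist le_min (divisor_bound_dioph gam0 k0 iS dio) (le_trans db h1).
  exists x; split=> // t; apply: le_trans (x3 t) _; rewrite mulrC.
  have Cx0 : 0 <= Cx by have := le_trans (normr_ge0 _) (x3 0); rewrite pmulr_rge0.
  by rewrite ler_wpM2l // ger1_powR ?e0 // ler_pdivrMr // mul1r ler1n.
(* The root of b1 c^3 + average g_00 = 0; it is nonzero because the average is, and p0 = c^2 then
   ensures transversality. *)
have [c hc] := cubic_root (- complex.Re (G0 0) / b1).
have c0 : c != 0.
  apply: contra_neq G00 => c0; move: hc; rewrite c0 expr0n /= => /esym/eqP.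
  by rewrite mulf_eq0 invr_eq0 (negbTE b1_neq0) orbF oppr_eq0 => /eqP.
have [C1 hC1] := good_parameters (fun k => dotr k omega')
  (or_introl (expf_neq0 2 c0) : c ^+ 2 != 0 \/ 0 + - (3 * b1 * c ^+ 2) != 0).
exists C1, 1; split=> // gam /andP[gam0 _] dio.
have [F0 [Pi [F00 mP PP mu_P hP]]] := hC1 _ gam0.
pose r := divisor_bound (n := n0) gam S.
have r0 k : k != 0 -> 0 < r k by exact: divisor_bound_gt0.
have bal : (b1 * c ^+ 3)%:C%C + G0 0 = 0.
  by rewrite hc mulrCA mulfV // mulr1 -(sym0_real sG0) -rmorphD addNr.
have [s1 [Cx [s10 H]]] := forced_case omega' rf0 fc_sum f_eq fc0 fc1 fc2 fc3 rg0 famG symG g_eq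
  b1_neq0 c0 F00 r0 bal.
(* The scale is s = eps^(1/3), so the threshold for [s] is cubed. *)
exists (s1 ^+ 3), Cx; split; first by rewrite exprn_gt0.
move=> eps /andP[e0 es]; pose s := eps `^ (1 / 3).
have s0 : 0 < s by exact: powR_gt0.
have sE : s ^+ 3 = eps by rewrite powR_third_cubed // ltW.
have ss : s <= s1 by rewrite -(ler_pXn2r (n := 3)) ?nnegrE ?sE // ltW.
exists Pi; split=> // a Pa; have [crit hF res] := hP _ Pa.
have [|k k0|x [x1 x2 x3]] := H s a (omega0 a) (tau0 a) _ crit hF; first by rewrite s0.
  have db := divisor_bound_mwt gam0 k0 nS; have [h1 _] := res k.
  by rewrite /rdist le_min (divisor_bound_dioph gam0 k0 iS dio) (le_trans db h1).
rewrite sE in x1; exists x; split=> // t; rewrite mulrC; exact: x3.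
Qed.
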